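(* Let $\Omega$ be a smooth bounded pseudoconvex domain in $\mathbb{C}^n$ on which the $\overline{\partial}$-Neumann operator is compact. Let $T\in\mathscr{T}(\overline{\Omega})$, where $\mathscr{T}(\overline{\Omega})$ is the norm closed subalgebra of the algebra of bounded linear operators on the Bergman space $A^2(\Omega)$ generated by the Toeplitz operators $\{T_\phi:\phi\in C(\overline{\Omega})\}$, and assume that $\lim_{z\to p}\widetilde{T}(z)=0$ for all $p\in b\Omega$, where $\widetilde{T}$ is the Berezin transform of $T$. Then $T$ is a compact operator on $A^2(\Omega)$.
   Context: $b\Omega$ denotes the boundary of $\Omega$; ''smooth'' means $C^\infty$-smooth boundary. The Bergman space $A^2(\Omega)$ is the closed subspace of $L^2(\Omega)$ (Lebesgue measure $dV$) consisting of holomorphic functions; $P:L^2(\Omega)\to A^2(\Omega)$ is the orthogonal (Bergman) projection. For $\phi\in L^\infty(\Omega)$ the Toeplitz operator $T_\phi:A^2(\Omega)\to A^2(\Omega)$ is $T_\phi f=P(\phi f)$. $K$ is the Bergman kernel of $\Omega$, i.e. $K(\cdot,z)\in A^2(\Omega)$ and $f(z)=\langle f,K(\cdot,z)\rangle$ for all $f\in A^2(\Omega)$, $z\in\Omega$. The normalized Bergman kernel is $k_z(w)=K(w,z)/\sqrt{K(z,z)}$. For a bounded linear operator $S$ on $A^2(\Omega)$, its Berezin transform is the function $\widetilde{S}(z)=\langle Sk_z,k_z\rangle$, $z\in\Omega$. Limits $z\to p$ are taken over $z\in\Omega$. The $\overline{\partial}$-Neumann operator $N$ is the bounded inverse, on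 the space $L^2_{(0,1)}(\Omega)$ of square integrable $(0,1)$-forms, of the complex Laplacian $\overline{\partial}^*\overline{\partial}+\overline{\partial}\,\overline{\partial}^*$, where $\overline{\partial}^*$ is the Hilbert space adjoint of $\overline{\partial}$ (it exists since $\Omega$ is bounded and pseudoconvex). Its compactness means compactness as an operator on $L^2_{(0,1)}(\Omega)$. *)

(* Defs.v *)
From HB Require Import structures.
From mathcomp Require Import all_boot all_order all_algebra.
From mathcomp Require Import all_classical all_reals all_analysis.
From mathcomp Require Import complex.

Set Implicit Arguments.
Unset Strict Implicit.
Unset Printing Implicit Defensive.

Import Order.TTheory GRing.Theory Num.Theory.
Import numFieldNormedType.Exports.

Local Open Scope classical_set_scope.
Local Open Scope ring_scope.
Local Open Scope complex_scope.

(* C^n is 'rV[R[i]]_n. A function (or form) on an open set Om is represented by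
   a total function on C^n of which only the values on Om matter. *)

HB.instance Definition _ (R : realType) := NormedModule.copy R[i] R[i]^o.

Notation Re := complex.Re.
Notation Im := complex.Im.

(** * Lebesgue measure on R^n and on C^n *)

Section lebesgue_tuple.
Context {R : realType}.
Local Notation mR := (measurableTypeR R).

Definition cons_pair n (p : mR * n.-tuple mR) : n.+1.-tuple mR :=
  [tuple of p.1 :: p.2].

Lemma measurable_cons_pair n : measurable_fun setT (@cons_pair n).
Proof. exact: measurable_cons. Qed.

Definition lebesgue_cons n
    (m : {sigma_finite_measure set (n.-tuple mR) -> \bar R}) :=
  pushforward (@lebesgue_measure R \x m)%E (@cons_pair n).

Section instances.
Variables (n : nat) (m : {sigma_finite_measure set (n.-tuple mR) -> \bar R}).

Let pushforward_cons : {measure set (n.+1.-tuple mR) -> \bar R} :=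
  measure_function_pushforward__canonical__measure_function_Measure
    (product_measure1 (@lebesgue_measure R) m) (@measurable_cons_pair n).

HB.instance Definition _ := isMeasure.Build _ _ _ (lebesgue_cons m)
  (measure0 pushforward_cons) (measure_ge0 pushforward_cons)
  (@measure_semi_sigma_additive _ _ _ pushforward_cons).

Let lebesgue_cons_sigma_finite : sigma_finite setT (lebesgue_cons m).
Proof.
have /sigma_finiteP[F [FT Fnd Foo]] := sigma_finiteT (@lebesgue_measure R).
have /sigma_finiteP[G [GT Gnd Goo]] := sigma_finiteT m.
pose hd (t : n.+1.-tuple mR) : mR := tnth t ord0.
pose tl (t : n.+1.-tuple mR) : n.-tuple mR := [tuple of behead t].
exists (fun k => hd @^-1` F k `&` tl @^-1` G k).
  apply/esym; rewrite -subTset => t _.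
  have [i _ Fi] : (\bigcup_i F i) (hd t) by rewrite -FT.
  have [j _ Gj] : (\bigcup_i G i) (tl t) by rewrite -GT.
  exists (maxn i j) => //; split.
    by have /subsetPset := Fnd _ _ (leq_maxl i j); apply.
  by have /subsetPset := Gnd _ _ (leq_maxr i j); apply.
move=> k; have [mF Fk] := Foo k; have [mG Gk] := Goo k; split.
  apply: measurableI; rewrite -[X in measurable X]setTI.
    exact: measurable_tnth.
  exact: measurable_behead.
rewrite /lebesgue_cons /pushforward.
rewrite (_ : _ @^-1` _ = F k `*` G k); last first.
  apply/seteqP; split => -[x t]/= [Fx Gt]; split => //=.
    rewrite (_ : t = tl (cons_pair (x, t))) //; exact/val_inj.
  rewrite /preimage/= (_ : tl (cons_pair (x, t)) = t) //; exact/val_inj.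
by rewrite product_measure1E// lte_mul_pinfty// ge0_fin_numE.
Qed.

HB.instance Definition _ := Measure_isSigmaFinite.Build _ _ _
  (lebesgue_cons m) lebesgue_cons_sigma_finite.

End instances.

Fixpoint lebesgue_tuple n :
    {sigma_finite_measure set (n.-tuple mR) -> \bar R} :=
  match n with
  | 0 => @dirac _ (0.-tuple mR) [tuple] R
  | n'.+1 => lebesgue_cons (lebesgue_tuple n')
  end.

End lebesgue_tuple.

Definition Cn_display : measure_display.
Proof. exact. Qed.

Section Cn_measurable.
Context {R : realType} (n : nat).
Local Notation Cn := 'rV[R[i]]_n.
Local Notation mR := (measurableTypeR R).

Definition real_coord (k : 'I_(n + n)) (z : Cn) : mR :=
  match fintype.split k with inl j => Re (z 0 j) | inr j => Im (z 0 j) end.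

Let Cn_set0 : g_sigma_preimage real_coord set0.
Proof. exact: sigma_algebra0. Qed.

Let Cn_setC A : g_sigma_preimage real_coord A ->
  g_sigma_preimage real_coord (~` A).
Proof. exact: sigma_algebraC. Qed.

Let Cn_bigcup (F : (set Cn)^nat) :
  (forall i, g_sigma_preimage real_coord (F i)) ->
  g_sigma_preimage real_coord (\bigcup_i F i).
Proof. exact: sigma_algebra_bigcup. Qed.

HB.instance Definition _ := @isMeasurable.Build Cn_display Cn
  (g_sigma_preimage real_coord) Cn_set0 Cn_setC Cn_bigcup.

Definition Cn_of_tuple (t : (n + n).-tuple mR) : Cn :=
  \row_j (tnth t (lshift n j) +i* tnth t (rshift n j)).

Lemma measurable_Cn_of_tuple : measurable_fun setT Cn_of_tuple.
Proof.
apply: (@measurability _ _ _ _ _ _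
  (\big[setU/set0]_(k < n + n) preimage_set_system setT (real_coord k) measurable)).
  by [].
move=> A [C GC <-]; move: GC; rewrite -bigcup_seq => -[k _ [B mB <-]].
rewrite setTI setTI -comp_preimage.
rewrite (_ : _ \o _ = (fun t : (n + n).-tuple mR => tnth t k)); last first.
  apply/funext => t /=; rewrite /real_coord.
  by case: splitP => j kj; rewrite mxE /=; congr tnth; exact/val_inj.
by rewrite -[X in measurable X]setTI; exact: measurable_tnth.
Qed.

Definition volume := pushforward (@lebesgue_tuple R (n + n)) Cn_of_tuple.

Let pm : {measure set Cn -> \bar R} :=
  measure_function_pushforward__canonical__measure_function_Measure
    (@lebesgue_tuple R (n + n)) measurable_Cn_of_tuple.

HB.instance Definition _ := isMeasure.Build _ _ _ volume
  (measure0 pm) (measure_ge0 pm) (@measure_semi_sigma_additive _ _ _ pm).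

End Cn_measurable.

(** * Smooth domains and pseudoconvexity *)

Section domains.
Context {R : realType} {n : nat}.
Local Notation C := R[i].
Local Notation Cn := 'rV[C]_n.
Implicit Types (Om : set Cn) (rho : Cn -> R) (f : Cn -> C).

(* [inl j] is the direction of x_j and [inr j] that of y_j (z_j = x_j + i y_j). *)
Definition real_dir (k : 'I_n + 'I_n) : Cn :=
  match k with
  | inl j => delta_mx 0 j
  | inr j => (0 +i* 1) *: delta_mx 0 j
  end.

Definition along (k : 'I_n + 'I_n) rho (z : Cn) : R -> R :=
  fun t => rho (z + t%:C *: real_dir k).

Definition rpartial (k : 'I_n + 'I_n) rho : Cn -> R :=
  fun z => derive1 (along k rho z) 0.

Definition smooth rho : Prop :=
  forall s : seq ('I_n + 'I_n),
    continuous (foldr rpartial rho s) /\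
    forall k z, derivable (along k (foldr rpartial rho s) z) 0 1.

Definition csmooth f : Prop :=
  smooth (fun z => Re (f z)) /\ smooth (fun z => Im (f z)).

Definition cpartial (k : 'I_n + 'I_n) f : Cn -> C :=
  fun z => rpartial k (fun w => Re (f w)) z +i* rpartial k (fun w => Im (f w)) z.

Definition dz (j : 'I_n) f : Cn -> C :=
  fun z => 2^-1 * (cpartial (inl j) f z - (0 +i* 1) * cpartial (inr j) f z).

Definition dzbar (j : 'I_n) f : Cn -> C :=
  fun z => 2^-1 * (cpartial (inl j) f z + (0 +i* 1) * cpartial (inr j) f z).

Definition boundary Om : set Cn := closure Om `\` interior Om.

Definition defining_function Om rho : Prop :=
  [/\ smooth rho, Om = [set z | rho z < 0] &
    forall p, boundary Om p ->
      rho p = 0 /\ exists k, rpartial k rho p != 0].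

Definition smooth_bounded_domain Om : Prop :=
  [/\ Om !=set0, open Om, connected Om, bounded_set Om &
    exists rho, defining_function Om rho].

(* Nonnegativity of the Levi form on the complex tangent space at each boundary
   point. In R[i], [0 <= x] says that x is real and nonnegative. *)
Definition pseudoconvex Om : Prop :=
  exists2 rho, defining_function Om rho &
    let crho := fun z => (rho z)%:C in
    forall p, boundary Om p -> forall t : Cn,
      \sum_j dz j crho p * t 0 j = 0 ->
      0 <= \sum_j \sum_k dz j (dzbar k crho) p * t 0 j * (t 0 k)^*.

Definition test_function Om f : Prop :=
  csmooth f /\
  exists K, [/\ compact K, K `<=` Om & forall z, ~ K z -> f z = 0].

End domains.

(** * Operators on semi-inner product spaces *)

(* A Hilbert space of classes of functions is given by the set V of the
   functions and the sesquilinear form ip; two functions stand for the same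
   vector when the seminorm of their difference is 0. *)

Section operators.
Context {R : realType} {E : lmodType R[i]}.
Variables (V : set E) (ip : E -> E -> R[i]).
Implicit Types (S T : E -> E).

Definition hnorm (f : E) : R := Num.sqrt (Re (ip f f)).

Definition bounded_op T : Prop :=
  [/\ forall f, V f -> V (T f),
      forall (a : R[i]) f g, V f -> V g ->
        hnorm (T (a *: f + g) - (a *: T f + T g)) = 0 &
      exists M : R, forall f, V f -> hnorm (T f) <= M * hnorm f].

Definition compact_op T : Prop :=
  bounded_op T /\
  forall u : nat -> E, (forall k, V (u k)) ->
    (exists M : R, forall k, hnorm (u k) <= M) ->
    exists (s : nat -> nat) (l : E),
      [/\ forall k, (s k < s k.+1)%N, V l &
        hnorm (T (u (s k)) - l) @[k --> \oo] --> (0 : R)].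

Definition closed_subalgebra (A : set (E -> E)) : Prop :=
  [/\ A `<=` bounded_op,
      forall (a : R[i]) S T, A S -> A T -> A (fun f => a *: S f + T f),
      forall S T, A S -> A T -> A (S \o T) &
      forall T, bounded_op T ->
        (forall e : R, 0 < e -> exists2 S, A S &
          forall f, V f -> hnorm (T f - S f) <= e * hnorm f) ->
        A T].

End operators.

(* The graph of the Hilbert space adjoint of a densely defined operator with
   graph [A]. *)
Definition adjoint_graph (R : realType) (E F : Type)
    (VE : set E) (ipE : E -> E -> R[i]) (VF : set F) (ipF : F -> F -> R[i])
    (A : E -> F -> Prop) : F -> E -> Prop :=
  fun v x => [/\ VF v, VE x & forall h g, A h g -> ipF g v = ipE h x].

(** * Toeplitz operators on the Bergman space *)

Section bergman.
Context {R : realType} {n : nat}.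
Local Notation C := R[i].
Local Notation Cn := 'rV[C]_n.
Variable Om : set Cn.
Implicit Types (f g : Cn -> C).

Definition L2 f : Prop :=
  [/\ measurable_fun Om (fun z => Re (f z)),
      measurable_fun Om (fun z => Im (f z)) &
      (\int[@volume R n]_(z in Om) ((Re (f z)) ^+ 2 + (Im (f z)) ^+ 2)%:E
        < +oo)%E].

Definition cintegral f : C :=
  (\int[@volume R n]_(z in Om) Re (f z)) +i*
  (\int[@volume R n]_(z in Om) Im (f z)).

Definition L2ip f g : C := cintegral (fun z => f z * (g z)^*).

Definition bergman_space f : Prop :=
  L2 f /\ forall z, Om z -> differentiable f z.

Definition bergman_proj f : Cn -> C :=
  xget 0 [set g | bergman_space g /\
    forall h, bergman_space h -> L2ip (f - g) h = 0].

Definition toeplitz (phi : Cn -> C) : (Cn -> C) -> (Cn -> C) :=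
  fun f => bergman_proj (phi \* f).

Definition toeplitz_algebra : set ((Cn -> C) -> (Cn -> C)) :=
  smallest (closed_subalgebra bergman_space L2ip)
    [set toeplitz phi | phi in [set phi | {within closure Om, continuous phi}]].

(* [bergman_kernel z] is w |-> K(w, z). *)
Definition bergman_kernel (z : Cn) : Cn -> C :=
  xget 0 [set k | bergman_space k /\
    forall f, bergman_space f -> f z = L2ip f k].

Definition normalized_kernel (z : Cn) : Cn -> C :=
  fun w => bergman_kernel z w / sqrtC (bergman_kernel z z).

Definition berezin (T : (Cn -> C) -> (Cn -> C)) (z : Cn) : C :=
  L2ip (T (normalized_kernel z)) (normalized_kernel z).

End bergman.

(** * The dbar-Neumann operator *)

(* A (0,1)-form sum_j u_j dzbar_j is the row (u_j); a (0,2)-form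
   sum_(j < k) w_jk dzbar_j /\ dzbar_k is the antisymmetric matrix (w_jk). *)

Section dbar_Neumann.
Context {R : realType} {n : nat}.
Local Notation C := R[i].
Local Notation Cn := 'rV[C]_n.
Variable Om : set Cn.
Implicit Types (f : Cn -> C) (u v : Cn -> 'rV[C]_n) (w : Cn -> 'M[C]_n).

Definition L2_01 u : Prop := forall j, L2 Om (fun z => u z 0 j).

Definition ip_01 u v : C :=
  \sum_j L2ip Om (fun z => u z 0 j) (fun z => v z 0 j).

Definition L2_02 w : Prop :=
  (forall j k, L2 Om (fun z => w z j k)) /\
  forall z, Om z -> (w z)^T = - w z.

Definition ip_02 (w w' : Cn -> 'M[C]_n) : C :=
  \sum_(j < n) \sum_(k < n | (j < k)%N) L2ip Om (fun z => w z j k) (fun z => w' z j k).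

(* Maximal (weak) extensions of dbar; [dbar_0 f u] says that f is in the domain
   and that dbar f = u. *)
Definition dbar_0 f u : Prop :=
  [/\ L2 Om f, L2_01 u &
    forall chi, test_function Om chi -> forall j,
      cintegral Om (fun z => u z 0 j * chi z) =
      - cintegral Om (fun z => f z * dzbar j chi z)].

Definition dbar_1 u w : Prop :=
  [/\ L2_01 u, L2_02 w &
    forall chi, test_function Om chi -> forall j k,
      cintegral Om (fun z => w z j k * chi z) =
      - cintegral Om (fun z => u z 0 k * dzbar j chi z - u z 0 j * dzbar k chi z)].

Definition dbar_0_adj : (Cn -> 'rV[C]_n) -> (Cn -> C) -> Prop :=
  adjoint_graph (L2 Om) (L2ip Om) L2_01 ip_01 dbar_0.

Definition dbar_1_adj : (Cn -> 'M[C]_n) -> (Cn -> 'rV[C]_n) -> Prop :=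
  adjoint_graph L2_01 ip_01 L2_02 ip_02 dbar_1.

Definition complex_laplacian u g : Prop :=
  exists w a f b,
    [/\ dbar_1 u w, dbar_1_adj w a, dbar_0_adj u f, dbar_0 f b & g = a + b].

Definition dbar_Neumann (g : Cn -> 'rV[C]_n) : Cn -> 'rV[C]_n :=
  xget 0 [set u | complex_laplacian u g].

End dbar_Neumann.

(* Main.v *)
Require Import Defs.
From HB Require Import structures.
From mathcomp Require Import all_boot all_order all_algebra.
From mathcomp Require Import all_classical all_reals all_analysis.
From mathcomp Require Import measurable_realfun.
From mathcomp Require Import complex ring lra.

Set Implicit Arguments.
Unset Strict Implicit.
Unset Printing Implicit Defensive.

Import Order.TTheory GRing.Theory Num.Theory.
Import numFieldNormedType.Exports.

Local Open Scope classical_set_scope.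
Local Open Scope ring_scope.
Local Open Scope complex_scope.

(* Call a bounded sequence of A^2 null if it tends to 0 pointwise. Bounded
   sequences of A^2 have pointwise convergent subsequences, so T is compact as
   soon as T f_k -> 0 for every null sequence f_k. For smooth phi and f in A^2,
   phi f - P(phi f) is dominated by Kohn's solution dbar^* N (f dbar phi), and
   compactness of N makes it tend to 0 along null sequences. Hence every T in
   the Toeplitz algebra acts on null sequences, up to an error eps, as the
   multiplication by some smooth phi.
   Let l_m tend to a boundary point p with normalized kernels forming a null
   sequence. Kernels are eigenvectors of the adjoints of the multiplications by
   the coordinates, so these kernels concentrate at p, the Berezin transform of
   T at l_m is within eps of phi(p) in the limit, and |phi(p)| <= eps.
   It follows that on {|phi| > 2 eps} the norm of K(., l) is bounded by a
   multiple of 1 + sum_i |K(l, z_i)| for finitely many points z_i: otherwise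
   there would be such a sequence l_m in this set. This majorant is in L^2, so
   for a null sequence dominated convergence gives phi f_k -> 0 in L^2 over
   this set, and T f_k -> 0. *)

(** [bergman_proj], [bergman_kernel] and [dbar_Neumann] select a value with [xget], so nothing is
    known about them until an admissible value is shown to exist. For the first two this rests on
    completeness of A^2: an L^2 limit of holomorphic functions is a priori only weakly holomorphic,
    and Weyl's lemma changes it on a null set into a holomorphic function. Conversely, functions
    that are merely complex differentiable at each point have to be shown weakly holomorphic, which
    is Goursat's theorem. For [dbar_Neumann], surjectivity of the Laplacian is extracted from the
    additivity of the selected operator.

    The symbol phi depends on eps because continuous symbols and norm limits of operators are only
    approximated by smooth symbols, while smoothness is what puts f dbar phi in L^2. Approximate
    symbols are stable under sums, products and norm limits.

    The points z_i are rational points: they are countable and dense, and bounded sequences of A^2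
    are locally equicontinuous, so pointwise smallness need only be tested there. *)

Local Notation Re := complex.Re.
Local Notation Im := complex.Im.

(** * Real-valued norms on complex normed spaces *)

Section real_norm.
Context {R : realType}.
Local Notation C := R[i].

(** Norms of modules over [R[i]] are complex numbers. Their real parts live in the ordered field
    [R], where [lra] and [nra] apply. *)
Definition rn (V : normedZmodType C) (v : V) : R := Re `|v|.

Lemma rnE (V : normedZmodType C) (v : V) : `|v| = (rn v)%:C.
Proof. by rewrite /rn RRe_real// normr_real. Qed.

Lemma rn_ge0 (V : normedZmodType C) (v : V) : 0 <= rn v.
Proof. by rewrite -lecR -rnE normr_ge0. Qed.

Lemma rn0 (V : normedZmodType C) : rn (0 : V) = 0.
Proof. by rewrite /rn normr0. Qed.

Lemma rnN (V : normedZmodType C) (v : V) : rn (- v) = rn v.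
Proof. by rewrite /rn normrN. Qed.

Lemma rn_distC (V : normedZmodType C) (v w : V) : rn (v - w) = rn (w - v).
Proof. by rewrite -rnN opprB. Qed.

Lemma rnD (V : normedZmodType C) (v w : V) : rn (v + w) <= rn v + rn w.
Proof. by rewrite -lecR rmorphD/= -!rnE ler_normD. Qed.

Lemma rnB (V : normedZmodType C) (v w : V) : rn (v - w) <= rn v + rn w.
Proof. by rewrite -(rnN w) rnD. Qed.

Lemma rn_trans (V : normedZmodType C) (u v w : V) :
  rn (u - w) <= rn (u - v) + rn (v - w).
Proof. by rewrite (le_trans _ (rnD _ _))// addrA subrK. Qed.

Lemma rn_eq0 (V : normedZmodType C) (v : V) : rn v = 0 -> v = 0.
Proof. by move=> h; apply/eqP; rewrite -normr_eq0 rnE h. Qed.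

Lemma rnZ (V : normedModType C) (a : C) (v : V) : rn (a *: v) = rn a * rn v.
Proof. by apply: complexI; rewrite -rnE normrZ !rnE rmorphM. Qed.

Lemma rnM (a b : C) : rn (a * b) = rn a * rn b.
Proof. by apply: complexI; rewrite -rnE normrM !rnE rmorphM. Qed.

Lemma rn_sum (V : normedZmodType C) I (r : seq I) (P : pred I) (F : I -> V) :
  rn (\sum_(i <- r | P i) F i) <= \sum_(i <- r | P i) rn (F i).
Proof.
elim/big_ind2 : _ => //; first by rewrite rn0.
by move=> x y z t hx hz; rewrite (le_trans (rnD _ _))// lerD.
Qed.

Lemma rn_sqrt (x : C) : rn x = Num.sqrt (Re x ^+ 2 + Im x ^+ 2).
Proof. by rewrite /rn normc_def. Qed.

Lemma rn_sq (x : C) : rn x ^+ 2 = Re x ^+ 2 + Im x ^+ 2.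
Proof. by rewrite rn_sqrt sqr_sqrtr// addr_ge0// sqr_ge0. Qed.

Lemma rn_real (x : R) : rn (x%:C : C) = `|x|.
Proof. by rewrite rn_sqrt/= expr0n addr0 sqrtr_sqr. Qed.

Lemma rn1 : rn (1 : C) = 1.
Proof. by rewrite rn_real normr1. Qed.

Lemma rni : rn ('i : C) = 1.
Proof. by rewrite rn_sqrt/= expr0n expr1n add0r sqrtr1. Qed.

Lemma rnV (x : C) : rn x^-1 = (rn x)^-1.
Proof. by apply: complexI; rewrite -rnE normfV rnE -fmorphV. Qed.

Lemma rnJ (x : C) : rn (x^*) = rn x.
Proof. by rewrite /rn normcJ. Qed.

Lemma normr_Re (x : C) : `|Re x| <= rn x.
Proof.
rewrite -(sqrtr_sqr (Re x)) rn_sqrt ler_wsqrtr// lerDl sqr_ge0//.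
Qed.

Lemma normr_Im (x : C) : `|Im x| <= rn x.
Proof.
rewrite -(sqrtr_sqr (Im x)) rn_sqrt ler_wsqrtr// lerDr sqr_ge0//.
Qed.

Lemma rn_le_ReIm (x : C) : rn x <= `|Re x| + `|Im x|.
Proof.
have -> : x = (Re x)%:C + 'i * (Im x)%:C by rewrite -complexE.
by rewrite (le_trans (rnD _ _))// rnM rni mul1r !rn_real -complexE.
Qed.

Lemma cReM (x y : C) : Re (x * y) = Re x * Re y - Im x * Im y.
Proof. by case: x => a b; case: y. Qed.

Lemma cImM (x y : C) : Im (x * y) = Re x * Im y + Im x * Re y.
Proof. by case: x => a b; case: y. Qed.

Lemma cReD (x y : C) : Re (x + y) = Re x + Re y.
Proof. by case: x => a b; case: y. Qed.

Lemma cImD (x y : C) : Im (x + y) = Im x + Im y.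
Proof. by case: x => a b; case: y. Qed.

Lemma cReN (x : C) : Re (- x) = - Re x.
Proof. by case: x. Qed.

Lemma cImN (x : C) : Im (- x) = - Im x.
Proof. by case: x. Qed.

Lemma cReJ (x : C) : Re (x^*) = Re x.
Proof. by case: x. Qed.

Lemma cImJ (x : C) : Im (x^*) = - Im x.
Proof. by case: x. Qed.

Lemma Re_sum I (r : seq I) (P : pred I) (F : I -> C) :
  Re (\sum_(i <- r | P i) F i) = \sum_(i <- r | P i) Re (F i).
Proof. by elim/big_rec2 : _ => // i x y _ <-; rewrite cReD. Qed.

Lemma eqc (x y : C) : Re x = Re y -> Im x = Im y -> x = y.
Proof. by case: x y => a b [c d] /= -> ->. Qed.

Lemma mulcJ (x : C) : x * x^* = (rn x ^+ 2)%:C.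
Proof. by rewrite rn_sq; case: x => a b; apply: eqc => /=; ring. Qed.

End real_norm.

(** * Neighbourhoods and limits in terms of the real norm *)

Section real_topology.
Context {R : realType}.
Local Notation C := R[i].

(** The passage from filters, whose radii are complex numbers, to real epsilon-delta statements. *)
Lemma nbhs_rnP (V : normedModType C) (z : V) (A : set V) :
  nbhs z A <-> exists2 e : R, 0 < e & forall w, rn (w - z) < e -> A w.
Proof.
split=> [/nbhs_normP[e /= e0 zA]|[e e0 zA]].
  exists (Re e).
    by rewrite -ltcR RRe_real// gtr0_real.
  move=> w we; apply: zA => /=; rewrite rnE rn_distC.
  by rewrite -(RRe_real (gtr0_real e0)) ltcR.
apply/nbhs_normP; exists e%:C; first by rewrite /= ltcR.
by move=> w /=; rewrite rnE ltcR rn_distC => /zA.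
Qed.

Lemma cvg_rnP (V : normedModType C) T (F : set_system T) {FF : Filter F}
    (f : T -> V) (l : V) :
  f @ F --> l <-> forall e : R, 0 < e -> \forall x \near F, rn (f x - l) < e.
Proof.
split=> [fl e e0|fl].
  by have /fl : nbhs l [set w | rn (w - l) < e] by apply/nbhs_rnP; exists e.
by move=> A /nbhs_rnP[e e0 lA]; apply: filterS (fl _ e0) => x /lA.
Qed.

Lemma cvg_rn0P (V : normedModType C) T (F : set_system T) {FF : Filter F}
    (f : T -> V) (l : V) :
  f @ F --> l <-> rn (f x - l) @[x --> F] --> (0 : R).
Proof.
rewrite cvg_rnP; split=> [h|/cvgr0Pnorm_lt h] .
  apply/cvgr0Pnorm_lt => e e0; apply: filterS (h e e0) => x.
  by rewrite ger0_norm// rn_ge0.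
by move=> e /h; apply: filterS => x; rewrite ger0_norm// rn_ge0.
Qed.

Lemma cvg_nbhsP (V W : normedModType C) (f : V -> W) (z : V) (l : W) :
  f w @[w --> z] --> l <-> forall e : R, 0 < e ->
    exists2 d : R, 0 < d & forall w, rn (w - z) < d -> rn (f w - l) < e.
Proof.
rewrite (@cvg_rnP _ _ (nbhs z) (nbhs_filter z)); split => h e /h.
  by move=> /nbhs_rnP.
by move=> H; apply/nbhs_rnP.
Qed.

Lemma cvg_nbhsRP (V : normedModType C) (f : V -> R) (z : V) (l : R) :
  f w @[w --> z] --> l <-> forall e : R, 0 < e ->
    exists2 d : R, 0 < d & forall w, rn (w - z) < d -> `|f w - l| < e.
Proof.
split => [/(@cvgrPdist_lt _ R^o _ _ (nbhs_filter z)) h e /h/nbhs_rnP[d d0 H]|h].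
  by exists d => // w /H; rewrite distrC.
apply/(@cvgrPdist_lt _ R^o _ _ (nbhs_filter z)) => e /h H.
by apply/nbhs_rnP; case: H => d d0 H; exists d => // w /H; rewrite distrC.
Qed.

Lemma continuous_Re (x : C) : Re y @[y --> x] --> Re x.
Proof.
apply/cvg_nbhsRP => e e0; exists e => // y ye.
by rewrite -cReN -cReD (le_lt_trans (normr_Re _)).
Qed.

Lemma continuous_Im (x : C) : Im y @[y --> x] --> Im x.
Proof.
apply/cvg_nbhsRP => e e0; exists e => // y ye.
by rewrite -cImN -cImD (le_lt_trans (normr_Im _)).
Qed.

Lemma cvg_ReIm T (F : set_system T) {FF : Filter F} (f : T -> C) (l : C) :
  f @ F --> l <->
  (Re (f x) @[x --> F] --> Re l) /\ (Im (f x) @[x --> F] --> Im l).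
Proof.
split=> [fl|[]].
  by split; [apply: continuous_cvg (fl); exact: continuous_Re|
             apply: continuous_cvg (fl); exact: continuous_Im].
move=> /cvgrPdist_lt fr /cvgrPdist_lt fi; apply/cvg_rnP => e e0.
have e2 : 0 < e / 2 by rewrite divr_gt0.
apply: filterS2 (fr _ e2) (fi _ e2) => x h1 h2.
rewrite (le_lt_trans (rn_le_ReIm _))// cReD cImD cReN cImN.
by rewrite distrC [X in _ + X]distrC (splitr e) ltrD.
Qed.

Lemma cvg_real_complex T (F : set_system T) {FF : Filter F} (f : T -> R) (l : R) :
  f @ F --> l -> (f x)%:C @[x --> F] --> (l%:C : C).
Proof. by move=> fl; apply/cvg_ReIm; split => //=; exact: cvg_cst. Qed.

Lemma cvg_conjc T (F : set_system T) {FF : Filter F} (f : T -> C) (l : C) :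
  f @ F --> l -> (f x)^* @[x --> F] --> (l^* : C).
Proof.
move=> /cvg_ReIm[fr fi]; apply/cvg_ReIm; split.
  by under eq_fun do rewrite cReJ; rewrite cReJ.
by under eq_fun do rewrite cImJ; rewrite cImJ; exact: cvgN.
Qed.

End real_topology.

Section Cn_norm.
Context {R : realType} {n : nat}.
Local Notation C := R[i].
Local Notation Cn := 'rV[C]_n.

Lemma rn_coord (z : Cn) j : rn (z 0 j) <= rn z.
Proof.
rewrite -lecR -!rnE [leRHS]/Num.norm/= mx_normE.
have -> : `|z 0 j| = `|z 0 j|%:nng%:num by [].
by rewrite num_le; apply/bigmax_geP; right; exists (0, j).
Qed.

Lemma rn_lt (z : Cn) (e : R) : 0 < e -> (forall j, rn (z 0 j) < e) -> rn z < e.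
Proof.
move=> e0 h; rewrite -ltcR -rnE.
have [->|z0] := eqVneq `|z| 0; first by rewrite ltcR.
have [[i j] /= zE] := mx_norm_neq0 z0.
by rewrite [ltLHS]zE ord1 rnE ltcR.
Qed.

Lemma rn_le (z : Cn) (e : R) : 0 <= e -> (forall j, rn (z 0 j) <= e) -> rn z <= e.
Proof.
move=> e0 h; apply/ler_addgt0Pr => d d0; apply/ltW/rn_lt; first lra.
by move=> j; rewrite (le_lt_trans (h j))// ltrDl.
Qed.

Lemma rn_real_dir (k : 'I_n + 'I_n) : rn (real_dir k : Cn) <= 1.
Proof.
apply: rn_le => // j; case: k => k /=; rewrite !mxE eqxx /=; case: eqP => _;
  by rewrite ?mulr1 ?mulr0 ?rni ?rn1 ?rn0.
Qed.

Lemma continuous_coord j (z : Cn) : w 0 j @[w --> z] --> z 0 j.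
Proof.
apply/cvg_nbhsP => e e0; exists e => // w we.
by rewrite (le_lt_trans _ we)// (le_trans _ (rn_coord _ j))// !mxE.
Qed.

End Cn_norm.

#[global] Instance nbhs_Cn_filter {R : realType} {n : nat} (z : 'rV[R[i]]_n) :
  ProperFilter (nbhs z) := nbhs_pfilter z.

#[global] Instance nbhs_C_filter {R : realType} (z : R[i]) :
  ProperFilter (nbhs z) := nbhs_pfilter z.

(** * Lebesgue measure on C^n *)

Section lebesgue_tuple_theory.
Context {R : realType}.
Local Notation mR := (measurableTypeR R).

(** The pushforward under a translation and Lebesgue measure agree on half-open intervals, and this
    determines the measure. *)
Lemma lebesgue_measure_shift (a : R) (A : set mR) : measurable A ->
  lebesgue_measure ((fun x => x + a) @^-1` A) = lebesgue_measure A.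
Proof.
move=> mA.
have ms : measurable_fun setT ((fun x => x + a) : mR -> mR).
  exact: measurable_funD.
apply/esym/(lebesgue_measure_unique (mu := measure_function_pushforward__canonical__measure_function_Measure (@lebesgue_measure R) ms)) => //.
move=> X [[x y] _ <-] /=; rewrite /pushforward/=.
rewrite (_ : _ @^-1` _ = `]x - a, y - a]%classic); last first.
  by apply/seteqP; split => z /=; rewrite !in_itv/= ltrBlDr lerBrDr.
by rewrite !lebesgue_measure_itv/= !lte_fin ltrD2r -!EFinB; case: ifP => // _; congr EFin; ring.
Qed.

Definition shift_tuple n (a t : n.-tuple mR) : n.-tuple mR :=
  [tuple tnth t i + tnth a i | i < n].

Lemma shift_cons_pair n (a : n.+1.-tuple mR) (x : mR) (t : n.-tuple mR) :
  shift_tuple a (cons_pair (x, t)) =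
  cons_pair (x + thead a, shift_tuple (behead_tuple a) t).
Proof.
apply: eq_from_tnth => i; rewrite tnth_mktuple.
case: (unliftP ord0 i) => [j ->|->].
  rewrite !tnthS tnth_mktuple [in LHS](tuple_eta a) tnthS; congr (_ + tnth _ _).
by rewrite !tnth0 /thead.
Qed.

(** Induction on the dimension: the product measure integrates the measures of the sections, the
    induction hypothesis translates each section, and the one-dimensional case translates the
    variable of integration. *)
Lemma lebesgue_tuple_shift n (a : n.-tuple mR) (A : set (n.-tuple mR)) :
  measurable A ->
  lebesgue_tuple n (shift_tuple a @^-1` A) = lebesgue_tuple n A.
Proof.
elim: n a A => [|n ih] a A mA.
  by congr (lebesgue_tuple 0 _); apply/seteqP; split => t /=; rewrite (tuple0 (shift_tuple a t)) (tuple0 t).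
have mB : measurable (@cons_pair R n @^-1` A).
  by rewrite -[X in measurable X]setTI; exact: measurable_cons_pair.
change (product_measure1 (@lebesgue_measure R) (lebesgue_tuple n)
   (@cons_pair R n @^-1` (shift_tuple a @^-1` A)) =
  product_measure1 (@lebesgue_measure R) (lebesgue_tuple n) (@cons_pair R n @^-1` A)).
rewrite /product_measure1/=.
set B := @cons_pair R n @^-1` A.
have mf : measurable_fun setT (lebesgue_tuple n \o xsection B).
  exact: measurable_fun_xsection.
transitivity (\int[lebesgue_measure]_x (lebesgue_tuple n \o xsection B) (x + thead a)%R)%E.
  apply: eq_integral => x _ /=.
  rewrite -(ih (behead_tuple a) (xsection B (x + thead a))); last exact: measurable_xsection.
  congr (lebesgue_tuple n _); apply/seteqP; split => t; rewrite /xsection/= !inE /B /=;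
    by rewrite shift_cons_pair.
have ms : measurable_fun setT ((fun x => x + thead a) : mR -> mR).
  exact: measurable_funD.
rewrite -(@ge0_integral_pushforward _ _ _ _ _ _ ms lebesgue_measure setT (lebesgue_tuple n \o xsection B)) //.
apply: eq_measure_integral => /= C mC _.
by rewrite /pushforward lebesgue_measure_shift.
Qed.

Definition tbox n (M : R) : set (n.-tuple mR) :=
  [set t | forall i, `|(tnth t i : R)| <= M].

Lemma lebesgue_tuple_box n (M : R) :
  measurable (@tbox n M) /\
  (lebesgue_tuple n (@tbox n M) < +oo)%E.
Proof.
elim: n => [|n [mB ih]].
  rewrite (_ : @tbox 0 M = setT); last by apply/seteqP; split => // t _ [].
  by split => //; rewrite /= diracT ltry.
have EB : (@tbox n.+1 M) =
    (fun t => tnth t ord0) @^-1` `[- M, M]%classic `&`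
    (fun t : n.+1.-tuple mR => [tuple of behead t]) @^-1` (@tbox n M).
  apply/seteqP; split => t /=.
    move=> h; split; first by rewrite in_itv/= -ler_norml.
    by move=> i; rewrite tnth_behead.
  rewrite in_itv/= -ler_norml => -[h0 h] i.
  by case: (unliftP ord0 i) => [j ->|->//]; have := h j; rewrite (tuple_eta t) tnthS; congr (`|(tnth _ _ : R)| <= _); exact/val_inj.
split.
  rewrite EB; apply: measurableI; rewrite -[X in measurable X]setTI.
    exact: measurable_tnth.
  exact: measurable_behead.
change (product_measure1 (@lebesgue_measure R) (lebesgue_tuple n)
   (@cons_pair R n @^-1` (@tbox n.+1 M)) < +oo)%E.
rewrite (_ : _ @^-1` _ = `[- M, M]%classic `*` (@tbox n M)).
  rewrite product_measure1E//.
  have hI : (lebesgue_measure ([set` `[(- M)%R, M]] : set mR) < +oo)%E.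
    by rewrite (@lebesgue_measure_itv R `[- M, M])/=; case: ifP => _; rewrite ?ltry// -EFinB ltry.
  by rewrite lte_mul_pinfty// ge0_fin_numE.
rewrite EB; apply/seteqP; split => -[x t] /= [h1 h2]; split => //.
  by have -> : t = [tuple of behead (cons_pair (x, t))] by exact/val_inj.
by have <- : t = [tuple of behead (cons_pair (x, t))] by exact/val_inj.
Qed.

(** Together with translation invariance, positivity of the whole space yields positivity of every
    ball in [volume_ball_gt0]. *)
Lemma lebesgue_tuple_gt0 n : (0 < lebesgue_tuple n (setT : set (n.-tuple mR)))%E.
Proof.
elim: n => [|n ih]; first by rewrite /= diracT lte01.
change (0 < product_measure1 (@lebesgue_measure R) (lebesgue_tuple n)
   (@cons_pair R n @^-1` setT))%E.
rewrite preimage_setT -setXTT product_measure1E//.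
rewrite mule_gt0//.
have -> : (setT : set mR) = `]-oo, +oo[%classic by rewrite set_itvE.
rewrite [ltRHS](_ : _ = +oo%E) ?ltry//.
exact: (@lebesgue_measure_itv R `]-oo, +oo[).
Qed.

End lebesgue_tuple_theory.

Section volume_theory.
Context {R : realType} {n : nat}.
Local Notation C := R[i].
Local Notation Cn := 'rV[C]_n.
Local Notation mR := (measurableTypeR R).

Lemma measurable_real_coord (k : 'I_(n + n)) :
  measurable_fun (setT : set Cn) (real_coord k).
Proof.
move=> _ B mB; rewrite setTI; apply: sub_sigma_algebra => /=.
by rewrite -bigcup_seq/=; exists k => /=; [rewrite mem_index_enum|exists B; rewrite ?setTI].
Qed.

Lemma measurable_coord_Re j : measurable_fun (setT : set Cn) (fun z => Re (z 0 j)).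
Proof.
rewrite (_ : (fun _ => _) = real_coord (lshift n j)); first exact: measurable_real_coord.
by apply/funext => z; rewrite /real_coord; case: split_ordP => k /eqP; rewrite ?eq_lrshift// => /eqP/lshift_inj ->.
Qed.

Lemma measurable_coord_Im j : measurable_fun (setT : set Cn) (fun z => Im (z 0 j)).
Proof.
rewrite (_ : (fun _ => _) = real_coord (rshift n j)); first exact: measurable_real_coord.
by apply/funext => z; rewrite /real_coord; case: split_ordP => k /eqP; rewrite ?eq_rlshift// => /eqP/rshift_inj ->.
Qed.

Lemma measurable_fun_CnP d (T : measurableType d) (f : T -> Cn) :
  (forall j, measurable_fun setT (fun x => Re (f x 0 j))) ->
  (forall j, measurable_fun setT (fun x => Im (f x 0 j))) ->
  measurable_fun setT f.
Proof.
move=> hr hi.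
apply: (@measurability _ _ _ _ _ _
  (\big[setU/set0]_(k < n + n) preimage_set_system setT (@real_coord R n k) measurable)).
  by [].
move=> A [D GD <-]; move: GD; rewrite -bigcup_seq => -[k _ [B mB <-]].
rewrite setTI setTI -comp_preimage -[X in measurable X]setTI.
have : measurable_fun setT (real_coord k \o f).
  rewrite /real_coord; case: (split_ordP k) => j _ /=; first exact: hr.
  exact: hi.
exact.
Qed.

Lemma real_coord_Cn_of_tuple k (t : (n + n).-tuple mR) :
  real_coord k (Cn_of_tuple t) = tnth t k.
Proof. by rewrite /real_coord; case: split_ordP => j ->; rewrite !mxE. Qed.

Lemma measurable_shift (a : Cn) : measurable_fun setT (fun z : Cn => z + a).
Proof.
apply: measurable_fun_CnP => j.
  under eq_fun do rewrite mxE cReD.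
  by apply: measurable_funD => //; exact: measurable_coord_Re.
under eq_fun do rewrite mxE cImD.
by apply: measurable_funD => //; exact: measurable_coord_Im.
Qed.

Lemma measurable_sub2 : measurable_fun setT (fun z : Cn * Cn => z.1 - z.2).
Proof.
apply: measurable_fun_CnP => j.
  under eq_fun do rewrite 2!mxE cReD cReN.
  by apply: measurable_funB; apply: (measurableT_comp (measurable_coord_Re j)).
under eq_fun do rewrite 2!mxE cImD cImN.
by apply: measurable_funB; apply: (measurableT_comp (measurable_coord_Im j)).
Qed.

Lemma volumeE (A : set Cn) :
  volume A = lebesgue_tuple (n + n) (@Cn_of_tuple R n @^-1` A).
Proof. by []. Qed.

Lemma volume_shift (a : Cn) (A : set Cn) : measurable A ->
  volume ((fun z => z + a) @^-1` A) = volume A.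
Proof.
move=> mA; rewrite !volumeE.
pose ta : (n + n).-tuple mR := [tuple real_coord k a | k < n + n].
rewrite -(@lebesgue_tuple_shift _ _ ta (_ @^-1` A)); last first.
  by rewrite -[X in measurable X]setTI; exact: measurable_Cn_of_tuple.
apply: (f_equal (lebesgue_tuple (n + n))); apply/funext => t.
apply: (f_equal A); apply/rowP => j; rewrite !mxE !tnth_mktuple /real_coord.
case: split_ordP => k; last by move=> /eqP; rewrite eq_lrshift.
move=> /lshift_inj <-; case: split_ordP => k'; first by move=> /eqP; rewrite eq_rlshift.
by move=> /rshift_inj <-; case: (a 0 j).
Qed.

Definition box (M : R) : set Cn := [set z | forall k, `|(real_coord k z : R)| <= M].

Lemma preimage_box M : @Cn_of_tuple R n @^-1` box M = @tbox R (n + n) M.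
Proof.
by apply/seteqP; split => t /= h k; have := h k; rewrite real_coord_Cn_of_tuple.
Qed.

Lemma measurable_box M : measurable (box M).
Proof.
rewrite (_ : box M = \bigcap_k (real_coord k @^-1` `[- M, M]%classic)); last first.
  apply/seteqP; split => z h k; first by move=> _ /=; rewrite in_itv/= -ler_norml; exact: h.
  by have /= := h k I; rewrite in_itv/= -ler_norml.
apply: fin_bigcap_measurable => // k _.
by rewrite -[X in measurable X]setTI; exact: measurable_real_coord.
Qed.

Lemma volume_box_fin M : (volume (box M) < +oo)%E.
Proof. by rewrite volumeE preimage_box; have [] := @lebesgue_tuple_box R (n + n) M. Qed.

Lemma volume_setT_gt0 : (0 < volume (setT : set Cn))%E.
Proof. by rewrite volumeE preimage_setT lebesgue_tuple_gt0. Qed.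

Lemma bigcup_box : \bigcup_k box k%:R = setT.
Proof.
rewrite -subTset => z _; pose M := \sum_k `|(real_coord k z : R)|.
exists (Num.trunc M).+1 => // k; apply: (@le_trans _ _ M).
  by rewrite /M (bigD1 k)//= lerDl sumr_ge0.
by apply: ltW; rewrite truncnS_gt.
Qed.

Lemma volume_sigma_finite : sigma_finite setT (@volume R n).
Proof.
exists (fun k => box k%:R); first by rewrite bigcup_box.
by move=> k; split; [exact: measurable_box|exact: volume_box_fin].
Qed.

HB.instance Definition _ := Measure_isSigmaFinite.Build _ _ _
  (@volume R n) volume_sigma_finite.

End volume_theory.

(** * Semi-inner product spaces *)

Section sequences_real.
Context {R : realType}.

Lemma cvgn0P (x : nat -> R) : x k @[k --> \oo] --> (0 : R) <->
  forall e : R, 0 < e -> exists N, forall k, (N <= k)%N -> `|x k| < e.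
Proof.
split=> [/cvgr0Pnorm_lt h e /h [N _ H]|h].
  by exists N => k Nk; exact: H.
apply/cvgr0Pnorm_lt => e /h[N H].
by exists N => // k /= /H.
Qed.

Lemma inv_small (e : R) : 0 < e -> exists N, forall k, (N <= k)%N -> k.+1%:R^-1 < e.
Proof.
move=> e0; exists (Num.trunc e^-1) => k Nk; rewrite invf_plt ?posrE//.
by rewrite (lt_le_trans (truncnS_gt _))// ler_nat.
Qed.

(** The first-order condition at a minimum: at [t = - X / (G + 1)] the expression equals
    [- (X / (G + 1)) ^+ 2]. *)
Lemma lin_sq0 (X G : R) : 0 <= G -> (forall t, 0 <= t * X + t ^+ 2 * G) -> X = 0.
Proof.
move=> G0 h; apply/eqP/negPn/negP => X0.
have := h (- X / (G + 1)).
have -> : - X / (G + 1) * X + (- X / (G + 1)) ^+ 2 * G = - (X / (G + 1)) ^+ 2.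
  by field; lra.
by rewrite oppr_ge0 leNgt exprn_even_gt0//= mulf_neq0// invr_eq0; apply/eqP; lra.
Qed.

End sequences_real.

Section prehilbert.
Context {R : realType} {E : lmodType R[i]}.
Local Notation C := R[i].
Variables (V : set E) (ip : E -> E -> C).

(** The form is only semi-definite: functions that agree almost everywhere stay distinct elements,
    and equality of vectors is expressed by a difference of norm 0. *)
Record prehilbert : Prop := PreHilbert {
  ph0 : V 0;
  phL : forall (a : C) f g, V f -> V g -> V (a *: f + g);
  phlin : forall (a : C) f g h, V f -> V g -> V h ->
    ip (a *: f + g) h = a * ip f h + ip g h;
  phC : forall f g, V f -> V g -> ip g f = (ip f g)^*;
  ph_ge0 : forall f, V f -> 0 <= Re (ip f f) }.

Hypothesis H : prehilbert.
Local Notation hn := (hnorm ip).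

Lemma phZ a f : V f -> V (a *: f).
Proof. by move=> Vf; rewrite -[_ *: _]addr0; apply: phL => //; exact: ph0. Qed.

Lemma phD f g : V f -> V g -> V (f + g).
Proof. by move=> Vf Vg; rewrite -[f]scale1r; exact: phL. Qed.

Lemma phN f : V f -> V (- f).
Proof. by move=> Vf; rewrite -scaleN1r; exact: phZ. Qed.

Lemma phB f g : V f -> V g -> V (f - g).
Proof. by move=> Vf Vg; apply: phD => //; exact: phN. Qed.

Lemma ipDl f g h : V f -> V g -> V h -> ip (f + g) h = ip f h + ip g h.
Proof. by move=> *; rewrite -{1}[f]scale1r phlin// mul1r. Qed.

Lemma ip0l h : V h -> ip 0 h = 0.
Proof.
move=> Vh; have := ipDl (ph0 H) (ph0 H) Vh; rewrite addr0 => /eqP.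
by rewrite -subr_eq subrr eq_sym => /eqP.
Qed.

Lemma ipZl a f h : V f -> V h -> ip (a *: f) h = a * ip f h.
Proof.
move=> Vf Vh; rewrite -[a *: f]addr0 phlin//; last exact: ph0.
by rewrite ip0l// addr0.
Qed.

Lemma ipNl f h : V f -> V h -> ip (- f) h = - ip f h.
Proof. by move=> *; rewrite -scaleN1r ipZl// mulN1r. Qed.

Lemma ipBl f g h : V f -> V g -> V h -> ip (f - g) h = ip f h - ip g h.
Proof. by move=> *; rewrite ipDl ?ipNl//; exact: phN. Qed.

Lemma ipDr f g h : V f -> V g -> V h -> ip f (g + h) = ip f g + ip f h.
Proof.
move=> Vf Vg Vh; rewrite (phC H (phD Vg Vh) Vf) ipDl// rmorphD/=.
by rewrite -!(phC H).
Qed.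

Lemma ipZr a f h : V f -> V h -> ip f (a *: h) = a^* * ip f h.
Proof.
move=> Vf Vh; rewrite (phC H (phZ a Vh) Vf) ipZl// rmorphM/=.
by rewrite -(phC H).
Qed.

Lemma ipNr f h : V f -> V h -> ip f (- h) = - ip f h.
Proof. by move=> *; rewrite -scaleN1r ipZr// rmorphN1 mulN1r. Qed.

Lemma ipBr f g h : V f -> V g -> V h -> ip f (g - h) = ip f g - ip f h.
Proof. by move=> *; rewrite ipDr ?ipNr//; exact: phN. Qed.

Lemma ip0r h : V h -> ip h 0 = 0.
Proof. by move=> Vh; rewrite (phC H (ph0 H) Vh) ip0l// conjc0. Qed.

Lemma hn_ge0 f : 0 <= hn f. Proof. exact: sqrtr_ge0. Qed.

Lemma hn_sq f : V f -> hn f ^+ 2 = Re (ip f f).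
Proof. by move=> Vf; rewrite sqr_sqrtr// ph_ge0. Qed.

Lemma ip_self f : V f -> ip f f = (hn f ^+ 2)%:C.
Proof.
move=> Vf; apply: eqc; rewrite hn_sq//=.
by have := congr1 (fun x : C => Im x) (phC H Vf Vf); rewrite cImJ; lra.
Qed.

Lemma hnZ a f : V f -> hn (a *: f) = rn a * hn f.
Proof.
move=> Vf; apply/eqP; rewrite -(eqrXn2 (n := 2))// ?mulr_ge0 ?rn_ge0 ?hn_ge0//.
rewrite hn_sq ?exprMn; last exact: phZ.
have -> : ip (a *: f) (a *: f) = (rn a ^+ 2 * hn f ^+ 2)%:C.
  by rewrite (ipZl a Vf (phZ a Vf)) (ipZr a Vf Vf) (ip_self Vf) mulrA mulcJ -rmorphM.
by [].
Qed.

Lemma hnN f : V f -> hn (- f) = hn f.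
Proof. by move=> Vf; rewrite -scaleN1r hnZ// rnN rn1 mul1r. Qed.

Lemma hn0 : hn 0 = 0.
Proof. by rewrite /hnorm ip0l ?sqrtr0//; exact: ph0. Qed.

Lemma hnB_sq f g : V f -> V g ->
  hn (f - g) ^+ 2 = hn f ^+ 2 - 2 * Re (ip f g) + hn g ^+ 2.
Proof.
move=> Vf Vg; rewrite !hn_sq//; last exact: phB.
rewrite ipBl ?ipBr//; last exact: phB.
by rewrite (phC H Vf Vg) !(cReD, cReN, cReJ); ring.
Qed.

Lemma hnD_sq f g : V f -> V g ->
  hn (f + g) ^+ 2 = hn f ^+ 2 + 2 * Re (ip f g) + hn g ^+ 2.
Proof.
move=> Vf Vg; have := hnB_sq Vf (phN Vg); rewrite opprK => ->.
by rewrite hnN// ipNr// cReN; ring.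
Qed.

Lemma hn_distC f g : V f -> V g -> hn (f - g) = hn (g - f).
Proof. by move=> Vf Vg; rewrite -hnN ?opprB//; exact: phB. Qed.

Lemma cauchy_schwarz f g : V f -> V g -> rn (ip f g) <= hn f * hn g.
Proof.
move=> Vf Vg.
(* The square of the norm of [f - (t%:C * ip f g) *: g]. If [hn g] is not 0, the minimiser
   [(hn g ^+ 2)^-1] gives the inequality; if it is 0, the expression is affine in [t] and becomes
   negative for large [t] unless [ip f g = 0]. *)
have key (t : R) : 0 <= hn f ^+ 2 - 2 * t * rn (ip f g) ^+ 2 +
    t ^+ 2 * rn (ip f g) ^+ 2 * hn g ^+ 2.
  have := sqr_ge0 (hn (f - (t%:C * ip f g) *: g)).
  rewrite hnB_sq//; last exact: phZ.
  rewrite hnZ// ipZr//.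
  have -> : Re ((t%:C * ip f g)^* * ip f g) = t * rn (ip f g) ^+ 2.
    by rewrite rn_sq; case: (ip f g) => a b /=; ring.
  rewrite rnM rn_real !exprMn real_normK ?num_real// => h.
  by apply: le_trans h _; rewrite mulrA.
have g0 := hn_ge0 g; have f0 := hn_ge0 f; have p0 := rn_ge0 (ip f g).
rewrite -(@ler_pXn2r _ 2)// ?nnegrE ?mulr_ge0// exprMn.
have [gz|gnz] := eqVneq (hn g) 0; last first.
  have g2 : 0 < hn g ^+ 2 by rewrite exprn_gt0// lt_def gnz.
  have := mulr_ge0 (ltW g2) (key (hn g ^+ 2)^-1).
  suff -> : hn g ^+ 2 * (hn f ^+ 2 - 2 * (hn g ^+ 2)^-1 * rn (ip f g) ^+ 2 +
    (hn g ^+ 2)^-1 ^+ 2 * rn (ip f g) ^+ 2 * hn g ^+ 2) =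
    hn f ^+ 2 * hn g ^+ 2 - rn (ip f g) ^+ 2 by rewrite subr_ge0.
  by field; rewrite gnz.
rewrite gz expr0n mulr0 leNgt; apply/negP => p2.
have := key ((hn f ^+ 2 + 1) / rn (ip f g) ^+ 2).
rewrite gz expr0n mulr0 addr0.
suff -> : hn f ^+ 2 - 2 * ((hn f ^+ 2 + 1) / rn (ip f g) ^+ 2) * rn (ip f g) ^+ 2
   = - hn f ^+ 2 - 2 by have := sqr_ge0 (hn f); lra.
by field; move: (lt0r_neq0 p2); rewrite expf_eq0.
Qed.

Lemma hnD f g : V f -> V g -> hn (f + g) <= hn f + hn g.
Proof.
move=> Vf Vg.
rewrite -(@ler_pXn2r _ 2)// ?nnegrE ?addr_ge0 ?hn_ge0//.
rewrite hnD_sq//.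
have h : Re (ip f g) <= hn f * hn g.
  by rewrite (le_trans (ler_norm _))// (le_trans (normr_Re _))// cauchy_schwarz.
by rewrite -subr_ge0; move: h; set x := Re _; nra.
Qed.

Lemma hnB f g : V f -> V g -> hn (f - g) <= hn f + hn g.
Proof. by move=> Vf Vg; rewrite -(hnN Vg) hnD//; exact: phN. Qed.

Lemma hn_trans g f h : V f -> V g -> V h -> hn (f - h) <= hn (f - g) + hn (g - h).
Proof.
move=> Vf Vg Vh; rewrite (le_trans _ (hnD _ _))//; try exact: phB.
by rewrite addrA subrK.
Qed.

Lemma hn_le_dist f g : V f -> V g -> hn f <= hn g + hn (f - g).
Proof. by move=> Vf Vg; rewrite -{1}(subrK g f) addrC hnD//; exact: phB. Qed.

Lemma ip_null f g : V f -> V g -> hn f = 0 -> ip f g = 0.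
Proof.
move=> Vf Vg f0; apply: rn_eq0; apply/eqP; rewrite eq_le rn_ge0 andbT.
by rewrite (le_trans (cauchy_schwarz _ _))// f0 mul0r.
Qed.

Lemma ip_nullr f g : V f -> V g -> hn g = 0 -> ip f g = 0.
Proof. by move=> Vf Vg g0; rewrite (phC H Vg Vf) ip_null// conjc0. Qed.

Definition complete : Prop := forall u : nat -> E, (forall k, V (u k)) ->
  (forall e : R, 0 < e -> exists N, forall i j, (N <= i)%N -> (N <= j)%N ->
    hn (u i - u j) < e) ->
  exists2 l, V l & hn (u k - l) @[k --> \oo] --> (0 : R).

Lemma cvg_ipr (u : nat -> E) l f : V f -> V l -> (forall k, V (u k)) ->
  hn (u k - l) @[k --> \oo] --> (0 : R) -> forall e : R, 0 < e ->
  exists N, forall k, (N <= k)%N -> rn (ip f (u k) - ip f l) < e.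
Proof.
move=> Vf Vl Vu /cvgn0P ul e e0.
have f1 : 0 < hn f + 1 by rewrite ltr_wpDl// hn_ge0.
have [N HN] := ul (e / (hn f + 1)) (divr_gt0 e0 f1).
exists N => k /HN; rewrite ger0_norm ?hn_ge0// => h.
rewrite -ipBr// (le_lt_trans (cauchy_schwarz _ _))//; first exact: phB.
move: h; rewrite ltr_pdivlMr//.
by have := hn_ge0 (u k - l); have := hn_ge0 f; set a := hn f; set b := hn _; nra.
Qed.

End prehilbert.

Section hilbert.
Context {R : realType} {E : lmodType R[i]}.
Local Notation C := R[i].
Variables (V : set E) (ip : E -> E -> C).
Hypothesis H : prehilbert V ip.
Local Notation hn := (hnorm ip).

Lemma cvg_ipl (u : nat -> E) l f : V f -> V l -> (forall k, V (u k)) ->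
  hn (u k - l) @[k --> \oo] --> (0 : R) -> forall e : R, 0 < e ->
  exists N, forall k, (N <= k)%N -> rn (ip (u k) f - ip l f) < e.
Proof.
move=> Vf Vl Vu ul e e0; have [N HN] := cvg_ipr H Vf Vl Vu ul e0.
exists N => k /HN; rewrite (phC H (Vu k) Vf) (phC H Vl Vf) => h.
by rewrite -rnJ rmorphB.
Qed.

Lemma cvg_hn (u : nat -> E) l : V l -> (forall k, V (u k)) ->
  hn (u k - l) @[k --> \oo] --> (0 : R) -> forall e : R, 0 < e ->
  exists N, forall k, (N <= k)%N -> hn (u k) < hn l + e /\ hn l < hn (u k) + e.
Proof.
move=> Vl Vu /cvgn0P ul e /ul[N HN]; exists N => k /HN.
rewrite ger0_norm ?hn_ge0// => h; split.
  by rewrite (le_lt_trans (hn_le_dist H (Vu k) Vl))// ltrD2l.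
by rewrite (le_lt_trans (hn_le_dist H Vl (Vu k)))// ltrD2l (hn_distC H).
Qed.

Lemma prehilbert_sub (W : set E) : W `<=` V -> W 0 ->
  (forall (a : C) f g, W f -> W g -> W (a *: f + g)) -> prehilbert W ip.
Proof.
move=> WV W0 WL; split => //.
- by move=> a f g h /WV Vf /WV Vg /WV Vh; exact: (phlin H).
- by move=> f g /WV Vf /WV Vg; exact: (phC H).
- by move=> f /WV Vf; exact: (ph_ge0 H).
Qed.

(* Minimizing [|Phi b|^2 - 2 Re (l b)] produces the representing vector as a
   limit of vectors [Phi b]. *)
Lemma riesz (F : lmodType C) (B : set F) (Phi : F -> E) (l : F -> C) (c : R) :
  complete V ip -> B 0 ->
  (forall (a : C) x y, B x -> B y -> B (a *: x + y)) ->
  (forall x, B x -> V (Phi x)) ->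
  (forall (a : C) x y, B x -> B y -> Phi (a *: x + y) = a *: Phi x + Phi y) ->
  (forall (a : C) x y, B x -> B y -> l (a *: x + y) = a * l x + l y) ->
  0 <= c -> (forall x, B x -> rn (l x) <= c * hn (Phi x)) ->
  exists u, [/\ V u, forall x, B x -> l x = ip (Phi x) u, hn u <= c &
    exists2 b : nat -> F, forall k, B (b k) &
      hn (Phi (b k) - u) @[k --> \oo] --> (0 : R)].
Proof.
move=> cV B0 BL VPhi PhiL lL c0 lc.
pose J x := hn (Phi x) ^+ 2 - 2 * Re (l x).
have Jge x : B x -> - c ^+ 2 <= J x.
  move=> Bx; rewrite /J.
  have : Re (l x) <= c * hn (Phi x).
    by rewrite (le_trans (ler_norm _))// (le_trans (normr_Re _))// lc.
  by move: (hn (Phi x)) (Re (l x)) => p q; have := sqr_ge0 (p - c); nra.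
have Phi0 : Phi 0 = 0.
  by have := PhiL (-1) 0 0 B0 B0; rewrite scaler0 addr0 scaleN1r addNr.
have l0 : l 0 = 0.
  by have := lL (-1) 0 0 B0 B0; rewrite scaler0 addr0 mulN1r addNr.
have BZ a x : B x -> B (a *: x) by move=> Bx; rewrite -[_ *: _]addr0; exact: BL.
have PhiZ a x : B x -> Phi (a *: x) = a *: Phi x.
  by move=> Bx; rewrite -[_ *: _]addr0 PhiL// Phi0 addr0.
have lZ a x : B x -> l (a *: x) = a * l x.
  by move=> Bx; rewrite -[_ *: _]addr0 lL// l0 addr0.
pose m := inf (J @` B).
have infJ : has_inf (J @` B).
  by split; [exists (J 0), 0|exists (- c ^+ 2) => _ [x Bx <-]; exact: Jge].
have mJ x : B x -> m <= J x.
  by move=> Bx; apply: ge_inf; [case: infJ|exists x].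
have /choice[b bP] (k : nat) : exists x, B x /\ J x < m + k.+1%:R^-1.
  have k0 : 0 < k.+1%:R^-1 :> R by rewrite invr_gt0.
  have [_ [x Bx <-] h] := inf_adherent k0 infJ.
  by exists x.
have Bb k : B (b k) by case: (bP k).
have Vb k : V (Phi (b k)) by exact: VPhi.
(* Parallelogram law: the value of [J] at the midpoint of [b i] and [b j] is at least the infimum
   [m], while both ends are nearly minimal. *)
have cauchy i j : hn (Phi (b i) - Phi (b j)) ^+ 2 <=
    2 * i.+1%:R^-1 + 2 * j.+1%:R^-1.
  have [[_ hi] [_ hj]] := (bP i, bP j).
  pose z := 2^-1 *: (1 *: b i + b j).
  have Bz : B z by apply: BZ; exact: BL.
  have := mJ _ Bz; rewrite /J /z PhiZ ?lZ ?lL ?PhiL//; try exact: BL.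
  rewrite scale1r mul1r (hnZ H); last exact: (phD H).
  rewrite exprMn (hnB_sq H (Vb i) (Vb j)) (hnD_sq H (Vb i) (Vb j)).
  have -> : (2^-1 : C) = (2^-1 : R)%:C by rewrite fmorphV/= rmorph_nat.
  have -> (q : C) : Re ((2^-1 : R)%:C * q) = 2^-1 * Re q.
    by case: q => p q /=; rewrite mul0r subr0.
  rewrite rn_real ger0_norm ?invr_ge0// cReD.
  move: hi hj; rewrite /J.
  move: (hn (Phi (b i)) ^+ 2) (hn (Phi (b j)) ^+ 2) (Re (l _)) (Re (l _))
    (Re (ip _ _)) (i.+1%:R^-1) (j.+1%:R^-1) => p q r s t e e'.
  by have -> : (2^-1 : R) ^+ 2 = 4^-1 by [field]; lra.
have [u Vu ub] : exists2 u, V u & hn (Phi (b k) - u) @[k --> \oo] --> (0 : R).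
  apply: cV => // e e0.
  have e4 : 0 < e ^+ 2 / 4 by rewrite divr_gt0// exprn_gt0.
  have [N HN] := inv_small e4; exists N => i j Ni Nj.
  rewrite -(@ltr_pXn2r _ 2)// ?nnegrE ?hn_ge0 ?ltW//.
  rewrite (le_lt_trans (cauchy i j))//.
  by move: (HN _ Ni) (HN _ Nj); move: (i.+1%:R^-1) (j.+1%:R^-1) (e ^+ 2) => p q r; lra.
(* First variation of [J] at [b k] in the direction [- t *: x], halved, in the limit of large
   [k]. *)
have ReP x : B x -> Re (l x) = Re (ip (Phi x) u).
  move=> Bx; apply/eqP; rewrite -subr_eq0; apply/eqP.
  apply: (@lin_sq0 _ _ (hn (Phi x) ^+ 2 / 2)).
    by rewrite divr_ge0// sqr_ge0.
  move=> t; apply/ler_addgt0Pr => e e0.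
  have Vx := VPhi _ Bx.
  have t1 : 0 < `|t| + 1 by rewrite ltr_wpDl.
  have [N HN] := cvg_ipr H Vx Vu Vb ub (divr_gt0 e0 (mulr_gt0 (@ltr0Sn R 1) t1)).
  have [N' HN'] := inv_small e0; pose k := maxn N N'.
  have := HN k (leq_maxl _ _); have := HN' k (leq_maxr _ _).
  have [_ hk] := bP k.
  have := mJ _ (BL (- t)%:C _ _ Bx (Bb k)).
  rewrite /J PhiL// lL// (hnD_sq H)//; last exact: (phZ H).
  rewrite (ipZl H)// (hnZ H)// cReD.
  have rZ (q : C) : Re ((- t)%:C * q) = - t * Re q.
    by case: q => p q /=; rewrite mul0r subr0.
  rewrite !rZ rn_real normrN exprMn real_normK ?num_real//.
  move: hk; rewrite /J => hk h1 h2 h3.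
  have h4 : `|Re (ip (Phi x) (Phi (b k))) - Re (ip (Phi x) u)| < e / (2 * (`|t| + 1)).
    by apply: le_lt_trans h3; rewrite -cReN -cReD normr_Re.
  have h5 : `|t * (Re (ip (Phi x) (Phi (b k))) - Re (ip (Phi x) u))| <= e / 2.
    rewrite normrM; apply: (@le_trans _ _ ((`|t| + 1) * (e / (2 * (`|t| + 1))))).
      by rewrite ler_pM// ?lerDl// ltW.
    by rewrite le_eqVlt; apply/orP; left; apply/eqP; field; lra.
  move: h5; rewrite ler_norml => /andP[h5 h6].
  move: h1 h2 hk h5 h6; move: (Re (ip (Phi x) u)) (Re (ip _ _)) (Re (l _)) (Re (l _))
    (hn (Phi x) ^+ 2) (hn (Phi (b k)) ^+ 2) (k.+1%:R^-1) => p q r s v w d.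
  by lra.
exists u; split => //.
- move=> x Bx; apply: eqc; first exact: ReP.
  have := ReP _ (BZ (- 'i%C) _ Bx); rewrite lZ// PhiZ// (ipZl H)//; last exact: VPhi.
  by rewrite !mulNr !cReN ![_ * l _]mulrC ![_ * ip _ _]mulrC !ReiNIm !opprK.
- have uc e : 0 < e -> hn u ^+ 2 <= c * hn u + (c + 1) * e.
    move=> e0; have [N HN] := cvg_hn Vu Vb ub e0.
    have [N' HN'] := cvg_ipl Vu Vu Vb ub e0.
    have [h1 _] := HN _ (leq_maxl N N'); have := HN' _ (leq_maxr N N').
    set k := maxn N N'; move: h1 => h1 h2; rewrite (hn_sq H)//.
    have h3 : Re (ip u u) <= Re (ip (Phi (b k)) u) + e.
      rewrite -lerBlDl -cReN -cReD (le_trans (ler_norm _))//.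
      by rewrite (le_trans (normr_Re _))// rn_distC ltW.
    have h4 : Re (ip (Phi (b k)) u) <= c * hn (Phi (b k)).
      by rewrite -ReP// (le_trans (ler_norm _))// (le_trans (normr_Re _))// lc.
    by nra.
  have h : hn u ^+ 2 <= c * hn u.
    apply/ler_addgt0Pr => e e0; have c1 : 0 < c + 1 by lra.
    by have := uc _ (divr_gt0 e0 c1); rewrite mulrCA mulfV ?gt_eqF// mulr1.
  by have := hn_ge0 ip u; nra.
- by exists b.
Qed.

End hilbert.

(** * Complex integrals over measurable subsets of C^n *)

Section real_integrals.
Context {R : realType} d (T : measurableType d).
Variables (mu : {measure set T -> \bar R}) (D : set T).
Hypothesis mD : measurable D.

Definition ri (g : T -> R) : Prop := mu.-integrable D (EFin \o g).

Lemma ri_meas g : ri g -> measurable_fun D g.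
Proof. by move=> /integrableP[/measurable_EFinP]. Qed.

Lemma riD f g : ri f -> ri g -> ri (fun x => f x + g x).
Proof. by move=> fi gi; have := integrableD mD fi gi. Qed.

Lemma riZ (a : R) f : ri f -> ri (fun x => a * f x).
Proof. by move=> fi; have := integrableZl mD a fi. Qed.

Lemma riN f : ri f -> ri (fun x => - f x).
Proof. by move=> fi; have := integrableN fi. Qed.

Lemma ri0 : ri (fun=> 0).
Proof. exact: integrable0. Qed.

Lemma ri_le (f g : T -> R) : measurable_fun D f -> (forall x, D x -> `|f x| <= g x) ->
  ri g -> ri f.
Proof.
move=> mf fg gi; apply: (le_integrable mD _ _ gi); first exact/measurable_EFinP.
by move=> x Dx /=; rewrite lee_fin (le_trans (fg x Dx))// ler_norm.
Qed.

Lemma ri_eq f g : (forall x, D x -> f x = g x) -> ri f -> ri g.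
Proof.
move=> fg fi; apply: (ri_le _ _ (riD (riZ 0 fi) (integrable_norm fi))).
  by apply: (eq_measurable_fun f) (ri_meas fi) => x /set_mem /fg.
by move=> x Dx; rewrite -fg// mul0r add0r.
Qed.

Lemma ri_norm f : ri f -> ri (fun x => `|f x|).
Proof. by move=> /integrable_norm. Qed.

Lemma ri_finP (g : T -> R) : measurable_fun D g -> (forall x, D x -> 0 <= g x) ->
  (\int[mu]_(x in D) (g x)%:E < +oo)%E <-> ri g.
Proof.
move=> mg g0; split => [h|/integrableP[_]].
  apply/integrableP; split; first exact/measurable_EFinP.
  rewrite (_ : (\int[mu]_(x in D) _ = \int[mu]_(x in D) (g x)%:E)%E)//.
  by apply: eq_integral => x /set_mem Dx; rewrite /= ger0_norm// g0.
apply: le_lt_trans; rewrite le_eqVlt; apply/orP; left; apply/eqP.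
by apply: eq_integral => x /set_mem Dx; rewrite /= ger0_norm// g0.
Qed.

Lemma Rint_EFin g : ri g ->
  (\int[mu]_(x in D) (g x)%:E)%E = (\int[mu]_(x in D) g x)%:E.
Proof. by move=> gi; rewrite /Rintegral fineK//; exact: integrable_fin_num. Qed.

Lemma Rint_ge0 g : (forall x, D x -> 0 <= g x) -> 0 <= \int[mu]_(x in D) g x.
Proof. exact: Rintegral_ge0. Qed.

Lemma Rint_le f g : ri f -> ri g -> (forall x, D x -> f x <= g x) ->
  \int[mu]_(x in D) f x <= \int[mu]_(x in D) g x.
Proof. exact: le_Rintegral. Qed.

Lemma Rint_eq f g : (forall x, D x -> f x = g x) ->
  \int[mu]_(x in D) f x = \int[mu]_(x in D) g x.
Proof. by move=> h; apply: eq_Rintegral => x /set_mem /h. Qed.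

Lemma Rint_dct (f : nat -> T -> R) (g h : T -> R) :
  (forall k, measurable_fun D (f k)) -> ri h ->
  (forall k x, D x -> `|f k x| <= h x) ->
  (forall x, D x -> f k x @[k --> \oo] --> g x) ->
  ri g /\ (\int[mu]_(x in D) `|f k x - g x| @[k --> \oo] --> (0 : R)).
Proof.
move=> mf hi fh fg.
have mg : measurable_fun D g by apply: (measurable_fun_cvg mf).
have [|||||/=] := @dominated_convergence _ _ _ mu D mD
  (fun k x => (f k x)%:E) (EFin \o g) (EFin \o h).
- by move=> k; exact/measurable_EFinP.
- exact/measurable_EFinP.
- by apply: aeW => x Dx; apply: cvg_EFin; [exact: nearW|exact: fg].
- exact: hi.
- by apply: aeW => x k Dx; rewrite /= lee_fin fh.
move=> gi h0 _; split => //.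
have E k : (\int[mu]_(x in D) `|(f k x)%:E - (g x)%:E|)%E =
    (\int[mu]_(x in D) `|f k x - g x|)%:E.
  rewrite -Rint_EFin//; apply: ri_norm; apply: riD; last exact: riN.
  exact: (ri_le (mf k) (fh k) hi).
move: h0; under eq_fun do rewrite E.
by move=> /fine_cvgP[_].
Qed.

End real_integrals.

Arguments ri {R d T} mu D g.

(** * Borel sets and measurable complex functions on C^n *)

Section Cn_measurability.
Context {R : realType} {n : nat}.
Local Notation C := R[i].
Local Notation Cn := 'rV[C]_n.

(** The sigma-algebra on C^n is generated by the real coordinates. An open set is the union of the
    countably many grid cells [Q v m], of side [m.+1%:R^-1], that it contains. *)
Lemma measurable_open (O : set Cn) : open O -> measurable O.
Proof.
move=> oO.
pose Q (v : {ffun 'I_(n + n) -> int}) (m : nat) : set Cn :=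
  [set z | forall k, Num.floor (m.+1%:R * (real_coord k z : R)) = v k].
have mQ v m : measurable (Q v m).
  rewrite (_ : Q v m = \bigcap_k ((fun z : Cn => m.+1%:R * (real_coord k z : R)) @^-1`
      [set` `[(v k)%:~R : R, ((v k) + 1)%:~R[%R])); last first.
    apply/seteqP; split => z h k; first by move=> _ /=; rewrite in_itv/= -(h k) floor_le_tmp floorD1_gt.
    have /= := h k I; rewrite in_itv/= => /andP[h1 h2]; apply/eqP; rewrite floor_eq h1 h2//.
  apply: fin_bigcap_measurable => // k _.
  rewrite -[X in measurable X]setTI; apply: measurable_funM => //.
  exact: measurable_real_coord.
pose G (vm : {ffun 'I_(n + n) -> int} * nat) : set Cn :=
  if `[<Q vm.1 vm.2 `<=` O>] then Q vm.1 vm.2 else set0.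
rewrite (_ : O = \bigcup_vm G vm).
  apply: countable_bigcupT_measurable; first exact: countableP.
  by move=> vm; rewrite /G; case: ifP.
apply/seteqP; split => [z Oz|z [[v m] _]]; last first.
  by rewrite /G; case: asboolP => // h /h.
have /nbhs_rnP[e e0 zO] : nbhs z O by exact: oO.
have [N HN] := inv_small (divr_gt0 e0 (@ltr0Sn R 1)).
have hN := HN N (leqnn _).
pose v : {ffun 'I_(n + n) -> int} := [ffun k => Num.floor (N.+1%:R * (real_coord k z : R))].
exists (v, N) => //; rewrite /G asboolT; first by move=> k; rewrite ffunE.
move=> w hw; apply: zO; apply: rn_lt => // j; rewrite !mxE.
have close k : `|real_coord k w - real_coord k z| < N.+1%:R^-1.
  have := hw k; rewrite ffunE => hk.
  have N0 : 0 < N.+1%:R :> R by [].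
  rewrite -(ltr_pM2l N0) mulfV ?gt_eqF// -{1}(gtr0_norm N0) -normrM mulrBr.
  have := floor_le_tmp (N.+1%:R * real_coord k w); have := floorD1_gt (N.+1%:R * real_coord k w).
  have := floor_le_tmp (N.+1%:R * real_coord k z); have := floorD1_gt (N.+1%:R * real_coord k z).
  rewrite hk intrD => h1 h2 h3 h4; rewrite ltr_norml; apply/andP; split; lra.
rewrite (le_lt_trans (rn_le_ReIm _))// cReD cImD cReN cImN (splitr e) ltrD//.
  apply: lt_trans hN; have := close (lshift n j); rewrite /real_coord.
  by case: split_ordP => k /eqP; rewrite ?eq_lrshift// => /eqP/lshift_inj <-.
apply: lt_trans hN; have := close (rshift n j); rewrite /real_coord.
by case: split_ordP => k /eqP; rewrite ?eq_rlshift// => /eqP/rshift_inj <-.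
Qed.

Lemma measurable_closed (O : set Cn) : closed O -> measurable O.
Proof.
by move=> cO; rewrite -(setCK O); apply: measurableC; apply: measurable_open; exact: closed_openC.
Qed.

Lemma measurable_cont (D : set Cn) (g : Cn -> R) : open D ->
  (forall z, D z -> g w @[w --> z] --> g z) -> measurable_fun D g.
Proof.
move=> oD cg; apply: (measurability (@RGenOInfty.G R)).
  exact: RGenOInfty.measurableE.
move=> _ [_ [a ->] <-]; apply: measurable_open.
rewrite openE => z [Dz] /=; rewrite in_itv/= andbT => az.
have /nbhs_rnP[e1 e10 h1] : nbhs z D by exact: oD.
have /cvg_nbhsRP := cg z Dz; move=> /(_ (g z - a)); rewrite subr_gt0 => /(_ az)[e2 e20 h2].
apply/nbhs_rnP; exists (Num.min e1 e2); first by rewrite lt_min e10.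
move=> w; rewrite lt_min => /andP[w1 w2]; split; first exact: h1.
have := h2 w w2; rewrite ltr_norml => /andP[+ _] => h.
by rewrite /= in_itv/= andbT; lra.
Qed.

Definition mc (D : set Cn) (f : Cn -> C) : Prop :=
  measurable_fun D (fun z => Re (f z)) /\ measurable_fun D (fun z => Im (f z)).

Lemma mc_cont (D : set Cn) (f : Cn -> C) : open D ->
  (forall z, D z -> f w @[w --> z] --> f z) -> mc D f.
Proof.
move=> oD cf; split; apply: measurable_cont => // z /cf;
  by move=> /(@cvg_ReIm _ _ (nbhs z) (nbhs_filter z))[].
Qed.

Lemma mcD D f g : mc D f -> mc D g -> mc D (fun z => f z + g z).
Proof.
move=> [f1 f2] [g1 g2]; split.
  by under eq_fun do rewrite cReD; exact: measurable_funD.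
by under eq_fun do rewrite cImD; exact: measurable_funD.
Qed.

Lemma mcM D f g : mc D f -> mc D g -> mc D (fun z => f z * g z).
Proof.
move=> [f1 f2] [g1 g2]; split.
  by under eq_fun do rewrite cReM; apply: measurable_funB; exact: measurable_funM.
by under eq_fun do rewrite cImM; apply: measurable_funD; exact: measurable_funM.
Qed.

Lemma mcJ D f : mc D f -> mc D (fun z => (f z)^*).
Proof.
move=> [f1 f2]; split; first by under eq_fun do rewrite cReJ.
by under eq_fun do rewrite cImJ; exact: measurable_funN.
Qed.

Lemma mc_cst D (a : C) : mc D (fun=> a).
Proof. by split; exact: measurable_cst. Qed.

Lemma mc_real D (g : Cn -> R) : measurable_fun D g -> mc D (fun z => (g z)%:C).
Proof. by move=> mg; split => //=; exact: measurable_cst. Qed.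

Lemma mcZ D a f : mc D f -> mc D (fun z => a * f z).
Proof. by move=> mf; apply: mcM => //; exact: mc_cst. Qed.

Lemma mcB D f g : mc D f -> mc D g -> mc D (fun z => f z - g z).
Proof.
move=> mf mg; apply: mcD => //; split.
  by under eq_fun do rewrite cReN; apply: measurable_funN; case: mg.
by under eq_fun do rewrite cImN; apply: measurable_funN; case: mg.
Qed.

Lemma mc_eq (D : set Cn) f g : (forall z, D z -> f z = g z) -> mc D f -> mc D g.
Proof.
move=> fg [f1 f2]; split.
  by apply: eq_measurable_fun f1 => z /set_mem /fg ->.
by apply: eq_measurable_fun f2 => z /set_mem /fg ->.
Qed.

Lemma mc_sub (D D' : set Cn) f : measurable D' -> D `<=` D' -> mc D' f -> mc D f.
Proof. by move=> mD' DD' [f1 f2]; split; exact: measurable_funS f1 || exact: measurable_funS f2. Qed.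

Lemma mc_rn2 (D : set Cn) f : mc D f -> measurable_fun D (fun z => rn (f z) ^+ 2).
Proof.
move=> [f1 f2]; under eq_fun do rewrite rn_sq.
by apply: measurable_funD; exact: measurable_funX.
Qed.

Lemma mc_rn (D : set Cn) f : measurable D -> mc D f -> measurable_fun D (fun z => rn (f z)).
Proof.
move=> mD mf; rewrite (_ : (fun _ => _) = (fun x => Num.sqrt x) \o (fun z => rn (f z) ^+ 2)).
  apply: measurableT_comp (mc_rn2 mf).
  by apply: continuous_measurable_fun; exact: sqrt_continuous.
by apply/funext => z /=; rewrite sqrtr_sqr ger0_norm// rn_ge0.
Qed.

End Cn_measurability.

Section complex_integral.
Context {R : realType} {n : nat}.
Local Notation C := R[i].
Local Notation Cn := 'rV[C]_n.
Local Notation vol := (@volume R n).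
Variable D : set Cn.
Hypothesis mD : measurable D.

Definition ci (f : Cn -> C) : Prop :=
  ri vol D (fun z => Re (f z)) /\ ri vol D (fun z => Im (f z)).

Lemma ci_mc f : ci f -> mc D f.
Proof. by move=> [f1 f2]; split; [exact: ri_meas f1|exact: ri_meas f2]. Qed.

Lemma ci_le f (g : Cn -> R) : mc D f -> (forall z, D z -> rn (f z) <= g z) ->
  ri vol D g -> ci f.
Proof.
move=> [f1 f2] fg gi; split.
  by apply: (ri_le mD f1 _ gi) => z Dz; rewrite (le_trans (normr_Re _))// fg.
by apply: (ri_le mD f2 _ gi) => z Dz; rewrite (le_trans (normr_Im _))// fg.
Qed.

Lemma ci_rn f : ci f -> ri vol D (fun z => rn (f z)).
Proof.
move=> fi; have [f1 f2] := fi.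
apply: (ri_le mD _ _ (riD mD (ri_norm f1) (ri_norm f2))).
  by apply: mc_rn => //; exact: ci_mc.
by move=> z _; rewrite ger0_norm ?rn_ge0// rn_le_ReIm.
Qed.

Lemma ciD f g : ci f -> ci g -> ci (fun z => f z + g z).
Proof.
move=> [f1 f2] [g1 g2]; split.
  by under eq_fun do rewrite cReD; exact: riD.
by under eq_fun do rewrite cImD; exact: riD.
Qed.

Lemma ciZ a f : ci f -> ci (fun z => a * f z).
Proof.
move=> fi; apply: (ci_le (mcZ a (ci_mc fi)) _ (riZ mD (rn a) (ci_rn fi))).
by move=> z _; rewrite rnM.
Qed.

Lemma ciN f : ci f -> ci (fun z => - f z).
Proof. by move=> /(ciZ (-1)); under eq_fun do rewrite mulN1r. Qed.

Lemma ciB f g : ci f -> ci g -> ci (fun z => f z - g z).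
Proof. by move=> fi /ciN gi; exact: ciD. Qed.

Lemma ci0 : ci (fun=> 0).
Proof. by split; exact: ri0. Qed.

Lemma ci_eq f g : (forall z, D z -> f z = g z) -> ci f -> ci g.
Proof. by move=> fg [f1 f2]; split; [apply: ri_eq f1|apply: ri_eq f2] => // z /fg ->. Qed.

Lemma ci_sum (I : Type) (r : seq I) (P : pred I) (F : I -> Cn -> C) :
  (forall i, P i -> ci (F i)) -> ci (fun z => \sum_(i <- r | P i) F i z).
Proof.
move=> h; elim: r => [|i r ih].
  by apply: ci_eq ci0 => z _; rewrite big_nil.
case Pi : (P i); last by apply: ci_eq ih => z _; rewrite big_cons Pi.
by apply: ci_eq (ciD (h i Pi) ih) => z _; rewrite big_cons Pi.
Qed.

Local Notation I := (cintegral D).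

Lemma cintegral_eq f g : (forall z, D z -> f z = g z) -> I f = I g.
Proof. by move=> fg; rewrite /cintegral; congr Complex; apply: Rint_eq => z /fg ->. Qed.

Lemma cintegralD f g : ci f -> ci g -> I (fun z => f z + g z) = I f + I g.
Proof.
move=> [f1 f2] [g1 g2]; apply: eqc => /=.
  by under eq_Rintegral do rewrite cReD; rewrite RintegralD.
by under eq_Rintegral do rewrite cImD; rewrite RintegralD.
Qed.

Lemma cintegralZ a f : ci f -> I (fun z => a * f z) = a * I f.
Proof.
move=> [f1 f2]; apply: eqc => /=.
  under eq_Rintegral do rewrite cReM -mulNr; rewrite RintegralD ?RintegralZl//; try exact: (riZ mD).
  by rewrite cReM/= mulNr.
under eq_Rintegral do rewrite cImM addrC; rewrite RintegralD ?RintegralZl//; try exact: (riZ mD).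
by rewrite cImM/= addrC.
Qed.

Lemma cintegralN f : ci f -> I (fun z => - f z) = - I f.
Proof.
move=> fi; rewrite -mulN1r -cintegralZ//.
by apply: cintegral_eq => z _; rewrite mulN1r.
Qed.

Lemma cintegralB f g : ci f -> ci g -> I (fun z => f z - g z) = I f - I g.
Proof. by move=> fi gi; rewrite cintegralD ?cintegralN//; exact: ciN. Qed.

Lemma cintegral0 : I (fun=> 0) = 0.
Proof.
have := cintegralD ci0 ci0; under cintegral_eq do rewrite addr0.
by move/eqP; rewrite -subr_eq subrr eq_sym => /eqP.
Qed.

Lemma cintegral_sum (J : Type) (r : seq J) (P : pred J) (F : J -> Cn -> C) :
  (forall i, P i -> ci (F i)) ->
  I (fun z => \sum_(i <- r | P i) F i z) = \sum_(i <- r | P i) I (F i).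
Proof.
move=> h; elim: r => [|i r ih].
  by rewrite big_nil -[RHS]cintegral0; apply: cintegral_eq => z _; rewrite big_nil.
rewrite big_cons -ih; case Pi : (P i); last first.
  by apply: cintegral_eq => z _; rewrite big_cons Pi.
rewrite -cintegralD; [|exact: h|exact: ci_sum].
by apply: cintegral_eq => z _; rewrite big_cons Pi.
Qed.

Lemma cintegralJ f : ci f -> I (fun z => (f z)^*) = (I f)^*.
Proof.
move=> [f1 f2]; apply: eqc => /=.
  by under eq_Rintegral do rewrite cReJ.
under eq_Rintegral do rewrite cImJ -mulN1r.
by rewrite RintegralZl// mulN1r.
Qed.

(** Multiplication by the unimodular constant [a] makes the integral real and nonnegative; then it
    is the integral of a real part, which is bounded pointwise. *)
Lemma rn_cintegral f : ci f -> rn (I f) <= \int[vol]_(z in D) rn (f z).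
Proof.
move=> fi; have [->|I0] := eqVneq (I f) 0; first by rewrite rn0; apply: Rint_ge0 => z _; exact: rn_ge0.
pose a : C := (I f)^* / (rn (I f))%:C.
have rI0 : rn (I f) != 0 by apply: contra_neq I0 => /rn_eq0.
have a1 : rn a = 1.
  by rewrite rnM rnV rnJ rn_real ger0_norm ?rn_ge0// mulfV.
have : (rn (I f)) = Re (I (fun z => a * f z)).
  rewrite cintegralZ// /a mulrAC [_^* * _]mulrC mulcJ -fmorphV -rmorphM/=.
  by rewrite expr2 -mulrA mulfV// mulr1.
move=> ->; rewrite /=; apply: Rint_le => //.
- by case: (ciZ a fi).
- exact: ci_rn.
- move=> z _; rewrite (le_trans (ler_norm _))// (le_trans (normr_Re _))//.
  by rewrite rnM a1 mul1r.
Qed.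

(** ** Square integrable functions *)

Lemma L2P f : L2 D f <-> mc D f /\ ri vol D (fun z => rn (f z) ^+ 2).
Proof.
split => [[f1 f2 h]|[[f1 f2] h]].
  split => //; apply/ri_finP => //; first exact: mc_rn2.
    by move=> z _; exact: sqr_ge0.
  by under eq_integral do rewrite rn_sq.
split => //; move/ri_finP : h => /(_ (mc_rn2 (conj f1 f2))).
by under eq_integral do rewrite rn_sq; apply => z _; exact: sqr_ge0.
Qed.

Lemma L2_mc f : L2 D f -> mc D f. Proof. by move=> /L2P[]. Qed.

Lemma L2_ri f : L2 D f -> ri vol D (fun z => rn (f z) ^+ 2).
Proof. by move=> /L2P[]. Qed.

Lemma L2_le f (g : Cn -> R) : mc D f -> (forall z, D z -> rn (f z) ^+ 2 <= g z) ->
  ri vol D g -> L2 D f.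
Proof.
move=> mf fg gi; apply/L2P; split => //; apply: (ri_le mD _ _ gi); first exact: mc_rn2.
by move=> z Dz; rewrite ger0_norm ?sqr_ge0// fg.
Qed.

Lemma L2_mul_ci f g : L2 D f -> L2 D g -> ci (fun z => f z * g z).
Proof.
move=> Lf Lg; apply: (ci_le _ _ (riD mD (L2_ri Lf) (L2_ri Lg))).
  by apply: mcM; exact: L2_mc.
move=> z _; rewrite rnM; have := sqr_ge0 (rn (f z) - rn (g z)).
by have := rn_ge0 (f z); have := rn_ge0 (g z); move: (rn _) (rn _) => a b; nra.
Qed.

Lemma L2J f : L2 D f -> L2 D (fun z => (f z)^*).
Proof.
move=> Lf; apply: (L2_le (mcJ (L2_mc Lf)) _ (L2_ri Lf)).
by move=> z _; rewrite rnJ.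
Qed.

Lemma L2_ip_ci f g : L2 D f -> L2 D g -> ci (fun z => f z * (g z)^*).
Proof. by move=> Lf /L2J Lg; exact: L2_mul_ci. Qed.

Lemma L2_bd f (g : Cn -> C) (M : R) : L2 D f -> mc D g ->
  (forall z, D z -> rn (g z) <= M) -> L2 D (fun z => g z * f z).
Proof.
move=> Lf mg gM; apply: (L2_le (mcM mg (L2_mc Lf)) _ (riZ mD (M ^+ 2) (L2_ri Lf))).
by move=> z Dz; rewrite rnM exprMn ler_wpM2r ?sqr_ge0// lerXn2r// ?nnegrE ?rn_ge0// ?(le_trans _ (gM z Dz)) ?rn_ge0// gM.
Qed.

Lemma L2_lin a f g : L2 D f -> L2 D g -> L2 D (a *: f + g).
Proof.
move=> Lf Lg.
apply: (L2_le _ _ (riD mD (riZ mD (2 * rn a ^+ 2) (L2_ri Lf)) (riZ mD 2 (L2_ri Lg)))).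
  by apply: mcD; [apply: mcZ|]; exact: L2_mc.
move=> z _; rewrite fctE; have := rnD (a * f z) (g z); rewrite rnM.
have := rn_ge0 (a * f z + g z); have := sqr_ge0 (rn a * rn (f z) - rn (g z)).
move: (rn (a * f z + g z)) => y h1 h2 h3.
have : y ^+ 2 <= (rn a * rn (f z) + rn (g z)) ^+ 2 by rewrite lerXn2r// nnegrE (le_trans h2).
by move: h1; rewrite sqrrB sqrrD !exprMn; lra.
Qed.

Lemma L20 : L2 D 0.
Proof.
apply/L2P; split; first exact: mc_cst.
by apply: ri_eq (ri0 vol D) => // z _; rewrite rn0 expr0n.
Qed.

Lemma L2_eq f g : (forall z, D z -> f z = g z) -> L2 D f -> L2 D g.
Proof.
move=> fg /L2P[mf fi]; apply/L2P; split; first exact: mc_eq mf.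
by apply: ri_eq fi => // z /fg ->.
Qed.

Lemma L2_prehilbert : prehilbert (L2 D) (L2ip D).
Proof.
split; [exact: L20|by move=> *; exact: L2_lin| | |].
- move=> a f g h Lf Lg Lh; rewrite /L2ip -(cintegralZ a (L2_ip_ci Lf Lh)).
  rewrite -(cintegralD (ciZ a (L2_ip_ci Lf Lh)) (L2_ip_ci Lg Lh)).
  by apply: cintegral_eq => z _; rewrite !fctE mulrDl mulrA.
- move=> f g Lf Lg; rewrite /L2ip -cintegralJ; last exact: L2_ip_ci.
  by apply: cintegral_eq => z _; rewrite rmorphM/= conjcK mulrC.
- move=> f Lf; rewrite /L2ip /=; apply: Rint_ge0 => z _.
  by rewrite mulcJ/= sqr_ge0.
Qed.

Local Notation hn := (hnorm (L2ip D)).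

Lemma L2_hn2 f : L2 D f -> hn f ^+ 2 = \int[vol]_(z in D) rn (f z) ^+ 2.
Proof.
move=> Lf; rewrite (hn_sq L2_prehilbert)//=.
by apply: Rint_eq => z _; rewrite mulcJ.
Qed.

Lemma L2_hn_le f g : L2 D f -> L2 D g -> (forall z, D z -> rn (f z) <= rn (g z)) ->
  hn f <= hn g.
Proof.
move=> Lf Lg fg; rewrite -(@ler_pXn2r _ 2)// ?nnegrE ?hn_ge0// !L2_hn2//.
apply: Rint_le => //; [exact: L2_ri|exact: L2_ri|].
by move=> z Dz; rewrite lerXn2r// ?nnegrE ?rn_ge0// fg.
Qed.

Lemma L2_hn_bd f (g : Cn -> C) (M : R) : 0 <= M -> L2 D f -> L2 D (fun z => g z * f z) ->
  (forall z, D z -> rn (g z) <= M) -> hn (fun z => g z * f z) <= M * hn f.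
Proof.
move=> M0 Lf Lgf gM.
rewrite -[X in X * _](ger0_norm M0) -(rn_real M) -(hnZ L2_prehilbert)//.
apply: L2_hn_le => //; first exact: (phZ L2_prehilbert).
by move=> z Dz; rewrite fctE !rnM rn_real ger0_norm// ler_wpM2r ?rn_ge0// gM.
Qed.

Lemma ri_cst (a : R) : (vol D < +oo)%E -> ri vol D (fun=> a).
Proof.
move=> vD; apply/integrableP; split; first exact: measurable_cst.
by rewrite integral_cst// lte_mul_pinfty.
Qed.

Lemma L2_bounded (f : Cn -> C) (M : R) : (vol D < +oo)%E -> mc D f ->
  (forall z, D z -> rn (f z) <= M) -> L2 D f.
Proof.
move=> vD mf fM; apply: (L2_le mf (g := fun=> M ^+ 2)).
  by move=> z Dz; rewrite lerXn2r// ?nnegrE ?rn_ge0// ?(le_trans _ (fM z Dz)) ?rn_ge0// fM.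
exact: ri_cst.
Qed.

Lemma cauchy_cvgr (x : nat -> R) :
  (forall e : R, 0 < e -> exists N, forall i j, (N <= i)%N -> (N <= j)%N ->
    `|x i - x j| < e) -> cvgn x.
Proof.
move=> cx; apply/cauchy_cvgP/cauchy_exP => e /cx[N HN].
by exists (x N); exists N => // j /= Nj; apply: HN.
Qed.

Lemma cauchy_cvgc (x : nat -> C) :
  (forall e : R, 0 < e -> exists N, forall i j, (N <= i)%N -> (N <= j)%N ->
    rn (x i - x j) < e) -> exists l : C, x k @[k --> \oo] --> l.
Proof.
move=> cx.
have h1 : cvgn (fun k => Re (x k)).
  apply: cauchy_cvgr => e /cx[N HN]; exists N => i j Ni Nj.
  by rewrite -cReN -cReD (le_lt_trans (normr_Re _))// HN.
have h2 : cvgn (fun k => Im (x k)).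
  apply: cauchy_cvgr => e /cx[N HN]; exists N => i j Ni Nj.
  by rewrite -cImN -cImD (le_lt_trans (normr_Im _))// HN.
exists (limn (fun k => Re (x k)) +i* limn (fun k => Im (x k))).
by apply/cvg_ReIm.
Qed.

Lemma fast_cauchy (E : lmodType C) (V : set E) (ip : E -> E -> C) (u : nat -> E) :
  (forall e : R, 0 < e -> exists N, forall i j, (N <= i)%N -> (N <= j)%N ->
    hnorm ip (u i - u j) < e) ->
  exists s : nat -> nat, (forall k, (s k < s k.+1)%N) /\
    forall k i, (s k <= i)%N -> hnorm ip (u i - u (s k)) < 2^-1 ^+ k.
Proof.
move=> cu.
have /choice[N NP] k : exists N, forall i j, (N <= i)%N -> (N <= j)%N ->
    hnorm ip (u i - u j) < 2^-1 ^+ k by apply: cu; rewrite exprn_gt0// invr_gt0.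
pose s := fix s k := if k is k'.+1 then maxn (s k').+1 (N k) else N 0.
exists s; split; first by move=> k /=; rewrite leq_max leqnn.
have Ns k : (N k <= s k)%N by case: k => //= k; rewrite leq_maxr.
by move=> k i ski; apply: NP => //; exact: leq_trans ski.
Qed.

Lemma subseq_cvg (E : lmodType C) (V : set E) (ip : E -> E -> C) (u : nat -> E)
    (s : nat -> nat) l : prehilbert V ip -> (forall k, V (u k)) -> V l ->
  (forall k, (s k < s k.+1)%N) ->
  (forall e : R, 0 < e -> exists N, forall i j, (N <= i)%N -> (N <= j)%N ->
    hnorm ip (u i - u j) < e) ->
  hnorm ip (u (s k) - l) @[k --> \oo] --> (0 : R) ->
  hnorm ip (u k - l) @[k --> \oo] --> (0 : R).
Proof.
move=> H Vu Vl sinc cu /cvgn0P ul; apply/cvgn0P => e e0.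
have e2 : 0 < e / 2 by rewrite divr_gt0.
have [N HN] := cu _ e2; have [M HM] := ul _ e2.
have sk k : (k <= s k)%N by elim: k => // k ih; exact: leq_ltn_trans ih (sinc k).
exists N => k Nk; rewrite ger0_norm ?hn_ge0//.
pose m := maxn N M; rewrite (le_lt_trans (hn_trans H (Vu k) (Vu (s m)) Vl))//.
rewrite (splitr e) ltrD//; first by apply: HN => //; rewrite (leq_trans (leq_maxl N M))//.
by have := HM m (leq_maxr _ _); rewrite ger0_norm ?hn_ge0.
Qed.

(** Riesz-Fischer: along a subsequence whose consecutive distances are below [2^-1 ^+ k], the sum of
    the absolute increments is in L^2, hence finite almost everywhere, and it dominates the distance
    to the limit. *)
Lemma L2_complete : complete (L2 D) (L2ip D).
Proof.
move=> u Lu cu; have [s [sinc sP]] := fast_cauchy (L2 D) cu.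
have H := L2_prehilbert.
pose v k := u (s k); have Lv k : L2 D (v k) by exact: Lu.
pose d k : Cn -> C := fun z => (rn (v k.+1 z - v k z))%:C.
have Ldiff k : L2 D (v k.+1 - v k) by exact: (phB H).
have rdE k z : rn (d k z) = rn (v k.+1 z - v k z).
  by rewrite /d rn_real ger0_norm ?rn_ge0.
have Ld k : L2 D (d k).
  apply: (L2_le _ _ (L2_ri (Ldiff k))); last by move=> z _; rewrite rdE.
  by apply: mc_real; apply: mc_rn => //; exact: L2_mc (Ldiff k).
have hd k : hn (d k) <= 2^-1 ^+ k.
  apply: (@le_trans _ _ (hn (v k.+1 - v k))).
    by apply: L2_hn_le => // z _; rewrite rdE.
  by apply/ltW/sP; rewrite ltnW.
pose G K : Cn -> C := \sum_(k < K) d k.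
have LG K : L2 D (G K).
  by elim: K => [|K ih]; rewrite /G ?big_ord0 ?big_ord_recr; [exact: L20|exact: (phD H)].
have hG K : hn (G K) <= 2.
  suff : hn (G K) <= 2 - 2 * 2^-1 ^+ K by have : 0 <= (2^-1 : R) ^+ K by []; lra.
  elim: K => [|K ih]; first by rewrite /G big_ord0 (hn0 H) expr0; lra.
  rewrite /G big_ord_recr/= (le_trans (hnD H (LG K) (Ld K)))//.
  by rewrite exprS; have := hd K; rewrite /G in ih; lra.
pose g K z := \sum_(k < K) rn (v k.+1 z - v k z).
have GE K z : G K z = (g K z)%:C.
  by rewrite /G /g fct_sumE rmorph_sum.
have g0 K z : 0 <= g K z by apply: sumr_ge0 => k _; exact: rn_ge0.
have rG K z : rn (G K z) = g K z by rewrite GE rn_real ger0_norm.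
have gmono z : {homo (fun K => g K z) : K K' / (K <= K')%N >-> K <= K'}.
  apply: homo_leq => [//|? ? ?|K]; first exact: le_trans.
  by rewrite /g big_ord_recr/= lerDl rn_ge0.
have mg K : measurable_fun D (g K).
  have := mc_rn mD (L2_mc (LG K)); apply: eq_measurable_fun => z _; exact: rG.
(* The partial sums have L^2 norm at most 2; monotone convergence carries the bound to the full
   sum. *)
have intg : (\int[vol]_(z in D) limn (fun K => (g K z ^+ 2)%:E) <= 4%:E)%E.
  rewrite monotone_convergence//.
  - apply: lime_le.
      apply: ereal_nondecreasing_is_cvgn => i j ij; apply: ge0_le_integral => //.
      + by move=> z _; rewrite lee_fin sqr_ge0.
      + by apply/measurable_EFinP; exact: measurable_funX.
      + by apply/measurable_EFinP; exact: measurable_funX.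
      + by move=> z _; rewrite lee_fin lerXn2r// ?nnegrE//; exact: gmono.
    apply: nearW => K.
    have gi : ri vol D (fun z => g K z ^+ 2).
      by apply: ri_eq (L2_ri (LG K)) => // z _; rewrite rG.
    rewrite Rint_EFin// lee_fin.
    rewrite (_ : \int[vol]_(z in D) _ = hn (G K) ^+ 2).
      have -> : 4 = 2 ^+ 2 :> R by ring.
      by rewrite lerXn2r// ?nnegrE ?hn_ge0.
    by rewrite L2_hn2//; apply: Rint_eq => z _; rewrite rG.
  - by move=> K; apply/measurable_EFinP; exact: measurable_funX.
  - by move=> K z _; rewrite lee_fin sqr_ge0.
  - by move=> z _ i j ij; rewrite lee_fin lerXn2r// ?nnegrE//; exact: gmono.
have cvgE z : cvgn (fun K => (g K z ^+ 2)%:E).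
  by apply: ereal_nondecreasing_is_cvgn => i j ij; rewrite lee_fin lerXn2r// ?nnegrE//; exact: gmono.
pose h z := limn (fun K => (g K z ^+ 2)%:E).
have mh : measurable_fun D h.
  apply: (emeasurable_fun_cvg (fun K z => (g K z ^+ 2)%:E)).
    by move=> K; apply/measurable_EFinP; exact: measurable_funX.
  by move=> z _; exact: cvgE.
have h0 z : (0 <= h z)%E by apply: lime_ge => //; apply: nearW => K; rewrite lee_fin sqr_ge0.
have hi : vol.-integrable D h.
  apply/integrableP; split => //; apply: (@le_lt_trans _ _ 4%:E); last by rewrite ltry.
  by under eq_integral do rewrite gee0_abs//.
pose A := D `&` [set z | h z \is a fin_num].
have mA : measurable A by exact: emeasurable_fin_num.
have aeA : vol.-negligible (D `\` A).
  have [B [mB B0 AB]] := integrable_ae mD hi.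
  exists B; split => // z [Dz nA]; apply: AB => /= hz; apply: nA; split => //.
  exact: hz.
have tel z i j : (i <= j)%N -> rn (v j z - v i z) <= g j z - g i z.
  move=> /subnK <-; elim: (j - i)%N => [|m ih]; first by rewrite add0n !subrr rn0.
  rewrite addSn (le_trans (rn_trans _ (v (m + i)%N z) _))//.
  by rewrite [g _.+1 z]/g big_ord_recr/= -/(g _ z); lra.
have cauchyA z : A z -> exists l : C, v k z @[k --> \oo] --> l.
  move=> [Dz /= hfin].
  have gb K : g K z <= fine (h z) + 1.
    have : (((g K z) ^+ 2)%:E <= h z)%E.
      apply: (lime_ge (cvgE z)); exists K => // i /= Ki.
      by rewrite lee_fin lerXn2r// ?nnegrE//; exact: gmono.
    rewrite -{1}(fineK hfin) lee_fin; have := g0 K z; have : 0 <= fine (h z) by exact: fine_ge0.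
    by move: (g K z) (fine (h z)) => a b /=; nra.
  have gc : cvgn (fun K => g K z).
    apply: nondecreasing_is_cvgn; first by move=> i j ij; apply: gmono.
    by exists (fine (h z) + 1) => _ [K _ <-].
  apply: cauchy_cvgc => e e0.
  have /cvgrPdist_lt := gc; move=> /(_ (e / 2)); rewrite divr_gt0// => /(_ isT)[N _ HN].
  exists N => i j Ni Nj; have := HN i Ni; have := HN j Nj; rewrite /=.
  wlog ij : i j {Ni Nj} / (i <= j)%N => [wl h1 h2|].
    by case: (leqP i j) => [|/ltnW] /wl; [exact|rewrite rn_distC; exact].
  rewrite rn_distC !ltr_norml => /andP[h1 h2] /andP[h3 h4].
  by rewrite (le_lt_trans (tel z _ _ ij))//; lra.
have /choice[l lP] z : exists l : C, (A z -> v k z @[k --> \oo] --> l) /\ (~ A z -> l = v 0 z).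
  have [Az|nAz] := pselect (A z); last by exists (v 0 z).
  by have [l lz] := cauchyA z Az; exists l; split.
(* Outside [A] the sequence is frozen at [v 0], so that it converges everywhere and [l] is
   measurable as a pointwise limit. *)
pose w k z : C := v 0 z + (\1_A z : R)%:C * (v k z - v 0 z).
have wA k z : A z -> w k z = v k z.
  by move=> Az; rewrite /w indicE mem_set// mul1r addrC subrK.
have wnA k z : ~ A z -> w k z = v 0 z.
  by move=> Az; rewrite /w indicE memNset// mul0r addr0.
have wl z : w k z @[k --> \oo] --> l z.
  have [Az|nAz] := pselect (A z).
    by rewrite (_ : (fun k => _) = (fun k => v k z)); [exact: (lP z).1|apply/funext => k; rewrite wA].
  rewrite (_ : (fun k => _) = fun=> l z); first exact: cvg_cst.
  by apply/funext => k; rewrite wnA// (lP z).2.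
have mw k : mc D (w k).
  apply: mcD; first exact: L2_mc (Lv 0%N).
  apply: mcM; first by apply: mc_real; exact: measurable_indic.
  by apply: mcB; exact: L2_mc (Lv _).
have ml : mc D l.
  split.
    apply: (measurable_fun_cvg (fun k => (mw k).1)) => z _.
    by have /cvg_ReIm[] := wl z.
  apply: (measurable_fun_cvg (fun k => (mw k).2)) => z _.
  by have /cvg_ReIm[] := wl z.
(* The integrable majorant for the final dominated convergence. *)
have vlh k z : A z -> ((rn (v k z - l z) ^+ 2)%:E <= h z)%E.
  move=> Az; have hz := Az.2.
  have gK j : (((g j z) ^+ 2)%:E <= h z)%E.
    apply: (lime_ge (cvgE z)); exists j => // i /= Ki.
    by rewrite lee_fin lerXn2r// ?nnegrE//; exact: gmono.
  rewrite -(fineK hz) lee_fin.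
  have fh0 : 0 <= fine (h z) by exact: fine_ge0.
  rewrite -(sqr_sqrtr fh0) lerXn2r// ?nnegrE ?rn_ge0 ?sqrtr_ge0//.
  apply/ler_addgt0Pr => e e0.
  have /cvg_rnP/(_ e e0)[N _ HN] := (lP z).1 Az.
  pose j := maxn k N; have := HN j (leq_maxr _ _) => /= hj.
  rewrite (le_trans (rn_trans _ (v j z) _))// lerD ?(ltW hj)//.
  rewrite rn_distC (le_trans (tel z _ _ (leq_maxl _ _)))//.
  apply: (@le_trans _ _ (g j z)); first by rewrite gerDl oppr_le0.
  rewrite -[leLHS]ger0_norm// -sqrtr_sqr ler_wsqrtr//.
  by rewrite -lee_fin fineK.
have Ll0 : L2 D (l - v 0%N).
  apply/L2P; split; first by apply: mcB => //; exact: L2_mc (Lv _).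
  apply: (le_integrable mD _ _ hi).
    apply/measurable_EFinP; apply: (@mc_rn2 _ _ _ (l - v 0%N)).
    by apply: mcB => //; exact: L2_mc (Lv 0%N).
  move=> z Dz; rewrite /= ger0_norm ?sqr_ge0// gee0_abs//.
  have [Az|nAz] := pselect (A z); first by rewrite fctE rn_distC; exact: vlh.
  by rewrite fctE (lP z).2// subrr rn0 expr0n.
have Ll : L2 D l by rewrite -(subrK (v 0%N) l); exact: (phD H).
exists l => //; apply: (subseq_cvg H Lu Ll sinc cu).
have Lvl k : L2 D (v k - l) by exact: (phB H).
suff hc : hn (v k - l) ^+ 2 @[k --> \oo] --> (0 : R).
  apply/cvgn0P => e e0; have /cvgn0P/(_ _ (exprn_gt0 2 e0))[N HN] := hc.
  exists N => k /HN; rewrite !ger0_norm ?hn_ge0 ?sqr_ge0//.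
  by rewrite ltr_pXn2r// ?nnegrE ?hn_ge0// ltW.
have [|||||_ h1 _] := @dominated_convergence _ _ _ vol D mD
  (fun k z => (rn (v k z - l z) ^+ 2)%:E) (fun=> 0%E) h.
- move=> k; apply/measurable_EFinP; apply: (@mc_rn2 _ _ _ (v k - l)).
  exact: L2_mc (Lvl k).
- exact: measurable_cst.
- have : {ae vol, forall z, D z -> h z \is a fin_num} by exact: integrable_ae.
  apply: filterS => z hz Dz; apply: cvg_EFin; first exact: nearW.
  have /cvg_rn0P vz := (lP z).1 (conj Dz (hz Dz)).
  by have := cvgM vz vz; rewrite mul0r; exact.
- exact: hi.
- have : {ae vol, forall z, D z -> h z \is a fin_num} by exact: integrable_ae.
  apply: filterS => z hz k Dz; rewrite /= ger0_norm ?sqr_ge0//.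
  by apply: vlh; split => //; exact: hz.
move: h1 => /=.
have E k : (\int[vol]_(z in D) `|(rn (v k z - l z) ^+ 2)%:E - 0| = (hn (v k - l) ^+ 2)%:E)%E.
  rewrite L2_hn2// -Rint_EFin//; last exact: L2_ri (Lvl k).
  by apply: eq_integral => z _; rewrite sube0 /= ger0_norm ?sqr_ge0.
under eq_fun do rewrite E.
by move=> /fine_cvgP[_].
Qed.

End complex_integral.

(** * Functions of class C^1 on open subsets of C^n *)

Section differentiation.
Context {R : realType} {n : nat}.
Local Notation C := R[i].
Local Notation Cn := 'rV[C]_n.
Implicit Types (f g : Cn -> C) (r s : Cn -> R) (k : 'I_n + 'I_n) (z : Cn).

Definition hasdR k r z (d : R) := is_derive (0 : R) (1 : R) (along k r z) d.

Definition hasd k f z (d : C) :=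
  hasdR k (fun w => Re (f w)) z (Re d) /\ hasdR k (fun w => Im (f w)) z (Im d).

Lemma along0 k r z : along k r z 0 = r z.
Proof. by rewrite /along scale0r addr0. Qed.

Lemma hasdR_eq k r z d d' : hasdR k r z d -> d = d' -> hasdR k r z d'.
Proof. by move=> h <-. Qed.

Lemma hasd_eq k f z d d' : hasd k f z d -> d = d' -> hasd k f z d'.
Proof. by move=> h <-. Qed.

Lemma hasdRP k r z d : hasdR k r z d <->
  forall e : R, 0 < e -> exists2 t0 : R, 0 < t0 &
    forall t : R, t != 0 -> `|t| < t0 ->
      `|(r (z + t%:C *: real_dir k) - r z) / t - d| < e.
Proof.
split=> [h e e0|h].
  have := @ex_derive _ _ _ _ _ _ _ h; rewrite /derivable => /cvg_ex[l hl].
  have ld : l = d.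
    by rewrite -(@derive_val _ _ _ _ _ _ _ h); apply/esym/cvg_lim.
  have /cvgrPdist_lt/(_ _ e0) := hl; rewrite ld => -[t0 /= t00 H].
  exists t0 => // t tn0 tt0; have := H t; rewrite /= sub0r normrN => /(_ tt0 tn0).
  by rewrite /along [_ *: 1]mulr1 addr0 scale0r addr0 distrC mulrC.
have hd : (t^-1 *: (along k r z (t *: (1 : R) + 0) - along k r z 0)) @[t --> (0:R)^'] --> d.
  apply/cvgrPdist_lt => e /h[t0 t00 H]; exists t0 => // t /=; rewrite sub0r normrN => tt0 tn0.
  by have := H t tn0 tt0; rewrite /along [_ *: 1]mulr1 addr0 scale0r addr0 distrC mulrC.
apply: DeriveDef; first by apply/cvg_ex; exists d.
exact: cvg_lim.
Qed.

Lemma hasdR_uniq k r z d d' : hasdR k r z d -> hasdR k r z d' -> d = d'.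
Proof. by move=> h h'; rewrite -(@derive_val _ _ _ _ _ _ _ h) -(@derive_val _ _ _ _ _ _ _ h'). Qed.

Lemma hasd_uniq k f z d d' : hasd k f z d -> hasd k f z d' -> d = d'.
Proof. by move=> [h1 h2] [h1' h2']; apply: eqc; apply: hasdR_uniq; eassumption. Qed.

Lemma hasdR_rpartial k r z d : hasdR k r z d -> rpartial k r z = d.
Proof. by move=> h; rewrite /rpartial derive1E; exact: (@derive_val _ _ _ _ _ _ _ h). Qed.

Lemma rpartial_hasdR k r z : derivable (along k r z) 0 1 -> hasdR k r z (rpartial k r z).
Proof. by move=> h; rewrite /rpartial derive1E; exact: derivableP. Qed.

Lemma hasd_cpartial k f z d : hasd k f z d -> cpartial k f z = d.
Proof. by move=> [/hasdR_rpartial h1 /hasdR_rpartial h2]; apply: eqc. Qed.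

Lemma hasdR_near k r s z d : (\forall w \near z, r w = s w) -> hasdR k r z d -> hasdR k s z d.
Proof.
move=> /nbhs_rnP[e e0 rs] /hasdRP h; apply/hasdRP => e' /h[t0 t00 H].
exists (Num.min t0 e); first by rewrite lt_min t00.
move=> t tn0; rewrite lt_min => /andP[tt0 te].
rewrite -!rs ?subrr ?rn0//; first exact: H.
rewrite addrC addKr rnZ rn_real (le_lt_trans _ te)//.
by rewrite ler_piMr// rn_real_dir.
Qed.

Lemma hasd_near k f g z d : (\forall w \near z, f w = g w) -> hasd k f z d -> hasd k g z d.
Proof. by move=> fg [h1 h2]; split; [apply: hasdR_near h1|apply: hasdR_near h2]; apply: filterS fg => w ->. Qed.

Lemma hasdR_line k r z t d : hasdR k r (z + t%:C *: real_dir k) d ->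
  is_derive t (1 : R) (along k r z) d.
Proof.
move=> h.
have E : along k r z = (along k r (z + t%:C *: real_dir k)) \o (fun x => x - t).
  apply/funext => x; rewrite /along /= -addrA -scalerDl -rmorphD/=.
  by congr (r (z + _%:C *: _)); rewrite addrC subrK.
rewrite E; have -> : d = d * 1 by rewrite mulr1.
apply: is_derive1_comp; first by rewrite subrr.
by apply: is_derive_eq; rewrite subr0.
Qed.

Lemma hasdR_cst k (a : R) z : hasdR k (fun=> a) z 0.
Proof. exact: is_derive_cst. Qed.

Lemma hasdRD k r s z d e : hasdR k r z d -> hasdR k s z e ->
  hasdR k (fun w => r w + s w) z (d + e).
Proof. by move=> h1 h2; exact: (is_deriveD h1 h2). Qed.

Lemma hasdRN k r z d : hasdR k r z d -> hasdR k (fun w => - r w) z (- d).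
Proof. by move=> h1; exact: (is_deriveN h1). Qed.

Lemma hasdRB k r s z d e : hasdR k r z d -> hasdR k s z e ->
  hasdR k (fun w => r w - s w) z (d - e).
Proof. by move=> h1 h2; exact: (is_deriveB h1 h2). Qed.

Lemma hasdRM k r s z d e : hasdR k r z d -> hasdR k s z e ->
  hasdR k (fun w => r w * s w) z (d * s z + r z * e).
Proof.
move=> h1 h2; have := is_deriveM h1 h2; rewrite !along0 => h.
by apply: is_derive_eq h _; rewrite addrC; congr (_ + _); rewrite [LHS]mulrC.
Qed.

Lemma hasdR_comp k r z d (phi : R -> R) (a : R) : hasdR k r z d ->
  is_derive (r z) (1 : R) phi a -> hasdR k (fun w => phi (r w)) z (a * d).
Proof. by move=> h1 h2; apply: (@is_derive1_comp _ phi (along k r z)) => //; rewrite along0. Qed.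

Lemma hasd_cst k (a : C) z : hasd k (fun=> a) z 0.
Proof. by split; exact: hasdR_cst. Qed.

Lemma hasdD k f g z d e : hasd k f z d -> hasd k g z e ->
  hasd k (fun w => f w + g w) z (d + e).
Proof.
move=> [h1 h2] [h3 h4]; split; rewrite ?cReD ?cImD.
  by under [X in hasdR _ X]eq_fun do rewrite cReD; exact: hasdRD.
by under [X in hasdR _ X]eq_fun do rewrite cImD; exact: hasdRD.
Qed.

Lemma hasdM k f g z d e : hasd k f z d -> hasd k g z e ->
  hasd k (fun w => f w * g w) z (d * g z + f z * e).
Proof.
move=> [h1 h2] [h3 h4]; split.
  under [X in hasdR _ X]eq_fun do rewrite cReM.
  apply: hasdR_eq (hasdRB (hasdRM h1 h3) (hasdRM h2 h4)) _.
  by rewrite cReD !cReM; ring.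
under [X in hasdR _ X]eq_fun do rewrite cImM.
apply: hasdR_eq (hasdRD (hasdRM h1 h4) (hasdRM h2 h3)) _.
by rewrite cImD !cImM; ring.
Qed.

Lemma hasdZ k (a : C) f z d : hasd k f z d -> hasd k (fun w => a * f w) z (a * d).
Proof. by move=> h; apply: hasd_eq (hasdM (hasd_cst k a z) h) _; rewrite mul0r add0r. Qed.

Lemma hasdN k f z d : hasd k f z d -> hasd k (fun w => - f w) z (- d).
Proof.
move=> h; rewrite -mulN1r; have := hasdZ (-1) h.
by under eq_fun do rewrite mulN1r.
Qed.

Lemma hasdB k f g z d e : hasd k f z d -> hasd k g z e ->
  hasd k (fun w => f w - g w) z (d - e).
Proof. by move=> h1 /hasdN; exact: hasdD. Qed.

Lemma hasdJ k f z d : hasd k f z d -> hasd k (fun w => (f w)^*) z (d^*).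
Proof.
move=> [h1 h2]; split; first by rewrite cReJ; under [X in hasdR _ X]eq_fun do rewrite cReJ.
by rewrite cImJ; under [X in hasdR _ X]eq_fun do rewrite cImJ; exact: hasdRN.
Qed.

Lemma hasd_real k r z d : hasdR k r z d -> hasd k (fun w => (r w)%:C) z (d%:C).
Proof. by move=> h; split => //=; exact: hasdR_cst. Qed.

Lemma hasd_coord k (j : 'I_n) z : hasd k (fun w => w 0 j) z ((real_dir k : Cn) 0 j).
Proof.
by split; apply/hasdRP => e e0; exists 1 => // t tn0 _;
  rewrite !mxE ?cReD ?cImD [_ + _ - _]addrC addKr; case: ((real_dir k : Cn) 0 j) => a b /=;
  rewrite mul0r ?subr0 ?addr0 ?add0r [_ * _ / _]mulrAC mulfV// mul1r subrr normr0.
Qed.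

Lemma hasd_sum (I : Type) (rr : seq I) (P : pred I) k (F : I -> Cn -> C) (d : I -> C) z :
  (forall i, P i -> hasd k (F i) z (d i)) ->
  hasd k (fun w => \sum_(i <- rr | P i) F i w) z (\sum_(i <- rr | P i) d i).
Proof.
move=> h; elim: rr => [|i rr ih].
  by rewrite big_nil; under eq_fun do rewrite big_nil; exact: hasd_cst.
rewrite big_cons; under [X in hasd _ X]eq_fun do rewrite big_cons.
by case Pi : (P i) => //; apply: hasdD => //; exact: h.
Qed.

Lemma hasd_shift k f z a d : hasd k f (z + a) d -> hasd k (fun w => f (w + a)) z d.
Proof.
move=> [/hasdRP h1 /hasdRP h2]; split; apply/hasdRP => e e0.
  by have [t0 t00 H] := h1 e e0; exists t0 => // t; rewrite addrAC; exact: H.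
by have [t0 t00 H] := h2 e e0; exists t0 => // t; rewrite addrAC; exact: H.
Qed.

(** Reduced to the inverse of a real function by [(f w)^-1 = ((rn (f w) ^+ 2)^-1)%:C * (f w)^*], an
    identity that also holds at zeros of [f], since the inverse of 0 is 0. *)
Lemma hasdV k f z d : f z != 0 -> hasd k f z d ->
  hasd k (fun w => (f w)^-1) z (- d / f z ^+ 2).
Proof.
move=> fz0 hf.
have rn2 : 0 < rn (f z) ^+ 2.
  by rewrite exprn_gt0// lt_def rn_ge0 andbT; apply: contra_neq fz0 => /rn_eq0.
have E w : (f w)^-1 = ((rn (f w) ^+ 2)^-1)%:C * (f w)^*.
  have [->|w0] := eqVneq (f w) 0; first by rewrite invr0 rmorph0 mulr0.
  have r0 : rn (f w) != 0 by apply: contra_neq w0 => /rn_eq0.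
  apply: (mulfI w0); rewrite mulfV// mulrCA mulcJ -rmorphM/= mulVf//.
  by rewrite expf_eq0.
have h2 : hasdR k (fun w => rn (f w) ^+ 2) z (2 * Re (d * (f z)^*)).
  under [X in hasdR _ X]eq_fun do rewrite rn_sq.
  have [h3 h4] := hf.
  apply: hasdR_eq (hasdRD (hasdRM h3 h3) (hasdRM h4 h4)) _.
  by rewrite cReM cReJ cImJ; ring.
have h3 : hasdR k (fun w => (rn (f w) ^+ 2)^-1) z
    (- (rn (f z) ^+ 2) ^- 2 * (2 * Re (d * (f z)^*))).
  apply: (@hasdR_comp _ _ _ _ (fun x => x^-1)) => //.
  apply: is_derive_eq; first by apply: is_deriveV; rewrite ?gt_eqF//; exact: is_derive_id.
  by rewrite [_ *: _]mulr1.
under [X in hasd _ X]eq_fun do rewrite E.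
apply: hasd_eq (hasdM (hasd_real h3) (hasdJ hf)) _.
have -> : - d / f z ^+ 2 = - d * (((rn (f z) ^+ 2)^-1)%:C * (f z)^*) ^+ 2.
  by rewrite -exprVn E.
move: rn2; rewrite rn_sq; case: (f z) => a b; case: d {hf h2 h3} => c e /= ab.
by apply: eqc => /=; field; rewrite gt_eqF.
Qed.

(** ** Continuity at a point *)

(* A one-constructor inductive keeps unification from unfolding filters. *)
Variant ctn f z : Prop := Ctn of f w @[w --> z] --> f z.

Lemma ctnP f z : ctn f z <-> forall e : R, 0 < e ->
  exists2 d : R, 0 < d & forall w, rn (w - z) < d -> rn (f w - f z) < e.
Proof.
by split=> [[/cvg_nbhsP]|/cvg_nbhsP].
Qed.

Lemma ctn_cst (a : C) z : ctn (fun=> a) z.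
Proof. by constructor; exact: cvg_cst. Qed.

Lemma ctnD f g z : ctn f z -> ctn g z -> ctn (fun w => f w + g w) z.
Proof. by move=> [a] [b]; constructor; exact: (cvgD a b). Qed.

Lemma ctnM f g z : ctn f z -> ctn g z -> ctn (fun w => f w * g w) z.
Proof. by move=> [a] [b]; constructor; exact: (cvgM a b). Qed.

Lemma ctnN f z : ctn f z -> ctn (fun w => - f w) z.
Proof. by move=> [a]; constructor; exact: (cvgN a). Qed.

Lemma ctnB f g z : ctn f z -> ctn g z -> ctn (fun w => f w - g w) z.
Proof. by move=> [a] [b]; constructor; exact: (cvgB a b). Qed.

Lemma ctnJ f z : ctn f z -> ctn (fun w => (f w)^*) z.
Proof. by move=> [a]; constructor; exact: (cvg_conjc a). Qed.

Lemma ctnV f z : f z != 0 -> ctn f z -> ctn (fun w => (f w)^-1) z.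
Proof. by move=> f0 [a]; constructor; exact: (cvgV f0 a). Qed.

Lemma ctn_coord j z : ctn (fun w => w 0 j) z.
Proof. by constructor; exact: continuous_coord. Qed.

Lemma ctn_sum (I : Type) (rr : seq I) (P : pred I) (F : I -> Cn -> C) z :
  (forall i, P i -> ctn (F i) z) -> ctn (fun w => \sum_(i <- rr | P i) F i w) z.
Proof.
move=> h; elim: rr => [|i rr ih].
  by rewrite (_ : (fun _ => _) = fun=> 0); [exact: ctn_cst|apply/funext => w; rewrite big_nil].
rewrite (_ : (fun _ => _) = fun w => (if P i then F i w else 0) + \sum_(i <- rr | P i) F i w); last first.
  by apply/funext => w; rewrite big_cons; case: (P i) => //; rewrite add0r.
apply: ctnD ih; case Pi : (P i); [exact: h|exact: ctn_cst].
Qed.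

Lemma ctn_realP r z : ctn (fun w => (r w)%:C) z <-> r w @[w --> z] --> r z.
Proof.
split=> [[]|h]; last by constructor; exact: (cvg_real_complex h).
by move=> /(@cvg_ReIm _ _ (nbhs z) (nbhs_pfilter z))[].
Qed.

Lemma ctn_real_comp r z (phi : R -> R) : ctn (fun w => (r w)%:C) z ->
  {for r z, continuous phi} -> ctn (fun w => (phi (r w))%:C) z.
Proof. by move=> /ctn_realP h1 h2; apply/ctn_realP; exact: (continuous_cvg _ h2 h1). Qed.

Lemma ctn_shift f a z : ctn f (z + a) -> ctn (fun w => f (w + a)) z.
Proof.
move=> /ctnP h; apply/ctnP => e /h[d d0 H]; exists d => // w wd; apply: H.
by rewrite opprD addrACA subrr addr0.
Qed.

Lemma ctn_ReIm f z : ctn f z ->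
  (Re (f w) @[w --> z] --> Re (f z)) /\ (Im (f w) @[w --> z] --> Im (f z)).
Proof. by move=> [/(@cvg_ReIm _ _ (nbhs z) (nbhs_pfilter z))]. Qed.

(** ** C^1 functions *)

(** The derivatives are data instead of [cpartial], so that explicit formulas for them pass through
    the rules of calculus. *)
Definition C1 (O : set Cn) f (Df : 'I_n + 'I_n -> Cn -> C) : Prop :=
  forall z, O z -> [/\ ctn f z, forall k, hasd k f z (Df k z) & forall k, ctn (Df k) z].

Implicit Types (O : set Cn) (Df Dg : 'I_n + 'I_n -> Cn -> C).

Lemma C1_eqD O f Df Dg : (forall k z, Df k z = Dg k z) -> C1 O f Df -> C1 O f Dg.
Proof. by move=> h; rewrite (_ : Df = Dg)//; apply/funext => k; apply/funext => z. Qed.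

Lemma C1_cst O (a : C) : C1 O (fun=> a) (fun _ _ => 0).
Proof. by move=> z Oz; split => [|k|k]; [exact: ctn_cst|exact: hasd_cst|exact: ctn_cst]. Qed.

Lemma C1D O f g Df Dg : C1 O f Df -> C1 O g Dg ->
  C1 O (fun z => f z + g z) (fun k z => Df k z + Dg k z).
Proof.
move=> h1 h2 z Oz; have [a1 a2 a3] := h1 z Oz; have [b1 b2 b3] := h2 z Oz.
by split => [|k|k]; [exact: ctnD|exact: hasdD|exact: ctnD].
Qed.

Lemma C1M O f g Df Dg : C1 O f Df -> C1 O g Dg ->
  C1 O (fun z => f z * g z) (fun k z => Df k z * g z + f z * Dg k z).
Proof.
move=> h1 h2 z Oz; have [a1 a2 a3] := h1 z Oz; have [b1 b2 b3] := h2 z Oz.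
by split => [|k|k]; [exact: ctnM|exact: hasdM|apply: ctnD; exact: ctnM].
Qed.

Lemma C1Z O (a : C) f Df : C1 O f Df -> C1 O (fun z => a * f z) (fun k z => a * Df k z).
Proof. by move=> h; refine (C1_eqD _ (C1M (C1_cst a) h)) => k z; rewrite mul0r add0r. Qed.

Lemma C1_coord O j : C1 O (fun z => z 0 j) (fun k _ => (real_dir k : Cn) 0 j).
Proof.
by move=> z Oz; split => [|k|k]; [exact: ctn_coord|exact: hasd_coord|exact: ctn_cst].
Qed.

Lemma C1_sum (I : Type) (rr : seq I) (P : pred I) O (F : I -> Cn -> C)
    (DF : I -> 'I_n + 'I_n -> Cn -> C) : (forall i, P i -> C1 O (F i) (DF i)) ->
  C1 O (fun z => \sum_(i <- rr | P i) F i z) (fun k z => \sum_(i <- rr | P i) DF i k z).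
Proof.
move=> h z Oz; split => [|k|k].
- by apply: ctn_sum => i Pi; have [] := h i Pi z Oz.
- by apply: hasd_sum => i Pi; have [] := h i Pi z Oz.
- by apply: (@ctn_sum _ _ _ (fun i => DF i k)) => i Pi; have [] := h i Pi z Oz.
Qed.

Lemma C1_shift O f Df a : C1 O f Df ->
  C1 [set z | O (z + a)] (fun z => f (z + a)) (fun k z => Df k (z + a)).
Proof.
move=> h z /= Oz; have [a1 a2 a3] := h _ Oz.
by split => [|k|k]; [exact: ctn_shift|exact: hasd_shift|exact: ctn_shift].
Qed.

End differentiation.

(** * Compactness, translation and integration by parts *)

Section compactness.
Context {R : realType} {n : nat}.
Local Notation C := R[i].
Local Notation Cn := 'rV[C]_n.
Local Notation vol := (@volume R n).
Implicit Types (f : Cn -> C) (K : set Cn).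

Lemma compact_square (M : R) : compact [set x : C | `|Re x| <= M /\ `|Im x| <= M].
Proof.
pose h (p : R * R) : C := p.1 +i* p.2.
have -> : [set x : C | `|Re x| <= M /\ `|Im x| <= M] =
    h @` (`[- M, M]%classic `*` `[- M, M]%classic).
  apply/seteqP; split => [x [h1 h2]|_ [[a b] [h1 h2] <-]] /=.
    by exists (Re x, Im x); [split; rewrite /= in_itv/= -ler_norml|case: x {h1 h2}].
  by move: h1 h2; rewrite /= !in_itv/= -!ler_norml.
apply: continuous_compact; last by apply: compact_setX; exact: segment_compact.
apply: continuous_subspaceT => -[a b].
apply/(@cvg_ReIm _ _ _ (nbhs_filter (a, b))); split => /=.
  exact: cvg_fst.
exact: cvg_snd.
Qed.

Lemma compact_ball (M : R) : compact [set z : Cn | rn z <= M].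
Proof.
have h := @rV_compact C n (fun=> [set x : C | `|Re x| <= M /\ `|Im x| <= M])
  (fun=> @compact_square M).
apply: (subclosed_compact _ h); last first.
  move=> z /= zM i; split.
    by rewrite (le_trans (normr_Re _))// (le_trans (rn_coord _ _)).
  by rewrite (le_trans (normr_Im _))// (le_trans (rn_coord _ _)).
rewrite -[X in closed X]setCK; apply: open_closedC; rewrite openE => z /= /negP; rewrite -ltNge => Mz.
apply/nbhs_rnP; exists (rn z - M); first by rewrite subr_gt0.
move=> w wz /=; apply/negP; rewrite -ltNge.
have := rn_trans z w 0; rewrite !subr0 rn_distC; lra.
Qed.

Lemma closed_bounded_compact K M : closed K -> (forall z, K z -> rn z <= M) -> compact K.
Proof. by move=> cK KM; exact: (subclosed_compact cK (@compact_ball M)). Qed.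

(** If [g] were unbounded on [K], its superlevel sets would generate a proper filter on [K], and a
    cluster point of it would contradict local boundedness. Continuity is not assumed, because
    [unif_ctn] applies this to an integer-valued function. *)
Lemma compact_seq_bounded K (g : Cn -> R) : compact K ->
  (forall z, K z -> exists2 d : R, 0 < d & exists M, forall w, rn (w - z) < d -> g w <= M) ->
  exists M, forall z, K z -> g z <= M.
Proof.
move=> cK loc; apply: contrapT => nb.
have nb' (M : R) : exists2 z, K z & M < g z.
  apply: contrapT => h; apply: nb; exists M => z Kz; rewrite leNgt; apply/negP => Mz.
  by apply: h; exists z.
have KF : ProperFilter (filter_from [set: R] (fun M => K `&` [set z | M < g z])).
  apply: filter_from_proper; first apply: filter_from_filter.
  - by exists 0.
  - move=> a b _ _; exists (Num.max a b) => // z [Kz] /=; rewrite gt_max => /andP[h1 h2].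
    by split; split.
  - by move=> M _; have [z Kz Mz] := nb' M; exists z.
have [z [Kz zcl]] := cK _ KF (ex_intro2 _ _ 0 I (@subIsetl _ _ _)).
have [d d0 [M HM]] := loc z Kz.
have [w [[Kw Mw] wd]] := zcl (K `&` [set z | M < g z]) [set w | rn (w - z) < d]
  (ex_intro2 _ _ M I (fun _ h => h)) ((nbhs_rnP _ _).2 (ex_intro2 _ _ d d0 (fun _ h => h))).
by have := HM w wd; rewrite leNgt Mw.
Qed.

Lemma compact_rn_bounded K : compact K -> exists2 M, 0 <= M & forall z, K z -> rn z <= M.
Proof.
move=> cK; have [|M HM] := @compact_seq_bounded K (fun z => rn z) cK.
  move=> z _; exists 1 => //; exists (rn z + 1) => w wz.
  by have := rn_trans w z 0; rewrite !subr0; lra.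
by exists (Num.max 0 M) => [|z Kz]; rewrite ?le_max ?lexx// HM ?orbT.
Qed.

Lemma ctn_compact_bounded K f : compact K -> (forall z, K z -> ctn f z) ->
  exists2 M, 0 <= M & forall z, K z -> rn (f z) <= M.
Proof.
move=> cK cf; have [|M HM] := @compact_seq_bounded K (fun z => rn (f z)) cK.
  move=> z /cf/ctnP/(_ 1 ltr01)[d d0 H]; exists d => //; exists (rn (f z) + 1) => w /H.
  by have := rn_trans (f w) (f z) 0; rewrite !subr0; lra.
by exists (Num.max 0 M) => [|z Kz]; rewrite ?le_max ?lexx// HM ?orbT.
Qed.

Lemma compact_closedC K : compact K -> closed K.
Proof. by move=> cK; apply: compact_closed => //; exact: norm_hausdorff. Qed.

Lemma ctn_mc f : (forall z, ctn f z) -> mc setT f.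
Proof. by move=> cf; apply: mc_cont; [exact: openT|move=> z _; case: (cf z)]. Qed.

Lemma ctn_mc_on (O : set Cn) f : open O -> (forall z, O z -> ctn f z) -> mc O f.
Proof. by move=> oO cf; apply: mc_cont => // z /cf[]. Qed.

Lemma rn_box (z : Cn) M : rn z <= M -> box M z.
Proof.
move=> zM k; rewrite /real_coord; case: split_ordP => j _.
  by rewrite (le_trans (normr_Re _))// (le_trans (rn_coord _ _)).
by rewrite (le_trans (normr_Im _))// (le_trans (rn_coord _ _)).
Qed.

Lemma volume_bounded_fin (D : set Cn) M : measurable D -> (forall z, D z -> rn z <= M) ->
  (vol D < +oo)%E.
Proof.
move=> mD DM; apply: le_lt_trans (volume_box_fin M).
by apply: le_measure; rewrite ?inE//; [exact: measurable_box|move=> z /DM/rn_box].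
Qed.

Lemma ri_indic (A : set Cn) : measurable A -> (vol A < +oo)%E -> ri vol setT (\1_A : Cn -> R).
Proof.
move=> mA vA; apply/ri_finP => //.
by rewrite integral_indic// setIT.
Qed.

Lemma ri_bounded_supp (g : Cn -> R) (M L : R) : measurable_fun setT g ->
  (forall z, `|g z| <= L) -> (forall z, M < rn z -> g z = 0) -> ri vol setT g.
Proof.
move=> mg gL g0; have B := measurable_box (R := R) (n := n) M.
apply: (ri_le measurableT mg (g := fun z => L * \1_(box M) z)).
  move=> z _; have [Mz|zM] := ltP M (rn z).
    by rewrite g0// normr0 mulr_ge0// (le_trans _ (gL z)).
  by rewrite indicE mem_set ?mulr1//; exact: rn_box.
by apply: riZ => //; apply: ri_indic => //; exact: volume_box_fin.
Qed.

Lemma ci_bounded_supp f (M L : R) : mc setT f -> (forall z, rn (f z) <= L) ->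
  (forall z, M < rn z -> f z = 0) -> ci setT f.
Proof.
move=> [m1 m2] fL f0; split; apply: (@ri_bounded_supp _ M L) => //.
- by move=> z; rewrite (le_trans (normr_Re _)).
- by move=> z /f0 ->.
- by move=> z; rewrite (le_trans (normr_Im _)).
- by move=> z /f0 ->.
Qed.

Lemma ctn_supp_bounded f M : (forall z, ctn f z) -> (forall z, M < rn z -> f z = 0) ->
  exists2 L, 0 <= L & forall z, rn (f z) <= L.
Proof.
move=> cf f0; have [L L0 HL] := ctn_compact_bounded (@compact_ball M) (fun z _ => cf z).
by exists L => // z; have [/f0->|zM] := ltP M (rn z); rewrite ?rn0// HL.
Qed.

Lemma ctn_supp_ci f M : (forall z, ctn f z) -> (forall z, M < rn z -> f z = 0) -> ci setT f.
Proof.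
move=> cf f0; have [L L0 HL] := ctn_supp_bounded cf f0.
exact: (ci_bounded_supp (ctn_mc cf) HL f0).
Qed.

(** ** Translation *)

Lemma integral_shift (g : Cn -> \bar R) (a : Cn) : measurable_fun setT g ->
  (forall z, 0 <= g z)%E -> (\int[vol]_z g (z + a)%R = \int[vol]_z g z)%E.
Proof.
move=> mg g0; have ms := measurable_shift (R := R) a.
rewrite -(@ge0_integral_pushforward _ _ _ _ _ _ ms vol setT g) //.
apply: eq_measure_integral => /= A mA _.
by rewrite /pushforward volume_shift.
Qed.

Lemma measurable_comp_shift d (T : measurableType d) (g : Cn -> T) (a : Cn) :
  measurable_fun setT g -> measurable_fun setT (fun z : Cn => g (z + a)).
Proof. by move=> mg; apply: measurableT_comp mg _; exact: measurable_shift. Qed.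

Lemma ri_shift (g : Cn -> R) (a : Cn) : ri vol setT g -> ri vol setT (fun z : Cn => g (z + a)).
Proof.
move=> /integrableP[mg gi]; apply/integrableP; split.
  exact: (measurable_comp_shift a mg).
apply: le_lt_trans gi; rewrite -(@integral_shift (fun z => `|(g z)%:E|%E) a)//.
by apply: measurableT_comp mg.
Qed.

Lemma Rint_shift (g : Cn -> R) (a : Cn) : ri vol setT g ->
  \int[vol]_z g (z + a) = \int[vol]_z g z.
Proof.
move=> gi; rewrite /Rintegral; congr fine.
have mg : measurable_fun setT (EFin \o g) by case/integrableP : gi.
rewrite integralE [RHS]integralE; congr (_ - _)%E.
  have <- := @integral_shift _ a (measurable_funepos mg) (fun z => funepos_ge0 _ z).
  by apply: eq_integral => x _; rewrite !funeposE.
have <- := @integral_shift _ a (measurable_funeneg mg) (fun z => funeneg_ge0 _ z).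
by apply: eq_integral => x _; rewrite !funenegE.
Qed.

Lemma ci_shift f (a : Cn) : ci setT f -> ci setT (fun z => f (z + a)).
Proof. by move=> [h1 h2]; split; [exact: (ri_shift a h1)|exact: (ri_shift a h2)]. Qed.

Lemma cintegral_shift f (a : Cn) : ci setT f ->
  cintegral setT (fun z => f (z + a)) = cintegral setT f.
Proof. by move=> [h1 h2]; rewrite /cintegral; congr Complex; exact: Rint_shift. Qed.

(** ** Mean value estimate and integration by parts *)

Lemma mean_value_R k (r : Cn -> R) z (t L : R) (dr : Cn -> R) :
  (forall s : R, `|s| <= `|t| ->
    hasdR k r (z + s%:C *: real_dir k) (dr (z + s%:C *: real_dir k)) /\
    `|dr (z + s%:C *: real_dir k)| <= L) ->
  `|r (z + t%:C *: real_dir k) - r z| <= L * `|t|.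
Proof.
move=> h; pose g := along k r z.
have gd s : `|s| <= `|t| -> is_derive s (1 : R) g (dr (z + s%:C *: real_dir k)).
  by move=> /h[h1 _]; exact: hasdR_line.
have E : r (z + t%:C *: real_dir k) - r z = g t - g 0 by rewrite /g along0.
have key a b : a <= b -> (forall s, a <= s <= b -> `|s| <= `|t|) -> `|g b - g a| <= L * `|b - a|.
  move=> ab sab.
  have hab s : s \in `[a, b] -> `|s| <= `|t| by rewrite in_itv/= => /sab.
  have h1 s : s \in `]a, b[ -> is_derive s (1 : R) g (dr (z + s%:C *: real_dir k)).
    by rewrite in_itv/= => /andP[/ltW h1 /ltW h2]; apply: gd; rewrite sab// h1 h2.
  have h2 : {within `[a, b], continuous g}.
    by apply: derivable_within_continuous => s /hab/gd hs; exact: (@ex_derive _ _ _ _ _ _ _ hs).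
  have [c cab ->] := MVT_segment ab h1 h2.
  by rewrite normrM ler_wpM2r// (h c _).2// hab.
rewrite E; have [t0|t0] := leP 0 t.
  rewrite -[X in _ <= _ * `|X|]subr0; apply: key => // s /andP[s0 st].
  by rewrite !ger0_norm// (le_trans s0).
have h0 s : t <= s <= 0 -> `|s| <= `|t|.
  by move=> /andP[s0 st]; rewrite (ler0_norm st) (ltr0_norm t0) lerN2.
by have := key t 0 (ltW t0) h0; rewrite sub0r normrN distrC.
Qed.

(** The factor 2 comes from treating real and imaginary parts separately. *)
Lemma mean_value k f z (t L : R) (df : Cn -> C) :
  (forall s : R, `|s| <= `|t| ->
    hasd k f (z + s%:C *: real_dir k) (df (z + s%:C *: real_dir k)) /\
    rn (df (z + s%:C *: real_dir k)) <= L) ->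
  rn (f (z + t%:C *: real_dir k) - f z) <= 2 * L * `|t|.
Proof.
move=> h; rewrite (le_trans (rn_le_ReIm _))// cReD cImD cReN cImN.
have -> : 2 * L * `|t| = L * `|t| + L * `|t| by ring.
apply: lerD.
  apply: (@mean_value_R k (fun w => Re (f w)) z t L (fun w => Re (df w))) => s /h[[h1 _] h2].
  by split => //; rewrite (le_trans (normr_Re _)).
apply: (@mean_value_R k (fun w => Im (f w)) z t L (fun w => Im (df w))) => s /h[[_ h1] h2].
by split => //; rewrite (le_trans (normr_Im _)).
Qed.

Lemma hasd_supp k f z d M : (forall w, M < rn w -> f w = 0) -> M < rn z -> hasd k f z d -> d = 0.
Proof.
move=> f0 Mz h; apply: (hasd_uniq h); apply: hasd_near (hasd_cst k 0 z).
apply/nbhs_rnP; exists (rn z - M); first by rewrite subr_gt0.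
move=> w wz; rewrite f0//.
by have := rn_trans z w 0; rewrite !subr0 rn_distC; lra.
Qed.

(** No iterated integral is involved: the difference quotients of [f] have integral 0 by translation
    invariance, and they converge to [Df k] boundedly with support in a fixed box. *)
Lemma ibp f Df M k : C1 setT f Df -> (forall z, M < rn z -> f z = 0) ->
  cintegral setT (Df k) = 0.
Proof.
move=> h f0.
have cf z : ctn f z by have [] := h z I.
have cD z : ctn (Df k) z by have [] := h z I.
have hD z : hasd k f z (Df k z) by have [] := h z I.
have D0 z : M < rn z -> Df k z = 0 by move=> Mz; exact: (hasd_supp f0 Mz (hD z)).
have [L L0 HL] := ctn_supp_bounded cD D0.
have fi := ctn_supp_ci cf f0; have Di := ctn_supp_ci cD D0.
pose t m : R := m.+1%:R^-1.
have t0 m : 0 < t m by rewrite invr_gt0.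
have t1 m : t m <= 1 by rewrite invf_le1// ler1n.
pose q m z : C := ((t m)^-1)%:C * (f (z + (t m)%:C *: real_dir k) - f z).
have qi m : ci setT (q m).
  by apply: ciZ => //; apply: ciB => //; exact: ci_shift.
have qint m : cintegral setT (q m) = 0.
  rewrite cintegralZ ?cintegralB ?cintegral_shift ?subrr ?mulr0//.
  - exact: ci_shift.
  - by apply: ciB => //; exact: ci_shift.
have qb m z : rn (q m z) <= 2 * L.
  rewrite rnM rn_real gtr0_norm ?invr_gt0//.
  rewrite ler_pdivrMl// mulrC -{2}(gtr0_norm (t0 m)).
  by apply: (mean_value (df := Df k)) => s _; split; [exact: hD|exact: HL].
have qs m z : M + 1 < rn z -> q m z = 0.
  move=> Mz; rewrite /q !f0 ?subrr ?mulr0//; first lra.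
  have := rn_trans z (z + (t m)%:C *: real_dir k) 0; rewrite !subr0 rn_distC [z + _ - z]addrAC subrr add0r rnZ rn_real.
  rewrite (ger0_norm (ltW (t0 m))).
  have := rn_real_dir (R := R) k; have := t1 m; have := t0 m; have := rn_ge0 (real_dir k : Cn).
  by move: (rn (real_dir k : Cn)) (t m) => a b; nra.
have qc z : q m z @[m --> \oo] --> Df k z.
  apply/cvg_rnP => e e0; have [/hasdRP h1 /hasdRP h2] := hD z.
  have [d1 d10 H1] := h1 _ (divr_gt0 e0 (@ltr0Sn R 1)).
  have [d2 d20 H2] := h2 _ (divr_gt0 e0 (@ltr0Sn R 1)).
  have [N1 HN1] := inv_small d10; have [N2 HN2] := inv_small d20.
  exists (maxn N1 N2) => // m; rewrite /= geq_max => /andP[/HN1 m1 /HN2 m2].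
  rewrite (le_lt_trans (rn_le_ReIm _))// cReD cImD cReN cImN (splitr e).
  have tn := gt_eqF (t0 m).
  apply: ltrD.
    have := H1 (t m); rewrite tn gtr0_norm// => /(_ isT m1); congr (`|_ - _| < _).
    by rewrite /q cReM/= mul0r subr0 cReD cReN mulrC.
  have := H2 (t m); rewrite tn gtr0_norm// => /(_ isT m2); congr (`|_ - _| < _).
  by rewrite /q cImM/= mul0r addr0 cImD cImN mulrC.
have dom : ri vol setT (fun z => (2 * L + L) * \1_(box (M + 1)) z : R).
  by apply: riZ => //; apply: ri_indic; [exact: measurable_box|exact: volume_box_fin].
have [|||_] := @Rint_dct _ _ _ vol setT measurableT (fun m z => rn (q m z - Df k z)) (fun=> 0) _ _ dom.
- by move=> m; apply: mc_rn => //; apply: mcB; apply: ci_mc.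
- move=> m z _; rewrite ger0_norm ?rn_ge0//; have [Mz|zM] := ltP (M + 1) (rn z).
    by rewrite qs// D0 ?subrr ?rn0 ?mulr_ge0//; lra.
  rewrite indicE mem_set; last exact: rn_box.
  by rewrite mulr1 (le_trans (rnB _ _))// lerD.
- by move=> z _; have /cvg_rn0P := qc z.
move=> /cvgn0P cv; apply: rn_eq0; apply/eqP; rewrite eq_le rn_ge0 andbT.
apply/ler_addgt0Pr => e e0; have [N HN] := cv _ e0; have := HN N (leqnn _).
have -> : cintegral setT (Df k) = - cintegral setT (fun z => q N z - Df k z).
  by rewrite cintegralB// qint sub0r opprK.
rewrite add0r rnN.
move=> hh; rewrite (le_trans (rn_cintegral _ _))//; first exact: ciB.
rewrite (le_trans _ (ltW hh))// ger0_norm; last by apply: Rint_ge0.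
apply: Rint_le => //; first by apply: ci_rn => //; exact: ciB.
  apply: ri_norm; apply: (@ri_eq _ _ _ vol setT measurableT (fun z => rn (q N z - Df k z))).
    by move=> z _; rewrite subr0.
  by apply: ci_rn => //; exact: ciB.
by move=> z _; rewrite subr0 ler_norm.
Qed.

End compactness.

(** * Convolution *)

Section uniform_continuity.
Context {R : realType} {n : nat}.
Local Notation C := R[i].
Local Notation Cn := 'rV[C]_n.
Implicit Types (f : Cn -> C).

Lemma unif_ctn f M : (forall z, ctn f z) -> (forall z, M < rn z -> f z = 0) ->
  forall e : R, 0 < e -> exists2 d : R, 0 < d &
    forall z w, rn (w - z) < d -> rn (f w - f z) < e.
Proof.
move=> cf f0 e e0.
(* [N.+1%:R^-1] is an admissible radius at [z]. The least such [N] is locally bounded, hence bounded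
   on the compact ball that contains the support. *)
pose good z (N : nat) := `[<forall w, rn (w - z) < N.+1%:R^-1 -> rn (f w - f z) < e>].
have good_near z : exists2 d : R, 0 < d & forall w w', rn (w - z) < d -> rn (w' - w) < d ->
    rn (f w' - f w) < e.
  have e2 : 0 < e / 2 by rewrite divr_gt0.
  have /ctnP/(_ _ e2)[d d0 H] := cf z.
  exists (d / 2); first by rewrite divr_gt0.
  move=> w w' h1 h2; rewrite (le_lt_trans (rn_trans _ (f z) _))// (splitr e) ltrD//.
    apply: H; have := rn_trans w' w z; lra.
  by rewrite rn_distC; apply: H; lra.
have ex z : exists N, good z N.
  have [d d0 H] := good_near z; have [N HN] := inv_small d0.
  exists N; apply/asboolP => w wz; apply: (H z w); rewrite ?subrr ?rn0//.
  by rewrite (lt_trans wz)// HN.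
pose g z : R := (ex_minn (ex z))%:R.
have [|B HB] := @compact_seq_bounded R n [set z | rn z <= M + 1] g (@compact_ball R n (M + 1)).
  move=> z _; have [d d0 H] := good_near z; have [N HN] := inv_small d0.
  exists d => //; exists N%:R => w wz; rewrite /g ler_nat; case: ex_minnP => m _; apply.
  apply/asboolP => w' w'w; apply: H wz _; rewrite (lt_trans w'w)//; exact: HN.
exists (Num.min 1 (Num.trunc B).+2%:R^-1); first by rewrite lt_min ltr01 invr_gt0/=.
move=> z w; rewrite lt_min => /andP[w1 w2].
have [Mz|zM] := ltP (M + 1) (rn z).
  have Mz' : M < rn z by lra.
  have Mw : M < rn w by have := rn_trans z w 0; rewrite !subr0 rn_distC; lra.
  by rewrite !f0// subrr rn0.
have := HB z zM; rewrite /g; case: ex_minnP => m /asboolP H _ mB; apply: H.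
rewrite (lt_le_trans w2)// lef_pV2 ?posrE// ler_nat.
suff : (m < (Num.trunc B).+2)%N by [].
by rewrite ltnS -ltnS -(ltr_nat R) (le_lt_trans mB)// (lt_trans (truncnS_gt _))// ltr_nat.
Qed.

(** Uniform continuity of [Df k] makes the first-order error uniform in the base point, as
    differentiation under an integral requires. *)
Lemma unif_hasd f Df M k : C1 setT f Df -> (forall z, M < rn z -> f z = 0) ->
  forall e : R, 0 < e -> exists2 d : R, 0 < d & forall z (t : R), `|t| < d ->
    rn (f (z + t%:C *: real_dir k) - f z - t%:C * Df k z) <= e * `|t|.
Proof.
move=> h f0 e e0.
have cD z : ctn (Df k) z by have [] := h z I.
have hD z : hasd k f z (Df k z) by have [] := h z I.
have D0 z : M < rn z -> Df k z = 0 by move=> Mz; exact: (hasd_supp f0 Mz (hD z)).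
have [d d0 H] := unif_ctn cD D0 (divr_gt0 e0 (@ltr0Sn R 1)).
exists d => // z t td.
(* mean value estimate for w |-> f w - (w - z)_k Df k z along the line *)
pose phi s : C := f (z + s%:C *: real_dir k) - s%:C * Df k z.
(* [P] stands for [Re] and for [Im], so that the real mean value theorem is applied once for
   both. *)
suff aux (P : C -> R) : (forall x y, P (x + y) = P x + P y) -> (forall (s : R) x, P (s%:C * x) = s * P x) ->
    (forall x, `|P x| <= rn x) -> (forall w d, hasd k f w d -> hasdR k (fun w => P (f w)) w (P d)) ->
    `|P (f (z + t%:C *: real_dir k) - f z - t%:C * Df k z)| <= e / 2 * `|t|.
  rewrite (le_trans (rn_le_ReIm _))//.
  have -> : e * `|t| = e / 2 * `|t| + e / 2 * `|t| by field.
  apply: lerD; apply: aux.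
  - exact: cReD.
  - by move=> s x; rewrite cReM/= mul0r subr0.
  - exact: normr_Re.
  - by move=> w d' [].
  - exact: cImD.
  - by move=> s x; rewrite cImM/= mul0r addr0.
  - exact: normr_Im.
  - by move=> w d' [].
move=> PD PZ Pn Pd.
have PN x : P (- x) = - P x.
  by have := PZ (-1) x; rewrite rmorphN1 !mulN1r.
pose g (s : R) : R := P (f (z + s%:C *: real_dir k)) - s * P (Df k z).
have gd (s : R) : is_derive s (1 : R) g (P (Df k (z + s%:C *: real_dir k)) - P (Df k z)).
  apply: is_deriveB; first exact: (hasdR_line (Pd _ _ (hD _))).
  apply: (is_derive_eq (is_deriveM (is_derive_id s 1) (is_derive_cst (P (Df k z)) s 1))).
  by rewrite scaler0 add0r [LHS]mulr1.
have key a b : a <= b -> (forall s, a <= s <= b -> `|s| <= `|t|) -> `|g b - g a| <= e / 2 * `|b - a|.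
  move=> ab sab.
  have h2 : {within `[a, b], continuous g}.
    by apply: derivable_within_continuous => s _; exact: (@ex_derive _ _ _ _ _ _ _ (gd s)).
  have [c + ->] := MVT_segment ab (fun s _ => gd s) h2.
  rewrite in_itv/= => /sab ct; rewrite normrM ler_wpM2r// -PN -PD (le_trans (Pn _))// ltW//.
  apply: H; rewrite addrAC subrr add0r rnZ rn_real (le_lt_trans _ td)//.
  by rewrite (le_trans _ ct)// ler_piMr// rn_real_dir.
have -> : P (f (z + t%:C *: real_dir k) - f z - t%:C * Df k z) = g t - g 0.
  by rewrite /g scale0r addr0 mul0r !PD !PN PZ; ring.
have [t0|t0] := leP 0 t.
  rewrite -[X in _ <= _ * `|X|]subr0; apply: key => // s /andP[s0 st].
  by rewrite !ger0_norm// (le_trans s0).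
have := key t 0 (ltW t0); rewrite sub0r normrN distrC; apply.
by move=> s /andP[s0 st]; rewrite (ler0_norm st) (ltr0_norm t0) lerN2.
Qed.

End uniform_continuity.

Section convolution.
Context {R : realType} {n : nat}.
Local Notation C := R[i].
Local Notation Cn := 'rV[C]_n.
Local Notation vol := (@volume R n).
Implicit Types (f u eta : Cn -> C).

(** The kernel is evaluated at [w - z], not at [z - w]: it is centred at [z] without reflection, and
    derivatives in [z] acquire a minus sign. *)
Definition conv eta u : Cn -> C := fun z => cintegral setT (fun w => u w * eta (w - z)).

Lemma ctn_sub eta a (w : Cn) : (forall z, ctn eta z) -> ctn (fun w => eta (w - a)) w.
Proof. by move=> h; exact: ctn_shift. Qed.

Lemma conv_ci eta u z L : (forall z, ctn eta z) -> (forall z, rn (eta z) <= L) ->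
  ci setT u -> ci setT (fun w => u w * eta (w - z)).
Proof.
move=> ce eL ui; apply: (ci_le measurableT (g := fun w => L * rn (u w))).
- apply: mcM; first exact: ci_mc ui.
  by apply: ctn_mc => w; exact: ctn_sub.
- by move=> w _; rewrite rnM mulrC ler_wpM2r// rn_ge0.
- by apply: riZ => //; exact: ci_rn.
Qed.

Lemma conv_bound eta u z L : (forall z, ctn eta z) -> (forall z, rn (eta z) <= L) ->
  ci setT u -> rn (conv eta u z) <= L * \int[vol]_w rn (u w).
Proof.
move=> ce eL ui; have h := conv_ci z ce eL ui.
rewrite (le_trans (rn_cintegral measurableT h))// -RintegralZl//; last exact: ci_rn.
apply: Rint_le => //; first exact: ci_rn.
  by apply: riZ => //; exact: ci_rn.
by move=> w _; rewrite rnM mulrC ler_wpM2r// rn_ge0.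
Qed.

Lemma conv_ctn eta u M : (forall z, ctn eta z) -> (forall z, M < rn z -> eta z = 0) ->
  ci setT u -> forall z, ctn (conv eta u) z.
Proof.
move=> ce e0 ui z; apply/ctnP => e ep.
have [L L0 HL] := ctn_supp_bounded ce e0.
pose I := \int[vol]_w rn (u w); have I0 : 0 <= I by apply: Rint_ge0 => w _; exact: rn_ge0.
have I1 : 0 < I + 1 by lra.
have [d d0 H] := unif_ctn ce e0 (divr_gt0 ep I1).
exists d => // w wz; rewrite /conv -cintegralB//; try exact: (conv_ci _ ce HL ui).
have hci : ci setT (fun x => u x * eta (x - w) - u x * eta (x - z)).
  by apply: ciB => //; exact: (conv_ci _ ce HL ui).
apply: (@le_lt_trans _ _ (e / (I + 1) * I)); last first.
  by rewrite mulrAC ltr_pdivrMr// ltr_pM2l//; lra.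
rewrite (le_trans (rn_cintegral measurableT hci))// -RintegralZl//; last exact: ci_rn.
apply: Rint_le => //; first exact: ci_rn.
  by apply: riZ => //; exact: ci_rn.
move=> x _; rewrite -mulrBr rnM mulrC ler_wpM2r ?rn_ge0// ltW// H//.
have -> : x - w - (x - z) = z - w by rewrite opprB addrC addrA subrK.
by rewrite rn_distC.
Qed.

(** The uniform first-order estimate for [eta] bounds the error of the difference quotient by a
    small multiple of the L^1 norm of [u]. *)
Lemma conv_C1 eta Deta u M : C1 setT eta Deta -> (forall z, M < rn z -> eta z = 0) ->
  ci setT u -> C1 setT (conv eta u) (fun k z => - conv (Deta k) u z).
Proof.
move=> h e0 ui.
have ce z : ctn eta z by have [] := h z I.
have cD k z : ctn (Deta k) z by have [] := h z I.
have hD k z : hasd k eta z (Deta k z) by have [] := h z I.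
have D0 k z : M < rn z -> Deta k z = 0 by move=> Mz; exact: (hasd_supp e0 Mz (hD k z)).
have [L L0 HL] := ctn_supp_bounded ce e0.
pose I := \int[vol]_w rn (u w); have I0 : 0 <= I by apply: Rint_ge0 => w _; exact: rn_ge0.
have I1 : 0 < I + 1 by lra.
move=> z _; split => [|k|k]; first exact: (conv_ctn ce e0 ui).
- have [L' L'0 HL'] := ctn_supp_bounded (cD k) (D0 k).
  have main e : 0 < e -> exists2 d : R, 0 < d & forall t : R, t != 0 -> `|t| < d ->
      rn ((t^-1)%:C * (conv eta u (z + t%:C *: real_dir k) - conv eta u z) + conv (Deta k) u z) < e.
    move=> ep; have [d d0 H] := unif_hasd k h e0 (divr_gt0 ep I1).
    exists d => // t tn0 td.
    have c1 a : ci setT (fun w => u w * eta (w - a)) := conv_ci a ce HL ui.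
    have c2 : ci setT (fun w => u w * Deta k (w - z)) := conv_ci z (cD k) HL' ui.
    rewrite /conv -cintegralB// -cintegralZ//; last exact: ciB.
    rewrite -cintegralD//; last by apply: ciZ => //; exact: ciB.
    have hci : ci setT (fun x => (t^-1)%:C * (u x * eta (x - (z + t%:C *: real_dir k)) - u x * eta (x - z))
        + u x * Deta k (x - z)).
      by apply: ciD => //; apply: ciZ => //; exact: ciB.
    apply: (@le_lt_trans _ _ (e / (I + 1) * I)); last first.
      by rewrite mulrAC ltr_pdivrMr// ltr_pM2l//; lra.
    rewrite (le_trans (rn_cintegral measurableT hci))// -RintegralZl//; last exact: ci_rn.
    apply: Rint_le => //; first exact: ci_rn.
      by apply: riZ => //; exact: ci_rn.
    move=> x _; rewrite -mulrBr mulrCA -mulrDr rnM mulrC ler_wpM2r ?rn_ge0//.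
    have tC : (t%:C : C) != 0 by rewrite (inj_eq (@complexI R) t 0).
    have := H (x - z) (- t); rewrite normrN => /(_ td); rewrite rmorphN scaleNr mulNr opprK.
    move=> hh; rewrite opprD addrA -(ler_pM2l (x := `|t|)) ?normr_gt0// [X in _ <= X]mulrC.
    apply: le_trans hh; rewrite -rn_real -rnM mulrDr fmorphV/= mulVKf//.
  have ReE (a : R) (x y w : C) : Re (a%:C * (x - y) + w) = a * (Re x - Re y) + Re w.
    by case: x y w => [x1 x2] [y1 y2] [w1 w2]/=; ring.
  have ImE (a : R) (x y w : C) : Im (a%:C * (x - y) + w) = a * (Im x - Im y) + Im w.
    by case: x y w => [x1 x2] [y1 y2] [w1 w2]/=; ring.
  split; apply/hasdRP => e /main[d d0 H]; exists d => // t tn0 td.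
    apply: le_lt_trans (H t tn0 td); apply: le_trans (normr_Re _).
    by rewrite ReE mulrC cReN opprK.
  apply: le_lt_trans (H t tn0 td); apply: le_trans (normr_Im _).
  by rewrite ImE mulrC cImN opprK.
- by apply: ctnN; exact: (conv_ctn (cD k) (D0 k) ui).
Qed.

End convolution.

(** * Closure properties of smooth functions *)

Section smooth_calculus.
Context {R : realType} {n : nat}.
Local Notation C := R[i].
Local Notation Cn := 'rV[C]_n.
Implicit Types (r : Cn -> R) (f g u : Cn -> C).

(** A coinduction principle. [smooth] quantifies over all iterated partial derivatives, whose
    formulas grow quickly; it is enough to exhibit a class of continuous functions that is stable
    under single derivatives. *)
Lemma csmooth_coind (S : set (Cn -> C)) :
  (forall f, S f -> (forall z, ctn f z) /\
    forall k, exists2 g, S g & forall z, hasd k f z (g z)) ->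
  forall f, S f -> csmooth f.
Proof.
move=> HS.
have key (s : seq ('I_n + 'I_n)) f : S f -> exists2 g, S g &
    foldr rpartial (fun z => Re (f z)) s = (fun z => Re (g z)) /\
    foldr rpartial (fun z => Im (f z)) s = (fun z => Im (g z)).
  move=> Sf; elim: s => [|k s [g Sg [E1 E2]]]; first by exists f.
  have [_ /(_ k)[g' Sg' H]] := HS g Sg; exists g' => //; rewrite [foldr _ _ _]/= E1 [foldr _ _ (k :: s)]/= E2.
  by split; apply/funext => z; apply: hasdR_rpartial; have [] := H z.
move=> f Sf; split => s; have [g Sg [E1 E2]] := key s f Sf; have [cg dg] := HS g Sg.
  rewrite E1; split=> [z|k z]; first by have [] := ctn_ReIm (cg z).
  by have [g' _ /(_ z)[d1 d2]] := dg k; exact: (@ex_derive _ _ _ _ _ _ _ d1).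
rewrite E2; split=> [z|k z]; first by have [] := ctn_ReIm (cg z).
by have [g' _ /(_ z)[d1 d2]] := dg k; exact: (@ex_derive _ _ _ _ _ _ _ d2).
Qed.

Lemma smooth_rpartial k r : smooth r -> smooth (rpartial k r).
Proof. by move=> h s; rewrite -foldr_rcons; exact: h. Qed.

Lemma csmooth_cpartial k f : csmooth f -> csmooth (cpartial k f).
Proof. by move=> [h1 h2]; split; apply: smooth_rpartial. Qed.

Lemma csmooth_ctn f z : csmooth f -> ctn f z.
Proof.
move=> [/(_ [::])[h1 _] /(_ [::])[h2 _]]; constructor.
by apply/cvg_ReIm; split; [exact: h1|exact: h2].
Qed.

Lemma csmooth_hasd k f z : csmooth f -> hasd k f z (cpartial k f z).
Proof.
by move=> [/(_ [::])[_ h1] /(_ [::])[_ h2]]; split; apply: rpartial_hasdR; [exact: h1|exact: h2].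
Qed.

Lemma csmooth_C1 O f : csmooth f -> C1 O f (fun k => cpartial k f).
Proof.
move=> h z _; split; first exact: csmooth_ctn.
  by move=> k; exact: csmooth_hasd.
by move=> k; apply: csmooth_ctn; exact: csmooth_cpartial.
Qed.

(* The smallest class containing what is needed; it is stable under partial
   derivatives, hence consists of smooth functions. *)
Inductive smooth_expr : (Cn -> C) -> Prop :=
| SEsmooth f : csmooth f -> smooth_expr f
| SEcst a : smooth_expr (fun=> a)
| SEcoord j : smooth_expr (fun z => z 0 j)
| SEconj f : smooth_expr f -> smooth_expr (fun z => (f z)^*)
| SEadd f g : smooth_expr f -> smooth_expr g -> smooth_expr (fun z => f z + g z)
| SEmul f g : smooth_expr f -> smooth_expr g -> smooth_expr (fun z => f z * g z)
| SEinv f : (forall z, f z != 0) -> smooth_expr f -> smooth_expr (fun z => (f z)^-1)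
| SEcomp (H : set (R -> R)) h f :
    (forall h, H h -> exists2 h', H h' & forall x, is_derive x (1 : R) h (h' x)) -> H h ->
    smooth_expr f -> smooth_expr (fun z => (h (Re (f z)))%:C)
| SEshift f a : smooth_expr f -> smooth_expr (fun z => f (z + a)).

Lemma smooth_expr_csmooth f : smooth_expr f -> csmooth f.
Proof.
move: f; apply: csmooth_coind => f; elim => {f}.
- move=> f h; split=> [z|k]; first exact: csmooth_ctn.
  exists (cpartial k f); first by apply: SEsmooth; exact: csmooth_cpartial.
  by move=> z; exact: csmooth_hasd.
- move=> a; split=> [z|k]; first exact: ctn_cst.
  by exists (fun=> 0); [exact: SEcst|move=> z; exact: hasd_cst].
- move=> j; split=> [z|k]; first exact: ctn_coord.
  by exists (fun=> (real_dir k : Cn) 0 j); [exact: SEcst|move=> z; exact: hasd_coord].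
- move=> f _ [c d]; split=> [z|k]; first exact: ctnJ.
  have [g Sg H] := d k; exists (fun z => (g z)^*); first exact: SEconj.
  by move=> z; exact: hasdJ.
- move=> f g _ [cf df] _ [cg dg]; split=> [z|k]; first exact: ctnD.
  have [f' Sf Hf] := df k; have [g' Sg Hg] := dg k.
  by exists (fun z => f' z + g' z); [exact: SEadd|move=> z; exact: hasdD].
- move=> f g Ef [cf df] Eg [cg dg]; split=> [z|k]; first exact: ctnM.
  have [f' Sf Hf] := df k; have [g' Sg Hg] := dg k.
  exists (fun z => f' z * g z + f z * g' z); last by move=> z; exact: hasdM.
  by apply: SEadd; exact: SEmul.
- move=> f f0 Ef [cf df]; split=> [z|k]; first by apply: ctnV.
  have [f' Sf Hf] := df k.
  exists (fun z => -1 * f' z * ((f z)^-1 * (f z)^-1)).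
    by apply: SEmul; apply: SEmul => //; [exact: SEcst|exact: SEinv|exact: SEinv].
  move=> z; apply: (hasd_eq (hasdV (f0 z) (Hf z))).
  by rewrite mulN1r expr2 invfM.
- move=> H h f HH Hh Ef [cf df].
  have cont (x : R) (g : R -> R) : H g -> {for x, continuous g}.
    move=> /HH[g' _ gd]; apply: differentiable_continuous; apply/derivable1_diffP.
    exact: (@ex_derive _ _ _ _ _ _ _ (gd x)).
  split=> [z|k].
    apply: (@ctn_real_comp _ _ (fun z => Re (f z))); last exact: cont.
    by apply/ctn_realP; have [] := ctn_ReIm (cf z).
  have [f' Sf Hf] := df k; have [h' Hh' hd] := HH h Hh.
  (* The last factor is the real part of [f' z], written with the constructors of [smooth_expr]. *)
  exists (fun z => (h' (Re (f z)))%:C * (2^-1 * (f' z + (f' z)^*))).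
    apply: SEmul; first exact: SEcomp HH Hh' Ef.
    by apply: SEmul; [exact: SEcst|apply: SEadd => //; exact: SEconj].
  move=> z; have [h1 _] := Hf z.
  apply: (hasd_eq (hasd_real (hasdR_comp h1 (hd _)))).
  rewrite rmorphM/=; congr (_ * _).
  have -> : f' z + (f' z)^* = (Re (f' z))%:C *+ 2.
    by case: (f' z) => a b; rewrite mulr2n; apply: eqc => /=; ring.
  by rewrite -[(Re _)%:C *+ 2]mulr_natl mulKf// pnatr_eq0.
- move=> f a _ [cf df]; split=> [z|k]; first exact: ctn_shift.
  have [g Sg H] := df k; exists (fun z => g (z + a)); first exact: SEshift.
  by move=> z; exact: hasd_shift.
Qed.

Lemma csmoothM f g : csmooth f -> csmooth g -> csmooth (fun z => f z * g z).
Proof. by move=> hf hg; apply: smooth_expr_csmooth; apply: SEmul; exact: SEsmooth. Qed.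

Lemma csmoothD f g : csmooth f -> csmooth g -> csmooth (fun z => f z + g z).
Proof. by move=> hf hg; apply: smooth_expr_csmooth; apply: SEadd; exact: SEsmooth. Qed.

Lemma csmooth_cst (a : C) : csmooth (fun _ : Cn => a).
Proof. by apply: smooth_expr_csmooth; exact: SEcst. Qed.

Lemma csmoothJ f : csmooth f -> csmooth (fun z => (f z)^*).
Proof. by move=> hf; apply: smooth_expr_csmooth; apply: SEconj; exact: SEsmooth. Qed.

Lemma csmooth_coord j : csmooth (fun z : Cn => z 0 j).
Proof. by apply: smooth_expr_csmooth; exact: SEcoord. Qed.

Lemma csmooth_shift f a : csmooth f -> csmooth (fun z => f (z + a)).
Proof. by move=> hf; apply: smooth_expr_csmooth; apply: SEshift; exact: SEsmooth. Qed.

(** The combination that defines [dzbar j], applied to any family of numbers in place of the partial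
    derivatives, so that known formulas for the derivatives can be inserted. *)
Definition db (j : 'I_n) (D : 'I_n + 'I_n -> C) : C := 2^-1 * (D (inl j) + (0 +i* 1) * D (inr j)).

Lemma dbM j D D' (x y : C) :
  db j (fun k => D k * y + x * D' k) = db j D * y + x * db j D'.
Proof.
rewrite /db; move: (D _) (D _) (D' _) (D' _) (0 +i* 1) (2^-1 : C) => a b c d i h; ring.
Qed.

Lemma dzbarE j f (D : 'I_n + 'I_n -> C) z : (forall k, hasd k f z (D k)) -> dzbar j f z = db j D.
Proof. by move=> h; rewrite /dzbar !(hasd_cpartial (h _)). Qed.

Lemma csmooth_dzbar j f : csmooth f -> csmooth (dzbar j f).
Proof.
move=> h; apply: smooth_expr_csmooth; apply: SEmul; first exact: SEcst.
by do ![apply: SEadd|apply: SEmul]; do ?exact: SEcst; apply: SEsmooth; exact: csmooth_cpartial.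
Qed.

Lemma dzbarM j f g z : csmooth f -> csmooth g ->
  dzbar j (fun z => f z * g z) z = dzbar j f z * g z + f z * dzbar j g z.
Proof.
move=> hf hg.
rewrite (dzbarE j (fun k => hasdM (csmooth_hasd k z hf) (csmooth_hasd k z hg))).
exact: (@dbM j (fun k => cpartial k f z) (fun k => cpartial k g z)).
Qed.

End smooth_calculus.

(** ** A smooth step function *)

Section smooth_step.
Context {R : realType}.
Implicit Types x t : R.

Lemma is_deriveRP (f : R -> R) x d : (forall e : R, 0 < e -> exists2 t0 : R, 0 < t0 &
    forall t : R, t != 0 -> `|t| < t0 -> `|(f (x + t) - f x) / t - d| < e) ->
  is_derive x (1 : R) f d.
Proof.
move=> h.
have hc : h^-1 *: (f (h *: 1 + x) - f x) @[h --> (0:R)^'] --> d.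
  apply/cvgrPdist_lt => e /h[t0 t00 H].
  apply/nbhs_ballP; exists t0 => //= t; rewrite /ball/= sub0r normrN => tt tn0.
  have := H t tn0 tt; rewrite distrC [_ *: (_ - _)]mulrC [_ *: 1]mulr1 [t + x]addrC//.
constructor; first by apply/cvg_ex; exists d.
exact: cvg_lim hc.
Qed.

(** The flat function exp(-1/x) with the negative powers of x that its derivatives produce: the span
    of these functions is stable under differentiation. *)
Definition expinv (k : nat) x : R := if 0 < x then x^-1 ^+ k * expR (- x^-1) else 0.

(** The exponential of [x^-1] exceeds the term of degree [k.+1] of its series. The linear bound
    makes the derivative at 0 vanish. *)
Lemma expinv_le k : exists2 M : R, 0 < M & forall x, 0 < x -> expinv k x <= M * x.
Proof.
exists (k.+1`!%:R) => [|x x0]; first by rewrite ltr0n fact_gt0.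
have F0 : 0 < (k.+1`!%:R : R) by rewrite ltr0n fact_gt0.
rewrite /expinv x0 expRN ler_pdivrMr ?expR_gt0//.
have := @expR_ge1Dxn R x^-1 k; rewrite invr_ge0 ltW// => /(_ isT) h.
have {}h : x^-1 ^+ k.+1 / k.+1`!%:R <= expR x^-1 by apply: le_trans h; rewrite lerDr.
apply: le_trans (ler_wpM2l _ h); last by rewrite mulr_ge0 ?(ltW F0)// ltW.
rewrite exprS [x^-1 * _ / _]mulrC [X in _ <= X]mulrACA.
have -> : x * (x^-1 * x^-1 ^+ k) = x^-1 ^+ k by rewrite mulVKf// gt_eqF.
by rewrite mulfV ?gt_eqF// mul1r.
Qed.

Lemma expinv_ge0 k x : 0 <= expinv k x.
Proof.
by rewrite /expinv; case: ifP => // x0; rewrite mulr_ge0 ?expR_ge0// exprn_ge0// invr_ge0 ltW.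
Qed.

Lemma expinv_gt0 k x : 0 < x -> 0 < expinv k x.
Proof. by move=> x0; rewrite /expinv x0 mulr_gt0 ?expR_gt0// exprn_gt0// invr_gt0. Qed.

Lemma expinv0 k x : x <= 0 -> expinv k x = 0.
Proof. by rewrite /expinv leNgt => /negbTE ->. Qed.

Lemma is_derive_expinv k x :
  is_derive x (1 : R) (expinv k) (- k%:R * expinv k.+1 x + expinv k.+2 x).
Proof.
have [x0|x0|x0] := ltgtP x 0.
- rewrite !expinv0 ?(ltW x0)// mulr0 addr0.
  apply: (near_eq_is_derive (f := fun=> 0)); rewrite ?oner_neq0//.
  near=> y; rewrite expinv0// ltW//; near: y; exact: lt_nbhsl.
- rewrite /expinv x0.
  apply: (near_eq_is_derive (f := fun x => x^-1 ^+ k * expR (- x^-1))); rewrite ?oner_neq0//.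
    by near=> y; rewrite ifT//; near: y; exact: lt_nbhsr.
  have xn0 : x != 0 by rewrite gt_eqF.
  have dV : is_derive x (1 : R) (fun y : R => y^-1) (- x ^- 2).
    by apply: is_derive_eq; [apply: is_deriveV => //; exact: is_derive_id|rewrite [LHS]mulr1].
  have dE : is_derive x (1 : R) (fun y : R => expR (- y^-1)) (expR (- x^-1) * x ^- 2).
    have h := is_deriveN dV; rewrite opprK in h.
    exact: (@is_derive1_comp _ expR (fun y : R => - y^-1) x _ _ (is_derive_expR _) h).
  have dX (m : nat) : is_derive x (1 : R) (fun y : R => y^-1 ^+ m) (- m%:R * x^-1 ^+ m.+1).
    elim: m => [|m ih].
      by rewrite oppr0 mul0r; under eq_fun do rewrite expr0; exact: is_derive_cst.
    under eq_fun do rewrite exprS.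
    apply: (is_derive_eq (is_deriveM dV ih)).
    rewrite -[LHS]/(x^-1 * (- m%:R * x^-1 ^+ m.+1) + x^-1 ^+ m * (- x ^- 2)) -exprVn !exprS -natr1; move: (m%:R : R) (x^-1) (x^-1 ^+ m); clear; intros; ring.
  apply: (is_derive_eq (is_deriveM (dX k) dE)).
  rewrite -[LHS]/(x^-1 ^+ k * (expR (- x^-1) * x ^- 2) + expR (- x^-1) * (- k%:R * x^-1 ^+ k.+1)).
  by rewrite -exprVn !exprS; ring.
- rewrite x0 !expinv0// mulr0 addr0.
  have [M M0 HM] := expinv_le k.+1.
  apply: is_deriveRP => e e0; exists (e / M); first exact: divr_gt0.
  move=> t tn0; rewrite add0r (expinv0 k (lexx 0)) !subr0 ltr_pdivlMr// => tM.
  have [t0|t0] := leP t 0; first by rewrite expinv0// mul0r normr0.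
  have -> : expinv k t / t = expinv k.+1 t by rewrite /expinv t0 exprSr mulrAC.
  by rewrite ger0_norm ?expinv_ge0// (le_lt_trans (HM t t0))// mulrC -{1}(gtr0_norm t0).
Unshelve. all: by end_near. Qed.

End smooth_step.

Section real_expr.
Context {R : realType}.
Implicit Types x : R.

(** Stable under differentiation by [real_expr_derive], hence a legitimate family [H] in
    [SEcomp]. *)
Inductive real_expr : (R -> R) -> Prop :=
| REexpinv k : real_expr (expinv k)
| REcst a : real_expr (fun=> a)
| REaffine h a b : real_expr h -> real_expr (fun x => h (a * x + b))
| READd f g : real_expr f -> real_expr g -> real_expr (fun x => f x + g x)
| REmul f g : real_expr f -> real_expr g -> real_expr (fun x => f x * g x)
| REinv f : (forall x, f x != 0) -> real_expr f -> real_expr (fun x => (f x)^-1).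

Lemma real_expr_derive f : real_expr f ->
  exists2 f', real_expr f' & forall x, is_derive x (1 : R) f (f' x).
Proof.
elim => {f}.
- move=> k; exists (fun x => - k%:R * expinv k.+1 x + expinv k.+2 x); last exact: is_derive_expinv.
  by apply: READd; [apply: REmul; [exact: REcst|exact: REexpinv]|exact: REexpinv].
- by move=> a; exists (fun=> 0); [exact: REcst|move=> x; exact: is_derive_cst].
- move=> h a b Eh [h' Eh' dh]; exists (fun x => h' (a * x + b) * a).
    by apply: REmul; [exact: REaffine|exact: REcst].
  move=> x; apply: (is_derive1_comp (dh _)).
  apply: (is_derive_eq (is_deriveD (is_deriveZ a (is_derive_id x 1)) (is_derive_cst b x 1))).
  by rewrite addr0 [LHS]mulr1.
- move=> f g Ef [f' Ef' df] Eg [g' Eg' dg]; exists (fun x => f' x + g' x); first exact: READd.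
  by move=> x; exact: (is_deriveD (df x) (dg x)).
- move=> f g Ef [f' Ef' df] Eg [g' Eg' dg]; exists (fun x => f x * g' x + g x * f' x).
    by apply: READd; exact: REmul.
  by move=> x; exact: (is_deriveM (df x) (dg x)).
- move=> f f0 Ef [f' Ef' df]; exists (fun x => -1 * ((f x)^-1 * (f x)^-1) * f' x).
    by do 2!apply: REmul => //; [exact: REcst|apply: REmul; exact: REinv].
  move=> x; apply: (is_derive_eq (is_deriveV (f0 x) (df x))).
  rewrite -[LHS]/(- (f x) ^- 2 * f' x) mulN1r; congr (- _ * _).
  by rewrite expr2 invfM.
Qed.

Lemma csmooth_real_expr n (h : R -> R) (f : 'rV[R[i]]_n -> R[i]) : real_expr h -> csmooth f ->
  csmooth (fun z => (h (Re (f z)))%:C).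
Proof.
move=> Eh sf; apply: smooth_expr_csmooth.
by apply: (SEcomp real_expr_derive Eh); exact: SEsmooth.
Qed.

(** Positive everywhere, because the half-lines on which the two terms are positive overlap. *)
Definition bump_den x : R := expinv 0 (x - 4^-1) + expinv 0 (1 - x).

Lemma bump_den_gt0 x : 0 < bump_den x.
Proof.
rewrite /bump_den; have [x1|x1] := ltP x 1.
  by rewrite ltr_wpDl ?expinv_ge0// expinv_gt0// subr_gt0.
by rewrite ltr_wpDr ?expinv_ge0// expinv_gt0//; lra.
Qed.

(** A smooth step from 0 on [x <= 4^-1] to 1 on [x >= 1]. It will be evaluated at |z_j|^2 / t^2, so
    the transition takes place for t/2 <= |z_j| <= t. *)
Definition step x : R := expinv 0 (x - 4^-1) / bump_den x.

Definition dstep x : R :=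
  (expinv 2 (x - 4^-1) * expinv 0 (1 - x) + expinv 0 (x - 4^-1) * expinv 2 (1 - x)) / bump_den x ^+ 2.

Let affE (h : R -> R) b : (fun x => h (x - b)) = (fun x => h (1 * x + - b)).
Proof. by apply/funext => x; rewrite mul1r. Qed.

Let affE' (h : R -> R) : (fun x => h (1 - x)) = (fun x => h (-1 * x + 1)).
Proof. by apply/funext => x; rewrite mulN1r addrC. Qed.

Lemma real_expr_left k b : real_expr (fun x => expinv k (x - b)).
Proof. by rewrite affE; apply: REaffine; exact: REexpinv. Qed.

Lemma real_expr_right k : real_expr (fun x => expinv k (1 - x)).
Proof. by rewrite affE'; apply: REaffine; exact: REexpinv. Qed.

Lemma real_expr_den : real_expr bump_den.
Proof. by apply: READd; [exact: real_expr_left|exact: real_expr_right]. Qed.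

Lemma real_expr_step : real_expr step.
Proof.
apply: REmul; first exact: real_expr_left.
by apply: REinv; [move=> x; rewrite gt_eqF// bump_den_gt0|exact: real_expr_den].
Qed.

Lemma real_expr_dstep : real_expr dstep.
Proof.
apply: REmul.
  apply: READd; apply: REmul;
  by [exact: real_expr_left|exact: real_expr_right].
apply: (REinv (f := fun x => bump_den x * bump_den x)).
  by move=> x; rewrite mulf_neq0// gt_eqF// bump_den_gt0.
by apply: REmul; exact: real_expr_den.
Qed.

Lemma is_derive_step x : is_derive x (1 : R) step (dstep x).
Proof.
have l1 : is_derive x (1 : R) (fun x => x - 4^-1) 1.
  apply: (is_derive_eq (is_deriveB (is_derive_id x 1) (is_derive_cst (4^-1 : R) x 1))).
  by rewrite subr0.
have l2 : is_derive x (1 : R) (fun x => 1 - x) (-1).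
  apply: (is_derive_eq (is_deriveB (is_derive_cst (1 : R) x 1) (is_derive_id x 1))).
  by rewrite sub0r.
have h1 : is_derive x (1 : R) (fun x => expinv 0 (x - 4^-1)) (expinv 2 (x - 4^-1)).
  apply: (is_derive_eq (@is_derive1_comp R (expinv 0) _ x _ _ (is_derive_expinv 0 _) l1)).
  by rewrite oppr0 mul0r add0r mulr1.
have h2 : is_derive x (1 : R) (fun x => expinv 0 (1 - x)) (- expinv 2 (1 - x)).
  apply: (is_derive_eq (@is_derive1_comp R (expinv 0) _ x _ _ (is_derive_expinv 0 _) l2)).
  by rewrite oppr0 mul0r add0r mulrN1.
have d0 := bump_den_gt0 x.
apply: (is_derive_eq (is_deriveM h1 (is_deriveV (lt0r_neq0 d0) (is_deriveD h1 h2)))).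
set A := expinv 0 (x - 4^-1); set A' := expinv 2 (x - 4^-1); set B' := expinv 2 (1 - x).
rewrite -[LHS]/(A * (- bump_den x ^- 2 * (A' - B')) + (bump_den x)^-1 * A') /dstep.
rewrite -/A -/A' -/B'; have -> : expinv 0 (1 - x) = bump_den x - A by rewrite /bump_den -/A [A + _]addrC addrK.
by field; rewrite gt_eqF.
Qed.

Lemma step_lt x : x <= 4^-1 -> step x = 0.
Proof. by move=> x4; rewrite /step expinv0 ?mul0r// subr_le0. Qed.

Lemma step_gt x : 1 <= x -> step x = 1.
Proof.
move=> x1; have := bump_den_gt0 x; rewrite /step /bump_den [expinv 0 (1 - x)]expinv0 ?subr_le0// addr0.
by move=> h; rewrite mulfV// gt_eqF.
Qed.

Lemma dstep_lt x : x <= 4^-1 -> dstep x = 0.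
Proof. by move=> x4; rewrite /dstep !(expinv0 _ (_ : x - 4^-1 <= 0)) ?subr_le0// !mul0r addr0 mul0r. Qed.

Lemma dstep_gt x : 1 <= x -> dstep x = 0.
Proof. by move=> x4; rewrite /dstep !(expinv0 _ (_ : 1 - x <= 0)) ?subr_le0// !mulr0 addr0 mul0r. Qed.

Lemma dstep_ge0 x : 0 <= dstep x.
Proof. by rewrite /dstep divr_ge0 ?sqr_ge0// addr_ge0// mulr_ge0// expinv_ge0. Qed.

Lemma dstep_gt0 : 0 < dstep 2^-1.
Proof.
rewrite /dstep divr_gt0 ?exprn_gt0 ?bump_den_gt0// ltr_wpDr//; last by rewrite mulr_gt0// expinv_gt0//; lra.
by rewrite mulr_ge0// expinv_ge0.
Qed.

End real_expr.

(** * Annular product kernels and their dbar-primitives *)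

Section kernels.
Context {R : realType} {n : nat}.
Local Notation C := R[i].
Local Notation Cn := 'rV[C]_n.
Implicit Types (r : 'I_n -> R) (z : Cn).

Definition sq j z : R := rn (z 0 j) ^+ 2.

Definition rstep (t x : R) : R := step (t ^- 2 * x).
Definition rdstep (t x : R) : R := t ^- 2 * dstep (t ^- 2 * x).

Lemma real_expr_rstep t : real_expr (rstep t).
Proof.
have -> : rstep t = (fun x => step (t ^- 2 * x + 0)) by apply/funext => x; rewrite addr0.
by apply: REaffine; exact: real_expr_step.
Qed.

Lemma real_expr_rdstep t : real_expr (rdstep t).
Proof.
apply: REmul; first exact: REcst.
rewrite (_ : (fun _ => _) = (fun x => dstep (t ^- 2 * x + 0))); last first.
  by apply/funext => x; rewrite addr0.
by apply: REaffine; exact: real_expr_dstep.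
Qed.

Lemma is_derive_rstep t x : is_derive x (1 : R) (rstep t) (rdstep t x).
Proof.
apply: (is_derive_eq (is_derive1_comp (is_derive_step (t ^- 2 * x))
  (is_deriveZ (t ^- 2) (is_derive_id x 1)))).
by rewrite [_ *: 1]mulr1 mulrC.
Qed.

Lemma csmooth_sq j (h : R -> R) : real_expr h -> csmooth (fun z : Cn => (h (sq j z))%:C).
Proof.
move=> Eh; rewrite (_ : (fun _ => _) = (fun z : Cn => (h (Re (z 0 j * (z 0 j)^*)))%:C)).
  by apply: csmooth_real_expr => //; apply: csmoothM; [|apply: csmoothJ]; exact: csmooth_coord.
by apply/funext => z; rewrite mulcJ.
Qed.

(* Each factor vanishes near z_j = 0, so that the difference of two kernels has a
   smooth compactly supported dbar-primitive. *)
Definition polykernel r z : R := \prod_j rdstep (r j) (sq j z).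

Definition polykernel' r j z : R := \prod_(l | l != j) rdstep (r l) (sq l z).

Lemma csmooth_prod (I : Type) (s : seq I) (P : pred I) (F : I -> Cn -> R) :
  (forall i, csmooth (fun z => (F i z)%:C)) -> csmooth (fun z => (\prod_(i <- s | P i) F i z)%:C).
Proof.
move=> h; elim: s => [|i s ih].
  rewrite (_ : (fun z => _) = fun=> 1); first exact: csmooth_cst.
  by apply/funext => z; rewrite big_nil.
have [Pi|Pi] := boolP (P i); last first.
  by rewrite (_ : (fun z => _) = (fun z => (\prod_(i <- s | P i) F i z)%:C))//; apply/funext => z; rewrite big_cons (negbTE Pi).
rewrite (_ : (fun z => _) = (fun z => (F i z)%:C * (\prod_(i <- s | P i) F i z)%:C)).
  exact: (csmoothM (h i) ih).
by apply/funext => z; rewrite big_cons Pi rmorphM.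
Qed.

Lemma csmooth_polykernel r : csmooth (fun z => (polykernel r z)%:C).
Proof. by apply: csmooth_prod => j; apply: csmooth_sq; exact: real_expr_rdstep. Qed.

Lemma csmooth_polykernel' r j : csmooth (fun z => (polykernel' r j z)%:C).
Proof. by apply: csmooth_prod => l; apply: csmooth_sq; exact: real_expr_rdstep. Qed.

Lemma polykernelE r j z : polykernel r z = rdstep (r j) (sq j z) * polykernel' r j z.
Proof. by rewrite /polykernel (bigD1 j). Qed.

Lemma rdstep_ge0 t x : 0 <= rdstep t x.
Proof. by rewrite mulr_ge0 ?dstep_ge0// invr_ge0 exprn_even_ge0. Qed.

Lemma rdstep_gt t x : 0 < t -> t ^+ 2 <= x -> rdstep t x = 0.
Proof.
by move=> t0 tx; rewrite /rdstep dstep_gt ?mulr0// mulrC ler_pdivlMr ?exprn_gt0// mul1r.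
Qed.

Lemma rstep_gt t x : 0 < t -> t ^+ 2 <= x -> rstep t x = 1.
Proof. by move=> t0 tx; rewrite /rstep step_gt// mulrC ler_pdivlMr ?exprn_gt0// mul1r. Qed.

Lemma rstep_lt t x : 0 < t -> 4 * x <= t ^+ 2 -> rstep t x = 0.
Proof.
move=> t0 tx; rewrite /rstep step_lt// mulrC ler_pdivrMr ?exprn_gt0//; lra.
Qed.

Lemma rdstep_lt t x : 0 < t -> 4 * x <= t ^+ 2 -> rdstep t x = 0.
Proof.
move=> t0 tx; rewrite /rdstep dstep_lt ?mulr0// mulrC ler_pdivrMr ?exprn_gt0//; lra.
Qed.

Lemma polykernel_ge0 r z : 0 <= polykernel r z.
Proof. by apply: prodr_ge0 => j _; exact: rdstep_ge0. Qed.

Lemma rn_gt (z : Cn) (M : R) : 0 <= M -> M < rn z -> exists j, M < rn (z 0 j).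
Proof.
move=> M0 Mz; apply: contrapT => h; move: Mz; rewrite ltNge => /negP; apply.
by apply: rn_le => // j; rewrite leNgt; apply/negP => hj; apply: h; exists j.
Qed.

Lemma polykernel_supp r M z : 0 <= M -> (forall j, 0 < r j <= M) -> M < rn z -> polykernel r z = 0.
Proof.
move=> M0 rM /(rn_gt M0)[j Mj]; rewrite (polykernelE _ j) rdstep_gt ?mul0r//; first by have /andP[] := rM j.
have /andP[rj0 rj] := rM j.
by rewrite lerXn2r ?nnegrE ?rn_ge0// ?(ltW rj0)// (le_trans rj)// ltW.
Qed.

Lemma polykernelN r z : polykernel r (- z) = polykernel r z.
Proof. by apply: eq_bigr => j _; rewrite /sq mxE rnN. Qed.

Lemma hasd_invariant k (f : Cn -> C) z :
  (forall t : R, f (z + t%:C *: real_dir k) = f z) -> hasd k f z 0.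
Proof.
by move=> h; split; apply/hasdRP => e e0; exists 1 => // t tn0 _; rewrite h subrr mul0r subr0 normr0.
Qed.

(* The denominator |z_j|^2 is made positive near 0, where the numerator vanishes. *)
Definition kernel_prim r j (s t a : R) z : C :=
  (z 0 j)^* * ((rstep s (sq j z) - rstep t (sq j z)) / (sq j z + expinv 0 (a - sq j z)))%:C
  * (polykernel' r j z)%:C.

Lemma csmooth_kernel_prim r j s t a : 0 < a -> csmooth (kernel_prim r j s t a).
Proof.
move=> a0; apply: csmoothM; last exact: csmooth_polykernel'.
apply: csmoothM; first by apply: csmoothJ; exact: csmooth_coord.
have -> : (fun z : Cn => ((rstep s (sq j z) - rstep t (sq j z)) / (sq j z + expinv 0 (a - sq j z)))%:C) =
    (fun z : Cn => ((fun x => rstep s x + -1 * rstep t x) (sq j z))%:C *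
      (z 0 j * (z 0 j)^* + (expinv 0 (-1 * sq j z + a))%:C)^-1).
  apply/funext => z; rewrite mulcJ -rmorphD/= -fmorphV -rmorphM/=; congr (_ * _^-1)%:C.
    by rewrite mulN1r.
  by congr (_ + expinv 0 _); rewrite mulN1r addrC.
apply: csmoothM.
  apply: (csmooth_sq j (h := fun x => rstep s x + -1 * rstep t x)); apply: READd; first exact: real_expr_rstep.
  by apply: REmul; [exact: REcst|exact: real_expr_rstep].
apply: smooth_expr_csmooth; apply: SEinv.
  move=> z; rewrite mulcJ -rmorphD/= (inj_eq (@complexI R) (_ + _) 0) gt_eqF//.
  have [h|h] := ltP (sq j z) a.
    by rewrite ltr_wpDl ?sqr_ge0// expinv_gt0// mulN1r addrC subr_gt0.
  by rewrite ltr_wpDr ?expinv_ge0// (lt_le_trans a0).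
apply: SEadd; last first.
  apply: SEsmooth; apply: (csmooth_sq j (h := fun x => expinv 0 (-1 * x + a))).
  by apply: REaffine; exact: REexpinv.
by apply: SEmul; [|apply: SEconj]; exact: SEcoord.
Qed.

Lemma dzbar_coord j z : dzbar j (fun z : Cn => z 0 j) z = 0.
Proof.
rewrite (dzbarE j (fun k => hasd_coord k j z)) /db /real_dir !mxE !eqxx mulr1.
by rewrite (_ : (1 : C) + _ = 0) ?mulr0//; apply: eqc => /=; ring.
Qed.

Lemma hasd_sq k j z (h : R -> R) (h' : R) : is_derive (sq j z) (1 : R) h h' ->
  hasd k (fun z : Cn => (h (sq j z))%:C) z
   (h' * Re ((real_dir k : Cn) 0 j * (z 0 j)^* + z 0 j * ((real_dir k : Cn) 0 j)^*))%:C.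
Proof.
move=> dh; apply: hasd_real; apply: hasdR_comp => //.
have [h1 _] := hasdM (hasd_coord k j z) (hasdJ (hasd_coord k j z)).
rewrite (_ : sq j = (fun z => Re (z 0 j * (z 0 j)^*)))//.
by apply/funext => w; rewrite mulcJ.
Qed.

Lemma dzbar_sq j z (h : R -> R) (h' : R) : is_derive (sq j z) (1 : R) h h' ->
  dzbar j (fun z : Cn => (h (sq j z))%:C) z = h'%:C * z 0 j.
Proof.
move=> dh; rewrite (dzbarE j (fun k => hasd_sq k dh)) /db /real_dir !mxE !eqxx mulr1.
apply: (mulfI (x := 2)); first by rewrite pnatr_eq0.
rewrite mulVKf ?pnatr_eq0//; case: (z 0 j) => x y.
by rewrite -(rmorph_nat (real_complex R)); apply: eqc => /=; ring.
Qed.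

Lemma dzbar_polykernel' r j z : dzbar j (fun z => (polykernel' r j z)%:C) z = 0.
Proof.
have h k : k = inl j \/ k = inr j -> hasd k (fun z => (polykernel' r j z)%:C) z 0.
  move=> kE; apply: hasd_invariant => t; congr (_%:C); apply: eq_bigr => l lj.
  by case: kE => ->; rewrite /sq !mxE eqxx (negbTE lj) !mulr0 addr0.
by rewrite /dzbar !(hasd_cpartial (h _ _)); [|right|left]; rewrite // mulr0 addr0 mulr0.
Qed.

(** Away from z_j = 0 the first two factors of [kernel_prim] are a function F(|z_j|^2) / z_j with F
    = [rstep s - rstep t], and dbar_j of this is F'(|z_j|^2), while the remaining factor does not
    depend on z_j. Near z_j = 0 both sides vanish. *)
Lemma dzbar_kernel_prim r j s t a z : 0 < a -> 0 < s -> 0 < t ->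
  4 * a <= s ^+ 2 -> 4 * a <= t ^+ 2 ->
  dzbar j (kernel_prim r j s t a) z =
  ((rdstep s (sq j z) - rdstep t (sq j z)) * polykernel' r j z)%:C.
Proof.
move=> a0 s0 t0 sa ta.
have [z0|z0] := eqVneq (z 0 j) 0.
  have sz : sq j z = 0 by rewrite /sq z0 rn0 expr0n.
  rewrite !rdstep_lt// ?sz ?mulr0 ?sqr_ge0// subrr mul0r.
  have h k : hasd k (kernel_prim r j s t a) z 0.
    apply: (@hasd_near _ _ _ (fun=> 0)); last exact: hasd_cst.
    apply/nbhs_rnP; exists (Num.min 1 a); first by rewrite lt_min ltr01.
    move=> w; rewrite lt_min => /andP[w1 wa].
    have sw : sq j w < a.
      have := rn_coord (w - z) j; rewrite !mxE z0 subr0 => h.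
      rewrite /sq expr2 (@le_lt_trans _ _ (1 * rn (w 0 j)))// ?mul1r; last exact: le_lt_trans wa.
      by rewrite ler_piMl ?rn_ge0// ltW// (le_lt_trans h).
    by rewrite /kernel_prim !rstep_lt ?subrr ?mul0r ?mulr0 ?mul0r//; apply: le_trans sa || apply: le_trans ta;
      rewrite ler_pM2l// ltW.
  by rewrite /dzbar !(hasd_cpartial (h _)) mulr0 addr0 mulr0.
(* Multiplying by the holomorphic function z_j removes the quotient before differentiating. *)
have E : (fun z => z 0 j * kernel_prim r j s t a z) =
    (fun z => ((rstep s \- rstep t) (sq j z))%:C * (polykernel' r j z)%:C).
  apply/funext => w; rewrite /kernel_prim !mulrA mulcJ -rmorphM/=; congr (_%:C * _).
  have [wa|wa] := ltP (sq j w) a.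
    by rewrite !rstep_lt ?subrr ?mul0r ?mulr0//; apply: le_trans sa || apply: le_trans ta;
      rewrite ler_pM2l// ltW.
  by rewrite (expinv0 0 (_ : a - _ <= 0)) ?subr_le0// addr0 mulrC mulfVK// gt_eqF// (lt_le_trans a0).
apply: (mulfI z0).
have := dzbarM j z (csmooth_coord j) (csmooth_kernel_prim r j s t a0).
rewrite E dzbar_coord mul0r add0r => <-.
have sst : csmooth (fun z : Cn => ((rstep s \- rstep t) (sq j z))%:C).
  apply: csmooth_sq; rewrite (_ : _ \- _ = fun x => rstep s x + -1 * rstep t x).
    apply: READd; first exact: real_expr_rstep.
    by apply: REmul; [exact: REcst|exact: real_expr_rstep].
  by apply/funext => x /=; rewrite mulN1r.
rewrite (dzbarM j z sst (csmooth_polykernel' r j)) dzbar_polykernel' mulr0 addr0.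
rewrite (dzbar_sq (is_deriveB (is_derive_rstep s _) (is_derive_rstep t _))).
by rewrite mulrAC mulrC -rmorphM.
Qed.

End kernels.

Section dominated.
Context {R : realType} d (T : measurableType d).
Variables (mu : {measure set T -> \bar R}) (D : set T).
Hypothesis mD : measurable D.

Lemma Rint_cvg (f : nat -> T -> R) (g h : T -> R) :
  (forall k, measurable_fun D (f k)) -> ri mu D h ->
  (forall k x, D x -> `|f k x| <= h x) ->
  (forall x, D x -> f k x @[k --> \oo] --> g x) ->
  \int[mu]_(x in D) f k x @[k --> \oo] --> \int[mu]_(x in D) g x.
Proof.
move=> mf hi fh fg; have [gi hc] := Rint_dct mD mf hi fh fg.
have fi k : ri mu D (f k) by exact: (ri_le mD (mf k) (fh k) hi).
apply/cvgrPdist_lt => e e0; have /cvgrPdist_lt/(_ e e0) := hc; apply: filterS => k.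
rewrite sub0r normrN => hk; apply: le_lt_trans hk.
rewrite distrC [leRHS]ger0_norm; last by apply: Rint_ge0.
have -> : \int[mu]_(x in D) f k x - \int[mu]_(x in D) g x = \int[mu]_(x in D) (f k x - g x).
  by rewrite RintegralB//; exact: fi.
by rewrite le_normr_Rintegral//; apply: (riD mD) => //; exact: riN.
Qed.

Lemma Rint_cvg0 (f : nat -> T -> R) (g h : T -> R) :
  (forall k, measurable_fun D (f k)) -> ri mu D h ->
  (forall k x, D x -> `|f k x| <= h x) ->
  (forall x, D x -> f k x @[k --> \oo] --> g x) ->
  (forall k, \int[mu]_(x in D) f k x = 0) -> \int[mu]_(x in D) g x = 0.
Proof.
move=> mf hi fh fg f0; have := Rint_cvg mf hi fh fg; under eq_fun do rewrite f0.
by move=> /cvg_lim <-//; rewrite lim_cst.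
Qed.

End dominated.

(** * Rational points and positivity of the volume of balls *)

Section dense_points.
Context {R : realType} {n : nat}.
Local Notation C := R[i].
Local Notation Cn := 'rV[C]_n.
Local Notation vol := (@volume R n).

(** An enumeration of the points with rational real coordinates; a number that is no code gives the
    origin. *)
Definition rational_point (i : nat) : Cn :=
  if @unpickle 'rV[rat * rat]_n i is Some q then \row_j (ratr (q 0 j).1 +i* ratr (q 0 j).2)
  else 0.

Lemma rational_point_dense (z : Cn) (e : R) : 0 < e -> exists i, rn (rational_point i - z) < e.
Proof.
move=> e0; have e2 : 0 < e / 2 by rewrite divr_gt0.
have ex (x : R) : exists q : rat, `|ratr q - x| < e / 2.
  have [q] := @rat_in_itvoo R (x - e / 2) (x + e / 2) ltac:(lra).
  by rewrite in_itv/= => /andP[h1 h2]; exists q; rewrite ltr_norml; apply/andP; split; lra.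
pose q : 'rV[rat * rat]_n := \row_j (projT1 (cid (ex (Re (z 0 j)))), projT1 (cid (ex (Im (z 0 j))))).
exists (pickle q); rewrite /rational_point pickleK; apply: rn_lt => // j.
rewrite !mxE/= (le_lt_trans (rn_le_ReIm _))// cReD cImD cReN cImN/= [X in _ < X](_ : e = e / 2 + e / 2); last by field.
by apply: ltrD; [case: (cid (ex (Re (z 0 j))))|case: (cid (ex (Im (z 0 j))))].
Qed.

Lemma open_rnP (O : set Cn) : open O <->
  forall z, O z -> exists2 d : R, 0 < d & forall w, rn (w - z) < d -> O w.
Proof.
rewrite openE; split=> h z /h; first by move=> /nbhs_rnP.
by move=> hd; apply/nbhs_rnP.
Qed.

Lemma open_rn_ball (z : Cn) (d : R) : open [set w : Cn | rn (w - z) < d].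
Proof.
apply/open_rnP => w /= wd; exists (d - rn (w - z)); first by rewrite subr_gt0.
by move=> x xw /=; have := rn_trans x w z; lra.
Qed.

(** Otherwise all balls of radius [d] would be null by translation, and countably many of them,
    centred at rational points, cover the space. *)
Lemma volume_ball_gt0 (z : Cn) (d : R) : 0 < d -> (0 < vol [set w : Cn | (rn (w - z) < d)%R])%E.
Proof.
move=> d0; rewrite lt_neqAle measure_ge0 andbT eq_sym; apply/negP => /eqP v0.
have mb (x : Cn) : measurable [set w : Cn | rn (w - x) < d].
  by apply: measurable_open; exact: open_rn_ball.
have vb (x : Cn) : vol [set w : Cn | rn (w - x) < d] = 0%E.
  rewrite -v0 -(volume_shift (z - x) (mb z)).
  by apply: (f_equal vol); apply/funext => w; rewrite /preimage/=; have -> : w + (z - x) - z = w - x by rewrite addrA addrAC addrK.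
have := @measure_sigma_subadditive _ _ _ vol setT (fun i => [set w : Cn | rn (w - rational_point i) < d])
  (fun i => mb _) measurableT.
have cover : setT `<=` \bigcup_i [set w : Cn | rn (w - rational_point i) < d].
  by move=> w _; have [i hi] := rational_point_dense w d0; exists i => //=; rewrite rn_distC.
move=> /(_ cover); rewrite eseries0; last by move=> i _ _; exact: vb.
by rewrite leNgt volume_setT_gt0.
Qed.

Lemma Rint_gt0 (g : Cn -> R) (z : Cn) : (forall w, ctn (fun w => (g w)%:C) w) ->
  (forall w, 0 <= g w) -> ri vol setT g -> 0 < g z -> 0 < \int[vol]_w g w.
Proof.
move=> cg g0 gi gz.
have /ctnP/(_ (g z / 2))[|d d0 H] := cg z; first by rewrite divr_gt0.
pose A := [set w : Cn | rn (w - z) < Num.min d 1].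
have mA : measurable A by apply: measurable_open; exact: open_rn_ball.
have vA : (vol A < +oo)%E.
  apply: (@volume_bounded_fin _ _ _ (1 + rn z)) => // w; rewrite /A/= lt_min => /andP[_ w1].
  by have := rn_trans w z 0; rewrite !subr0; lra.
have iA := ri_indic mA vA.
have vA0 : 0 < fine (vol A).
  by rewrite fine_gt0// vA andbT; apply: volume_ball_gt0; rewrite lt_min d0/=.
have IA : \int[vol]_w \1_A w = fine (vol A).
  by rewrite /Rintegral integral_indic// setIT.
apply: (@lt_le_trans _ _ (\int[vol]_w (g z / 2 * \1_A w))).
  by rewrite RintegralZl// IA mulr_gt0// divr_gt0.
apply: Rint_le => //; first exact: riZ.
move=> w _; rewrite indicE; have [wA|wA] := boolP (w \in A); last by rewrite mulr0.
rewrite mulr1; move: wA; rewrite inE /A/= lt_min => /andP[/H + _].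
by rewrite -rmorphB/= rn_real ltr_norml => /andP[h1 h2]; lra.
Qed.

End dense_points.

Section approximate_identity.
Context {R : realType} {n : nat}.
Local Notation C := R[i].
Local Notation Cn := 'rV[C]_n.
Local Notation vol := (@volume R n).

(** The value [a] is free: [a = u z] gives convergence at points of continuity, and [a = 0] gives
    the uniform bounds for dominated convergence. *)
Lemma conv_approx (k : Cn -> R) (u : Cn -> C) (z : Cn) (a : C) (M e : R) :
  (forall w, ctn (fun w => (k w)%:C) w) -> (forall w, 0 <= k w) ->
  (forall w, M < rn w -> k w = 0) -> ci setT u ->
  (forall w, rn (w - z) <= M -> rn (u w - a) <= e) ->
  rn (conv (fun w => (k w)%:C) u z - (\int[vol]_w k w)%:C * a) <= e * \int[vol]_w k w.
Proof.
move=> ck k0 kM ui ua.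
have kM' w : M < rn w -> (k w)%:C = 0 by move=> /kM ->.
have [L L0 HL] := ctn_supp_bounded ck kM'.
have kci := ctn_supp_ci ck kM'; have [kri _] := kci.
have kci' := ci_shift (- z) kci; have [kri' _] := kci'.
have I1 : (\int[vol]_w k w)%:C * a = cintegral setT (fun w => a * (k (w - z))%:C).
  rewrite cintegralZ// mulrC (cintegral_shift (- z) kci); congr (_ * _); apply: eqc => //=.
  by rewrite /Rintegral integral0.
have c1 := conv_ci z ck HL ui.
rewrite I1 /conv -cintegralB//; last exact: ciZ.
have c2 : ci setT (fun w => u w * (k (w - z))%:C - a * (k (w - z))%:C) by apply: ciB => //; exact: ciZ.
rewrite (le_trans (rn_cintegral measurableT c2))//.
have <- : \int[vol]_w k (w - z) = \int[vol]_w k w by rewrite (Rint_shift (- z) kri).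
rewrite -RintegralZl//; apply: Rint_le => //; [exact: ci_rn|exact: riZ|].
move=> w _; rewrite -mulrBl rnM rn_real (ger0_norm (k0 _)).
have [h|h] := leP (rn (w - z)) M; first by rewrite ler_wpM2r ?ua.
by rewrite kM// !mulr0.
Qed.

End approximate_identity.

(** * The fundamental lemma of the calculus of variations *)

Section fundamental_lemma.
Context {R : realType} {n : nat}.
Local Notation C := R[i].
Local Notation Cn := 'rV[C]_n.
Local Notation vol := (@volume R n).

(** Open sets form a generating class stable under intersection, as the Dynkin induction in
    [fundamental_real] requires. *)
Lemma measurable_open_sigma : @measurable _ Cn = <<s [set O : set Cn | open O] >>.
Proof.
apply/seteqP; split => A mA; last first.
  apply: (smallest_sub _ _ mA); first exact: sigma_algebra_measurable.
  by move=> O; exact: measurable_open.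
pose T := g_sigma_algebraType [set O : set Cn | open O].
have mcoord (p : Cn -> R) : (forall z, p w @[w --> z] --> p z) -> measurable_fun setT (p : T -> R).
  move=> cp; apply: (measurability (@RGenOInfty.G R)).
    exact: RGenOInfty.measurableE.
  move=> _ [_ [a ->] <-]; rewrite setTI; apply: sub_sigma_algebra => /=.
  apply/open_rnP => z /=; rewrite in_itv/= andbT => az.
  have /cvg_nbhsRP := cp z; move=> /(_ (p z - a)); rewrite subr_gt0 => /(_ az)[d d0 h].
  exists d => // w /h; rewrite in_itv/= andbT ltr_norml => /andP[? _]; lra.
have : measurable_fun setT (id : T -> Cn).
  apply: measurable_fun_CnP => j; apply: mcoord => z.
    by have [] := ctn_ReIm (ctn_coord j z).
  by have [] := ctn_ReIm (ctn_coord j z).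
by move=> /(_ measurableT A mA); rewrite setTI.
Qed.

(** [d] is the distance to the complement of [U], truncated at 1; the truncation also gives a value
    when the complement is empty. *)
Lemma open_Lipschitz (U : set Cn) : open U -> exists d : Cn -> R,
  [/\ forall z, 0 <= d z <= 1, forall z w, `|d w - d z| <= rn (w - z),
     forall z, ~ U z -> d z = 0 & forall z, U z -> 0 < d z].
Proof.
move=> /open_rnP oU.
pose S z : set R := [set r | r = 1 \/ exists2 w, ~ U w & r = rn (z - w)].
have S1 z : S z 1 by left.
have Slb z : lbound (S z) 0 by move=> r [->//|[w _ ->]]; exact: rn_ge0.
have hS z : has_inf (S z) by split; [exists 1|exists 0].
have le z r : S z r -> inf (S z) <= r by move=> Sr; apply: ge_inf => //; exists 0.
have Lip z w : inf (S w) <= inf (S z) + rn (w - z).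
  rewrite -lerBlDr; apply: lb_le_inf; first by exists 1.
  move=> r [->|[x Ux ->]]; rewrite lerBlDr.
    by apply: le_trans (le w 1 (S1 w)) _; rewrite lerDl rn_ge0.
  apply: le_trans (le w (rn (w - x)) _) _; first by right; exists x.
  by rewrite [X in _ <= X]addrC; exact: rn_trans.
exists (fun z => inf (S z)); split => [z|z w|z Uz|z Uz].
- rewrite le// andbT; apply: lb_le_inf => //; by exists 1.
- rewrite ler_norml; have := Lip z w; have := Lip w z; rewrite rn_distC.
  by move: (inf _) (inf _) (rn _) => x y r h1 h2; apply/andP; split; lra.
- apply/eqP; rewrite eq_le; apply/andP; split; last by apply: lb_le_inf => //; exists 1.
  by apply: le; right; exists z; rewrite // subrr rn0.
- have [d d0 H] := oU z Uz; apply: (@lt_le_trans _ _ (Num.min 1 d)); first by rewrite lt_min ltr01.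
  apply: lb_le_inf; first by exists 1.
  move=> r [->|[w Uw ->]]; first by rewrite ge_min lexx.
  rewrite ge_min; apply/orP; right; rewrite leNgt; apply/negP => wz; apply: Uw; apply: H.
  by rewrite rn_distC.
Qed.

(** The indicator of an open set is the limit of the continuous functions [Num.min 1 (k%:R * d z)],
    so the integral of [g] over open subsets vanishes. Dynkin's lemma extends this to measurable
    sets, and the set where [g >= 0] recovers the absolute value. *)
Lemma fundamental_real (V : set Cn) (g : Cn -> R) : open V -> ri vol V g ->
  (forall chi : Cn -> R, (forall z, ctn (fun z => (chi z)%:C) z) -> (forall z, 0 <= chi z <= 1) ->
    (forall z, ~ V z -> chi z = 0) -> \int[vol]_(z in V) (g z * chi z) = 0) ->
  \int[vol]_(z in V) `|g z| = 0.
Proof.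
move=> oV gi H; have mV := measurable_open oV.
have mg := ri_meas gi.
have gM (p : Cn -> R) : measurable_fun V p -> (forall z, V z -> `|p z| <= 1) -> ri vol V (fun z => g z * p z).
  move=> mp p1; apply: (ri_le mV _ _ (ri_norm gi)); first exact: measurable_funM.
  by move=> z Vz; rewrite normrM ler_piMr// p1.
have mi (A : set Cn) : measurable A -> measurable_fun V (\1_A : Cn -> R).
  by move=> mA; apply: measurable_indic.
have i1 (A : set Cn) (z : Cn) : `|\1_A z : R| <= 1.
  by rewrite indicE; case: (_ \in _); rewrite ?normr1// normr0.
pose P (A : set Cn) := measurable A /\ \int[vol]_(z in V) (g z * \1_A z) = 0.
have Popen O : open O -> P O.
  move=> oO; split; first exact: measurable_open.
  have [d [d01 dL dn dp]] := open_Lipschitz (openI oV oO).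
  pose chi (k : nat) z := Num.min 1 (k%:R * d z).
  have cchi k z : ctn (fun z => (chi k z)%:C) z.
    apply/ctnP => e e0; exists (e / k.+1%:R); first by rewrite divr_gt0.
    move=> w; rewrite ltr_pdivlMr// => wz; rewrite -rmorphB/= rn_real (le_lt_trans _ wz)//.
    apply: (@le_trans _ _ (k%:R * `|d w - d z|)).
      rewrite -[X in _ <= X * _](ger0_norm (ler0n _ _)) -normrM mulrBr /chi.
      have h (a b : R) : `|Num.min 1 a - Num.min 1 b| <= `|a - b|.
        by rewrite !minEle; case: ifPn => ?; case: ifPn => ?; rewrite ler_norml; apply/andP; split;
          have := ler_norm (a - b); have := ler_norm (b - a); rewrite distrC; lra.
      exact: h.
    by rewrite mulrC; apply: ler_pM => //; rewrite ler_nat.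
  have chi01 k z : 0 <= chi k z <= 1.
    have /andP[h1 h2] := d01 z.
    by rewrite /chi le_min ler01 mulr_ge0//= ge_min lexx.
  have chin k z : chi k z <= 1 by have /andP[] := chi01 k z.
  have cvgi z : V z -> g z * chi k z @[k --> \oo] --> g z * \1_O z.
    move=> Vz; apply: cvgM; first exact: cvg_cst.
    have [Oz|nOz] := pselect (O z); last first.
      rewrite indicE memNset// (_ : (fun k => chi k z) = fun=> 0); first exact: cvg_cst.
      by apply/funext => k; rewrite /chi dn ?mulr0 ?minr_r//; [rewrite minEle; case: ifP => //; lra|case].
    rewrite indicE mem_set//=; apply: cvg_near_cst.
    have dz := dp z (conj Vz Oz); have [N HN] := inv_small dz.
    exists N.+1 => // -[|k]//= Nk; rewrite /chi; apply/eqP; rewrite minEle ifT//.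
    have := HN k Nk.
    have k0 : 0 < (k.+1%:R : R) by [].
    by rewrite -(ltr_pM2l k0) mulfV ?gt_eqF// => /ltW.
  apply: (Rint_cvg0 mV (f := fun k z => g z * chi k z) (h := fun z => `|g z|)) => //.
  - move=> k; apply: measurable_funM => //.
    by have [m1 _] := ctn_mc (cchi k); exact: (measurable_funTS m1).
  - exact: ri_norm.
  - by move=> k x Vx; rewrite normrM ler_piMr// ger0_norm//; have /andP[] := chi01 k x.
  - move=> k; apply: H => // z nVz; rewrite /chi dn ?mulr0; [rewrite minEle; case: ifP => //; lra|by case].
have Pall A : measurable A -> P A.
  rewrite measurable_open_sigma => mA.
  apply: (@dynkin_induction _ Cn [set O : set Cn | open O] P) mA.
  - exact: measurable_open_sigma.
  - by move=> A' B' oA oB; exact: openI.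
  - by apply: Popen; exact: openT.
  - by move=> O; exact: Popen.
  - move=> S mS [_ IS]; split; first exact: measurableC.
    have [_ IT] := Popen setT (@openT _).
    rewrite -[RHS](subrr 0) -{1}IT -IS -RintegralB//; try by apply: gM => //; exact: mi.
    apply: Rint_eq => z _; rewrite -mulrBr; congr (_ * _); rewrite !indicE in_setT in_setC.
    by case: (z \in S); rewrite /= ?subrr ?subr0.
  - move=> F mF tF PF; split; first exact: bigcup_measurable.
    pose f k z := g z * \sum_(i < k) (\1_(F i) z : R).
    have Fsum k z : \sum_(i < k) (\1_(F i) z : R) = \1_(\big[setU/set0]_(i < k) F i) z.
      elim: k => [|k ih]; first by rewrite !big_ord0 indic0.
      rewrite !big_ord_recr/= ih !indicE in_setU.
      have [h1|h1] := boolP (z \in F k); last by rewrite orbF addr0.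
      have [h2|h2] := boolP (z \in _); last by rewrite add0r.
      exfalso; move: h1 h2; rewrite !inE -bigcup_mkord => h1 [j /= jk h2].
      by have := tF j k I I (ex_intro _ z (conj h2 h1)) => E; rewrite E ltnn in jk.
    have mU k : measurable (\big[setU/set0]_(i < k) F i) by apply: bigsetU_measurable.
    apply: (Rint_cvg0 mV (f := f) (h := fun z => `|g z|)).
    + move=> k; rewrite /f; under eq_fun do rewrite Fsum.
      by apply: measurable_funM => //; exact: mi.
    + exact: ri_norm.
    + by move=> k z Vz; rewrite /f Fsum normrM ler_piMr.
    + move=> z Vz; apply: cvgM; first exact: cvg_cst.
      have [[j _ Fj]|nF] := pselect ((\bigcup_k F k) z); last first.
        rewrite indicE memNset// (_ : (fun k => _) = fun=> 0); first exact: cvg_cst.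
        apply/funext => k; rewrite Fsum indicE memNset// -bigcup_mkord => -[i _ Fi].
        by apply: nF; exists i.
      rewrite indicE mem_set/=; last by exists j.
      apply: cvg_near_cst; exists j.+1 => // k /= jk; apply/eqP; rewrite Fsum indicE mem_set//.
      by rewrite -bigcup_mkord; exists j.
    + elim=> [|N ih].
        by rewrite (@Rint_eq _ _ _ vol V _ (fun=> 0)) ?/Rintegral ?integral0// => z _; rewrite /f big_ord0 mulr0.
      rewrite (@Rint_eq _ _ _ vol V _ (fun z => f N z + g z * \1_(F N) z)); last first.
        by move=> z _; rewrite /f big_ord_recr/= mulrDr.
      rewrite RintegralD//; first by rewrite ih (PF N).2 addr0.
        apply: (@ri_eq _ _ _ vol V mV (fun z => g z * \1_(\big[setU/set0]_(i < N) F i) z)).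
          by move=> z _; rewrite /f -Fsum.
        by apply: gM => //; exact: mi.
      by apply: gM => //; exact: mi.
pose A := V `&` [set z | 0 <= g z].
have mA : measurable A.
  have := mg mV `[0, +oo[%classic (measurable_itv _); rewrite /A (_ : _ @^-1` _ = [set z | 0 <= g z])//.
  by apply/seteqP; split => z /=; rewrite in_itv/= andbT.
have [_ IA] := Pall A mA; have [_ IT] := Pall setT measurableT.
have E z : V z -> `|g z| = 2 * (g z * \1_A z) - g z * \1_setT z.
  move=> Vz; rewrite !indicE in_setT/=; have [g0|g0] := leP 0 (g z).
    by rewrite (ger0_norm g0) mem_set// !mulr1; lra.
  by rewrite (ltr0_norm g0) memNset ?mulr0//; [lra|case=> _ /=; lra].
rewrite (@Rint_eq _ _ _ vol V _ _ E) RintegralB//.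
- by rewrite RintegralZl// ?IA ?IT ?mulr0 ?subr0//; apply: gM => //; exact: mi.
- by apply: riZ => //; apply: gM => //; exact: mi.
- by apply: gM => //; exact: mi.
Qed.

Lemma fundamental_lemma (V : set Cn) (h : Cn -> C) : open V -> ci V h ->
  (forall chi : Cn -> R, (forall z, ctn (fun z => (chi z)%:C) z) -> (forall z, 0 <= chi z <= 1) ->
    (forall z, ~ V z -> chi z = 0) -> cintegral V (fun z => h z * (chi z)%:C) = 0) ->
  \int[vol]_(z in V) rn (h z) = 0.
Proof.
move=> oV hi H; have mV := measurable_open oV; have [h1 h2] := hi.
have E1 : \int[vol]_(z in V) `|Re (h z)| = 0.
  apply: fundamental_real => // chi c1 c2 c3; have := H chi c1 c2 c3.
  move=> /(f_equal (@complex.Re R))/= <-; apply: Rint_eq => z _; by rewrite cReM/= mulr0 subr0.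
have E2 : \int[vol]_(z in V) `|Im (h z)| = 0.
  apply: fundamental_real => // chi c1 c2 c3; have := H chi c1 c2 c3.
  move=> /(f_equal (@complex.Im R))/= <-; apply: Rint_eq => z _; by rewrite cImM/= mulr0 add0r.
apply/eqP; rewrite eq_le; apply/andP; split; last by apply: Rint_ge0 => z _; exact: rn_ge0.
have -> : 0 = \int[vol]_(z in V) (`|Re (h z)| + `|Im (h z)|).
  by rewrite RintegralD ?E1 ?E2 ?addr0//; exact: ri_norm.
apply: Rint_le => //; [exact: ci_rn|by apply: riD => //; exact: ri_norm|].
by move=> z _; exact: rn_le_ReIm.
Qed.

End fundamental_lemma.

(** * Weakly holomorphic functions and the mean value property *)

Section cut.
Context {R : realType} {n : nat}.
Local Notation C := R[i].
Local Notation Cn := 'rV[C]_n.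
Local Notation vol := (@volume R n).
Implicit Types (f u : Cn -> C) (D Om : set Cn).

Definition cut D f z : C := if z \in D then f z else 0.

Lemma cutT D f z : D z -> cut D f z = f z.
Proof. by move=> Dz; rewrite /cut mem_set. Qed.

Let cutRe D f : (fun z => Re (cut D f z)) = (fun z => Re (f z)) \_ D.
Proof. by apply/funext => z; rewrite patchE /cut; case: ifP. Qed.

Let cutIm D f : (fun z => Im (cut D f z)) = (fun z => Im (f z)) \_ D.
Proof. by apply/funext => z; rewrite patchE /cut; case: ifP. Qed.

Lemma ci_cut D f : measurable D -> ci D f <-> ci setT (cut D f).
Proof.
move=> mD; rewrite /ci cutRe cutIm /ri -!restrict_EFin.
by split=> -[h1 h2]; split; apply/(integrable_mkcond _ mD).
Qed.

Lemma cintegral_cut D f : cintegral setT (cut D f) = cintegral D f.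
Proof.
by rewrite /cintegral cutRe cutIm -!Rintegral_mkcond.
Qed.

Lemma cintegral_cut_mul D f g : (forall z, ~ D z -> g z = 0) ->
  cintegral setT (fun z => cut D f z * g z) = cintegral D (fun z => f z * g z).
Proof.
move=> g0; rewrite -(cintegral_cut D); apply: cintegral_eq => z _; rewrite /cut.
by have [//|zD] := boolP (z \in D); rewrite mul0r.
Qed.

Lemma ci_mul_bd D f g (L : R) : measurable D -> ci D f -> mc D g -> (forall z, D z -> rn (g z) <= L) ->
  ci D (fun z => f z * g z).
Proof.
move=> mD fi mg gL; apply: (ci_le mD (mcM (ci_mc fi) mg) _ (riZ mD L (ci_rn mD fi))).
by move=> z Dz; rewrite rnM mulrC ler_wpM2r ?rn_ge0// gL.
Qed.

Lemma cintegral_db0 D p q : measurable D -> ci D p -> ci D q ->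
  cintegral D p = 0 -> cintegral D q = 0 ->
  cintegral D (fun z => 2^-1 * (p z + (0 +i* 1) * q z)) = 0.
Proof.
move=> mD pi qi p0 q0; rewrite (cintegralZ mD); last by apply: (ciD mD) => //; exact: (ciZ mD).
by rewrite (cintegralD mD) ?(cintegralZ mD)// ?p0 ?q0 ?mulr0 ?addr0 ?mulr0//; exact: (ciZ mD).
Qed.

(** The inverse of the truncated distance to the complement of [Om] is locally bounded, hence
    bounded on [K] by some [B']. The set [K'] consists of the points of a large ball where that
    distance is at least [B'^-1 / 2]. *)
Lemma compact_nbhd Om (K : set Cn) : open Om -> compact K -> K `<=` Om ->
  exists K' : set Cn, exists2 d : R, 0 < d &
    [/\ compact K', K' `<=` Om & forall z w, K z -> rn (w - z) <= d -> K' w].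
Proof.
move=> oOm cK KOm; have [f [f01 fL f0 fp]] := open_Lipschitz oOm.
have [M M0 HM] := compact_rn_bounded cK.
have [B HB] : exists B, forall z, K z -> (f z)^-1 <= B.
  apply: compact_seq_bounded => // z /KOm/fp fz; exists (f z / 2); first by rewrite divr_gt0.
  exists (f z / 2)^-1 => w wz; have := fL z w; have /andP[w0 _] := f01 w.
  rewrite ler_norml => /andP[h1 h2].
  by rewrite lef_pV2 ?posrE; lra.
pose B' := Num.max 1 B; have B1 : 1 <= B' by rewrite le_max lexx.
have B0 : 0 < B' by rewrite (lt_le_trans _ B1).
have fB z : K z -> B'^-1 <= f z.
  move=> Kz; rewrite -[f z]invrK lef_pV2 ?posrE ?invr_gt0//; last exact: fp (KOm _ Kz).
  by rewrite le_max HB// orbT.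
exists [set w | rn w <= M + 1 /\ B'^-1 / 2 <= f w].
exists (B'^-1 / 2); first by rewrite divr_gt0// invr_gt0.
have Bi : 0 < B'^-1 by rewrite invr_gt0.
have Bi1 : B'^-1 <= 1 by rewrite invf_le1.
split.
- apply: (@closed_bounded_compact _ _ _ (M + 1)); last by move=> z [].
  rewrite -[X in closed X]setCK; apply: open_closedC; apply/open_rnP => z /= /not_andP[|] /negP; rewrite -ltNge => h.
    exists (rn z - (M + 1)); first lra.
    move=> w wz [wM _]; have := rn_trans z w 0; rewrite !subr0 rn_distC; lra.
  exists (B'^-1 / 2 - f z); first lra.
  by move=> w wz [_ wM]; have := fL z w; rewrite ler_norml => /andP[h1 h2]; lra.
- move=> z [_ h]; apply: contrapT => /f0 fz; lra.
- move=> z w Kz wz; split; first by have := rn_trans w z 0; rewrite !subr0; have := HM z Kz; lra.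
  by have := fL z w; rewrite ler_norml => /andP[h1 h2]; have := fB z Kz; lra.
Qed.

Definition weakly_holo Om u := forall chi, test_function Om chi -> forall j,
  cintegral Om (fun z => u z * dzbar j chi z) = 0.

Lemma dzbar_shift j f a z : csmooth f -> dzbar j (fun w => f (w + a)) z = dzbar j f (z + a).
Proof.
move=> sf; rewrite (dzbarE j (fun k => hasd_shift (csmooth_hasd k (z + a) sf))).
by rewrite (dzbarE j (fun k => csmooth_hasd k (z + a) sf)).
Qed.

Lemma closed_rn_ball (z : Cn) (M : R) : closed [set w : Cn | rn (w - z) <= M].
Proof.
rewrite -[X in closed X]setCK; apply: open_closedC; apply/open_rnP => w /= /negP; rewrite -ltNge => h.
exists (rn (w - z) - M); first lra.
by move=> x xw /=; apply/negP; rewrite -ltNge; have := rn_trans w x z; rewrite (rn_distC w x); lra.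
Qed.

Lemma compact_rn_ball (z : Cn) (M : R) : compact [set w : Cn | rn (w - z) <= M].
Proof.
apply: (@closed_bounded_compact _ _ _ (M + rn z)); first exact: closed_rn_ball.
by move=> w /= h; have := rn_trans w z 0; rewrite !subr0; lra.
Qed.

Lemma polykernel_ci r (M : R) : 0 <= M -> (forall j, 0 < r j <= M) ->
  ci setT (fun z : Cn => (polykernel r z)%:C).
Proof.
move=> M0 rM; apply: (@ctn_supp_ci _ _ _ M) => z; first exact: (csmooth_ctn z (csmooth_polykernel r)).
by move=> Mz; rewrite (polykernel_supp M0 rM Mz).
Qed.

Lemma conv_cut Om u eta z : (forall w, eta (w - z) != 0 -> Om w) ->
  conv eta (cut Om u) z = cintegral Om (fun w => u w * eta (w - z)).
Proof.
move=> h; rewrite /conv cintegral_cut_mul// => w nOw; apply/eqP; apply: contrapT => /negP /h.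
exact: nOw.
Qed.

(** The difference of the two kernels is dbar_j of a translate of [kernel_prim]. That function has
    compact support, since far out in z_j both steps are equal to 1, and it is therefore a test
    function for [u]. *)
Lemma kernel_change1 Om u r r' j z (M : R) : measurable Om -> ci Om u -> weakly_holo Om u -> 0 <= M ->
  (forall l, 0 < r l <= M) -> (forall l, 0 < r' l <= M) -> (forall l, l != j -> r l = r' l) ->
  (forall w, rn (w - z) <= M -> Om w) ->
  conv (fun w => (polykernel r w)%:C) (cut Om u) z = conv (fun w => (polykernel r' w)%:C) (cut Om u) z.
Proof.
move=> mOm ui wu M0 rM rM' rr BOm.
have supp s w : (forall l, 0 < s l <= M) -> ((polykernel s (w - z))%:C : C) != 0 -> Om w.
  move=> sM h; apply: BOm; rewrite leNgt; apply/negP => wM; move: h.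
  by rewrite (polykernel_supp M0 sM wM) eqxx.
rewrite !conv_cut; try by move=> w; exact: supp.
have /andP[r0 r1] := rM j; have /andP[r0' r1'] := rM' j.
(* Where |z_j|^2 < a both steps vanish, and elsewhere the correction of the denominator in
   [kernel_prim] is 0. *)
pose a := Num.min (r j ^+ 2) (r' j ^+ 2) / 4.
have a0 : 0 < a by rewrite divr_gt0// lt_min !exprn_gt0.
have ar : 4 * a <= r j ^+ 2 by rewrite /a mulrC divfK// ge_min lexx.
have ar' : 4 * a <= r' j ^+ 2 by rewrite /a mulrC divfK// ge_min lexx orbT.
pose chi w := kernel_prim r j (r j) (r' j) a (w + - z).
have schi := csmooth_shift (- z) (csmooth_kernel_prim r j (r j) (r' j) a0).
have tchi : test_function Om chi.
  split=> //; exists [set w | rn (w - z) <= M]; split => //; first exact: compact_rn_ball.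
  move=> w /= /negP; rewrite -ltNge => /(rn_gt M0)[l Ml].
  have sqM s : 0 < s <= M -> s ^+ 2 <= sq l (w + - z).
    by move=> /andP[s0 sM]; rewrite /sq lerXn2r ?nnegrE ?rn_ge0// ?(ltW s0)// (le_trans sM)// ltW.
  rewrite /chi /kernel_prim; have [lj|lj] := eqVneq l j.
    by rewrite -lj !rstep_gt ?subrr ?mul0r ?mulr0 ?mul0r//; rewrite ?lj// -lj; apply: sqM; rewrite lj.
  have -> : polykernel' r j (w + - z) = 0.
    by rewrite /polykernel' (bigD1 l)//= rdstep_gt ?mul0r//; [have /andP[] := rM l|exact: sqM].
  by rewrite mulr0.
have := wu chi tchi j.
have E w : dzbar j chi w = (polykernel r (w - z))%:C - (polykernel r' (w - z))%:C.
  rewrite dzbar_shift; last exact: csmooth_kernel_prim.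
  rewrite dzbar_kernel_prim// -rmorphB/= !(polykernelE _ j) mulrBl; congr (_ - _ * _)%:C.
  by apply: eq_bigr => l lj; rewrite rr.
have pk s : (forall l, 0 < s l <= M) -> ci Om (fun w => u w * (polykernel s (w - z))%:C).
  move=> sM; have sp := csmooth_polykernel (R := R) (n := n) s.
  have [|L L0 HL] := ctn_supp_bounded (fun z => csmooth_ctn z sp) (M := M).
    by move=> w Mw; rewrite (polykernel_supp M0 sM Mw).
  apply: (@ci_mul_bd _ _ _ L) => //; apply: mc_sub (ctn_mc _) => // w.
  exact: (csmooth_ctn w (csmooth_shift (- z) sp)).
under cintegral_eq do rewrite E mulrBr.
by rewrite (cintegralB mOm (pk r rM) (pk r' rM')) => /eqP; rewrite subr_eq0 => /eqP.
Qed.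

Lemma kernel_change Om u r r' z (M : R) : measurable Om -> ci Om u -> weakly_holo Om u -> 0 <= M ->
  (forall l, 0 < r l <= M) -> (forall l, 0 < r' l <= M) ->
  (forall w, rn (w - z) <= M -> Om w) ->
  conv (fun w => (polykernel r w)%:C) (cut Om u) z = conv (fun w => (polykernel r' w)%:C) (cut Om u) z.
Proof.
move=> mOm ui wu M0 rM rM' BOm.
pose s (m : nat) (l : 'I_n) : R := if (l < m)%N then r' l else r l.
have sM m l : 0 < s m l <= M by rewrite /s; case: ifP.
have E m : (m <= n)%N -> conv (fun w => (polykernel r w)%:C) (cut Om u) z =
    conv (fun w => (polykernel (s m) w)%:C) (cut Om u) z.
  elim: m => [_|m ih mn]; first by [].
  rewrite (ih (ltnW mn)).
  apply: (@kernel_change1 Om u _ _ (Ordinal mn) z M mOm ui wu M0 (sM m) (sM m.+1) _ BOm) => l lm.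
  rewrite /s [in RHS]ltnS [in RHS]leq_eqVlt; have -> : (l == m :> nat) = false by apply/negbTE.
  by [].
rewrite (E n (leqnn n)).
have -> : s n = r' by apply/funext => l; rewrite /s ltn_ord.
by [].
Qed.

Definition pk (t : R) (z : Cn) : R := polykernel (fun=> t) z.
Definition pkc (t : R) (z : Cn) : C := (pk t z)%:C.
Definition pmass (t : R) : R := \int[vol]_z pk t z.

Lemma pk_supp t z : 0 < t -> t < rn z -> pk t z = 0.
Proof. by move=> t0; apply: polykernel_supp; [exact: ltW|move=> j; rewrite t0/=]. Qed.

Lemma pkc_supp t z : 0 < t -> t < rn z -> pkc t z = 0.
Proof. by move=> t0 tz; rewrite /pkc pk_supp. Qed.

Lemma pkc_smooth t : csmooth (pkc t). Proof. exact: csmooth_polykernel. Qed.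

Lemma pkc_ctn t z : ctn (pkc t) z. Proof. exact: csmooth_ctn (pkc_smooth t). Qed.

Lemma pk_ge0 t z : 0 <= pk t z. Proof. exact: polykernel_ge0. Qed.

Lemma pkN t z : pk t (- z) = pk t z. Proof. exact: polykernelN. Qed.

Lemma pkc_ci t : 0 < t -> ci setT (pkc t).
Proof. by move=> t0; apply: (@polykernel_ci _ t); [exact: ltW|move=> j; rewrite t0/=]. Qed.

Lemma pmass_gt0 t : 0 < t -> 0 < pmass t.
Proof.
(* Here |z_j|^2 = t^2 / 2 for all j, so each factor of the kernel is a positive multiple of
   [dstep 2^-1]. *)
move=> t0; pose z : Cn := const_mx ((Num.sqrt (t ^+ 2 / 2))%:C).
apply: (@Rint_gt0 _ _ _ z).
- by move=> w; exact: pkc_ctn.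
- by move=> w; exact: pk_ge0.
- by have [] := pkc_ci t0.
- apply: prodr_gt0 => j _; rewrite /sq mxE rn_real ger0_norm ?sqrtr_ge0// sqr_sqrtr; last first.
    by rewrite divr_ge0// sqr_ge0.
  rewrite /rdstep mulr_gt0 ?invr_gt0 ?exprn_gt0//.
  by rewrite mulrA mulVf ?mul1r ?dstep_gt0// gt_eqF// exprn_gt0.
Qed.

Lemma pmassE t : 0 < t -> (pmass t)%:C = cintegral setT (pkc t).
Proof. by move=> t0; apply: eqc => //=; rewrite /Rintegral integral0. Qed.

Lemma weakly_holo1 (M : R) : weakly_holo [set w : Cn | rn w < M] (fun=> 1).
Proof.
move=> chi [schi [K [cK KOm K0]]] j.
have [B B0 HB] := compact_rn_bounded cK.
have chi0 z : B < rn z -> chi z = 0.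
  by move=> Bz; apply: K0 => /HB; rewrite leNgt Bz.
have C1chi := csmooth_C1 (O := setT) schi.
have D0 k z : ~ K z -> cpartial k chi z = 0.
  move=> nK; apply: (hasd_uniq (csmooth_hasd k z schi)); apply: hasd_near (hasd_cst k 0 z).
  have : \forall w \near z, ~ K w.
    by apply: open_nbhs_nbhs; split; [apply: closed_openC; exact: compact_closedC|exact: nK].
  by apply: filterS => w /K0 ->.
have ciP k : ci setT (cpartial k chi).
  apply: (@ctn_supp_ci _ _ _ B) => z; first by have [_ _] := C1chi z I; apply.
  by move=> Bz; apply: D0 => /HB; rewrite leNgt Bz.
have d0 z : ~ rn z < M -> dzbar j chi z = 0.
  by move=> nz; rewrite /dzbar !D0 ?mulr0 ?addr0 ?mulr0// => /KOm.
rewrite -(@cintegral_cut_mul _ (fun=> 1) _ d0).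
rewrite (@cintegral_eq _ _ setT _ (dzbar j chi)); last first.
  move=> z _; rewrite /cut; have [_|/negP nz] := boolP (z \in _); first by rewrite mul1r.
  by rewrite mul0r d0// => /mem_set /nz.
exact: (cintegral_db0 measurableT (ciP _) (ciP _) (ibp (inl j) C1chi chi0) (ibp (inr j) C1chi chi0)).
Qed.

(** This is [kernel_change] for the constant function 1 on a ball that contains both supports. *)
Lemma pmass_indep s t : 0 < s -> 0 < t -> pmass s = pmass t.
Proof.
move=> s0 t0; suff : (pmass s)%:C = (pmass t)%:C :> C by move=> /complexI.
rewrite (pmassE s0) (pmassE t0).
pose M := Num.max s t; have M0 : 0 < M by rewrite lt_max s0.
pose Om := [set w : Cn | rn w < M + 1].
have oOm : open Om.
  have := @open_rn_ball R n 0 (M + 1); rewrite (_ : [set w | _] = Om)//.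
  by apply/funext => w; rewrite /= subr0.
have mOm := measurable_open oOm.
have ci1 : ci Om (fun=> 1).
  have h : (vol Om < +oo)%E by exact: (@volume_bounded_fin R n Om (M + 1) mOm (fun z hz => ltW hz)).
  by split; apply: ri_cst.
have := @kernel_change Om (fun=> 1) (fun=> s) (fun=> t) 0 M mOm ci1 (@weakly_holo1 _) (ltW M0).
have conv1 r : 0 < r -> r <= M -> conv (fun w => (polykernel (fun=> r) w)%:C) (cut Om (fun=> 1)) 0 = cintegral setT (pkc r).
  move=> r0 rM; apply: cintegral_eq => w _; rewrite subr0 /cut.
  have [_|/negP nw] := boolP (w \in Om); first by rewrite mul1r.
  rewrite mul0r pkc_supp//; rewrite ltNge; apply/negP => wr; apply: nw; apply/mem_set => /=.
  by rewrite /Om/=; lra.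
have sM : s <= M by rewrite le_max lexx.
have tM : t <= M by rewrite le_max lexx orbT.
move=> E; rewrite -(conv1 s s0 sM) -(conv1 t t0 tM); apply: E.
- by move=> _; rewrite s0.
- by move=> _; rewrite t0.
- by move=> w; rewrite subr0 /Om/=; lra.
Qed.

(** The average does not change when the radius shrinks, and for small radii it is close to [u z] by
    continuity at [z]. *)
Lemma mean_value_property Om u z t : measurable Om -> ci Om u -> weakly_holo Om u -> 0 < t ->
  (forall w, rn (w - z) <= t -> Om w) -> ctn u z ->
  conv (pkc t) (cut Om u) z = (pmass t)%:C * u z.
Proof.
move=> mOm ui wu t0 BOm /ctnP cu; apply/eqP; rewrite -subr_eq0; apply/eqP.
apply: rn_eq0; apply/eqP; rewrite eq_le rn_ge0 andbT; apply/ler_addgt0Pr => e e0; rewrite add0r.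
have p0 := pmass_gt0 t0.
have [d d0 H] := cu (e / pmass t) (divr_gt0 e0 p0).
pose s := Num.min t (d / 2); have s0 : 0 < s by rewrite lt_min t0 divr_gt0.
have st : s <= t by rewrite ge_min lexx.
have sd : s < d by rewrite gt_min; apply/orP; right; lra.
have -> : conv (pkc t) (cut Om u) z = conv (pkc s) (cut Om u) z.
  apply: (@kernel_change Om u _ _ z t) => //; [exact: ltW|by move=> l; rewrite t0/=|].
  by move=> l; rewrite s0 st.
rewrite (pmass_indep t0 s0).
apply: (@le_trans _ _ (e / pmass t * pmass s)); last by rewrite (pmass_indep s0 t0) divfK// gt_eqF.
apply: (@conv_approx _ _ (pk s) _ _ _ s).
- by move=> w; exact: pkc_ctn.
- by move=> w; exact: pk_ge0.
- by move=> w; exact: pk_supp.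
- by apply/(ci_cut _ mOm).
- move=> w ws; rewrite cutT; first by apply/ltW/H; exact: le_lt_trans sd.
  by apply: BOm; exact: le_trans st.
Qed.

End cut.

(** * B-splines and Goursat's theorem *)

Section bspline1.
Context {R : realType}.
Implicit Types x t : R.

Definition pos1 x : R := Num.max 0 x.
Definition pos2 x : R := pos1 x ^+ 2.

Lemma pos1E x : (0 <= x /\ pos1 x = x) \/ (x <= 0 /\ pos1 x = 0).
Proof. by rewrite /pos1; case: (leP 0 x) => h; [left|right; split => //; exact: ltW]. Qed.

Lemma pos2_deriv x : is_derive x (1 : R) pos2 (2 * pos1 x).
Proof.
apply: is_deriveRP => e e0; exists e => // t tn0 te; apply: le_lt_trans te.
have h : `|pos2 (x + t) - pos2 x - 2 * pos1 x * t| <= t * t.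
  rewrite ler_norml /pos2; case: (pos1E x) => -[hx ->]; case: (pos1E (x + t)) => -[ht ->]; apply/andP; split; nra.
have t0 : 0 < `|t| by rewrite normr_gt0.
rewrite -(ler_pM2r t0) -normrM mulrBl divfK//; apply: (le_trans h).
by rewrite -normrM ger0_norm// -expr2 sqr_ge0.
Qed.

(** The quadratic B-spline with knots 0, 1, 2, 3, written as a third difference of truncated
    squares: it is of class C^1, supported in [0, 3], and self-similar. *)
Definition bs x : R := 2^-1 * (pos2 (x - 0%:R) - 3 * pos2 (x - 1%:R) + 3 * pos2 (x - 2%:R) - pos2 (x - 3%:R)).
Definition dbs x : R := pos1 (x - 0%:R) - 3 * pos1 (x - 1%:R) + 3 * pos1 (x - 2%:R) - pos1 (x - 3%:R).

Lemma bs_deriv x : is_derive x (1 : R) bs (dbs x).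
Proof.
have h (c : R) : is_derive x (1 : R) (fun x => pos2 (x - c)) (2 * pos1 (x - c)).
  have l1 : is_derive x (1 : R) (fun x => x - c) 1.
    apply: (is_derive_eq (is_deriveB (is_derive_id x 1) (is_derive_cst (c : R) x 1))).
    by rewrite subr0.
  apply: (is_derive_eq (@is_derive1_comp R pos2 _ x _ _ (pos2_deriv _) l1)).
  by rewrite mulr1.
apply: (is_derive_eq (is_deriveZ (2^-1) (is_deriveB (is_deriveD (is_deriveB (h 0%:R) (is_deriveZ 3 (h 1%:R)))
  (is_deriveZ 3 (h 2%:R))) (h 3%:R)))).
rewrite -[LHS]/(2^-1 * (2 * pos1 (x - 0%:R) - 3 * (2 * pos1 (x - 1%:R)) + 3 * (2 * pos1 (x - 2%:R))
  - 2 * pos1 (x - 3%:R))) /dbs.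
by field.
Qed.

Lemma pos1_Lip x y : `|pos1 x - pos1 y| <= `|x - y|.
Proof.
rewrite ler_norml; have := ler_norm (x - y); have := ler_norm (y - x); rewrite (distrC y x).
by case: (pos1E x) => -[hx ->]; case: (pos1E y) => -[hy ->] => h1 h2; apply/andP; split; lra.
Qed.

Lemma dbs_cont x : {for x, continuous dbs}.
Proof.
have h (c : R) : {for x, continuous (fun y => pos1 (y - c))}.
  apply/cvgrPdist_lt => e e0; apply/nbhs_ballP; exists e => //= y; rewrite /ball/= => xy.
  by rewrite (le_lt_trans (pos1_Lip _ _))// opprB addrA subrK.
have c0 (c : R) : {for x, continuous (fun=> c)} by exact: cvg_cst.
exact: (cvgB (cvgD (cvgB (h 0%:R) (cvgM (c0 3) (h 1%:R))) (cvgM (c0 3) (h 2%:R))) (h 3%:R)).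
Qed.

Lemma bs_bounds x : 0 <= bs x <= 1.
Proof.
rewrite /bs /pos2; case: (pos1E (x - 0%:R)) => -[h0 ->]; case: (pos1E (x - 1%:R)) => -[h1 ->];
case: (pos1E (x - 2%:R)) => -[h2 ->]; case: (pos1E (x - 3%:R)) => -[h3 ->]; apply/andP; split; nra.
Qed.

Lemma bs_half x : 1 <= x <= 2 -> 2^-1 <= bs x.
Proof.
move=> /andP[x1 x2].
rewrite /bs /pos2; case: (pos1E (x - 0%:R)) => -[h0 ->]; case: (pos1E (x - 1%:R)) => -[h1 ->];
case: (pos1E (x - 2%:R)) => -[h2 ->]; case: (pos1E (x - 3%:R)) => -[h3 ->]; nra.
Qed.

Lemma dbs_bound x : `|dbs x| <= 1.
Proof.
rewrite ler_norml /dbs; case: (pos1E (x - 0%:R)) => -[h0 ->]; case: (pos1E (x - 1%:R)) => -[h1 ->];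
case: (pos1E (x - 2%:R)) => -[h2 ->]; case: (pos1E (x - 3%:R)) => -[h3 ->]; apply/andP; split; lra.
Qed.

Lemma bs_supp x : ~ 0 <= x <= 3 -> bs x = 0 /\ dbs x = 0.
Proof.
move=> h; have {}h : x < 0 \/ 3 < x.
  by have [?|h1] := ltP x 0; [left|right; rewrite ltNge; apply/negP => h2; apply: h; rewrite h1].
rewrite /bs /dbs /pos2; case: (pos1E (x - 0%:R)) => -[h0 ->]; case: (pos1E (x - 1%:R)) => -[h1 ->];
case: (pos1E (x - 2%:R)) => -[h2 ->]; case: (pos1E (x - 3%:R)) => -[h3 ->]; case: h => h; split; try (by lra); try field; nra.
Qed.

(** The coefficients of the two-scale relation [bs_refine], which takes the place of subdividing a
    cube. *)
Definition refc (i : 'I_4) : R := 4^-1 * ('C(3, i))%:R.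

Lemma refc_ge0 i : 0 <= refc i. Proof. by rewrite mulr_ge0. Qed.

Lemma refc_sum : \sum_i refc i = 2.
Proof.
rewrite !big_ord_recl big_ord0 /refc/= /bump/= !addnE /=.
have -> : 'C(3, 0) = 1%N by []. have -> : 'C(3, 1) = 3%N by [].
have -> : 'C(3, 2) = 3%N by []. have -> : 'C(3, 3) = 1%N by [].
by field.
Qed.

(* (1 + t)^3 (1 - t)^3 = (1 - t^2)^3, in terms of the truncated squares. *)
Lemma bs_refine x : bs x = \sum_i refc i * bs (2 * x - (i : nat)%:R).
Proof.
pose p (k : nat) := pos2 (x - k%:R / 2).
have F (i m : nat) : pos2 (2 * x - i%:R - m%:R) = 4 * p (i + m)%N.
  rewrite /p /pos2 natrD; have -> : 2 * x - i%:R - m%:R = 2 * (x - (i%:R + m%:R) / 2) by field.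
  by move: (_ - _) => y; case: (pos1E y) => -[hy ->]; case: (pos1E (2 * y)) => -[h2 ->]; nra.
have G (m : nat) : pos2 (x - m%:R) = p (m + m)%N.
  by rewrite /p natrD; congr pos2; field.
rewrite {1}/bs !G !big_ord_recl big_ord0 /refc /= /bump /= /bs.
rewrite (F 0%N 0%N) (F 0%N 1%N) (F 0%N 2%N) (F 0%N 3%N) (F 1%N 0%N) (F 1%N 1%N) (F 1%N 2%N) (F 1%N 3%N)
  (F 2%N 0%N) (F 2%N 1%N) (F 2%N 2%N) (F 2%N 3%N) (F 3%N 0%N) (F 3%N 1%N) (F 3%N 2%N) (F 3%N 3%N) !addnE /=.
have -> : 'C(3, 0) = 1%N by []. have -> : 'C(3, 1) = 3%N by [].
have -> : 'C(3, 2) = 3%N by []. have -> : 'C(3, 3) = 1%N by [].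
by field.
Qed.

End bspline1.

Section bspline.
Context {R : realType} {n : nat}.
Local Notation C := R[i].
Local Notation Cn := 'rV[C]_n.
Local Notation vol := (@volume R n).
Local Notation K := ('I_n + 'I_n)%type.
Implicit Types (a : K -> R) (l : R) (z w : Cn) (k : K).

Definition rc k z : R := match k with inl j => Re (z 0 j) | inr j => Im (z 0 j) end.

Definition vec a : Cn := \row_j (a (inl j) +i* a (inr j)).

Lemma rc_vec k a : rc k (vec a) = a k.
Proof. by case: k => j; rewrite /= mxE. Qed.

Lemma rcB k z w : rc k (z - w) = rc k z - rc k w.
Proof. by case: k => j; rewrite /= !mxE ?cReD ?cImD ?cReN ?cImN. Qed.

Lemma rn_rc z M : 0 <= M -> (forall k, `|rc k z| <= M) -> rn z <= 2 * M.
Proof.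
move=> M0 h; apply: rn_le; first by rewrite mulr_ge0.
move=> j; rewrite (le_trans (rn_le_ReIm _))// mulr_natl mulr2n.
by apply: lerD; [exact: (h (inl j))|exact: (h (inr j))].
Qed.

Lemma rc_rn k z : `|rc k z| <= rn z.
Proof. by case: k => j; apply: le_trans (rn_coord z j); [exact: normr_Re|exact: normr_Im]. Qed.

Lemma rc_line k k' z (t : R) : rc k' (z + t%:C *: real_dir k) = rc k' z + t * (k' == k)%:R.
Proof.
case: k k' => j [j'|j'] /=; rewrite !mxE ?cReD ?cImD; congr (_ + _); case: (z 0 j') => x y /=.
- by rewrite -[inl j' == inl j]/(j' == j); case: eqP => _ /=; ring.
- by case: eqP => _ /=; ring.
- by case: eqP => _ /=; ring.
- by rewrite -[inr j' == inr j]/(j' == j); case: eqP => _ /=; ring.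
Qed.

Lemma hasdR_rc k k' z : hasdR k (rc k') z (k' == k)%:R.
Proof.
apply/hasdRP => e e0; exists 1 => // t tn0 _.
by rewrite rc_line [rc k' z + _]addrC addrK mulrC mulKf// subrr normr0.
Qed.

Lemma ctn_rc k z : ctn (fun z => (rc k z)%:C) z.
Proof. by apply/ctn_realP; case: k => j; have [h1 h2] := ctn_ReIm (ctn_coord j z). Qed.

Definition arg a l k z : R := (rc k z - a k) / l.

Definition bspline a l z : R := \prod_k bs (arg a l k z).

Definition bspline_rest a l k z : R := \prod_(k' | k' != k) bs (arg a l k' z).

Definition dbspline a l k z : R := dbs (arg a l k z) / l * bspline_rest a l k z.

Lemma bsplineE a l k z : bspline a l z = bs (arg a l k z) * bspline_rest a l k z.
Proof. by rewrite /bspline (bigD1 k). Qed.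

Lemma bspline_rest_bounds a l k z : 0 <= bspline_rest a l k z <= 1.
Proof.
apply/andP; split; first by apply: prodr_ge0 => k' _; have /andP[] := bs_bounds (arg a l k' z).
by apply: prodr_ile1 => k' _; exact: bs_bounds.
Qed.

Lemma bspline_ge0 a l z : 0 <= bspline a l z.
Proof. by apply: prodr_ge0 => k' _; have /andP[] := bs_bounds (arg a l k' z). Qed.

Lemma hasdR_arg a l k k' z : l != 0 -> hasdR k (arg a l k') z ((k' == k)%:R / l).
Proof.
move=> l0; apply/hasdRP => e e0; exists 1 => // t tn0 _; rewrite /arg rc_line.
suff -> : ((rc k' z + t * (k' == k)%:R - a k') / l - (rc k' z - a k') / l) / t - (k' == k)%:R / l = 0 by rewrite normr0.
by field; rewrite tn0 l0.
Qed.

Lemma hasd_bspline a l k z : 0 < l -> hasd k (fun z => (bspline a l z)%:C) z (dbspline a l k z)%:C.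
Proof.
move=> l0; have ln0 : l != 0 by rewrite gt_eqF.
have h1 : hasd k (fun z => (bs (arg a l k z))%:C) z (dbs (arg a l k z) / l)%:C.
  apply: hasd_real; apply: hasdR_eq.
    exact: (hasdR_comp (hasdR_arg a k k z ln0) (bs_deriv _)).
  by rewrite eqxx mul1r.
have h2 : hasd k (fun z => (bspline_rest a l k z)%:C) z 0.
  apply: hasd_invariant => t; congr (_%:C); apply: eq_bigr => k' kk'.
  by rewrite /arg rc_line (negbTE kk') mulr0 addr0.
rewrite (_ : (fun z => _) = (fun z => (bs (arg a l k z))%:C * (bspline_rest a l k z)%:C)).
  by apply: hasd_eq (hasdM h1 h2) _; rewrite mulr0 addr0 -rmorphM.
by apply/funext => w; rewrite (bsplineE _ _ k) rmorphM.
Qed.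

Lemma ctn_prodR (I : Type) (s : seq I) (P : pred I) (F : I -> Cn -> R) z :
  (forall i, ctn (fun z => (F i z)%:C) z) -> ctn (fun z => (\prod_(i <- s | P i) F i z)%:C) z.
Proof.
move=> h; elim: s => [|i s ih].
  by rewrite (_ : (fun z => _) = fun=> 1); [exact: ctn_cst|apply/funext => w; rewrite big_nil].
have [Pi|Pi] := boolP (P i); last first.
  by rewrite (_ : (fun z => _) = (fun z => (\prod_(i <- s | P i) F i z)%:C))//; apply/funext => w; rewrite big_cons (negbTE Pi).
rewrite (_ : (fun z => _) = (fun z => (F i z)%:C * (\prod_(i <- s | P i) F i z)%:C)); first exact: ctnM.
by apply/funext => w; rewrite big_cons Pi rmorphM.
Qed.

Lemma ctn_arg a l k z : ctn (fun z => (arg a l k z)%:C) z.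
Proof.
rewrite (_ : (fun z => _) = (fun z => ((rc k z)%:C - (a k)%:C) * (l^-1)%:C)).
  by apply: ctnM (ctn_cst _ _); apply: ctnB (ctn_cst _ _); exact: ctn_rc.
by apply/funext => w; rewrite -rmorphB -rmorphM.
Qed.

Lemma ctn_bs a l k z : ctn (fun z => (bs (arg a l k z))%:C) z.
Proof.
apply: (@ctn_real_comp _ _ (arg a l k) _ bs); first exact: ctn_arg.
apply: differentiable_continuous; apply/derivable1_diffP.
exact: (@ex_derive _ _ _ _ _ _ _ (bs_deriv _)).
Qed.

Lemma ctn_bspline a l z : ctn (fun z => (bspline a l z)%:C) z.
Proof. by apply: ctn_prodR => k; exact: ctn_bs. Qed.

Lemma ctn_dbspline a l k z : ctn (fun z => (dbspline a l k z)%:C) z.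
Proof.
rewrite (_ : (fun z => _) = (fun z => (dbs (arg a l k z))%:C * (l^-1)%:C * (bspline_rest a l k z)%:C)).
  apply: ctnM; last by apply: ctn_prodR => k'; exact: ctn_bs.
  apply: ctnM (ctn_cst _ _); apply: (@ctn_real_comp _ _ (arg a l k) _ dbs); first exact: ctn_arg.
  exact: dbs_cont.
by apply/funext => w; rewrite -!rmorphM.
Qed.

Lemma C1_bspline a l : 0 < l -> C1 setT (fun z => (bspline a l z)%:C) (fun k z => (dbspline a l k z)%:C).
Proof.
move=> l0 z _; split; first exact: ctn_bspline.
  by move=> k; exact: hasd_bspline.
by move=> k; exact: ctn_dbspline.
Qed.

(** The side is [3 * l] because [bs] lives on [0, 3]. *)
Definition cube a l : set Cn := [set z | forall k, a k <= rc k z <= a k + 3 * l].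

Lemma bspline_supp a l z : 0 < l -> ~ cube a l z -> bspline a l z = 0 /\ forall k, dbspline a l k z = 0.
Proof.
move=> l0 /existsNP[k hk].
have h : ~ 0 <= arg a l k z <= 3.
  by rewrite /arg ler_pdivlMr ?mul0r ?ler_pdivrMr// => /andP[h1 h2]; apply: hk; apply/andP; split; lra.
have [b1 b2] := bs_supp h; split; first by rewrite (bsplineE _ _ k) b1 mul0r.
move=> k'; rewrite /dbspline; have [<-|kk'] := eqVneq k k'; first by rewrite b2 !mul0r.
by rewrite /bspline_rest (bigD1 k)//= b1 mul0r mulr0.
Qed.

Lemma dbspline_bound a l k z : 0 < l -> `|dbspline a l k z| <= l^-1.
Proof.
move=> l0; rewrite /dbspline !normrM normfV (gtr0_norm l0) mulrAC.
have /andP[h1 h2] := bspline_rest_bounds a l k z.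
have li : 0 <= l^-1 by rewrite invr_ge0 ltW.
rewrite ler_piMl//.
by rewrite (ger0_norm h1) mulr_ile1// dbs_bound.
Qed.

Lemma rn_db j (D : K -> C) M : (forall k, rn (D k) <= M) -> rn (db j D) <= M.
Proof.
move=> h; rewrite /db rnM rnV.
have -> : rn (2 : C) = 2 by rewrite -(rmorph_nat (real_complex R)) rn_real ger0_norm.
rewrite ler_pdivrMl// (le_trans (rnD _ _))// rnM rni mul1r.
by have := h (inl j); have := h (inr j); lra.
Qed.

Lemma cube_bounded a l z : 0 < l -> cube a l z -> rn z <= 2 * (\sum_k `|a k| + 3 * l).
Proof.
move=> l0 hz; apply: rn_rc; first by rewrite addr_ge0 ?sumr_ge0// mulr_ge0// ltW.
move=> k; have /andP[h1 h2] := hz k.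
have : `|a k| <= \sum_k `|a k| by rewrite (bigD1 k)//= lerDl sumr_ge0.
have g1 := ler_norm (a k); have g2 := ler_norm (- a k); rewrite normrN in g2.
by move=> g3; rewrite ler_norml; apply/andP; split; lra.
Qed.

(** The corner of one of the overlapping half-size cubes. It moves by at most [3 * l / 2] in each
    direction, so a cube of side [3 * l / 2] stays inside the given one. *)
Definition subcube a l (s : {ffun K -> 'I_4}) k : R := a k + (s k : nat)%:R * (l / 2).

Definition refs (s : {ffun K -> 'I_4}) : R := \prod_k refc (s k).

Lemma refs_ge0 s : 0 <= refs s.
Proof. by apply: prodr_ge0 => k _; exact: refc_ge0. Qed.

Lemma refs_sum : \sum_s refs s = 2 ^+ #|{: K}|.
Proof.
rewrite -(bigA_distr_bigA (fun (k : K) i => refc i)).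
by under eq_bigr do rewrite refc_sum; rewrite prodr_const.
Qed.

Lemma bspline_refine a l z : 0 < l -> bspline a l z = \sum_s refs s * bspline (subcube a l s) (l / 2) z.
Proof.
move=> l0; rewrite /bspline; under eq_bigr do rewrite bs_refine.
rewrite bigA_distr_bigA; apply: eq_bigr => s _; rewrite -big_split; apply: eq_bigr => k _ /=.
congr (_ * bs _); rewrite /arg /subcube; field; rewrite gt_eqF//.
Qed.

Lemma dbspline_refine a l k z : 0 < l -> dbspline a l k z = \sum_s refs s * dbspline (subcube a l s) (l / 2) k z.
Proof.
move=> l0; have l2 : 0 < l / 2 by rewrite divr_gt0.
have h : hasd k (fun z => \sum_s (refs s)%:C * (bspline (subcube a l s) (l / 2) z)%:C) z
    (\sum_s (refs s)%:C * (dbspline (subcube a l s) (l / 2) k z)%:C).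
  by apply: hasd_sum => s _; apply: hasdZ; exact: hasd_bspline.
have E : (fun z => \sum_s (refs s)%:C * (bspline (subcube a l s) (l / 2) z)%:C) = (fun z => (bspline a l z)%:C).
  apply/funext => w; rewrite (bspline_refine a w l0) rmorph_sum; apply: eq_bigr => s _.
  by rewrite rmorphM.
rewrite E in h; apply: (@complexI R); rewrite (hasd_uniq (hasd_bspline a k z l0) h) rmorph_sum/=.
by apply: eq_bigr => s _; rewrite -rmorphM.
Qed.

Lemma bspline_supp_rn a l z : 0 < l -> 2 * (\sum_k `|a k| + 3 * l) < rn z -> (bspline a l z)%:C = 0 :> C.
Proof.
move=> l0 h; have [|-> //] := bspline_supp (a := a) (z := z) l0.
by move=> /(cube_bounded l0); rewrite leNgt h.
Qed.

Lemma bspline_ri a l : 0 < l -> ri vol setT (bspline a l).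
Proof.
by move=> l0; have [] := ctn_supp_ci (ctn_bspline a l) (fun z => @bspline_supp_rn a l z l0).
Qed.

Definition mass l : R := \int[vol]_z bspline (fun=> 0) l z.

Lemma massE a l : 0 < l -> \int[vol]_z bspline a l z = mass l.
Proof.
move=> l0; rewrite /mass -(Rint_shift (- vec a) (bspline_ri (fun=> 0) l0)).
by apply: Rint_eq => z _; apply: eq_bigr => k _; rewrite /arg rcB rc_vec subr0.
Qed.

(** Scaling is read off the refinement relation, whose coefficients have this sum, without a change
    of variables. *)
Lemma mass_half l : 0 < l -> mass l = 2 ^+ #|{: K}| * mass (l / 2).
Proof.
move=> l0; have l2 : 0 < l / 2 by rewrite divr_gt0.
rewrite -refs_sum mulr_suml -(massE (fun=> 0) l0).
rewrite (@Rint_eq _ _ _ vol setT _ (fun z => \sum_s refs s * bspline (subcube (fun=> 0) l s) (l / 2) z)); last first.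
  by move=> z _; rewrite bspline_refine.
have aux (r : seq {ffun K -> 'I_4}) :
    ri vol setT (fun z => \sum_(s <- r) refs s * bspline (subcube (fun=> 0) l s) (l / 2) z) /\
    \int[vol]_z (\sum_(s <- r) refs s * bspline (subcube (fun=> 0) l s) (l / 2) z) = \sum_(s <- r) refs s * mass (l / 2).
  elim: r => [|s r [ih1 ih2]].
    split; first by apply: (@ri_eq _ _ _ vol setT measurableT (fun=> 0)); [move=> z _; rewrite big_nil|exact: ri0].
    rewrite big_nil (@Rint_eq _ _ _ vol setT _ (fun=> 0)) ?/Rintegral ?integral0//.
    by move=> z _; rewrite big_nil.
  have hs := riZ measurableT (refs s) (bspline_ri (subcube (fun=> 0) l s) l2).
  have E z : \sum_(s <- s :: r) refs s * bspline (subcube (fun=> 0) l s) (l / 2) z =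
    refs s * bspline (subcube (fun=> 0) l s) (l / 2) z + \sum_(s <- r) refs s * bspline (subcube (fun=> 0) l s) (l / 2) z.
    by rewrite big_cons.
  split.
    by apply: (@ri_eq _ _ _ vol setT measurableT _ _ (fun z _ => esym (E z))); exact: (riD measurableT hs ih1).
  rewrite (Rint_eq vol (fun z _ => E z)) RintegralD// ih2 big_cons; congr (_ + _).
  by rewrite RintegralZl ?massE//; exact: bspline_ri.
by have [_ ->] := aux (index_enum _).
Qed.

Lemma mass_gt0 l : 0 < l -> 0 < mass l.
Proof.
move=> l0; pose z := vec (fun _ : K => 3 / 2 * l).
apply: (@Rint_gt0 _ _ _ z).
- by move=> w; exact: ctn_bspline.
- by move=> w; exact: bspline_ge0.
- exact: bspline_ri.
- apply: prodr_gt0 => k _; rewrite /arg rc_vec subr0.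
  apply: (@lt_le_trans _ _ 2^-1) => //; apply: bs_half; rewrite mulfK ?gt_eqF//.
  by apply/andP; split; lra.
Qed.

End bspline.

(** * Complex differentiability in epsilon-delta form *)

Section frechet.
Context {R : realType} {n : nat}.
Local Notation C := R[i].
Local Notation Cn := 'rV[C]_n.
Implicit Types (f : Cn -> C) (c : 'I_n -> C) (z w : Cn).

Definition linform c (h : Cn) : C := \sum_j c j * h 0 j.

Lemma linform_linear c : linear (linform c).
Proof.
move=> a u v; rewrite /linform scaler_sumr -big_split; apply: eq_bigr => j _ /=.
by rewrite !mxE mulrDr mulrCA.
Qed.

HB.instance Definition _ c := GRing.isLinear.Build C Cn C *:%R (linform c) (linform_linear c).

Lemma linform_continuous c : continuous (linform c).
Proof.
by move=> z; have [] : ctn (linform c) z by apply: ctn_sum => j _; apply: ctnM; [exact: ctn_cst|exact: ctn_coord].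
Qed.

(** Differentiability with an explicit complex gradient and real tolerances; [frechetP] and
    [differentiable_frechet] relate it to [differentiable]. *)
Definition frechet f z c := forall e : R, 0 < e -> exists2 d : R, 0 < d &
  forall w, rn (w - z) < d -> rn (f w - f z - linform c (w - z)) <= e * rn (w - z).

Lemma frechetP f z c : frechet f z c -> differentiable f z.
Proof.
move=> h.
have E : f \o shift z = cst (f z) + linform c +o_ (0 : Cn) id.
  apply/eqaddoP => e e0.
  have eE : e = (Re e)%:C by apply: eqc => //=; have := ltW e0; case: (e) => a b; rewrite lecE/= => /andP[/eqP].
  have e0' : 0 < Re e by move: e0; rewrite {1}eE -[0]/((0 : R)%:C) ltcR.
  have [d d0 H] := h _ e0'.
  apply/nbhs_rnP; exists d => // w; rewrite subr0 => wd.
  have := H (w + z); rewrite addrK => /(_ wd).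
  rewrite !rnE eE -rmorphM/= lecR; congr (rn _ <= _).
  by rewrite /= -[RHS]/(f (w + z) - (f z + linform c w)) opprD addrA.
have D := diff_unique (@linform_continuous c) E.
by apply/diff_locallyP; rewrite D; split; [exact: linform_continuous|exact: E].
Qed.

Lemma differentiable_frechet f z : differentiable f z -> exists c, frechet f z c.
Proof.
move=> df; exists (fun j => 'd f z (delta_mx 0 j)) => e e0.
have /diff_locallyP[dc /eqaddoP h] := df.
have e0C : 0 < e%:C by rewrite -[0]/((0 : R)%:C) ltcR.
have /nbhs_rnP[d d0 H] := h _ e0C; exists d => // w wd.
have := H (w - z); rewrite subr0 => /(_ wd).
rewrite !rnE -rmorphM/= lecR; apply: le_trans; rewrite le_eqVlt; apply/orP; left; apply/eqP.
congr rn; rewrite -[RHS]/(f (w - z + z) - (f z + 'd f z (w - z))) subrK opprD addrA; congr (_ - _).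
rewrite [in RHS](matrix_sum_delta (w - z)) big_ord1 linear_sum; apply: eq_bigr => j _.
by rewrite linearZ mulrC.
Qed.

Lemma differentiable_ctn f z : differentiable f z -> ctn f z.
Proof. by move=> /differentiable_continuous h; constructor; exact: h. Qed.

End frechet.

(** * Goursat's argument with B-splines *)

Section goursat.
Context {R : realType} {n : nat}.
Local Notation C := R[i].
Local Notation Cn := 'rV[C]_n.
Local Notation vol := (@volume R n).
Local Notation K := ('I_n + 'I_n)%type.
Implicit Types (a : K -> R) (l : R) (z w : Cn) (k : K).

Variables (j : 'I_n) (g : Cn -> C).
Hypothesis gi : ci setT g.

Definition dbar_bspline a l w : C := db j (fun k => (dbspline a l k w)%:C).

(** The analogue of the contour integral of [g] along the boundary of a cell: the derivative of the
    spline replaces the boundary. *)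
Definition Lam a l : C := cintegral setT (fun w => g w * dbar_bspline a l w).

Lemma dbar_bspline_ctn a l w : ctn (dbar_bspline a l) w.
Proof.
apply: ctnM (ctn_cst _ _) _; apply: ctnD; first exact: ctn_dbspline.
by apply: ctnM (ctn_cst _ _) _; exact: ctn_dbspline.
Qed.

Lemma dbar_bspline_bound a l w : 0 < l -> rn (dbar_bspline a l w) <= l^-1.
Proof. by move=> l0; apply: rn_db => k; rewrite rn_real dbspline_bound. Qed.

Lemma dbar_bspline_supp a l w : 0 < l -> ~ cube a l w -> dbar_bspline a l w = 0.
Proof.
by move=> l0 /(bspline_supp l0)[_ h]; rewrite /dbar_bspline /db !h mulr0 addr0 mulr0.
Qed.

Lemma dbar_bspline_ci a l : 0 < l -> ci setT (fun w => g w * dbar_bspline a l w).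
Proof.
move=> l0; apply: (ci_mul_bd measurableT gi (ctn_mc (dbar_bspline_ctn a l))) => w _.
exact: dbar_bspline_bound.
Qed.

Lemma Lam_refine a l : 0 < l -> Lam a l = \sum_s (refs s)%:C * Lam (subcube a l s) (l / 2).
Proof.
move=> l0; have l2 : 0 < l / 2 by rewrite divr_gt0.
rewrite /Lam (@cintegral_eq _ _ _ _ (fun w => \sum_s (refs s)%:C * (g w * dbar_bspline (subcube a l s) (l / 2) w))).
  rewrite (cintegral_sum measurableT); last by move=> s _; apply: (ciZ measurableT); exact: dbar_bspline_ci.
  by apply: eq_bigr => s _; rewrite (cintegralZ measurableT)//; exact: dbar_bspline_ci.
move=> w _; under eq_bigr do rewrite mulrCA; rewrite -mulr_sumr; congr (_ * _).
rewrite /dbar_bspline /db !(dbspline_refine a _ w l0) !rmorph_sum/= mulr_sumr -big_split/= mulr_sumr.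
apply: eq_bigr => s _; rewrite !rmorphM/= [RHS]mulrCA; congr (_ * _).
by rewrite [RHS]mulrDr; congr (_ + _); exact: mulrCA.
Qed.

(** The weights [refs] are nonnegative with total [2 ^+ #|{: K}|], so the maximal term bounds the
    sum. *)
Lemma Lam_pick a l : 0 < l -> exists s, rn (Lam a l) <= 2 ^+ #|{: K}| * rn (Lam (subcube a l s) (l / 2)).
Proof.
move=> l0.
pose F (s : {ffun K -> 'I_4}) := rn (Lam (subcube a l s) (l / 2)).
have [s hs] : exists s, forall s', F s' <= F s.
  have [s _ hs] := @arg_maxP _ _ _ [ffun=> ord0] predT F isT; exists s => s'; exact: hs.
exists s; rewrite (Lam_refine a l0) (le_trans (rn_sum _ _ _))// -refs_sum mulr_suml.
apply: ler_sum => s' _; rewrite rnM rn_real (ger0_norm (refs_ge0 s')).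
exact: (ler_wpM2l (refs_ge0 s') (hs s')).
Qed.

(** Complex affine functions have zero dbar, so the integrand is dbar_j of a product with compact
    support. This allows subtracting the first-order approximation of [g]. *)
Lemma Lam_affine a l (b : C) (c : 'I_n -> C) z0 : 0 < l ->
  cintegral setT (fun w => (b + linform c (w - z0)) * dbar_bspline a l w) = 0 /\
  ci setT (fun w => (b + linform c (w - z0)) * dbar_bspline a l w).
Proof.
move=> l0; pose p w := b + linform c (w - z0).
pose Dp (k : K) w := linform c (real_dir k).
have C1p : C1 setT p Dp.
  have h := C1D (C1_cst b : C1 setT _ _) (C1_shift (a := - z0) (@C1_sum _ _ _ (index_enum 'I_n) predT setT
    (fun i (w : Cn) => c i * w 0 i) _ (fun i _ => C1Z (c i) (C1_coord i : C1 setT _ _)))).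
  by apply: C1_eqD h => k w; rewrite add0r.
have h := C1M C1p (C1_bspline a l0).
have supp w : 2 * (\sum_k `|a k| + 3 * l) < rn w -> p w * (bspline a l w)%:C = 0.
  by move=> hw; rewrite (bspline_supp_rn l0 hw) mulr0.
pose D k w := Dp k w * (bspline a l w)%:C + p w * (dbspline a l k w)%:C.
have Dci k : ci setT (D k).
  apply: (@ctn_supp_ci _ _ _ (2 * (\sum_k `|a k| + 3 * l))) => w; first by have [_ _] := h w I; apply.
  move=> hw; rewrite /D (bspline_supp_rn l0 hw) mulr0 add0r.
  have [|_ ->] := bspline_supp (a := a) (z := w) l0; last by rewrite mulr0.
  by move=> /(cube_bounded l0); rewrite leNgt hw.
have i0 := cintegral_db0 measurableT (Dci (inl j)) (Dci (inr j)) (ibp (inl j) h supp) (ibp (inr j) h supp).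
have E w : 2^-1 * (D (inl j) w + (0 +i* 1) * D (inr j) w) = p w * dbar_bspline a l w.
  have -> : 2^-1 * (D (inl j) w + (0 +i* 1) * D (inr j) w) = db j (fun k => Dp k w * (bspline a l w)%:C + p w * (dbspline a l k w)%:C) by [].
  rewrite dbM (_ : db j (Dp^~ w) = 0) ?mul0r ?add0r//.
  rewrite /db /Dp /linform mulr_sumr -big_split/= big1 ?mulr0// => i _.
  by rewrite !mxE; case: (c i) => x y; case: (i == j); apply: eqc => /=; ring.
split; first by rewrite -i0; apply: cintegral_eq => w _; rewrite E.
have : ci setT (fun w => 2^-1 * (D (inl j) w + (0 +i* 1) * D (inr j) w)).
  by apply: (ciZ measurableT); apply: (ciD measurableT) => //; exact: (ciZ measurableT).
by apply: (ci_eq measurableT) => w _; rewrite E.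
Qed.

(** The cube is the middle third of the support of a spline of scale [3 * l], and there each factor
    is at least 1/2. Its volume is thus controlled by [mass], whose scaling is known. *)
Lemma cube_majorant a l w : 0 < l -> cube a l w ->
  1 <= 2 ^+ #|{: K}| * bspline (fun k => a k - 3 * l) (3 * l) w.
Proof.
move=> l0 hw; rewrite -prodr_const -big_split/=.
apply: (@le_trans _ _ (\prod_(k : K) 1)); first by rewrite big1.
apply: ler_prod => k _; rewrite ler01/= -ler_pdivrMl// mulr1.
apply: bs_half; rewrite /arg; have /andP[h1 h2] := hw k.
by rewrite ler_pdivlMr ?mulr_gt0// ler_pdivrMr ?mulr_gt0//; apply/andP; split; lra.
Qed.

Section one_cube.
Variables (a0 : K -> R) (l0 : R).
Hypothesis l00 : 0 < l0.
Hypothesis gd : forall z, cube a0 l0 z -> exists c, frechet g z c.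

Let ll (m : nat) : R := l0 / 2 ^+ m.

Let llS m : ll m.+1 = ll m / 2.
Proof. by rewrite /ll exprSr invfM mulrA. Qed.

Let ll0 m : 0 < ll m. Proof. by rewrite divr_gt0// exprn_gt0. Qed.

(** Corners of the nested cubes of scale [ll m]; their common point is [zstar]. *)
Fixpoint aa (m : nat) : K -> R :=
  match m with 0 => a0 | m.+1 => subcube (aa m) (ll m) (projT1 (cid (Lam_pick (aa m) (ll0 m)))) end.

Let aaS m : rn (Lam (aa m) (ll m)) <= 2 ^+ #|{: K}| * rn (Lam (aa m.+1) (ll m.+1)).
Proof. by rewrite llS /=; case: (cid _). Qed.

Let aa_le m k : aa m k <= aa m.+1 k.
Proof. by rewrite /= /subcube lerDl mulr_ge0// divr_ge0// ltW. Qed.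

Let aa_ge m k : aa m.+1 k + 3 * ll m.+1 <= aa m k + 3 * ll m.
Proof.
rewrite llS /= /subcube; case: (cid _) => s _ /=; have := ll0 m; move: (ll m) => l lp.
have : ((s k : nat)%:R : R) <= 3 by rewrite ler_nat -ltnS ltn_ord.
by move: ((s k : nat)%:R : R) => i; nra.
Qed.

Let aa_mono m p k : (m <= p)%N -> aa m k <= aa p k /\ aa p k + 3 * ll p <= aa m k + 3 * ll m.
Proof.
elim: p => [|p ih]; first by rewrite leqn0 => /eqP ->.
rewrite leq_eqVlt => /orP[/eqP ->//|]; rewrite ltnS => /ih[h1 h2].
by split; [exact: le_trans h1 (aa_le p k)|exact: le_trans (aa_ge p k) h2].
Qed.

Let zz k : R := sup [set x | exists m, x = aa m k].

Let zz_cube m k : aa m k <= zz k <= aa m k + 3 * ll m.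
Proof.
have ub p : aa p k <= aa m k + 3 * ll m.
  have [pm|mp] := leqP p m.
    by have [h1 _] := aa_mono k pm; apply: le_trans h1 _; rewrite lerDl mulr_ge0// ltW.
  have [_ h2] := aa_mono k (ltnW mp); apply: le_trans h2.
  by rewrite lerDl mulr_ge0// ltW.
apply/andP; split.
  by apply: ub_le_sup; [exists (aa m k + 3 * ll m) => _ [p ->]|exists m].
by apply: ge_sup; [exists (aa 0 k), 0%N|move=> _ [p ->]].
Qed.

Let zstar : Cn := vec zz.

Let Lam_lower m : rn (Lam a0 l0) <= (2 ^+ #|{: K}|) ^+ m * rn (Lam (aa m) (ll m)).
Proof.
elim: m => [|m ih]; first by rewrite expr0 mul1r /ll expr0 divr1.
apply: le_trans ih _; rewrite exprSr -mulrA ler_wpM2l ?exprn_ge0//.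
Qed.

Let mass_ll m : mass (n := n) (3 * l0) = (2 ^+ #|{: K}|) ^+ m * mass (n := n) (3 * ll m).
Proof.
elim: m => [|m ->]; first by rewrite expr0 mul1r /ll expr0 divr1.
rewrite exprSr -mulrA; congr (_ * _); rewrite (mass_half (n := n) (_ : 0 < 3 * ll m)) ?mulr_gt0//.
by rewrite llS mulrA.
Qed.

(* Goursat's argument, with the bspline-spline of a cube instead of its indicator: by
   refinement some half-size subcube carries at least the average share of
   Lam, and differentiability at the common point of the nested cubes makes
   that share too small. *)
Lemma Lam_eq0 : Lam a0 l0 = 0.
Proof.
apply: rn_eq0; apply/eqP; rewrite eq_le rn_ge0 andbT; apply/ler_addgt0Pr => e e0; rewrite add0r.
have M0 : 0 < mass (R := R) (n := n) (3 * l0) by apply: mass_gt0; rewrite mulr_gt0.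
pose N : R := 2 ^+ #|{: K}|; have N0 : 0 < N by rewrite exprn_gt0.
(* The 6 comes from [rn (w - zstar) <= 6 * l] on a cube and [N] from [cube_majorant]. The factor
   [N ^+ m] lost in [Lam_lower] is exactly regained by [mass_ll]. *)
pose e' := e / (6 * N * mass (n := n) (3 * l0)).
have e'0 : 0 < e' by rewrite divr_gt0// !mulr_gt0.
have zc : cube a0 l0 zstar by move=> k; rewrite rc_vec; have := zz_cube 0 k; rewrite /ll expr0 divr1.
have [c /(_ e' e'0)[d d0 H]] := gd zc.
have [m hm] : exists m, 6 * ll m < d.
  have [m hm] := inv_small (divr_gt0 d0 (mulr_gt0 (@ltr0Sn R 5) l00)).
  exists m; have := hm m (leqnn m); rewrite /ll => h.
  have h2 : (2 ^+ m)^-1 <= (m.+1%:R^-1 : R).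
    by rewrite lef_pV2 ?posrE ?exprn_gt0// -natrX ler_nat ltn_expl.
  have := le_lt_trans h2 h; rewrite ltr_pdivlMr ?mulr_gt0//.
  by rewrite mulrC -!mulrA.
pose l := ll m; have lp : 0 < l := ll0 m.
pose b := g zstar.
have [i0 ci0'] := Lam_affine (aa m) b c zstar lp.
have main : rn (Lam (aa m) l) <= e' * 6 * N * mass (n := n) (3 * l).
  rewrite /Lam -[cintegral _ _]subr0 -i0 -(cintegralB measurableT)//; last exact: dbar_bspline_ci.
  have cB : ci setT (fun w => g w * dbar_bspline (aa m) l w - (b + linform c (w - zstar)) * dbar_bspline (aa m) l w).
    by apply: (ciB measurableT) => //; exact: dbar_bspline_ci.
  rewrite (le_trans (rn_cintegral measurableT cB))//.
  have l3 : 0 < 3 * l by rewrite mulr_gt0.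
  rewrite -(massE (fun k => aa m k - 3 * l) l3) -RintegralZl//; last exact: bspline_ri.
  apply: Rint_le => //; [exact: ci_rn|by apply: riZ => //; exact: bspline_ri|].
  move=> w _; rewrite -mulrBl rnM; have [hw|hw] := pselect (cube (aa m) l w); last first.
    rewrite (dbar_bspline_supp lp hw) rn0 mulr0; apply: mulr_ge0; last exact: bspline_ge0.
    by apply: mulr_ge0; [apply: mulr_ge0 => //|]; exact: ltW.
  have wz : rn (w - zstar) <= 6 * l.
    have -> : 6 * l = 2 * (3 * l) by ring.
    apply: rn_rc; first exact: ltW.
    move=> k; rewrite rcB rc_vec ler_norml; have /andP[h1 h2] := zz_cube m k.
    by have /andP[h3 h4] := hw k; rewrite -/l in h2 *; apply/andP; split; lra.
  have := H w (le_lt_trans wz hm); rewrite -addrA -opprD -/b => h1.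
  apply: (@le_trans _ _ (e' * 6)).
    apply: (@le_trans _ _ (e' * (6 * l) * l^-1)); last first.
      by rewrite mulrA mulfK// gt_eqF.
    apply: ler_pM; rewrite ?rn_ge0//; last exact: dbar_bspline_bound.
    by apply: le_trans h1 _; rewrite ler_wpM2l// ltW.
  by have := ler_wpM2l (mulr_ge0 (ltW e'0) (ler0n R 6)) (cube_majorant lp hw); rewrite mulr1 mulrA.
apply: le_trans (Lam_lower m) _.
have := ler_wpM2l (exprn_ge0 m (ltW N0)) main; rewrite -/N -/l => h; apply: le_trans h _.
have -> : N ^+ m * (e' * 6 * N * mass (n := n) (3 * l)) = e' * 6 * N * mass (n := n) (3 * l0).
  by rewrite (mass_ll m) -/N -/l; move: (N ^+ m) (mass _) => x y; ring.
rewrite /e' le_eqVlt; apply/orP; left; apply/eqP.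
by field; rewrite !gt_eqF.
Qed.

End one_cube.

End goursat.

(** * From the Cauchy-Riemann equations to differentiability, and from differentiability to weak
    holomorphy *)

Section cauchy_riemann.
Context {R : realType} {n : nat}.
Local Notation C := R[i].
Local Notation Cn := 'rV[C]_n.
Local Notation vol := (@volume R n).
Local Notation K := ('I_n + 'I_n)%type.
Implicit Types (f u F : Cn -> C) (z w h : Cn).

Lemma frechet_near f g z c : (exists2 d : R, 0 < d & forall w, rn (w - z) < d -> f w = g w) ->
  frechet f z c -> frechet g z c.
Proof.
move=> [d d0 fg] hf e /hf[d' d'0 H]; exists (Num.min d d'); first by rewrite lt_min d0.
move=> w; rewrite lt_min => /andP[w1 w2]; rewrite -!fg ?subrr ?rn0//; exact: H.
Qed.

Lemma rc_sum h : h = \sum_(k : K) (rc k h)%:C *: real_dir k.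
Proof.
apply/rowP => j; rewrite summxE big_sumType/= (bigD1 j)//= [X in _ + X + _]big1 => [|i ij]; last first.
  by rewrite !mxE [j == i]eq_sym (negbTE ij) andbF mulr0.
rewrite (bigD1 j)//= [X in _ + (_ + X)]big1 => [|i ij]; last first.
  by rewrite !mxE [j == i]eq_sym (negbTE ij) andbF !mulr0.
rewrite !mxE !eqxx; case: (h 0 j) => x y; apply: eqc => /=; ring.
Qed.

(** After subtraction of the candidate linear part, all real partial derivatives are small near [z];
    in the imaginary directions this is the Cauchy-Riemann equation. The increment is then summed
    along coordinate segments, which stay within [N * rn h] of [z]. *)
Lemma C1_frechet F (D : K -> Cn -> C) z : C1 setT F D -> (forall j, db j (D^~ z) = 0) ->
  frechet F z (fun j => D (inl j) z).
Proof.
move=> hF cr e e0.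
pose N : R := (n + n)%:R + 1; have N0 : 0 < N by rewrite ltr_wpDl.
pose eps := e / (2 * N); have eps0 : 0 < eps by rewrite divr_gt0// mulr_gt0.
have [d d0 Hd] : exists2 d : R, 0 < d & forall w k, rn (w - z) < d -> rn (D k w - D k z) <= eps.
  have ex k : exists2 d : R, 0 < d & forall w, rn (w - z) < d -> rn (D k w - D k z) <= eps.
    have [_ _ /(_ k)/ctnP/(_ _ eps0)[d d0 H]] := hF z I.
    by exists d => // w /H /ltW.
  pose dd k := sval (cid2 (ex k)).
  exists (\big[Num.min/1]_k dd k).
    by apply: (big_ind (fun x => 0 < x)) => //; [move=> x y x0 y0; rewrite lt_min x0|move=> k _; rewrite /dd; case: (cid2 _)].
  move=> w k wd.
  have : \big[Num.min/1]_k dd k <= dd k by rewrite (bigD1 k)//= ge_min lexx.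
  by rewrite /dd; case: (cid2 (ex k)) => x /= x0 Hx /(lt_le_trans wd); exact: Hx.
have [d' d'0 Hd'] : exists2 d' : R, 0 < d' & N * d' < d.
  by exists (d / (2 * N)); [rewrite divr_gt0// mulr_gt0|rewrite invfM mulrA mulrC mulrA mulrC divfK ?gt_eqF//; lra].
exists d' => // w wd; set h := w - z in wd *.
pose c j := D (inl j) z; pose G x : C := F x - linform c x.
have dG k x : hasd k G x (D k x - D k z).
  apply: hasdB; first by have [_ + _] := hF x I; apply.
  have h1 : hasd k (linform c) x (linform c (real_dir k)).
    by apply: hasd_sum => j _; apply: hasdZ; exact: hasd_coord.
  apply: (hasd_eq h1); rewrite /linform; case: k {h1} => j; rewrite (bigD1 j)//= big1 ?addr0.
  - by rewrite !mxE !eqxx mulr1.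
  - by move=> i ij; rewrite !mxE (negbTE ij) andbF mulr0.
  - have := cr j; rewrite /db => /eqP; rewrite mulf_eq0 invr_eq0 pnatr_eq0/= /c => /eqP.
    rewrite !mxE !eqxx mulr1; case: (D (inl j) z) => a b; case: (D (inr j) z) => a' b' [h1 h2].
    by apply: eqc => /=; nra.
  - by move=> i ij; rewrite !mxE (negbTE ij) andbF !mulr0.
have key (s : seq K) : uniq s -> rn (\sum_(k <- s) (rc k h)%:C *: real_dir k : Cn) <= \sum_(k <- s) rn h /\
    ((\sum_(k <- s) rn h) <= (n + n)%:R * rn h ->
     rn (G (z + \sum_(k <- s) (rc k h)%:C *: real_dir k) - G z) <= \sum_(k <- s) 2 * eps * rn h).
  move=> us; split.
    rewrite (le_trans (rn_sum _ _ _))//; apply: ler_sum => k _.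
    by rewrite rnZ rn_real (le_trans _ (rc_rn k h))// ler_piMr// rn_real_dir.
  elim: s us => [_ _|k s ih /= /andP[_ us] hs].
    by rewrite !big_nil addr0 subrr rn0.
  have hs' : \sum_(k <- s) rn h <= (n + n)%:R * rn h.
    by apply: le_trans hs; rewrite big_cons lerDr rn_ge0.
  rewrite !big_cons; set p := z + \sum_(k <- s) (rc k h)%:C *: real_dir k.
  have -> : z + ((rc k h)%:C *: real_dir k + \sum_(k <- s) (rc k h)%:C *: real_dir k) = p + (rc k h)%:C *: real_dir k.
    by rewrite /p addrA addrAC.
  apply: le_trans (rn_trans _ (G p) _) _; apply: lerD; last exact: ih.
  apply: le_trans (_ : 2 * eps * `|rc k h| <= _); last first.
    by rewrite ler_wpM2l ?rc_rn// mulr_ge0// ltW.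
  apply: (@mean_value _ _ _ _ _ _ _ (fun x => D k x - D k z)) => r rh; split; first exact: dG.
  apply: Hd; apply: le_lt_trans Hd'.
  have -> : p + r%:C *: real_dir k - z = \sum_(k <- s) (rc k h)%:C *: real_dir k + r%:C *: real_dir k.
    by rewrite /p addrAC [z + _]addrC addrK.
  rewrite (le_trans (rnD _ _))//; apply: (@le_trans _ _ ((n + n)%:R * rn h + rn h)).
    apply: lerD.
      apply: le_trans hs'; rewrite (le_trans (rn_sum _ _ _))//; apply: ler_sum => k' _.
      by rewrite rnZ rn_real (le_trans _ (rc_rn k' h))// ler_piMr// rn_real_dir.
    by rewrite rnZ rn_real (le_trans _ (rc_rn k h))// (le_trans _ rh)// ler_piMr// rn_real_dir.
  by rewrite -[X in _ + X]mul1r -mulrDl ler_wpM2l ?(ltW N0)// ltW.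
have Ksum (x : R) : \sum_(k : K) x = (n + n)%:R * x.
  by rewrite sumr_const card_sum card_ord mulr_natl.
have [_] := key (index_enum K) (index_enum_uniq _).
rewrite -rc_sum !Ksum => /(_ (lexx _)).
have -> : z + h = w by rewrite /h addrC subrK.
have -> : G w - G z = F w - F z - linform c h.
  have -> : linform c h = linform c w - linform c z by rewrite /h linearB.
  rewrite /G; move: (linform c w) (linform c z) (F w) (F z) => x1 x2 x3 x4.
  ring.
move=> hh; apply: le_trans hh _; rewrite mulrA ler_wpM2r ?rn_ge0//.
have -> : (n + n)%:R * (2 * eps) = e * ((n + n)%:R / N) by rewrite /eps; field; rewrite gt_eqF.
by rewrite ler_piMr ?(ltW e0)// ler_pdivrMr// mul1r /N lerDl.
Qed.

Lemma cint_cvg0 (D : set Cn) (f : nat -> Cn -> C) F (h : Cn -> R) : measurable D ->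
  (forall k, mc D (f k)) -> ri vol D h -> (forall k x, D x -> rn (f k x) <= h x) ->
  (forall x, D x -> f k x @[k --> \oo] --> F x) ->
  (forall k, cintegral D (f k) = 0) -> cintegral D F = 0.
Proof.
move=> mD mf hi fh fF f0; apply: eqc.
  apply: (Rint_cvg0 mD (f := fun k x => Re (f k x)) _ hi).
  - by move=> k; have [] := mf k.
  - by move=> k x Dx; rewrite (le_trans (normr_Re _))// fh.
  - by move=> x Dx; have /cvg_ReIm[] := fF x Dx.
  - by move=> k; have := f_equal (@complex.Re R) (f0 k).
apply: (Rint_cvg0 mD (f := fun k x => Im (f k x)) _ hi).
- by move=> k; have [] := mf k.
- by move=> k x Dx; rewrite (le_trans (normr_Im _))// fh.
- by move=> x Dx; have /cvg_ReIm[] := fF x Dx.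
- by move=> k; have := f_equal (@complex.Im R) (f0 k).
Qed.

Lemma compact_measurable (K : set Cn) : compact K -> measurable K.
Proof. by move=> cK; apply: measurable_closed; exact: compact_closedC. Qed.

Lemma compact_fin (K : set Cn) : compact K -> (vol K < +oo)%E.
Proof.
move=> cK; have [M _ HM] := compact_rn_bounded cK.
exact: (volume_bounded_fin (compact_measurable cK) HM).
Qed.

Lemma ci_compact (K : set Cn) f L : compact K -> mc K f -> (forall z, K z -> rn (f z) <= L) -> ci K f.
Proof.
move=> cK mf fL; apply: (ci_le (compact_measurable cK) mf fL); apply: (ri_cst (compact_measurable cK)).
exact: compact_fin.
Qed.

Lemma test_supp0 (K : set Cn) f k z : compact K -> csmooth f -> (forall z, ~ K z -> f z = 0) -> ~ K z ->
  cpartial k f z = 0.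
Proof.
move=> cK sf f0 nK; apply: (hasd_uniq (csmooth_hasd k z sf)); apply: hasd_near (hasd_cst k 0 z).
have : \forall w \near z, ~ K w.
  by apply: open_nbhs_nbhs; split; [apply: closed_openC; exact: compact_closedC|exact: nK].
by apply: filterS => w /f0 ->.
Qed.

(** Nothing is known about continuity of the derivatives of [f], so integration by parts is applied
    to B-spline smoothings. These are of class C^1, satisfy the Cauchy-Riemann equations on the
    support of the test function by [Lam_eq0], and converge to [f] after normalization. *)
Lemma holo_weakly_holo (Om : set Cn) f : open Om -> (forall z, Om z -> differentiable f z) ->
  weakly_holo Om f.
Proof.
move=> oOm df chi [schi [K0 [cK KOm chi0]]] j.
have cf z : Om z -> ctn f z by move=> /df; exact: differentiable_ctn.
have [K' [d d0 [cK' KOm' KK']]] := compact_nbhd oOm cK KOm.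
have [L L0 HL] := ctn_compact_bounded cK' (fun z Kz => cf z (KOm' z Kz)).
have mf : mc Om f by exact: ctn_mc_on.
have mK' := compact_measurable cK'.
have fi : ci K' f.
  by apply: (@ci_compact _ _ L) => //; apply: mc_sub KOm' mf; exact: measurable_open.
pose g := cut K' f; have gi : ci setT g by apply/(ci_cut _ mK').
have gL z : rn (g z) <= L by rewrite /g /cut; case: ifPn => [/set_mem/HL //|_]; rewrite rn0.
have [M M0 HM] := compact_rn_bounded cK.
have chiM z : M < rn z -> chi z = 0 by move=> Mz; apply: chi0 => /HM; rewrite leNgt Mz.
have D0 k z : ~ K0 z -> cpartial k chi z = 0 := test_supp0 k cK schi chi0.
have dchi0 z : ~ K0 z -> dzbar j chi z = 0 by move=> nz; rewrite /dzbar !D0// mulr0 addr0 mulr0.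
have sdchi := csmooth_dzbar j schi.
have C1chi := csmooth_C1 (O := setT) schi.
have dchiM z : M < rn z -> dzbar j chi z = 0 by move=> Mz; apply: dchi0 => /HM; rewrite leNgt Mz.
have [L' L'0 HL'] := ctn_supp_bounded (fun z => csmooth_ctn z sdchi) dchiM.
have ml (m : nat) : 0 < d / 12 / m.+1%:R by rewrite !divr_gt0.
(* The spline of scale [l m] has radius at most [6 * l m], hence at most [d / 2]; the other [d / 2]
   leaves room for a neighbourhood on which [g] coincides with [f]. *)
pose l m := d / 12 / m.+1%:R.
have ld m : 6 * l m <= d / 2.
  have -> : d / 2 = 6 * (d / 12) by field.
  by rewrite ler_wpM2l// /l ler_pdivrMr// ler_peMr ?ler1n// divr_ge0// ltW.
pose eta m w : C := (bspline (fun=> 0) (l m) w)%:C.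
have eta0 m w : 6 * l m < rn w -> eta m w = 0.
  move=> h; apply: (@bspline_supp_rn R n (fun=> 0) (l m) w (ml m)); rewrite big1 => [|k _]; last by rewrite normr0.
  by rewrite add0r mulrA; move: h; rewrite (_ : 2 * 3 = 6)//; ring.
pose F m := conv (eta m) g.
have C1F m : C1 setT (F m) (fun k z => - conv (fun w => (dbspline (fun=> 0) (l m) k w)%:C) g z).
  by apply: (conv_C1 (C1_bspline _ (ml m)) (@eta0 m)).
have dbF m z : K0 z -> db j (fun k => - conv (fun w => (dbspline (fun=> 0) (l m) k w)%:C) g z) = 0.
  move=> Kz.
  have E : Lam j g (rc^~ z) (l m) = 0.
    apply: (@Lam_eq0 R n j g gi (rc^~ z) (l m) (ml m)) => w hw.
    have wz : rn (w - z) <= d / 2.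
      apply: le_trans (ld m); have -> : 6 * l m = 2 * (3 * l m) by ring.
      apply: rn_rc; first by rewrite mulr_ge0// ltW// ml.
      move=> k; rewrite rcB; have /andP[h1 h2] := hw k.
      by rewrite ger0_norm ?subr_ge0//; lra.
    have KwN x : rn (x - w) < d / 2 -> K' x.
      by move=> xw; apply: (KK' z x Kz); have := rn_trans x w z; lra.
    have Kw : K' w by apply: KwN; rewrite subrr rn0; lra.
    have [c hc] := differentiable_frechet (df w (KOm' _ Kw)); exists c.
    apply: frechet_near hc; exists (d / 2); first by rewrite divr_gt0.
    by move=> x /KwN Kx; rewrite /g cutT.
  have cDB k : ci setT (fun w => g w * (dbspline (rc^~ z) (l m) k w)%:C).
    apply: (ci_mul_bd measurableT gi (L := (l m)^-1)); first exact: (ctn_mc (ctn_dbspline _ _ _)).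
    by move=> w _; rewrite rn_real dbspline_bound// ml.
  have ck k : conv (fun w => (dbspline (fun=> 0) (l m) k w)%:C) g z = cintegral setT (fun w => g w * (dbspline (rc^~ z) (l m) k w)%:C).
    apply: cintegral_eq => w _; congr (_ * _%:C).
    rewrite /dbspline /bspline_rest /arg rcB subr0; congr (_ * _).
    by apply: eq_bigr => k' _; rewrite rcB subr0.
  move: E; rewrite /Lam /dbar_bspline /db !ck.
  rewrite (@cintegral_eq _ _ _ _ (fun w => 2^-1 * (g w * (dbspline (rc^~ z) (l m) (inl j) w)%:C
     + (0 +i* 1) * (g w * (dbspline (rc^~ z) (l m) (inr j) w)%:C)))); last first.
    by move=> w _; rewrite mulrCA mulrDr; congr (_ * (_ + _)); exact: mulrCA.
  rewrite (cintegralZ measurableT); last by apply: (ciD measurableT) => //; exact: (ciZ measurableT).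
  rewrite (cintegralD measurableT)//; last exact: (ciZ measurableT).
  by rewrite (cintegralZ measurableT)// mulrN -opprD mulrN => ->; rewrite oppr0.
have intF m : cintegral setT (fun z => F m z * dzbar j chi z) = 0.
  have hC := C1M (C1F m) C1chi.
  have supp w : M < rn w -> F m w * chi w = 0 by move=> /chiM ->; rewrite mulr0.
  pose D k w := - conv (fun x => (dbspline (fun=> 0) (l m) k x)%:C) g w * chi w + F m w * cpartial k chi w.
  have Dci k : ci setT (D k).
    apply: (@ctn_supp_ci _ _ _ M) => w; first by have [_ _] := hC w I; apply.
    move=> Mw; rewrite /D chiM// D0 ?mulr0 ?addr0//.
    by move=> /HM; rewrite leNgt Mw.
  have i0 := cintegral_db0 measurableT (Dci (inl j)) (Dci (inr j)) (ibp (inl j) hC supp) (ibp (inr j) hC supp).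
  rewrite -i0; apply: cintegral_eq => w _.
  have -> : 2^-1 * (D (inl j) w + (0 +i* 1) * D (inr j) w) = db j (fun k => - conv (fun x => (dbspline (fun=> 0) (l m) k x)%:C) g w * chi w + F m w * cpartial k chi w) by [].
  rewrite dbM; have [Kw|nKw] := pselect (K0 w); first by rewrite dbF// mul0r add0r.
  by rewrite chi0// mulr0 add0r.
have ms m := mass_gt0 (n := n) (ml m).
have approx m z a e : (forall w, rn (w - z) <= 6 * l m -> rn (g w - a) <= e) ->
    rn (((mass (n := n) (l m))^-1)%:C * F m z - a) <= e.
  move=> h.
  have := conv_approx (ctn_bspline (fun=> 0) (l m)) (bspline_ge0 (fun=> 0) (l m)) (M := 6 * l m) _ gi h.
  rewrite -/(mass (n := n) (l m)) => /(_ _)/wrap[w /eta0 h1|]; first by apply: (@complexI R).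
  move=> h2; rewrite -(ler_pM2r (ms m)); apply: le_trans h2.
  rewrite -[X in _ * X](gtr0_norm (ms m)) -rn_real -rnM mulrC mulrBr mulrA -rmorphM/= mulfV ?mul1r//.
  by rewrite gt_eqF.
have main : cintegral setT (fun z => g z * dzbar j chi z) = 0.
  apply: (@cint_cvg0 setT (fun m z => ((mass (n := n) (l m))^-1)%:C * F m z * dzbar j chi z) _ (fun z => L * rn (dzbar j chi z))) => //.
  - move=> m; apply: (@mcM _ _ setT (fun z => ((mass (n := n) (l m))^-1)%:C * F m z)).
      by apply: mcZ; apply: ctn_mc => z; have [] := C1F m z I.
    by apply: ctn_mc => z; exact: csmooth_ctn.
  - apply: riZ => //; apply: ci_rn => //; apply: (ctn_supp_ci _ dchiM) => z; exact: csmooth_ctn.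
  - move=> m z _; rewrite rnM ler_wpM2r ?rn_ge0//.
    by have := @approx m z 0 L; rewrite subr0; apply => w _; rewrite subr0.
  - move=> z _; have [Kz|nKz] := pselect (K0 z); last first.
      by rewrite dchi0// mulr0; under eq_fun do rewrite mulr0; exact: cvg_cst.
    apply: cvgM; last exact: cvg_cst.
    have zK' w : rn (w - z) <= d -> K' w := KK' z w Kz.
    have Kz' : K' z by apply: zK'; rewrite subrr rn0 ltW.
    rewrite /g cutT//; apply/cvg_rnP => e e0.
    have /ctnP/(_ (e / 2))[|d1 d10 Hd1] := cf z (KOm' _ Kz'); first by rewrite divr_gt0.
    have [N HN] := inv_small (divr_gt0 d10 d0).
    exists N => // m /= /HN; rewrite ltr_pdivlMr// => hm.
    apply: (@le_lt_trans _ _ (e / 2)); last by lra.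
    apply: approx => w wz; rewrite /g cutT; last first.
      by apply: zK'; apply: (le_trans wz); apply: (le_trans (ld m)); lra.
    apply/ltW/Hd1; apply: (le_lt_trans wz); apply: le_lt_trans hm.
    rewrite /l mulrC -mulrA mulrCA -mulrA; have := invr_gt0 (m.+1%:R : R); rewrite ltr0Sn.
    by move: (m.+1%:R^-1) => x /esym x0; nra.
  - move=> m; rewrite (@cintegral_eq _ _ _ _ (fun z => ((mass (n := n) (l m))^-1)%:C * (F m z * dzbar j chi z))).
      rewrite (cintegralZ measurableT) ?intF ?mulr0//.
      apply: (@ctn_supp_ci _ _ _ M) => z.
        by apply: ctnM; [have [] := C1F m z I|exact: csmooth_ctn].
      by move=> /dchiM ->; rewrite mulr0.
    by move=> z _; rewrite mulrA.
rewrite -(cintegral_cut_mul (D := Om)); last by move=> z nz; apply: dchi0 => /KOm.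
rewrite -main; apply: cintegral_eq => z _.
have [Kz|nKz] := pselect (K0 z); last by rewrite dchi0// !mulr0.
rewrite /g !cutT//; last exact: KOm.
by apply: (KK' z) => //; rewrite subrr rn0 ltW.
Qed.

End cauchy_riemann.

(** * Weyl's lemma *)

Section fubini.
Context {R : realType} {n : nat}.
Local Notation C := R[i].
Local Notation Cn := 'rV[C]_n.
Local Notation vol := (@volume R n).
Implicit Types (f u : Cn -> C) (z w : Cn).

Lemma fubini_conv_real (p q k : Cn -> R) (L : R) : ri vol setT p -> ri vol setT q ->
  measurable_fun setT k -> (forall z, `|k z| <= L) ->
  \int[vol]_z ((\int[vol]_w (p w * k (w - z))) * q z) =
  \int[vol]_w (p w * (\int[vol]_z (q z * k (w - z)))).
Proof.
move=> pi qi mk kL; have mp := ri_meas pi; have mq := ri_meas qi.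
pose F (x : Cn * Cn) : R := p x.2 * k (x.2 - x.1) * q x.1.
have mF : measurable_fun setT F.
  have mk2 : measurable_fun setT (fun x : Cn * Cn => k (x.2 - x.1)).
    apply: (measurableT_comp mk).
    exact: (measurableT_comp (@measurable_sub2 R n) (@measurable_swap _ _ _ _)).
  apply: measurable_funM; last exact: (measurableT_comp mq measurable_fst).
  by apply: measurable_funM => //; exact: (measurableT_comp mp measurable_snd).
have msub (w : Cn) : measurable_fun setT (fun z : Cn => k (w - z)).
  rewrite (_ : (fun z => _) = (fun x : Cn * Cn => k (x.1 - x.2)) \o (fun z => (w, z)))//.
  apply: measurableT_comp; last exact: measurable_pair1.
  exact: (measurableT_comp mk (@measurable_sub2 R n)).
have msub' (z : Cn) : measurable_fun setT (fun w : Cn => k (w - z)).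
  exact: measurable_comp_shift.
have kp z : ri vol setT (fun w => p w * k (w - z)).
  apply: (ri_le measurableT _ _ (riZ measurableT L (ri_norm pi))); first exact: measurable_funM.
  by move=> w _; rewrite normrM mulrC ler_wpM2r.
have kq w : ri vol setT (fun z => q z * k (w - z)).
  apply: (ri_le measurableT _ _ (riZ measurableT L (ri_norm qi))); first exact: measurable_funM.
  by move=> z _; rewrite normrM mulrC ler_wpM2r.
have L0 : 0 <= L by apply: le_trans (kL 0); exact: normr_ge0.
have iF : ((vol : {sigma_finite_measure set Cn -> \bar R}) \x (vol : {sigma_finite_measure set Cn -> \bar R}))%E.-integrable setT (EFin \o F).
  apply/(@integrable12ltyP _ _ _ _ R vol vol); first exact/measurable_EFinP.
  apply: (@le_lt_trans _ _ (\int[vol]_z ((L * \int[vol]_w `|p w|) * `|q z|)%:E)%E); last first.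
    have := riZ measurableT (L * \int[vol]_w `|p w|) (ri_norm qi) => h.
    by rewrite (Rint_EFin measurableT h) ltry.
  apply: ge0_le_integral => //.
  - by move=> z _; exact: integral_ge0.
  - have mA : measurable_fun setT (abse \o (EFin \o F)).
      by apply: measurableT_comp => //; exact/measurable_EFinP.
    by apply: (measurable_fun_fubini_tonelli_F (abse \o (EFin \o F)) mA) => x; exact: abse_ge0.
  - apply/measurable_EFinP; apply: measurable_funM => //; exact: measurableT_comp.
  - move=> z _; rewrite -[leLHS](_ : (\int[vol]_w (`|p w * k (w - z)| * `|q z|)%:E = _)%E); last first.
      by apply: eq_integral => w _; rewrite /F/= [in RHS]normrM.
    have h2 : ri vol setT (fun w => `|p w * k (w - z)| * `|q z|).
      apply: (@ri_eq _ _ _ vol setT measurableT (fun w => `|q z| * `|p w * k (w - z)|)); first by move=> w _; rewrite mulrC.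
      by apply: riZ => //; exact: ri_norm.
    rewrite (Rint_EFin measurableT h2) lee_fin.
    have h3 := riZ measurableT (`|q z| * L) (ri_norm pi).
    rewrite [leRHS](_ : _ = \int[vol]_w (`|q z| * L * `|p w|)); last first.
      by rewrite RintegralZl//; [ring|exact: ri_norm].
    apply: Rint_le => // w _; rewrite normrM mulrC -mulrA ler_wpM2l// mulrC ler_wpM2r//.
have := @Fubini _ _ _ _ R vol vol _ iF.
have E1 z : (\int[vol]_w ((EFin \o F) (z, w)) = ((\int[vol]_w (p w * k (w - z))) * q z)%:E)%E.
  have h : ri vol setT (fun w => F (z, w)).
    apply: (@ri_eq _ _ _ vol setT measurableT (fun w => q z * (p w * k (w - z)))); last exact: riZ.
    by move=> w _; rewrite /F/= mulrC.
  transitivity ((\int[vol]_w F (z, w))%:E); first exact: (Rint_EFin measurableT h).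
  congr (_%:E); transitivity (\int[vol]_w (q z * (p w * k (w - z)))).
    by apply: Rint_eq => w _; rewrite /F/=; ring.
  by rewrite (RintegralZl _ measurableT (kp z)) mulrC.
have E2 w : (\int[vol]_z ((EFin \o F) (z, w)) = (p w * (\int[vol]_z (q z * k (w - z))))%:E)%E.
  have h : ri vol setT (fun z => F (z, w)).
    apply: (@ri_eq _ _ _ vol setT measurableT (fun z => p w * (q z * k (w - z)))); last exact: riZ.
    by move=> z _; rewrite /F/=; ring.
  transitivity ((\int[vol]_z F (z, w))%:E); first exact: (Rint_EFin measurableT h).
  congr (_%:E); transitivity (\int[vol]_z (p w * (q z * k (w - z)))).
    by apply: Rint_eq => z _; rewrite /F/=; ring.
  by rewrite (RintegralZl _ measurableT (kq w)).
under eq_integral do rewrite E1.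
under [in X in _ = X -> _]eq_integral do rewrite E2.
by move=> /(f_equal fine).
Qed.

(** Evenness of [k] lets the averaging move from [u] to [q]. *)
Lemma fubini_conv (u chi : Cn -> C) (k q : Cn -> R) (L : R) : ci setT u -> ri vol setT q ->
  measurable_fun setT k -> (forall z, `|k z| <= L) -> (forall z, k (- z) = k z) ->
  cintegral setT (fun z => conv (fun x => (k x)%:C) u z * (q z)%:C) =
  cintegral setT (fun w => u w * conv (fun x => (k x)%:C) (fun z => (q z)%:C) w).
Proof.
move=> [u1 u2] qi mk kL ke.
have ReI (D : set Cn) f : Re (cintegral D f) = \int[vol]_(z in D) Re (f z) by [].
have ImI (D : set Cn) f : Im (cintegral D f) = \int[vol]_(z in D) Im (f z) by [].
have Ek w : conv (fun x => (k x)%:C) (fun z => (q z)%:C) w = (\int[vol]_z (q z * k (w - z)))%:C.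
  apply: eqc; rewrite ?ReI ?ImI /=.
    by apply: Rint_eq => z _ /=; rewrite ?(mulr0, mul0r, subr0, addr0) -(ke (w - z)) opprB.
  by rewrite (@Rint_eq _ _ _ vol setT _ (fun=> 0)) ?/Rintegral ?integral0// => z _ /=; rewrite ?(mulr0, mul0r, subr0, addr0).
have MR (x : C) (y : R) : Re (x * y%:C) = Re x * y by case: x => a b /=; ring.
have MI (x : C) (y : R) : Im (x * y%:C) = Im x * y by case: x => a b /=; ring.
apply: eqc; rewrite ?ReI ?ImI.
  rewrite -[RHS](_ : \int[vol]_w (Re (u w) * (\int[vol]_z (q z * k (w - z)))) = _); last first.
    by apply: Rint_eq => w _; rewrite Ek MR.
  rewrite -(fubini_conv_real u1 qi mk kL); apply: Rint_eq => z _; rewrite MR; congr (_ * _).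
  by rewrite ReI; apply: Rint_eq => w _; rewrite MR.
rewrite -[RHS](_ : \int[vol]_w (Im (u w) * (\int[vol]_z (q z * k (w - z)))) = _); last first.
  by apply: Rint_eq => w _; rewrite Ek MI.
rewrite -(fubini_conv_real u2 qi mk kL); apply: Rint_eq => z _; rewrite MI; congr (_ * _).
by rewrite ImI; apply: Rint_eq => w _; rewrite MI.
Qed.

End fubini.

Section weyl.
Context {R : realType} {n : nat}.
Local Notation C := R[i].
Local Notation Cn := 'rV[C]_n.
Local Notation vol := (@volume R n).
Implicit Types (f u : Cn -> C) (z w : Cn) (Om : set Cn).

(** Up to sign, dbar of the smoothing at [z] is the integral of [u] against dbar of the kernel
    centred at [z], which is a test function in [Om]. *)
Lemma smoothing_differentiable Om u t z : open Om -> ci Om u -> weakly_holo Om u -> 0 < t ->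
  (forall w, rn (w - z) <= t -> Om w) ->
  differentiable (conv (pkc t) (cut Om u)) z.
Proof.
move=> oOm ui wu t0 BOm; have mOm := measurable_open oOm.
have gi : ci setT (cut Om u) by apply/(ci_cut _ mOm).
have c1 := conv_C1 (csmooth_C1 (O := setT) (pkc_smooth t)) (fun z => @pkc_supp R n t z t0) gi.
apply: (frechetP (C1_frechet (z := z) c1 _)) => j.
have cD k : ci setT (fun w => cut Om u w * cpartial k (pkc t) (w - z)).
  have [|L L0 HL] := ctn_supp_bounded (M := t) (fun z => csmooth_ctn z (csmooth_cpartial k (pkc_smooth (n := n) t))).
    by move=> w tw; apply: (hasd_supp (fun z => @pkc_supp R n t z t0) tw (csmooth_hasd k w (pkc_smooth t))).
  exact: (conv_ci z (fun w => csmooth_ctn w (csmooth_cpartial k (pkc_smooth t))) HL gi).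
have tchi : test_function Om (fun w => pkc t (w + - z)).
  split; first exact: csmooth_shift (pkc_smooth t).
  exists [set w | rn (w - z) <= t]; split => //; first exact: compact_rn_ball.
  by move=> w /= /negP; rewrite -ltNge => h; rewrite pkc_supp.
have := wu _ tchi j; rewrite -(cintegral_cut_mul (D := Om)); last first.
  move=> w nw; rewrite dzbar_shift; last exact: pkc_smooth.
  have tw : t < rn (w - z) by rewrite ltNge; apply/negP => /BOm.
  have d0 k := hasd_supp (fun z => @pkc_supp R n t z t0) tw (csmooth_hasd k _ (pkc_smooth t)).
  by rewrite /dzbar !d0 mulr0 addr0 mulr0.
rewrite (@cintegral_eq _ _ _ _ (fun w => 2^-1 * (cut Om u w * cpartial (inl j) (pkc t) (w - z)
     + (0 +i* 1) * (cut Om u w * cpartial (inr j) (pkc t) (w - z))))); last first.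
  move=> w _; rewrite dzbar_shift; last exact: pkc_smooth.
  by rewrite /dzbar mulrCA mulrDr; congr (_ * (_ + _)); exact: mulrCA.
rewrite (cintegralZ measurableT); last by apply: (ciD measurableT) => //; exact: (ciZ measurableT).
rewrite (cintegralD measurableT)//; last exact: (ciZ measurableT).
by rewrite (cintegralZ measurableT)// /db /conv mulrN -opprD mulrN => ->; rewrite oppr0.
Qed.

Lemma null_of_integral (V : set Cn) (h : Cn -> C) : measurable V -> mc V h ->
  ci V h -> \int[vol]_(z in V) rn (h z) = 0 ->
  exists N, [/\ measurable N, vol N = 0%E & forall z, V z -> ~ N z -> h z = 0].
Proof.
move=> mV mh hi h0.
have hr := ci_rn mV hi.
have mr : measurable_fun V (fun z => rn (h z)) by exact: mc_rn.
have : (\int[vol]_(z in V) `|(rn (h z))%:E| = 0)%E.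
  rewrite (_ : (\int[vol]_(z in V) _ = \int[vol]_(z in V) (rn (h z))%:E)%E).
    by rewrite (Rint_EFin mV hr) h0.
  by apply: eq_integral => z _; rewrite gee0_abs// lee_fin rn_ge0.
move=> /(ae_eq_integral_abs vol mV (f := fun z => (rn (h z))%:E))[]; first exact/measurable_EFinP.
move=> N [mN N0 sN]; exists N; split => // z Vz nNz; apply: contrapT => hz; apply: nNz; apply: sN => /= H.
by apply: hz; apply: rn_eq0; have := H Vz => -[].
Qed.

(** By [kernel_change] every radius below [d z] gives the same average [f z], so locally [f] is a
    smoothing of fixed radius and hence holomorphic. To compare [f] with [u], both are paired with a
    cutoff: Fubini moves the averaging to the cutoff, where the radius can tend to 0. *)
Lemma weyl Om u : open Om -> (vol Om < +oo)%E -> ci Om u -> weakly_holo Om u ->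
  exists f, (forall z, Om z -> differentiable f z) /\
    exists N, [/\ measurable N, vol N = 0%E & forall z, Om z -> ~ N z -> u z = f z].
Proof.
move=> oOm vOm ui wu; have mOm := measurable_open oOm.
have gi : ci setT (cut Om u) by apply/(ci_cut _ mOm).
have [d [d01 dL d0 dp]] := open_Lipschitz oOm.
have ricst (V : set Cn) (c : R) : measurable V -> V `<=` Om -> ri vol V (fun=> c).
  move=> mV VO; apply: (ri_cst mV); apply: le_lt_trans vOm.
  by apply: le_measure; rewrite ?inE.
move=> {vOm}.
have dball z t : t < d z -> forall w, rn (w - z) <= t -> Om w.
  move=> tz w wz; apply: contrapT => /d0 dw; have := dL z w; rewrite dw sub0r normrN.
  by have := ler_norm (d z); lra.
pose f z := ((pmass (n := n) (d z / 2))^-1)%:C * conv (pkc (d z / 2)) (cut Om u) z.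
have fE z t : 0 < t -> t < d z -> f z = ((pmass (n := n) t)^-1)%:C * conv (pkc t) (cut Om u) z.
  move=> t0 tz; have dz2 : 0 < d z / 2 by rewrite divr_gt0// (lt_trans t0).
  rewrite /f (pmass_indep (n := n) dz2 t0).
  suff -> : conv (pkc (d z / 2)) (cut Om u) z = conv (pkc t) (cut Om u) z by [].
  apply: (@kernel_change _ _ Om u _ _ z (Num.max t (d z / 2))) => //.
  - by rewrite le_max ltW.
  - by move=> l; rewrite dz2/= le_max lexx orbT.
  - by move=> l; rewrite t0/= le_max lexx.
  - by apply: dball; rewrite gt_max tz/=; lra.
pose V t := [set z | t < d z].
have oV t : open (V t).
  apply/open_rnP => z tz; rewrite /V/= in tz; exists (d z - t); first by rewrite subr_gt0.
  by move=> w wz; rewrite /V/=; have := dL z w; rewrite ler_norml => /andP[h1 h2]; lra.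
have VOm t z : 0 < t -> V t z -> Om z.
  by move=> t0 tz; apply: (dball _ _ tz); rewrite subrr rn0 ltW.
have df t z : 0 < t -> V t z -> differentiable f z.
  move=> t0 tz.
  have := smoothing_differentiable oOm ui wu t0 (dball _ _ tz).
  move=> /differentiable_frechet[c hc].
  apply: (@frechetP _ _ _ _ (fun j => ((pmass (n := n) t)^-1)%:C * c j)).
  apply: (@frechet_near _ _ (fun z => ((pmass (n := n) t)^-1)%:C * conv (pkc t) (cut Om u) z)).
    have /open_rnP/(_ z tz)[e e0 He] := oV t.
    exists e; first exact: e0.
    by move=> w wz; exact: esym (fE w t t0 (He w wz)).
  move=> e e0; have p0 := pmass_gt0 (n := n) t0.
  have [e' e'0 He] := hc (e * pmass (n := n) t) (mulr_gt0 e0 p0).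
  exists e' => // w /He h.
  have -> : linform (fun j => ((pmass (n := n) t)^-1)%:C * c j) (w - z) = ((pmass (n := n) t)^-1)%:C * linform c (w - z).
    by rewrite /linform mulr_sumr; apply: eq_bigr => j _; rewrite mulrA.
  rewrite -!mulrBr rnM rn_real gtr0_norm ?invr_gt0// ler_pdivrMl//.
  by apply: le_trans h _; rewrite le_eqVlt mulrA [pmass _ * e]mulrC eqxx.
exists f; split.
  by move=> z Oz; apply: (df (d z / 2)); have := dp z Oz => h; rewrite ?divr_gt0// /V/=; lra.
have main t : 0 < t -> exists N, [/\ measurable N, vol N = 0%E & forall z, V t z -> ~ N z -> f z - u z = 0].
  move=> t0; have mV := measurable_open (oV t); have p0 := pmass_gt0 (n := n) t0.
  have VO : V t `<=` Om by move=> z; exact: VOm.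
  have cconv := conv_ctn (fun z => pkc_ctn t z) (fun z => @pkc_supp R n t z t0) gi.
  have [L L0 HL] := ctn_supp_bounded (fun z => @pkc_ctn R n t z) (fun z => @pkc_supp R n t z t0).
  have HL' z : `|pk t z| <= L by rewrite -rn_real; exact: HL.
  pose F z : C := ((pmass (n := n) t)^-1)%:C * conv (pkc t) (cut Om u) z.
  have Fi : ci (V t) F.
    apply: (ciZ mV); apply: (ci_le mV (g := fun=> L * \int[vol]_w rn (cut Om u w))).
    - by apply: mc_sub (ctn_mc cconv).
    - move=> z _; exact: (conv_bound _ (fun z => pkc_ctn t z) HL gi).
    - exact: ricst.
  have uV : ci (V t) u.
    have [u1 u2] := ui; split; exact: (integrableS mOm mV VO).
  have hi : ci (V t) (fun z => F z - u z) by exact: (ciB mV).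
  have fF z : V t z -> f z = F z by move=> tz; rewrite /F (fE z t).
  have : \int[vol]_(z in V t) rn (F z - u z) = 0.
    apply: fundamental_lemma => // chi cchi chi01 chi0.
    have mchi : measurable_fun setT chi by have [m1 _] := ctn_mc cchi.
    have chiN z : `|chi z| <= 1 by have /andP[h1 h2] := chi01 z; rewrite ger0_norm.
    have chii : ri vol setT chi.
      have h : ri vol (V t) chi.
        apply: (@ri_le _ _ _ vol (V t) mV _ (fun=> 1)).
        - exact: (measurable_funTS mchi).
        - by move=> z _.
        - exact: ricst.
      have /(ci_cut _ mV)[h1 _] : ci (V t) (fun z => (chi z)%:C).
        by split => //=; exact: ri0.
      apply: (@ri_eq _ _ _ vol setT measurableT _ _ _ h1) => z _; rewrite /cut; case: ifPn => //= /negP nz.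
      by rewrite chi0// => Vz; apply: nz; exact/mem_set.
    have chiiC : ci setT (fun z => (chi z)%:C) by split => //=; exact: ri0.
    have c1 : ci setT (fun z => conv (pkc t) (cut Om u) z * (chi z)%:C).
      apply: (ci_le measurableT (g := fun z => L * (\int[vol]_w rn (cut Om u w)) * `|chi z|)).
      - by apply: mcM; apply: ctn_mc.
      - move=> z _; rewrite rnM rn_real ler_wpM2r//.
        exact: (conv_bound _ (fun z => pkc_ctn t z) HL gi).
      - by apply: riZ => //; exact: ri_norm.
    have c2 : ci setT (fun z => cut Om u z * (chi z)%:C).
      apply: (ci_mul_bd measurableT gi (L := 1)); first exact: ctn_mc.
      by move=> z _; rewrite rn_real.
    have E1 : cintegral (V t) (fun z => (F z - u z) * (chi z)%:C) =
        ((pmass (n := n) t)^-1)%:C * cintegral setT (fun z => conv (pkc t) (cut Om u) z * (chi z)%:C)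
        - cintegral setT (fun z => cut Om u z * (chi z)%:C).
      rewrite -(cintegralZ measurableT)// -(cintegralB measurableT)//; last exact: (ciZ measurableT).
      rewrite -(cintegral_cut (V t)); apply: cintegral_eq => z _.
      rewrite /cut; have [/set_mem Vz|/negP nz] := boolP (z \in V t).
        by rewrite mem_set ?mulrBl ?mulrA//; exact: VOm Vz.
      by rewrite chi0 ?mulr0 ?subrr// => Vz; apply: nz; exact/mem_set.
    rewrite E1.
    (* The left side is free of [s], because the radius is changed before Fubini; this permits the
       limit of small [s] on the right. *)
    have ind s : 0 < s -> s <= t -> ((pmass (n := n) t)^-1)%:C * cintegral setT (fun z => conv (pkc t) (cut Om u) z * (chi z)%:C) =
        cintegral setT (fun w => cut Om u w * (((pmass (n := n) s)^-1)%:C * conv (pkc s) (fun z => (chi z)%:C) w)).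
      move=> s0 st.
      have -> : cintegral setT (fun z => conv (pkc t) (cut Om u) z * (chi z)%:C) =
         cintegral setT (fun z => conv (pkc s) (cut Om u) z * (chi z)%:C).
        have aux (a b c : C) : c = 0 -> a * c = b * c by move=> ->; rewrite !mulr0.
        apply: cintegral_eq => z _; have [Vz|nVz] := pselect (V t z).
          suff -> : conv (pkc t) (cut Om u) z = conv (pkc s) (cut Om u) z by [].
          apply: (@kernel_change _ _ Om u _ _ z t mOm ui wu (ltW t0) _ _ (dball _ _ Vz)) => l.
            by rewrite t0/=.
          by rewrite s0.
        by apply: aux; rewrite (chi0 z nVz).
      have [L2 L20 HL2] := ctn_supp_bounded (fun z => @pkc_ctn R n s z) (fun z => @pkc_supp R n s z s0).
      have mk : measurable_fun setT (pk (n := n) s) by have [m1 _] := ctn_mc (fun z => @pkc_ctn R n s z).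
      rewrite (@fubini_conv _ _ (cut Om u) (fun=> 0) (pk s) chi L2 gi chii mk) => [|z|z]; last exact: pkN; last first.
        by rewrite -rn_real; exact: HL2.
      rewrite (pmass_indep (n := n) t0 s0) -(cintegralZ measurableT).
        by apply: cintegral_eq => w _; rewrite mulrCA.
      have cc := conv_ctn (fun z => @pkc_ctn R n s z) (fun z => @pkc_supp R n s z s0) chiiC.
      apply: (ci_mul_bd measurableT gi (L := L2 * \int[vol]_w rn ((chi w)%:C : C))); first exact: ctn_mc.
      by move=> w _; exact: (conv_bound _ (fun z => pkc_ctn s z) HL2 chiiC).
    apply/eqP; rewrite subr_eq0; apply/eqP.
    pose s (m : nat) := t / m.+1%:R.
    have s0 m : 0 < s m by rewrite divr_gt0.
    have st m : s m <= t by rewrite ler_pdivrMr// ler_peMr ?ler1n// ltW.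
    apply/eqP; rewrite -subr_eq0; apply/eqP.
    pose G m w : C := cut Om u w * (((pmass (n := n) (s m))^-1)%:C * conv (pkc (s m)) (fun z => (chi z)%:C) w).
    have approx m w a e : (forall z, rn (z - w) <= s m -> rn ((chi z)%:C - a : C) <= e) ->
        rn (((pmass (n := n) (s m))^-1)%:C * conv (pkc (s m)) (fun z => (chi z)%:C) w - a) <= e.
      move=> h; have ps := pmass_gt0 (n := n) (s0 m).
      have h2 := conv_approx (fun z => @pkc_ctn R n (s m) z) (fun z => @pk_ge0 R n (s m) z)
        (fun z => @pk_supp R n (s m) z (s0 m)) chiiC h.
      rewrite -(ler_pM2r ps); apply: le_trans h2.
      rewrite -[X in _ * X](gtr0_norm ps) -rn_real -rnM mulrC mulrBr mulrA -rmorphM/= mulfV ?mul1r//.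
      by rewrite gt_eqF.
    have Gi m : ci setT (G m).
      have [L2 L20 HL2] := ctn_supp_bounded (fun z => @pkc_ctn R n (s m) z) (fun z => @pkc_supp R n (s m) z (s0 m)).
      have cc := conv_ctn (fun z => @pkc_ctn R n (s m) z) (fun z => @pkc_supp R n (s m) z (s0 m)) chiiC.
      apply: (ci_mul_bd measurableT gi (L := 1)); first by apply: mcZ; exact: ctn_mc.
      move=> w _; have := @approx m w 0 1; rewrite subr0; apply => z _.
      by rewrite subr0 rn_real.
    rewrite (ind _ (s0 0%N) (st 0%N)) -/(G 0%N) -(cintegralB measurableT)//.
    apply: (@cint_cvg0 _ _ setT (fun m w => G 0%N w - G m w) _ (fun w => 2 * rn (cut Om u w))) => //.
    - by move=> m; apply: mcB; exact: ci_mc (Gi _).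
    - by apply: riZ => //; exact: ci_rn.
    - move=> m w _; rewrite (le_trans (rnB _ _))// mulr_natl mulr2n.
      have h k : rn (G k w) <= rn (cut Om u w).
        rewrite /G rnM ler_piMr ?rn_ge0//; have := @approx k w 0 1; rewrite subr0; apply => z _.
        by rewrite subr0 rn_real.
      by apply: lerD.
    - move=> w _; apply: cvgB; first exact: cvg_cst.
      apply: cvgM; first exact: cvg_cst.
      apply/cvg_rnP => e e0; have /ctnP/(_ (e / 2))[|e1 e10 H] := cchi w; first by rewrite divr_gt0.
      have [N HN] := inv_small (divr_gt0 e10 t0).
      exists N => // m /= /HN; rewrite ltr_pdivlMr// => hm.
      apply: (@le_lt_trans _ _ (e / 2)); last by lra.
      apply: approx => z wz; apply/ltW/H; apply: (le_lt_trans wz).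
      by rewrite /s mulrC.
    - move=> m; rewrite (cintegralB measurableT (Gi 0%N) (Gi m)).
      have EG k : cintegral setT (G k) = ((pmass (n := n) t)^-1)%:C *
        cintegral setT (fun z => conv (pkc t) (cut Om u) z * (chi z)%:C) := esym (ind _ (s0 k) (st k)).
      have aux (a b c : C) : a = c -> b = c -> a - b = 0 by move=> -> ->; rewrite subrr.
      exact: (aux _ _ _ (EG 0%N) (EG m)).
  move=> h0; have [N [mN N0 HN]] := null_of_integral mV (ci_mc hi) hi h0.
  exists N; split; [exact: mN|exact: N0|].
  by move=> z Vz nNz; rewrite (fF z Vz); exact: HN Vz nNz.
(* The sets [V m.+1%:R^-1] exhaust [Om], so the exceptional set is a countable union of null
   sets. *)
have mpos (m : nat) : 0 < (m.+1%:R^-1 : R) by rewrite invr_gt0.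
pose NN (m : nat) := sval (cid (main _ (mpos m))).
have NP m : [/\ measurable (NN m), vol (NN m) = 0%E & forall z, V m.+1%:R^-1 z -> ~ NN m z -> f z - u z = 0].
  by rewrite /NN; case: (cid _).
exists (\bigcup_m NN m); split.
- by apply: bigcup_measurable => m _; have [] := NP m.
- apply/eqP; rewrite eq_le measure_ge0 andbT.
  have mN m : measurable (NN m) by have [] := NP m.
  have H := @measure_sigma_subadditive _ _ _ vol (\bigcup_m NN m) NN mN
    (bigcup_measurable (fun m _ => mN m)) (fun x h => h).
  by apply: (le_trans H); rewrite eseries0// => m _ _; have [] := NP m.
- move=> z Oz nN; have [N HN] := inv_small (dp z Oz).
  have [_ _ H] := NP N; apply/eqP; rewrite eq_sym -subr_eq0; apply/eqP; apply: H; first exact: (HN N (leqnn N)).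
  by move=> h; apply: nN; exists N.
Qed.

End weyl.

(** * The Bergman space *)

Section conv_equicontinuous.
Context {R : realType} {n : nat}.
Local Notation C := R[i].
Local Notation Cn := 'rV[C]_n.
Local Notation vol := (@volume R n).
Implicit Types (f u : Cn -> C) (z w : Cn).

Lemma conv_equi eta M : (forall z, ctn eta z) -> (forall z, M < rn z -> eta z = 0) ->
  forall e : R, 0 < e -> exists2 d : R, 0 < d & forall z w, rn (w - z) < d ->
    forall u, ci setT u -> rn (conv eta u w - conv eta u z) <= e * \int[vol]_x rn (u x).
Proof.
move=> ce e0 e ep; have [L L0 HL] := ctn_supp_bounded ce e0.
have [d d0 H] := unif_ctn ce e0 ep; exists d => // z w wz u ui.
have ci1 a := conv_ci a ce HL ui.
rewrite /conv -(cintegralB measurableT)//.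
have hci : ci setT (fun x => u x * eta (x - w) - u x * eta (x - z)) by exact: (ciB measurableT).
rewrite (le_trans (rn_cintegral measurableT hci))// -RintegralZl//; last exact: ci_rn.
apply: Rint_le => //; first exact: ci_rn.
  by apply: riZ => //; exact: ci_rn.
move=> x _; rewrite -mulrBr rnM mulrC ler_wpM2r ?rn_ge0// ltW// H//.
have -> : x - w - (x - z) = z - w by rewrite opprB addrC addrA subrK.
by rewrite rn_distC.
Qed.

Lemma Rint_rn_cut (Om : set Cn) u :
  \int[vol]_z rn (cut Om u z) = \int[vol]_(z in Om) rn (u z).
Proof.
rewrite [RHS]Rintegral_mkcond; apply: Rint_eq => z _; rewrite patchE /cut.
by case: ifP => // _; rewrite rn0.
Qed.

End conv_equicontinuous.

Section bergman_space.
Context {R : realType} {n : nat}.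
Local Notation C := R[i].
Local Notation Cn := 'rV[C]_n.
Local Notation vol := (@volume R n).
Variables (Om : set Cn) (B : R).
Hypothesis oOm : open Om.
Hypothesis bOm : forall z, Om z -> rn z <= B.
Implicit Types (f u g h : Cn -> C) (z w : Cn).
Local Notation A2 := (bergman_space Om).
Local Notation ip := (L2ip Om).
Local Notation hn := (hnorm (L2ip Om)).

Lemma mOm : measurable Om. Proof. exact: measurable_open. Qed.

Lemma vOm : (vol Om < +oo)%E. Proof. exact: (volume_bounded_fin mOm bOm). Qed.

Lemma L2H : prehilbert (L2 Om) ip. Proof. exact: (L2_prehilbert mOm). Qed.

Lemma A2_L2 f : A2 f -> L2 Om f. Proof. by case. Qed.

Lemma A2_diff f z : A2 f -> Om z -> differentiable f z. Proof. by move=> [_]; apply. Qed.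

Lemma A2_ctn f z : A2 f -> Om z -> ctn f z.
Proof. by move=> Af Oz; apply: differentiable_ctn; exact: A2_diff. Qed.

Lemma A2_0 : A2 0.
Proof. by split; [exact: (ph0 L2H)|move=> z _; exact: differentiable_cst]. Qed.

Lemma A2_lin (a : C) f g : A2 f -> A2 g -> A2 (a *: f + g).
Proof.
move=> [f1 f2] [g1 g2]; split; first exact: (phL L2H).
by move=> z Oz; apply: differentiableD; [apply: differentiableZ; exact: f2|exact: g2].
Qed.

Lemma A2H : prehilbert A2 ip.
Proof. by apply: (prehilbert_sub L2H); [exact: A2_L2|exact: A2_0|exact: A2_lin]. Qed.

Lemma L2_1 : L2 Om (fun=> 1).
Proof. by apply: (L2_bounded mOm vOm (M := 1)); [exact: mc_cst|move=> z _; rewrite rn1]. Qed.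

Lemma L2_ci u : L2 Om u -> ci Om u.
Proof.
move=> Lu; apply: (ci_eq mOm) (L2_mul_ci mOm Lu L2_1) => z _; by rewrite mulr1.
Qed.

Lemma L2_cut_ci u : L2 Om u -> ci setT (cut Om u).
Proof. by move=> Lu; apply/(ci_cut _ mOm); exact: L2_ci. Qed.

Lemma L1_le_L2 u : L2 Om u -> \int[vol]_z rn (cut Om u z) <= hn u * hn (fun=> 1).
Proof.
move=> Lu; rewrite Rint_rn_cut.
pose v z : C := (rn (u z))%:C.
have Lv : L2 Om v.
  apply: (L2_le mOm (g := fun z => rn (u z) ^+ 2)).
  - by apply: mc_real; exact: (mc_rn mOm (L2_mc Lu)).
  - by move=> z _; rewrite /v rn_real ger0_norm// rn_ge0.
  - exact: (L2_ri Lu).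
have E : \int[vol]_(z in Om) rn (u z) = Re (ip v (fun=> 1)).
  by apply: Rint_eq => z _; rewrite rmorph1 mulr1.
rewrite E (le_trans (ler_norm _))// (le_trans (normr_Re _))//.
rewrite (le_trans (cauchy_schwarz L2H Lv L2_1))// ler_wpM2r ?hn_ge0//.
by apply: (L2_hn_le mOm) => // z _; rewrite /v rn_real ger0_norm// rn_ge0.
Qed.

Lemma A2_weak f : A2 f -> weakly_holo Om f.
Proof. by move=> [_ df]; exact: holo_weakly_holo. Qed.

Lemma A2_repr f z t : A2 f -> 0 < t -> (forall w, rn (w - z) <= t -> Om w) ->
  f z = ((pmass (n := n) t)^-1)%:C * conv (pkc t) (cut Om f) z.
Proof.
move=> Af t0 BOm; have Oz : Om z by apply: BOm; rewrite subrr rn0 ltW.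
rewrite (mean_value_property mOm (L2_ci (A2_L2 Af)) (A2_weak Af) t0 BOm (A2_ctn Af Oz)).
by rewrite mulrA -rmorphM/= mulVf ?mul1r// gt_eqF// pmass_gt0.
Qed.

Lemma ball_in z : Om z -> exists2 t : R, 0 < t & forall w x, rn (w - z) < t -> rn (x - w) <= t -> Om x.
Proof.
move=> Oz; have /open_rnP/(_ z Oz)[d d0 H] := oOm; exists (d / 2); first by rewrite divr_gt0.
by move=> w x w1 w2; apply: H; have := rn_trans x w z; lra.
Qed.

(** One [d] serves the whole space: the variation of an average is bounded by the modulus of
    continuity of the kernel times an L^1 norm. *)
Lemma A2_equi z e : Om z -> 0 < e -> exists2 d : R, 0 < d &
  forall w, rn (w - z) < d -> Om w /\ forall f, A2 f -> rn (f w - f z) <= e * hn f.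
Proof.
move=> Oz e0; have [t t0 Ht] := ball_in Oz; have p0 := pmass_gt0 (n := n) t0.
pose c := hn (fun=> 1) + 1; have c0 : 0 < c by rewrite ltr_wpDl// hn_ge0.
have e'0 : 0 < e * pmass (n := n) t / c by rewrite divr_gt0// mulr_gt0.
have [d d0 H] := conv_equi (fun z => @pkc_ctn R n t z) (fun z => @pkc_supp R n t z t0) e'0.
exists (Num.min t d); first by rewrite lt_min t0.
move=> w; rewrite lt_min => /andP[wt wd]; split.
  by apply: (Ht w w wt); rewrite subrr rn0 ltW.
move=> f Af; have zt : rn (z - z) < t by rewrite subrr rn0.
rewrite (A2_repr Af t0 (fun x => Ht w x wt)) (A2_repr Af t0 (fun x => Ht z x zt)).
rewrite -mulrBr rnM rn_real gtr0_norm ?invr_gt0// ler_pdivrMl//.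
have Lf := A2_L2 Af.
apply: le_trans (H z w wd _ (L2_cut_ci Lf)) _.
apply: (@le_trans _ _ (e * pmass (n := n) t / c * (hn f * c))).
  apply: ler_wpM2l; first exact: ltW.
  by apply: le_trans (L1_le_L2 Lf) _; rewrite ler_wpM2l ?hn_ge0// lerDl.
rewrite le_eqVlt; apply/orP; left; apply/eqP.
by field; rewrite gt_eqF.
Qed.

(** The bound is uniform near [z], so norms of kernels are locally bounded; [kernel_majorant] uses
    this to exclude accumulation at interior points. *)
Lemma A2_eval z : Om z -> exists2 M : R, 0 <= M & exists2 d : R, 0 < d &
  forall w, rn (w - z) < d -> Om w /\ forall f, A2 f -> rn (f w) <= M * hn f.
Proof.
move=> Oz; have [t t0 Ht] := ball_in Oz; have p0 := pmass_gt0 (n := n) t0.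
have [L L0 HL] := ctn_supp_bounded (fun z => @pkc_ctn R n t z) (fun z => @pkc_supp R n t z t0).
exists ((pmass (n := n) t)^-1 * (L * hn (fun=> 1))).
  by rewrite mulr_ge0 ?invr_ge0 ?(ltW p0)// mulr_ge0// hn_ge0.
exists t => // w wt; split.
  by apply: (Ht w w wt); rewrite subrr rn0 ltW.
move=> f Af; have Lf := A2_L2 Af.
rewrite (A2_repr Af t0 (fun x => Ht w x wt)) rnM rn_real gtr0_norm ?invr_gt0//.
rewrite -mulrA ler_wpM2l ?invr_ge0 ?(ltW p0)//.
apply: le_trans (conv_bound w (fun z => @pkc_ctn R n t z) HL (L2_cut_ci Lf)) _.
by rewrite -mulrA ler_wpM2l// mulrC (le_trans (L1_le_L2 Lf)).
Qed.

Lemma weyl_L2 u : L2 Om u -> weakly_holo Om u -> exists2 f, A2 f & hn (u - f) = 0.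
Proof.
move=> Lu wu.
have [f [df [N [mN N0 HN]]]] := weyl oOm vOm (L2_ci Lu) wu.
have mf : mc Om f by apply: ctn_mc_on => // z Oz; apply: differentiable_ctn; exact: df.
have ae_eqE (p q : Cn -> R) : (forall z, Om z -> ~ N z -> p z = q z) ->
    measurable_fun Om p -> measurable_fun Om q -> (forall z, 0 <= p z) -> (forall z, 0 <= q z) ->
    (\int[vol]_(z in Om) (p z)%:E = \int[vol]_(z in Om) (q z)%:E)%E.
  move=> pq mp mq p0 q0; apply: (ge0_ae_eq_integral mOm).
  - exact/measurable_EFinP.
  - exact/measurable_EFinP.
  - by move=> z _; rewrite lee_fin.
  - by move=> z _; rewrite lee_fin.
  - exists N; split => // z /= hz; apply: contrapT => nN; apply: hz => Oz.
    by rewrite pq.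
have Lf : L2 Om f.
  have [m1 m2] := mf; have [u1 u2 u3] := Lu; split => //.
  rewrite (ae_eqE _ (fun z => Re (u z) ^+ 2 + Im (u z) ^+ 2))//.
  - by move=> z Oz nN; rewrite HN.
  - by apply: measurable_funD; apply: measurable_funX.
  - by apply: measurable_funD; apply: measurable_funX.
  - by move=> z; rewrite addr_ge0// sqr_ge0.
  - by move=> z; rewrite addr_ge0// sqr_ge0.
exists f; first by split.
have Luf : L2 Om (u - f) by exact: (phB L2H).
apply/eqP; rewrite -sqrf_eq0 (L2_hn2 mOm Luf) /Rintegral.
rewrite (ae_eqE _ (fun=> 0)) ?integral0//.
- by move=> z Oz nN; rewrite fctE /= (HN z Oz nN) subrr rn0 expr0n.
- by apply: mc_rn2; exact: (L2_mc Luf).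
- by move=> z; rewrite sqr_ge0.
Qed.

Lemma test_L2 (chi : Cn -> C) : test_function Om chi -> L2 Om chi.
Proof.
move=> [sc [K [cK KO K0]]].
have [L L0 HL] := ctn_compact_bounded cK (fun z _ => csmooth_ctn z sc).
apply: (L2_bounded mOm vOm (M := L)).
  by apply: mc_sub (ctn_mc _) => // z; exact: csmooth_ctn.
by move=> z _; have [/HL//|/K0 ->] := pselect (K z); rewrite rn0.
Qed.

Lemma test_dzbar (chi : Cn -> C) j : test_function Om chi -> test_function Om (dzbar j chi).
Proof.
move=> [sc [K [cK KO K0]]]; split; first exact: csmooth_dzbar.
exists K; split => // z nK; rewrite /dzbar !(test_supp0 _ cK sc K0 nK).
by rewrite mulr0 addr0 mulr0.
Qed.

Lemma cintegral_ip f g : cintegral Om (fun z => f z * g z) = ip f (fun z => (g z)^*).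
Proof. by apply: cintegral_eq => z _; congr (_ * _); case: (g z) => a b; apply: eqc; rewrite /= ?opprK. Qed.

(** The weak Cauchy-Riemann equations pass to L^2 limits, since they are inner products with fixed
    vectors; [weyl_L2] then supplies a holomorphic representative. *)
Lemma A2_complete : complete A2 ip.
Proof.
move=> u Au cu.
have [v Lv uv] := L2_complete mOm (fun k => A2_L2 (Au k)) cu.
have wv : weakly_holo Om v.
  move=> chi tc j; rewrite cintegral_ip.
  have Lc : L2 Om (fun z => (dzbar j chi z)^*) by apply: (L2J mOm); apply: test_L2; exact: test_dzbar.
  apply: rn_eq0; apply/eqP; rewrite eq_le rn_ge0 andbT; apply/ler_addgt0Pr => e e0; rewrite add0r.
  have [N HN] := cvg_ipl L2H Lc Lv (fun k => A2_L2 (Au k)) uv e0.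
  have := HN N (leqnn N); rewrite -[ip (u N) _]cintegral_ip (A2_weak (Au N) tc).
  by rewrite sub0r rnN => /ltW.
have [f Af vf] := weyl_L2 Lv wv; exists f => //.
apply/cvgn0P => e e0; have /cvgn0P/(_ e e0)[N HN] := uv; exists N => k /HN.
rewrite !ger0_norm ?hn_ge0//; apply: le_lt_trans.
by rewrite (le_trans (hn_trans L2H (A2_L2 (Au k)) Lv (A2_L2 Af)))// vf addr0.
Qed.

(** Point evaluation is bounded, so it has a Riesz representative and the selection in
    [bergman_kernel] is not the default value of [xget] by mere absence of candidates. *)
Lemma kernelP z : Om z -> A2 (bergman_kernel Om z) /\
  forall f, A2 f -> f z = ip f (bergman_kernel Om z).
Proof.
move=> Oz; have [M M0 [d d0 H]] := A2_eval Oz.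
have [|_ Hz] := H z; first by rewrite subrr rn0.
have [k [Ak Hk _ _]] := @riesz _ _ _ _ A2H _ A2 id (fun f => f z) M A2_complete A2_0 A2_lin
  (fun f Af => Af) (fun _ _ _ _ _ => erefl) (fun _ _ _ _ _ => erefl) M0 Hz.
rewrite /bergman_kernel; apply: (@xgetPex _ 0 [set k | A2 k /\ forall f, A2 f -> f z = ip f k]).
by exists k.
Qed.

Lemma projP h : L2 Om h -> A2 (bergman_proj Om h) /\
  forall f, A2 f -> ip (h - bergman_proj Om h) f = 0.
Proof.
move=> Lh.
have hb f : A2 f -> rn (ip f h) <= hn h * hn f.
  by move=> Af; rewrite mulrC; exact: (cauchy_schwarz L2H (A2_L2 Af) Lh).
have [g [Ag Hg _ _]] := @riesz _ _ _ _ A2H _ A2 id (fun f => ip f h) (hn h) A2_complete A2_0 A2_lin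
  (fun f Af => Af) (fun _ _ _ _ _ => erefl)
  (fun a f k Af Ak => phlin L2H a (A2_L2 Af) (A2_L2 Ak) Lh) (hn_ge0 _ _) hb.
rewrite /bergman_proj; apply: (@xgetPex _ 0 [set g | A2 g /\ forall f, A2 f -> ip (h - g) f = 0]).
exists g; split => // f Af; have Lf := A2_L2 Af; have Lg := A2_L2 Ag.
rewrite (phC L2H Lf (phB L2H Lh Lg)) (ipBr L2H Lf Lh Lg) -(Hg f Af) subrr.
exact: conjc0.
Qed.

End bergman_space.

(** * Symmetry of mixed partial derivatives *)

Section mixed_partials.
Context {R : realType} {n : nat}.
Local Notation C := R[i].
Local Notation Cn := 'rV[C]_n.
Local Notation K := ('I_n + 'I_n)%type.
Implicit Types (r : Cn -> R) (f : Cn -> C) (z w : Cn).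

Lemma smooth_hasdR k r z : smooth r -> hasdR k r z (rpartial k r z).
Proof. by move=> /(_ [::])[_ h]; apply: rpartial_hasdR; exact: h. Qed.

Lemma smooth_near r z e : smooth r -> 0 < e ->
  exists2 d : R, 0 < d & forall w, rn (w - z) < d -> `|r w - r z| < e.
Proof.
move=> /(_ [::])[c _] e0; have /cvg_nbhsRP/(_ e e0)[d d0 H] := c z.
by exists d.
Qed.

Lemma hasdR_shift k r z a d : hasdR k r (z + a) d -> hasdR k (fun w => r (w + a)) z d.
Proof.
move=> /hasdRP h; apply/hasdRP => e e0.
by have [t0 t00 H] := h e e0; exists t0 => // t; rewrite addrAC; exact: H.
Qed.

(** The mean value theorem is applied in direction [k] to the increment in direction [l], and then
    in direction [l]; the linear corrections in [f1] and [f2] turn both derivatives into error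
    terms. *)
Lemma double_difference k l r z e : smooth r -> 0 < e ->
  exists2 d : R, 0 < d & forall t s : R, `|t| < d -> `|s| < d ->
  `|r (z + s%:C *: real_dir k + t%:C *: real_dir l) - r (z + s%:C *: real_dir k) - r (z + t%:C *: real_dir l) + r z
    - t * s * rpartial l (rpartial k r) z| <= e * `|t| * `|s|.
Proof.
move=> sr e0; set c := rpartial l (rpartial k r) z.
have sk := smooth_rpartial k sr; have slk := smooth_rpartial l sk.
have [d d0 Hd] := smooth_near z slk e0.
exists (d / 2); first by rewrite divr_gt0.
move=> t s td sd.
pose f1 w := r (w + t%:C *: real_dir l) - r w - t * c * rc k w.
have d1 w : hasdR k f1 w (rpartial k r (w + t%:C *: real_dir l) - rpartial k r w - t * c).
  apply: hasdRB; first by apply: hasdRB; [apply: hasdR_shift|]; exact: smooth_hasdR.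
  apply: hasdR_eq (hasdRM (hasdR_cst k (t * c) w) (hasdR_rc k k w)) _.
  by rewrite mul0r add0r eqxx mulr1.
have smallk (x : R) (m : K) : `|x| < d / 2 -> rn (x%:C *: real_dir m : Cn) < d / 2.
  by move=> xd; rewrite rnZ rn_real (le_lt_trans _ xd)// ler_piMr// rn_real_dir.
have := @mean_value_R _ _ k f1 z s (e * `|t|) (fun w => rpartial k r (w + t%:C *: real_dir l) - rpartial k r w - t * c).
have -> : f1 (z + s%:C *: real_dir k) - f1 z = r (z + s%:C *: real_dir k + t%:C *: real_dir l) - r (z + s%:C *: real_dir k)
    - r (z + t%:C *: real_dir l) + r z - t * s * c.
  by rewrite /f1 rc_line eqxx mulr1; ring.
apply => x xs; split; first exact: d1.
set p := z + x%:C *: real_dir k.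
pose f2 w := rpartial k r w - c * rc l w.
have d2 w : hasdR l f2 w (rpartial l (rpartial k r) w - c).
  apply: hasdRB; first exact: smooth_hasdR.
  apply: hasdR_eq (hasdRM (hasdR_cst l c w) (hasdR_rc l l w)) _.
  by rewrite mul0r add0r eqxx mulr1.
have := @mean_value_R _ _ l f2 p t e (fun w => rpartial l (rpartial k r) w - c).
have -> : f2 (p + t%:C *: real_dir l) - f2 p = rpartial k r (p + t%:C *: real_dir l) - rpartial k r p - t * c.
  by rewrite /f2 rc_line eqxx mulr1; ring.
apply => y yt; split; first exact: d2.
apply/ltW/Hd; have -> : p + y%:C *: real_dir l - z = x%:C *: real_dir k + y%:C *: real_dir l.
  by rewrite /p addrAC [z + _]addrC addrK.
rewrite (le_lt_trans (rnD _ _))// [d]splitr ltrD//; apply: smallk.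
  exact: le_lt_trans xs sd.
exact: le_lt_trans yt td.
Qed.

(** With equal steps the second difference is symmetric in the two directions, and it approximates
    both mixed derivatives. *)
Lemma rpartialC k l r z : smooth r -> rpartial l (rpartial k r) z = rpartial k (rpartial l r) z.
Proof.
move=> sr; apply/eqP; rewrite -subr_eq0 -normr_eq0 eq_le normr_ge0 andbT.
apply/ler_addgt0Pr => e e0; rewrite add0r.
have e2 : 0 < e / 2 by rewrite divr_gt0.
have [d1 d10 H1] := double_difference k l z sr e2.
have [d2 d20 H2] := double_difference l k z sr e2.
pose t := Num.min d1 d2 / 2.
have t0 : 0 < t by rewrite divr_gt0// lt_min d10.
have m1 : Num.min d1 d2 <= d1 by rewrite ge_min lexx.
have m2 : Num.min d1 d2 <= d2 by rewrite ge_min lexx orbT.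
have m0 : 0 < Num.min d1 d2 by rewrite lt_min d10.
have td1 : `|t| < d1 by rewrite gtr0_norm// /t; lra.
have td2 : `|t| < d2 by rewrite gtr0_norm// /t; lra.
have h1 := H1 t t td1 td1; have := H2 t t td2 td2.
rewrite [z + t%:C *: real_dir l + t%:C *: real_dir k]addrAC => h2.
move: h1 h2; set A := r (_ + _ + _); set X := r (z + t%:C *: real_dir k); set Y := r (z + t%:C *: real_dir l).
move: (rpartial l (rpartial k r) z) (rpartial k (rpartial l r) z) => c1 c2.
rewrite (gtr0_norm t0) => h1 h2.
rewrite -(ler_pM2r (mulr_gt0 t0 t0)) -[X in `|_| * X](gtr0_norm (mulr_gt0 t0 t0)) -normrM.
move: h1 h2; rewrite !ler_norml => /andP[a1 a2] /andP[b1 b2].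
by apply/andP; split; lra.
Qed.

Lemma cpartialC k l f z : csmooth f -> cpartial l (cpartial k f) z = cpartial k (cpartial l f) z.
Proof. by move=> [h1 h2]; rewrite /cpartial /=; apply: eqc => /=; exact: rpartialC. Qed.

Lemma dzbarC j k f z : csmooth f -> dzbar j (dzbar k f) z = dzbar k (dzbar j f) z.
Proof.
move=> sf.
have h m l : hasd m (dzbar l f) z (2^-1 * (cpartial m (cpartial (inl l) f) z + (0 +i* 1) * cpartial m (cpartial (inr l) f) z)).
  apply: hasdZ; apply: hasdD; first by apply: csmooth_hasd; exact: csmooth_cpartial.
  by apply: hasdZ; apply: csmooth_hasd; exact: csmooth_cpartial.
rewrite {1}/dzbar [RHS]/dzbar !(hasd_cpartial (h _ _)).
have alg (a a' b b' c c' d d' i h' : C) : a = a' -> b = b' -> c = c' -> d = d' ->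
    h' * (h' * (a + i * b) + i * (h' * (c + i * d))) = h' * (h' * (a' + i * c') + i * (h' * (b' + i * d'))).
  by move=> -> -> -> ->; ring.
exact: (alg _ _ _ _ _ _ _ _ _ _ (cpartialC (inl k) (inl j) z sf) (cpartialC (inr k) (inl j) z sf)
  (cpartialC (inl k) (inr j) z sf) (cpartialC (inr k) (inr j) z sf)).
Qed.

End mixed_partials.

(** * The dbar-Neumann operator *)

Section forms.
Context {R : realType} {n : nat}.
Local Notation C := R[i].
Local Notation Cn := 'rV[C]_n.
Variables (Om : set Cn) (B : R).
Hypothesis oOm : open Om.
Hypothesis bOm : forall z, Om z -> rn z <= B.
Local Notation A2 := (bergman_space Om).
Local Notation ip := (L2ip Om).
Local Notation hn := (hnorm (L2ip Om)).
Local Notation hn1 := (hnorm (ip_01 Om)).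
Local Notation L2Hm := (L2H oOm).
Local Notation mO := (mOm oOm).

Lemma prehilbert_family (E : lmodType C) (I : finType) (P : pred I) (pr : I -> E -> Cn -> C) (V : set E) :
  (forall i a u v, pr i (a *: u + v) = a *: pr i u + pr i v) -> V 0 ->
  (forall (a : C) u v, V u -> V v -> V (a *: u + v)) -> (forall u i, V u -> L2 Om (pr i u)) ->
  prehilbert V (fun u v => \sum_(i | P i) ip (pr i u) (pr i v)).
Proof.
move=> prL V0 VL VP; split => //.
- move=> a f g h Vf Vg Vh; rewrite mulr_sumr -big_split; apply: eq_bigr => i _ /=.
  by rewrite prL (phlin L2Hm)//; exact: VP.
- move=> f g Vf Vg; rewrite rmorph_sum; apply: eq_bigr => i _.
  by apply: (phC L2Hm); exact: VP.
- move=> f Vf; rewrite Re_sum; apply: sumr_ge0 => i _; apply: (ph_ge0 L2Hm); exact: VP.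
Qed.

Definition comp01 (j : 'I_n) (u : Cn -> 'rV[C]_n) : Cn -> C := fun z => u z 0 j.

Lemma comp01L j (a : C) u v : comp01 j (a *: u + v) = a *: comp01 j u + comp01 j v.
Proof. by apply/funext => z; rewrite /comp01 !fctE !mxE. Qed.

Lemma z0v (z : Cn) (j : 'I_n) : (0 : Cn -> 'rV[C]_n) z 0 j = 0.
Proof. by have e : (0 : 'rV[C]_n) 0 j = 0 by rewrite mxE. Qed.

Lemma z0m (z : Cn) (j k : 'I_n) : (0 : Cn -> 'M[C]_n) z j k = 0.
Proof. by have e : (0 : 'M[C]_n) j k = 0 by rewrite mxE. Qed.

Lemma L2_01_prehilbert : prehilbert (L2_01 Om) (ip_01 Om).
Proof.
apply: (@prehilbert_family _ 'I_n predT comp01).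
- exact: comp01L.
- by move=> j; apply: (L2_eq mO) (ph0 L2Hm) => z _; exact/esym/z0v.
- by move=> a u v Lu Lv j; have := phL L2Hm a (Lu j) (Lv j); rewrite -comp01L.
- by move=> u j Lu; exact: Lu.
Qed.
Local Notation H1 := L2_01_prehilbert.

Definition comp02 (p : 'I_n * 'I_n) (w : Cn -> 'M[C]_n) : Cn -> C := fun z => w z p.1 p.2.

Lemma L2_02_prehilbert : prehilbert (L2_02 Om) (ip_02 Om).
Proof.
have -> : ip_02 Om = (fun u v => \sum_(p : 'I_n * 'I_n | (p.1 < p.2)%N) ip (comp02 p u) (comp02 p v)).
  by apply/funext => u; apply/funext => v; rewrite /ip_02 pair_big_dep.
have compL p (a : C) u v : comp02 p (a *: u + v) = a *: comp02 p u + comp02 p v.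
  by apply/funext => z; rewrite /comp02 !fctE !mxE.
apply: (@prehilbert_family _ _ _ comp02) => //.
- split; last by move=> z _; have e : (0 : 'M[C]_n)^T = - 0 by rewrite trmx0 oppr0.
  by move=> j k; apply: (L2_eq mO) (ph0 L2Hm) => z _; exact/esym/z0m.
- move=> a u v [u1 u2] [v1 v2]; split.
    by move=> j k; have := phL L2Hm a (u1 j k) (v1 j k); rewrite -(compL (j, k)).
  by move=> z Oz; rewrite !fctE linearD linearZ/= u2// v2// scalerN opprD.
- by move=> u p [u1 _]; exact: u1.
Qed.
Local Notation H2 := L2_02_prehilbert.

Lemma adjoint_graphL (E F : lmodType C) (VE : set E) (ipE : E -> E -> C) (VF : set F) (ipF : F -> F -> C)
    (A : E -> F -> Prop) : prehilbert VE ipE -> prehilbert VF ipF -> (forall h g, A h g -> VE h /\ VF g) ->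
  forall (a : C) v x v' x', adjoint_graph VE ipE VF ipF A v x -> adjoint_graph VE ipE VF ipF A v' x' ->
  adjoint_graph VE ipE VF ipF A (a *: v + v') (a *: x + x').
Proof.
move=> HE HF AV a v x v' x' [Fv Ex hv] [Fv' Ex' hv']; split; [exact: (phL HF)|exact: (phL HE)|].
move=> h g Ahg; have [Eh Fg] := AV h g Ahg.
rewrite (ipDr HF)//; last exact: (phZ HF).
rewrite (ipDr HE)//; last exact: (phZ HE).
by rewrite (ipZr HF)// (ipZr HE)// (hv h g Ahg) (hv' h g Ahg).
Qed.

Lemma ci_mul_test (u chi : Cn -> C) : L2 Om u -> test_function Om chi -> ci Om (fun z => u z * chi z).
Proof. by move=> Lu tc; apply: (L2_mul_ci mO) => //; exact: (test_L2 oOm bOm). Qed.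

Lemma ci_mul_dzbar (u chi : Cn -> C) j : L2 Om u -> test_function Om chi -> ci Om (fun z => u z * dzbar j chi z).
Proof. by move=> Lu tc; apply: ci_mul_test => //; exact: test_dzbar. Qed.

Lemma dbar_0L (a : C) f u f' u' : dbar_0 Om f u -> dbar_0 Om f' u' -> dbar_0 Om (a *: f + f') (a *: u + u').
Proof.
move=> [Lf Lu h] [Lf' Lu' h']; split; [exact: (phL L2Hm)|exact: (phL H1)|].
move=> chi tc j.
rewrite (@cintegral_eq _ _ Om _ (fun z => a * (u z 0 j * chi z) + u' z 0 j * chi z)); last first.
  by move=> z _; rewrite !fctE !mxE mulrDl mulrA.
rewrite (@cintegral_eq _ _ Om (fun z => (a *: f + f') z * dzbar j chi z) (fun z => a * (f z * dzbar j chi z) + f' z * dzbar j chi z)); last first.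
  by move=> z _; rewrite !fctE mulrDl mulrA.
have c1 := ci_mul_test (Lu j) tc; have c2 := ci_mul_test (Lu' j) tc.
have c3 := ci_mul_dzbar j Lf tc; have c4 := ci_mul_dzbar j Lf' tc.
rewrite (cintegralD mO (ciZ mO a c1) c2) (cintegralZ mO a c1) (h chi tc j) (h' chi tc j).
by rewrite (cintegralD mO (ciZ mO a c3) c4) (cintegralZ mO a c3) mulrN opprD.
Qed.

Lemma dbar_1L (a : C) f u f' u' : dbar_1 Om f u -> dbar_1 Om f' u' -> dbar_1 Om (a *: f + f') (a *: u + u').
Proof.
move=> [Lf Lu h] [Lf' Lu' h']; split; [exact: (phL H1)|exact: (phL H2)|].
move=> chi tc j k; have [u1 _] := Lu; have [u1' _] := Lu'.
pose G (f : Cn -> 'rV[C]_n) z := f z 0 k * dzbar j chi z - f z 0 j * dzbar k chi z.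
rewrite (@cintegral_eq _ _ Om _ (fun z => a * (u z j k * chi z) + u' z j k * chi z)); last first.
  by move=> z _; rewrite !fctE !mxE mulrDl mulrA.
rewrite (@cintegral_eq _ _ Om (fun z => _ - _) (fun z => a * G f z + G f' z)); last first.
  move=> z _; rewrite /G !fctE !mxE.
  move: (f z 0 k) (f z 0 j) (f' z 0 k) (f' z 0 j) (dzbar j chi z) (dzbar k chi z) => x1 x2 x3 x4 x5 x6; ring.
have c1 := ci_mul_test (u1 j k) tc; have c2 := ci_mul_test (u1' j k) tc.
have c3 : ci Om (G f) by apply: (ciB mO); [exact: (ci_mul_dzbar j (Lf k) tc)|exact: (ci_mul_dzbar k (Lf j) tc)].
have c4 : ci Om (G f') by apply: (ciB mO); [exact: (ci_mul_dzbar j (Lf' k) tc)|exact: (ci_mul_dzbar k (Lf' j) tc)].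
rewrite (cintegralD mO (ciZ mO a c1) c2) (cintegralZ mO a c1) (h chi tc j k) (h' chi tc j k).
by rewrite (cintegralD mO (ciZ mO a c3) c4) (cintegralZ mO a c3) mulrN opprD.
Qed.

Lemma boxL (a : C) x g x' g' : complex_laplacian Om x g -> complex_laplacian Om x' g' ->
  complex_laplacian Om (a *: x + x') (a *: g + g').
Proof.
move=> [w [a1 [f [b [h1 h2 h3 h4 ->]]]]] [w' [a1' [f' [b' [h1' h2' h3' h4' ->]]]]].
exists (a *: w + w'), (a *: a1 + a1'), (a *: f + f'), (a *: b + b'); split.
- exact: dbar_1L.
- by apply: (adjoint_graphL H1 H2) => // h k [].
- by apply: (adjoint_graphL L2Hm H1) => // h k [].
- exact: dbar_0L.
- by rewrite scalerDr addrACA.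
Qed.

Lemma box_cancel x g x' g' : complex_laplacian Om x g -> complex_laplacian Om x' (1 *: g + g') ->
  complex_laplacian Om (-1 *: x + x') g'.
Proof.
move=> h h'; have e : -1 *: g + (1 *: g + g') = g'.
  by rewrite scale1r scaleN1r; apply/funext => z; exact: (addKr (g z) (g' z)).
by rewrite -[X in complex_laplacian _ _ X]e; exact: boxL.
Qed.

Lemma hn_additive0 (E : lmodType C) (V : set E) ipE (T : E -> E) b g : prehilbert V ipE -> bounded_op V ipE T ->
  V b -> V g -> T g = 0 -> T (1 *: b + g) = 0 -> hnorm ipE (T b) = 0.
Proof.
move=> H [T1 T2 _] Vb Vg Tg Tbg.
by have := T2 1 b g Vb Vg; rewrite Tbg Tg scale1r addr0 sub0r (hnN H)//; exact: T1.
Qed.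

(** Both sides equal the sum of the products of the dbar parts and of the dbar-adjoint parts of [x]
    and [x']. *)
Lemma box_sym x g x' g' : complex_laplacian Om x g -> complex_laplacian Om x' g' ->
  ip_01 Om g x' = ip_01 Om x g'.
Proof.
move=> [w [a1 [f [b [h1 h2 h3 h4 ->]]]]] [w' [a1' [f' [b' [h1' h2' h3' h4' ->]]]]].
have [Lx Lw _] := h1; have [Lx' Lw' _] := h1'; have [_ La a2] := h2; have [_ La' a2'] := h2'.
have [_ Lf a3] := h3; have [_ Lf' a3'] := h3'; have [_ Lb _] := h4; have [_ Lb' _] := h4'.
rewrite (ipDl H1)// (ipDr H1)// (a3' _ _ h4) -(a2' _ _ h1); congr (_ + _).
  by rewrite (phC H1 Lx' La) -(a2 _ _ h1') -(phC H2 Lw' Lw).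
by rewrite (phC H1 Lb' Lx) (a3 _ _ h4') -(phC L2Hm Lf' Lf).
Qed.

Lemma oppr_sub_eq0 (a b x y : C) : a = - x -> b = - y -> x = y -> 0 = - (a - b).
Proof. by move=> -> -> ->; rewrite subrr oppr0. Qed.

(** The square of dbar is 0 weakly, because the operators [dzbar] commute on test functions. *)
Lemma dbar_0_dbar_1 f b : dbar_0 Om f b -> dbar_1 Om b 0.
Proof.
move=> [Lf Lb h]; split => //; first exact: (ph0 H2).
move=> chi tc j k; have tj := test_dzbar j tc; have tk := test_dzbar k tc.
rewrite (cintegralB mO); [|exact: ci_mul_test (Lb k) tj|exact: ci_mul_test (Lb j) tk].
have e0 : cintegral Om (fun z => (0 : Cn -> 'M[C]_n) z j k * chi z) = 0.
  by rewrite -[RHS](cintegral0 mO); apply: cintegral_eq => z _; rewrite z0m mul0r.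
have e3 : cintegral Om (fun z => f z * dzbar k (dzbar j chi) z) = cintegral Om (fun z => f z * dzbar j (dzbar k chi) z).
  have [sc _] := tc; apply: cintegral_eq => z _; exact: (congr1 (fun x => f z * x) (dzbarC k j z sc)).
rewrite e0; exact: (oppr_sub_eq0 (h _ tj k) (h _ tk j) e3).
Qed.

Lemma testM (chi f : Cn -> C) : test_function Om chi -> csmooth f -> test_function Om (fun z => f z * chi z).
Proof.
move=> [sc [K [cK KO K0]]] sf; split; first exact: csmoothM.
by exists K; split => // z /K0 ->; rewrite mulr0.
Qed.

Lemma testJ (chi : Cn -> C) : test_function Om chi -> test_function Om (fun z => (chi z)^*).
Proof.
move=> [sc [K [cK KO K0]]]; split; first exact: csmoothJ.
by exists K; split => // z /K0 ->; exact: conjc0.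
Qed.

Lemma test_sum (I : Type) (r : seq I) (P : pred I) (F : I -> Cn -> C) : (forall i, test_function Om (F i)) ->
  test_function Om (fun z => \sum_(i <- r | P i) F i z).
Proof.
move=> tF; elim: r => [|i r [s1 [K1 [cK1 KO1 K01]]]].
  rewrite (_ : (fun z => _) = fun=> 0); last by apply/funext => z; rewrite big_nil.
  by split; [exact: csmooth_cst|exists set0; split => //; exact: compact0].
rewrite (_ : (fun z => _) = (fun z => (if P i then F i z else 0) + \sum_(i <- r | P i) F i z)); last first.
  by apply/funext => z; rewrite big_cons; case: (P i); rewrite ?add0r.
have [s2 [K2 [cK2 KO2 K02]]] := tF i.
have s3 : csmooth (fun z => if P i then F i z else 0) by case: (P i); [exact: s2|exact: csmooth_cst].
split; first exact: (csmoothD s3 s1).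
exists (K1 `|` K2); split; [exact: compactU|by move=> z []; [exact: KO1|exact: KO2]|].
by move=> z /not_orP[n1 n2]; rewrite K01// K02// if_same addr0.
Qed.

Lemma weakly_holo_1 : weakly_holo Om (fun=> 1).
Proof. by apply: holo_weakly_holo => // z _; exact: differentiable_cst. Qed.

(** The integration by parts is the weak holomorphy of 1, tested on the product [phi * chi]. *)
Lemma test_dbar_0 phi : test_function Om phi -> dbar_0 Om phi (fun z => \row_j dzbar j phi z).
Proof.
move=> tphi; have [sphi _] := tphi; split; first exact: (test_L2 oOm bOm).
  move=> j; apply: (L2_eq mO) (test_L2 oOm bOm (test_dzbar j tphi)) => z _; by rewrite mxE.
move=> chi tc j; have [sc _] := tc.
have := weakly_holo_1 (testM tc sphi) j.
rewrite (@cintegral_eq _ _ Om _ (fun z => dzbar j phi z * chi z + phi z * dzbar j chi z)); last first.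
  by move=> z _; rewrite mul1r dzbarM.
have Lp := test_L2 oOm bOm tphi; have Ldp := test_L2 oOm bOm (test_dzbar j tphi).
rewrite (cintegralD mO (ci_mul_test Ldp tc) (ci_mul_dzbar j Lp tc)) => /eqP.
rewrite addr_eq0 => /eqP <-; apply: cintegral_eq => z _; by rewrite mxE.
Qed.

(** It puts dbar of a test function into the domain of the adjoint, so that [Neumann_onto] has an
    explicit nontrivial element in the range of the Laplacian. *)
Lemma dbar_0_adj_test phi : test_function Om phi ->
  dbar_0_adj Om (fun z => \row_j dzbar j phi z)
    (fun z => - \sum_j (dzbar j (fun z => (dzbar j phi z)^*) z)^*).
Proof.
move=> tphi; have [_ L1 _] := test_dbar_0 tphi.
have tj j := testJ (test_dzbar j tphi).
have ts : test_function Om (fun z => \sum_j (dzbar j (fun z => (dzbar j phi z)^*) z)^*).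
  by apply: test_sum => j; apply: testJ; exact: (test_dzbar j (tj j)).
split => //; first exact: (phN L2Hm (test_L2 oOm bOm ts)).
move=> h g [Lh Lg hg].
have ci1 j : ci Om (fun z => h z * dzbar j (fun z => (dzbar j phi z)^*) z) by exact: ci_mul_dzbar.
transitivity (- cintegral Om (fun z => \sum_j h z * dzbar j (fun z => (dzbar j phi z)^*) z)).
  rewrite (cintegral_sum mO) => [|j _]; last exact: ci1.
  rewrite -sumrN; apply: eq_bigr => j _; rewrite -(hg _ (tj j) j).
  by apply: cintegral_eq => z _; rewrite mxE.
rewrite -(cintegralN mO); last by apply: (ci_sum mO) => j _; exact: ci1.
apply: cintegral_eq => z _; rewrite rmorphN rmorph_sum mulrN mulr_sumr; congr (- _).
by apply: eq_bigr => j _; congr (_ * _); exact/esym/conjcK.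
Qed.

Lemma test_opp (f : Cn -> C) : test_function Om f -> test_function Om (fun z => - f z).
Proof.
move=> tf; have := testM tf (@csmooth_cst R n (-1)).
by rewrite (_ : (fun z => _) = (fun z => - f z))//; apply/funext => z; rewrite mulN1r.
Qed.

Lemma hn1_comp u j : L2_01 Om u -> hn (comp01 j u) <= hn1 u.
Proof.
move=> Lu; rewrite -(@ler_pXn2r _ 2)// ?nnegrE ?hn_ge0//.
rewrite (hn_sq H1 Lu) (hn_sq L2Hm (Lu j)) /ip_01 Re_sum (bigD1 j)//= lerDl.
by apply: sumr_ge0 => i _; exact: (ph_ge0 L2Hm).
Qed.

Hypothesis n_gt0 : (0 < n)%N.
Hypothesis Om0 : Om !=set0.
Hypothesis N_bounded : bounded_op (L2_01 Om) (ip_01 Om) (dbar_Neumann Om).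
Local Notation N := (dbar_Neumann Om).

(* Additivity of N forces the Laplacian to be onto: N vanishes off the range,
   and adding an element off the range to b in the range would give N b = 0,
   which fails for b = Box (dbar phi) with phi a bump function. *)
Lemma Neumann_onto g : L2_01 Om g -> complex_laplacian Om (N g) g.
Proof.
move=> Lg; apply: (@xgetPex _ 0 [set u | complex_laplacian Om u g]).
apply: contrapT => ng; have [z0 Oz0] := Om0; pose j0 := Ordinal n_gt0.
have [t t0 Ht] := ball_in oOm Oz0.
have Ht0 w : rn (w - z0) <= t -> Om w by apply: Ht; rewrite subrr rn0.
pose phi w := pkc t (w + - z0).
have tphi : test_function Om phi.
  split; first exact: csmooth_shift (pkc_smooth t).
  exists [set w | rn (w - z0) <= t]; split => //; first exact: compact_rn_ball.
  by move=> w /= /negP; rewrite -ltNge => h; rewrite /phi pkc_supp.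
(* [v0] is dbar [phi], [f0] the adjoint of dbar applied to [v0], and [b0] is dbar [f0]. Since dbar
   [v0] is 0, the Laplacian maps [v0] to [b0]. *)
pose v0 : Cn -> 'rV[C]_n := fun z => \row_j dzbar j phi z.
pose f0 z := - \sum_j (dzbar j (fun z => (dzbar j phi z)^*) z)^*.
have d0 := test_dbar_0 tphi; have da := dbar_0_adj_test tphi.
have tf0 : test_function Om f0.
  by apply: test_opp; apply: test_sum => j; apply: testJ; apply: test_dzbar; apply: testJ; exact: test_dzbar.
have d2 := test_dbar_0 tf0; pose b0 : Cn -> 'rV[C]_n := fun z => \row_j dzbar j f0 z.
have box0 : complex_laplacian Om v0 b0.
  exists 0, 0, f0, b0; split => //; [exact: dbar_0_dbar_1 d0| |by rewrite add0r].
  split; [exact: (ph0 H2)|exact: (ph0 H1)|].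
  by move=> h k [Lh Lk _]; rewrite (ip0r H2)// (ip0r H1).
have [_ Lb0 _] := d2; have [Lphi Lv0 _] := d0.
have [N1 N2 _] := N_bounded.
(* Off the range of the Laplacian, [xget] returns its default value 0. *)
have Ng : N g = 0.
  by apply: xgetPN => x bx; apply: ng; exists x.
have Nbg : N (1 *: b0 + g) = 0.
  apply: xgetPN => x bx; apply: ng.
  by exists (-1 *: v0 + x); exact (box_cancel box0 bx).
have Nb : hn1 (N b0) = 0.
  by exact (hn_additive0 H1 N_bounded Lb0 Lg Ng Nbg).
have boxb : complex_laplacian Om (N b0) b0.
  by apply: (@xgetPex _ 0 [set u | complex_laplacian Om u b0]); exists v0.
(* By symmetry this is the product of the null form [N b0] with [b0]. It also equals the squared
   norm of [f0]; once [f0] is null, so is [v0], whose squared norm is the product of [phi] and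
   [f0]. *)
have e1 : ip_01 Om b0 v0 = 0.
  exact (etrans (box_sym boxb box0) (ip_null H1 (N1 _ Lb0) Lb0 Nb)).
have [_ Lf0 ad] := da.
have f00 : hn f0 = 0.
  have e : ip f0 f0 = 0 by exact: (etrans (esym (ad _ _ d2)) e1).
  by rewrite /hnorm e sqrtr0.
have v00 : hn1 v0 = 0.
  have e : ip_01 Om v0 v0 = 0 by exact: (etrans (ad _ _ d0) (ip_nullr L2Hm Lphi Lf0 f00)).
  by rewrite /hnorm e sqrtr0.
have vj : hn (comp01 j0 v0) = 0.
  by apply/eqP; rewrite eq_le hn_ge0 andbT -v00 hn1_comp.
have sz : csmooth (fun z : Cn => (z 0 j0)^*) by apply: csmoothJ; exact: csmooth_coord.
have [sphi _] := tphi.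
have cJ z : dzbar j0 (fun z : Cn => (z 0 j0)^*) z = 1.
  rewrite (dzbarE j0 (fun k => hasdJ (hasd_coord k j0 z))) /db /real_dir !mxE !eqxx mulr1.
  apply: (mulfI (x := 2)); first by rewrite pnatr_eq0.
  rewrite mulVKf ?pnatr_eq0// -(rmorph_nat (real_complex R)); apply: eqc => /=; ring.
have Lz : L2 Om (fun z : Cn => z 0 j0).
  apply: (L2_bounded mO (vOm oOm bOm) (M := B)).
    by apply: mc_sub (ctn_mc _) => // z; exact: ctn_coord.
  by move=> z Oz; rewrite (le_trans (rn_coord z j0))// bOm.
have Ldp := test_L2 oOm bOm (test_dzbar j0 tphi).
(* Integrating by parts against the conjugate of z_j turns the null derivative of [phi] into a
   vanishing integral of [phi], but that integral is [pmass t]. *)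
have i1 := weakly_holo_1 (testM tphi sz) j0.
have i2 : cintegral Om (fun z => dzbar j0 phi z * (z 0 j0)^*) = 0.
  have h := ip_null L2Hm (Lv0 j0) Lz vj; rewrite -[RHS]h; apply: cintegral_eq => z _.
  by rewrite mxE.
have i3 : cintegral Om phi = (pmass (R := R) (n := n) t)%:C.
  have := mean_value_property mO (L2_ci oOm bOm (L2_1 oOm bOm)) weakly_holo_1 t0 Ht0 (ctn_cst 1 z0).
  rewrite mulr1 => <-; rewrite (@conv_cut _ _ Om (fun=> 1)).
    by apply: cintegral_eq => w _; rewrite mul1r.
  move=> w hw; apply: Ht0; rewrite leNgt; apply/negP => tw; move: hw.
  by rewrite pkc_supp ?eqxx.
move: i1; rewrite (@cintegral_eq _ _ Om _ (fun z => phi z + dzbar j0 phi z * (z 0 j0)^*)); last first.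
  move=> z _; rewrite mul1r (dzbarM j0 z sz sphi) cJ mul1r; congr (_ + _); exact: mulrC.
rewrite (cintegralD mO) ?i2 ?addr0.
- rewrite i3 => /eqP; rewrite (inj_eq (@complexI R) _ 0) => /eqP p0.
  by have := pmass_gt0 (n := n) t0; rewrite p0 ltxx.
- exact: (L2_ci oOm bOm Lphi).
- exact: (L2_ip_ci mO Ldp Lz).
Qed.

Lemma Neumann_sym g h : L2_01 Om g -> L2_01 Om h -> ip_01 Om g (N h) = ip_01 Om (N g) h.
Proof. by move=> Lg Lh; exact: (box_sym (Neumann_onto Lg) (Neumann_onto Lh)). Qed.

(* Kohn's formula: f = dbar^* N alpha. *)
Lemma kohn alpha : L2_01 Om alpha -> dbar_1 Om alpha 0 ->
  exists f, [/\ L2 Om f,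
    forall chi, test_function Om chi -> forall j,
      cintegral Om (fun z => alpha z 0 j * chi z) = - cintegral Om (fun z => f z * dzbar j chi z),
    forall h, A2 h -> ip h f = 0 & hn f ^+ 2 <= hn1 alpha * hn1 (N alpha)].
Proof.
move=> La d1; have [w [a [f [b [h1 h2 h3 h4 E]]]]] := Neumann_onto La.
have [Lu Lw _] := h1; have [_ Laa a2] := h2; have [_ Lf a3] := h3; have [_ Lb wf] := h4.
(* The difference [a] of [alpha] and [b] is dbar-closed and lies in the range of the adjoint of
   dbar, so it is orthogonal to itself. *)
have da : dbar_1 Om a 0.
  have := dbar_1L (-1) (dbar_0_dbar_1 h4) d1.
  by rewrite scaler0 addr0 E scaleN1r addrC addrK.
have a0 : hn1 a = 0.
  have e : ip_01 Om a a = 0 by exact: (etrans (esym (a2 _ _ da)) (ip0l H2 Lw)).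
  by rewrite /hnorm e sqrtr0.
exists f; split => //.
- move=> chi tc j; rewrite -(wf _ tc j) E.
  have aj : hn (comp01 j a) = 0 by apply/eqP; rewrite eq_le hn_ge0 andbT -a0 hn1_comp.
  rewrite (@cintegral_eq _ _ Om _ (fun z => a z 0 j * chi z + b z 0 j * chi z)); last first.
    by move=> z _; rewrite !fctE mxE mulrDl.
  rewrite (cintegralD mO (ci_mul_test (Laa j) tc) (ci_mul_test (Lb j) tc)).
  rewrite (cintegral_ip Om (fun z => a z 0 j)) (ip_null L2Hm (Laa j) _ aj) ?add0r//.
  by apply: (test_L2 oOm bOm); exact: testJ.
- move=> h Ah; have d0 : dbar_0 Om h 0.
    split; [exact: A2_L2|exact: (ph0 H1)|].
    move=> chi tc j; rewrite (A2_weak oOm Ah tc) oppr0 -[RHS](cintegral0 mO).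
    by apply: cintegral_eq => z _; rewrite z0v mul0r.
  by rewrite -(a3 _ _ d0) (ip0l H1).
- have e1 : ip f f = ip_01 Om alpha (N alpha).
    by rewrite -(a3 _ _ h4) {2}E (ipDl H1)// (ip_null H1 Laa Lu a0) add0r.
  rewrite (hn_sq L2Hm Lf) e1 (le_trans (ler_norm _))// (le_trans (normr_Re _))//.
  exact: (cauchy_schwarz H1).
Qed.

End forms.

(** * Null sequences and Hankel operators *)

Section vanish.
Context {R : realType}.
Implicit Types x y : nat -> R.

(* For sequences of nonnegative numbers this is convergence to 0. *)
Definition vanish x := forall e : R, 0 < e -> exists N, forall k, (N <= k)%N -> x k < e.

Lemma vanish_le x y : (forall k, x k <= y k) -> vanish y -> vanish x.
Proof. by move=> xy vy e /vy[N H]; exists N => k /H; exact: le_lt_trans. Qed.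

Lemma vanishD x y : vanish x -> vanish y -> vanish (fun k => x k + y k).
Proof.
move=> vx vy e e0; have e2 : 0 < e / 2 by rewrite divr_gt0.
have [N HN] := vx _ e2; have [N' HN'] := vy _ e2; exists (maxn N N') => k.
by rewrite geq_max => /andP[/HN h /HN' h']; lra.
Qed.

Lemma vanishZ (a : R) x : 0 <= a -> vanish x -> vanish (fun k => a * x k).
Proof.
move=> a0 vx e e0; have a1 : 0 < a + 1 by lra.
have [N HN] := vx _ (divr_gt0 e0 a1); exists N => k /HN.
rewrite ltr_pdivlMr// => h; have [x0|x0] := leP 0 (x k); first by nra.
by apply: le_lt_trans e0; rewrite mulr_ge0_le0// ltW.
Qed.

Lemma vanish0 : vanish (fun=> 0).
Proof. by move=> e e0; exists 0%N. Qed.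

Lemma vanish_sum (I : Type) (r : seq I) (F : I -> nat -> R) : (forall i, vanish (F i)) ->
  vanish (fun k => \sum_(i <- r) F i k).
Proof.
move=> vF; elim: r => [|i r ih].
  by apply: vanish_le vanish0 => k; rewrite big_nil.
by apply: vanish_le (vanishD (vF i) ih) => k; rewrite big_cons.
Qed.

Lemma vanish_approx x : (forall e : R, 0 < e -> exists2 y, vanish y & forall k, x k <= e + y k) -> vanish x.
Proof.
move=> h e e0; have e2 : 0 < e / 2 by rewrite divr_gt0.
have [y vy xy] := h _ e2; have [N HN] := vy _ e2; exists N => k /HN; have := xy k; lra.
Qed.

Lemma vanish_sub x (s : nat -> nat) : (forall k, (k <= s k)%N) -> vanish x -> vanish (x \o s).
Proof. by move=> ks vx e /vx[N H]; exists N => k Nk; apply: H; exact: leq_trans (ks k). Qed.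

Lemma vanish_sqrt x : vanish (fun k => x k ^+ 2) -> vanish x.
Proof.
move=> vx e e0; have [N HN] := vx _ (exprn_gt0 2 e0); exists N => k /HN h.
by rewrite ltNge; apply/negP => ex; move: h; rewrite ltNge lerXn2r// ?nnegrE ?ltW// (lt_le_trans e0).
Qed.

Lemma vanishP x : (forall k, 0 <= x k) -> vanish x <-> x k @[k --> \oo] --> (0 : R).
Proof.
by move=> x0; rewrite cvgn0P; split => h e /h[N H]; exists N => k /H; rewrite ger0_norm.
Qed.

Lemma not_vanish x : ~ vanish x -> exists2 e : R, 0 < e & exists s : nat -> nat, forall k, (k <= s k)%N /\ e <= x (s k).
Proof.
move=> nv; apply: contrapT => h; apply: nv => e e0; apply: contrapT => h'; apply: h; exists e => //.
suff /choice[s sP] (k : nat) : exists m, (k <= m)%N /\ e <= x m by exists s.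
apply: contrapT => hk; apply: h'; exists k => m km; rewrite ltNge; apply/negP => em; apply: hk.
by exists m.
Qed.

Lemma vanish_unique (a : R) x : vanish x -> (forall k, a <= x k) -> a <= 0.
Proof.
move=> vx ax; rewrite leNgt; apply/negP => a0; have [N /(_ N (leqnn N)) h] := vx a a0.
by have := ax N; rewrite leNgt h.
Qed.

Lemma incr_ge (s : nat -> nat) : (forall k, (s k < s k.+1)%N) -> forall k, (k <= s k)%N.
Proof. by move=> h; elim => // k ih; exact: leq_ltn_trans ih (h k). Qed.

End vanish.

Section null_sequences.
Context {R : realType} {n : nat}.
Local Notation C := R[i].
Local Notation Cn := 'rV[C]_n.
Variables (Om : set Cn) (B : R).
Hypothesis oOm : open Om.
Hypothesis bOm : forall z, Om z -> rn z <= B.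
Local Notation A2 := (bergman_space Om).
Local Notation ip := (L2ip Om).
Local Notation hn := (hnorm (L2ip Om)).
Local Notation hn1 := (hnorm (ip_01 Om)).
Local Notation L2Hm := (L2H oOm).
Local Notation A2Hm := (A2H oOm).
Local Notation mO := (mOm oOm).
Local Notation PB := (bergman_proj Om).

Definition nullseq (f : nat -> Cn -> C) : Prop :=
  [/\ forall k, A2 (f k), exists M : R, forall k, hn (f k) <= M &
    forall z, Om z -> vanish (fun k => rn (f k z))].

(** Let [W] be the set of vectors on which the claim holds. The Riesz vector [u] of the functional
    given by [h] on [W] is a limit of elements of [W], so boundedness of the sequence puts [u] in
    the same class. All kernels belong to [W], hence [h] and [u] agree at every point. *)
Lemma nullseq_weak_A2 f h : nullseq f -> A2 h -> vanish (fun k => rn (ip (f k) h)).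
Proof.
move=> [Af [M fM] f0] Ah; have A2L2 := @A2_L2 R n Om.
pose W : set (Cn -> C) := [set g | A2 g /\ vanish (fun k => rn (ip (f k) g))].
have W0 : W 0.
  split; first exact: A2_0.
  by apply: vanish_le vanish0 => k; rewrite (ip0r A2Hm)// rn0.
have WL (a : C) x y : W x -> W y -> W (a *: x + y).
  move=> [Ax vx] [Ay vy]; split; first exact: A2_lin.
  apply: vanish_le (vanishD (vanishZ (rn_ge0 a) vx) vy) => k.
  have Aax : A2 (a *: x) by exact: (phZ A2Hm).
  rewrite (ipDr A2Hm)// (ipZr A2Hm)// (le_trans (rnD _ _))//.
  by rewrite rnM rnJ.
have WA x : W x -> A2 x by case.
have bd x : W x -> rn (ip x h) <= hn h * hn x.
  by move=> [Ax _]; rewrite mulrC; exact: (cauchy_schwarz A2Hm).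
have [u [Au Hu _ [b Wb bu]]] := @riesz _ _ _ _ A2Hm _ W id (fun x => ip x h) (hn h)
  (A2_complete oOm bOm) W0 WL WA (fun _ _ _ _ _ => erefl)
  (fun a x y Wx Wy => phlin A2Hm a (WA _ Wx) (WA _ Wy) Ah) (hn_ge0 ip h) bd.
have M0 : 0 <= M by rewrite (le_trans (hn_ge0 ip (f 0%N))).
have Wu : vanish (fun k => rn (ip (f k) u)).
  apply: vanish_approx => e e0; have M1 : 0 < M + 1 by lra.
  have /cvgn0P/(_ _ (divr_gt0 e0 M1))[N /(_ N (leqnn N))] := bu.
  rewrite ger0_norm ?hn_ge0// ltr_pdivlMr// => hN.
  have [AbN vN] := Wb N; exists (fun k => rn (ip (f k) (b N))) => // k.
  have -> : ip (f k) u = ip (f k) (b N) - ip (f k) (b N - u) by rewrite (ipBr A2Hm)// subKr.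
  have cs := cauchy_schwarz A2Hm (Af k) (phB A2Hm AbN Au).
  have r := rnB (ip (f k) (b N)) (ip (f k) (b N - u)).
  have d0 := hn_ge0 ip (b N - u); have := fM k; move: hN cs r d0.
  move: (hn _) (hn _) (rn _) (rn _) (rn _) => p q x y w; nra.
have hu z : Om z -> h z = u z.
  move=> Oz; have [AK HK] := kernelP oOm bOm Oz.
  have WK : W (bergman_kernel Om z).
    by split => //; apply: vanish_le (f0 z Oz) => k; rewrite HK.
  by rewrite (HK h Ah) (HK u Au) (phC A2Hm AK Ah) (phC A2Hm AK Au) (Hu _ WK).
apply: vanish_le Wu => k; rewrite /L2ip (@cintegral_eq _ _ Om _ (fun z => f k z * (u z)^*))//.
by move=> z /hu ->.
Qed.

Lemma nullseq_weak f h : nullseq f -> L2 Om h -> vanish (fun k => rn (ip (f k) h)).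
Proof.
move=> nf Lh; have [APh HPh] := projP oOm bOm Lh; have [Af _ _] := nf.
apply: vanish_le (nullseq_weak_A2 nf APh) => k.
suff -> : ip (f k) h = ip (f k) (PB h) by [].
have LP := A2_L2 APh; have Lf := A2_L2 (Af k).
have := HPh _ (Af k); rewrite (phC L2Hm Lf (phB L2Hm Lh LP)) (ipBr L2Hm)// => /(congr1 conjc).
by rewrite conjcK conjc0 => /eqP; rewrite subr_eq0 => /eqP.
Qed.

Lemma proj_min h g : L2 Om h -> A2 g -> hn (h - PB h) <= hn (h - g).
Proof.
move=> Lh Ag; have [AP HP] := projP oOm bOm Lh; have LP := A2_L2 AP; have Lg := A2_L2 Ag.
have Ad := phB A2Hm AP Ag; have Ld := A2_L2 Ad; have Lhp := phB L2Hm Lh LP.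
rewrite -(@ler_pXn2r _ 2)// ?nnegrE ?hn_ge0//.
have -> : h - g = (h - PB h) + (PB h - g) by rewrite addrA subrK.
rewrite (hnD_sq L2Hm Lhp Ld) (HP _ Ad); have := sqr_ge0 (hn (PB h - g)).
by move: (hn _ ^+ 2) (hn _ ^+ 2) => p q /=; lra.
Qed.

Lemma proj_contract h : L2 Om h -> hn (PB h) <= hn h.
Proof.
move=> Lh; have [AP HP] := projP oOm bOm Lh; have LP := A2_L2 AP.
rewrite -(@ler_pXn2r _ 2)// ?nnegrE ?hn_ge0//.
have -> : h = (h - PB h) + PB h by rewrite subrK.
have -> : PB (h - PB h + PB h) = PB h by rewrite subrK.
rewrite (hnD_sq L2Hm (phB L2Hm Lh LP) LP) (HP _ AP); have := sqr_ge0 (hn (h - PB h)).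
by move: (hn _ ^+ 2) (hn _ ^+ 2) => p q /=; lra.
Qed.

Lemma csmooth_bounded (phi : Cn -> C) : csmooth phi -> exists2 L : R, 0 <= L & forall z, Om z -> rn (phi z) <= L.
Proof.
move=> sp; have cB := @compact_rn_ball R n 0 B.
have [L L0 HL] := ctn_compact_bounded cB (fun z _ => csmooth_ctn z sp).
by exists L => // z Oz; apply: HL => /=; rewrite subr0; exact: bOm.
Qed.

Lemma csmooth_mc (phi : Cn -> C) : csmooth phi -> mc Om phi.
Proof. by move=> sp; apply: mc_sub (ctn_mc _) => // z; exact: csmooth_ctn. Qed.

Lemma csmooth_L2M (phi f : Cn -> C) : csmooth phi -> L2 Om f -> L2 Om (fun z => phi z * f z).
Proof.
move=> sp Lf; have [L _ HL] := csmooth_bounded sp; exact: (L2_bd mO Lf (csmooth_mc sp) HL).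
Qed.

(** The form f dbar phi, which is dbar of phi f when f is holomorphic. *)
Definition fdbar (phi f : Cn -> C) : Cn -> 'rV[C]_n := fun z => \row_j (dzbar j phi z * f z).

Lemma fdbar_L2 phi f : csmooth phi -> L2 Om f -> L2_01 Om (fdbar phi f).
Proof.
move=> sp Lf j; apply: (L2_eq mO) (csmooth_L2M (csmooth_dzbar j sp) Lf) => z _; by rewrite mxE.
Qed.

(** Weak holomorphy of [f] is tested on the products of [chi] with the derivatives of [phi]; the
    mixed second derivatives of [phi] cancel. *)
Lemma dbar_1_fdbar phi f : csmooth phi -> A2 f -> dbar_1 Om (fdbar phi f) 0.
Proof.
move=> sp Af; have Lf := A2_L2 Af; split; [exact: fdbar_L2|exact: (ph0 (L2_02_prehilbert oOm))|].
move=> chi tc j k; have [sc _] := tc.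
have tj := testM tc (csmooth_dzbar j sp); have tk := testM tc (csmooth_dzbar k sp).
have e0 : cintegral Om (fun z => (0 : Cn -> 'M[C]_n) z j k * chi z) = 0.
  by rewrite -[RHS](cintegral0 mO); apply: cintegral_eq => z _; rewrite z0m mul0r.
have wj := A2_weak oOm Af tj k; have wk := A2_weak oOm Af tk j.
have cj := ci_mul_dzbar oOm bOm k Lf tj; have ck := ci_mul_dzbar oOm bOm j Lf tk.
rewrite e0; apply/esym/eqP; rewrite oppr_eq0; apply/eqP.
rewrite -[RHS](subrr (0 : C)) -{1}wk -wj -(cintegralB mO ck cj).
apply: cintegral_eq => z _; rewrite !mxE.
rewrite (dzbarM _ _ (csmooth_dzbar k sp) sc) (dzbarM _ _ (csmooth_dzbar j sp) sc) (dzbarC j k z sp).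
move: (f z) (chi z) (dzbar j phi z) (dzbar k phi z) (dzbar j chi z) (dzbar k chi z) (dzbar k _ z) => x1 x2 x3 x4 x5 x6 x7; ring.
Qed.

Hypothesis n_gt0 : (0 < n)%N.
Hypothesis Om0 : Om !=set0.
Hypothesis N_compact : compact_op (L2_01 Om) (ip_01 Om) (dbar_Neumann Om).
Local Notation N := (dbar_Neumann Om).
Local Notation H1 := (L2_01_prehilbert oOm).

(** With [F] Kohn's solution, phi f - F is weakly holomorphic, hence in A^2 up to a null function.
    So phi f is at distance at most |F| from A^2, and the projection realizes the minimal
    distance. *)
Lemma hankel_bound phi f : csmooth phi -> A2 f ->
  hn ((fun z => phi z * f z) - PB (fun z => phi z * f z)) ^+ 2 <= hn1 (fdbar phi f) * hn1 (N (fdbar phi f)).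
Proof.
move=> sp Af; have Lf := A2_L2 Af; have Lpf := csmooth_L2M sp Lf.
have [bN _] := N_compact.
have [F [LF dF _ FN]] := kohn oOm bOm n_gt0 Om0 bN (fdbar_L2 sp Lf) (dbar_1_fdbar sp Af).
set h := fun z => phi z * f z; pose u := h - F.
have Lu : L2 Om u by exact: (phB L2Hm).
have wu : weakly_holo Om u.
  move=> chi tc j; have [sc _] := tc.
  have c1 := ci_mul_dzbar oOm bOm j Lpf tc; have c2 := ci_mul_dzbar oOm bOm j LF tc.
  have -> : cintegral Om (fun z => u z * dzbar j chi z) = cintegral Om (fun z => h z * dzbar j chi z - F z * dzbar j chi z).
    by apply: cintegral_eq => z _; rewrite -mulrBl.
  rewrite (cintegralB mO c1 c2).
  have c3 := ci_mul_test oOm bOm (fdbar_L2 sp Lf j) tc.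
  have /eqP := dF chi tc j; rewrite -addr_eq0 => /eqP.
  have tp := testM tc sp; have := A2_weak oOm Af tp j.
  have -> : cintegral Om (fun z => f z * dzbar j (fun z => phi z * chi z) z) =
    cintegral Om (fun z => h z * dzbar j chi z + fdbar phi f z 0 j * chi z).
    apply: cintegral_eq => z _; rewrite mxE (dzbarM j z sp sc) /h.
    by move: (f z) (phi z) (chi z) (dzbar j _ z) (dzbar j _ z) => x1 x2 x3 x4 x5; ring.
  rewrite (cintegralD mO c1 c3).
  move: (cintegral _ _) (cintegral _ _) (cintegral _ _) => x y z /eqP; rewrite addr_eq0 => /eqP -> /eqP.
  by rewrite addr_eq0 => /eqP ->; rewrite !opprK subrr.
have [g Ag ug] := weyl_L2 oOm bOm Lu wu; have Lg := A2_L2 Ag.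
apply: le_trans FN; rewrite lerXn2r// ?nnegrE ?hn_ge0//.
rewrite (le_trans (proj_min Lpf Ag))//.
have -> : h - g = (u - g) + F by rewrite /u addrAC subrK.
by have := hnD L2Hm (phB L2Hm Lu Lg) LF; rewrite ug add0r.
Qed.

(** A compact operator sends weakly null sequences to norm null ones: a subsequential limit [l] of
    the images has product with itself equal to the limit of the products of [al] with [N l], by
    symmetry of [N], and these tend to 0. *)
Lemma compact_weak (al : nat -> Cn -> 'rV[C]_n) (M : R) : (forall k, L2_01 Om (al k)) ->
  (forall k, hn1 (al k) <= M) -> (forall h, L2_01 Om h -> vanish (fun k => rn (ip_01 Om (al k) h))) ->
  vanish (fun k => hn1 (N (al k))).
Proof.
move=> La aM wa; apply: contrapT => /not_vanish[e e0 [s sP]].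
have [bN cN] := N_compact; have [N1 _ _] := bN.
have [t [l [tinc Ll tl]]] := cN (al \o s) (fun k => La _) (ex_intro _ M (fun k => aM _)).
have Nl := N1 _ Ll; have NaL k : L2_01 Om (N (al (s (t k)))) by exact: N1.
have ts : forall k, (k <= s (t k))%N by move=> k; rewrite (leq_trans (incr_ge tinc k))//; case: (sP (t k)).
have l0 : ip_01 Om l l = 0.
  apply: rn_eq0; apply/eqP; rewrite eq_le rn_ge0 andbT.
  apply/ler_addgt0Pr => d d0; rewrite add0r.
  have d2 : 0 < d / 2 by rewrite divr_gt0.
  have [K HK] := cvg_ipl H1 Ll Ll NaL tl d2.
  have [K' HK'] := vanish_sub ts (wa _ Nl) d2.
  have := HK _ (leq_maxl K K'); have := HK' _ (leq_maxr K K'); rewrite /=.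
  set k := maxn K K'; rewrite (Neumann_sym oOm bOm n_gt0 Om0 bN (La _) Ll).
  rewrite rn_distC => h1 h2.
  have := rnD (ip_01 Om l l - ip_01 Om (N (al (s (t k)))) l) (ip_01 Om (N (al (s (t k)))) l).
  rewrite subrK; lra.
have hl : hn1 l = 0 by rewrite /hnorm l0 sqrtr0.
have [K HK] := cvg_hn H1 Ll NaL tl e0; have [h _] := HK K (leqnn K); rewrite hl add0r in h.
by have [_] := sP (t K); rewrite leNgt h.
Qed.

Lemma hn1_le_sum (u : Cn -> 'rV[C]_n) : L2_01 Om u -> hn1 u <= \sum_j hn (comp01 j u).
Proof.
move=> Lu; rewrite -(@ler_pXn2r _ 2)// ?nnegrE ?hn_ge0//; last by apply: sumr_ge0 => j _; exact: hn_ge0.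
rewrite (hn_sq H1 Lu) /ip_01 Re_sum.
have -> : \sum_j Re (ip (fun z => u z 0 j) (fun z => u z 0 j)) = \sum_j hn (comp01 j u) ^+ 2.
  by apply: eq_bigr => j _; rewrite (hn_sq L2Hm (Lu j)).
elim: (index_enum _) => [|j r ih]; first by rewrite !big_nil expr0n.
rewrite !big_cons; have := hn_ge0 ip (comp01 j u).
have : 0 <= \sum_(j <- r) hn (comp01 j u) by apply: sumr_ge0 => i _; exact: hn_ge0.
move: ih; move: (\sum_(j <- r) _) (\sum_(j <- r) _) (hn _) => p q x; nra.
Qed.

(** The forms f_k dbar phi are weakly null, because the bounded coefficients of dbar phi can be
    moved to the other factor of the inner product. *)
Lemma hankel_smooth phi f : csmooth phi -> nullseq f ->
  vanish (fun k => hn ((fun z => phi z * f k z) - PB (fun z => phi z * f k z))).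
Proof.
move=> sp nf; have [Af [M fM] f0] := nf; have Lf k := A2_L2 (Af k).
have /choice[L HL] (j : 'I_n) : exists L : R, 0 <= L /\ forall z, Om z -> rn (dzbar j phi z) <= L.
  by have [L L0 h] := csmooth_bounded (csmooth_dzbar j sp); exists L.
pose M' := \sum_j L j * M.
have M0 : 0 <= M by rewrite (le_trans (hn_ge0 ip (f 0%N))).
have aM k : hn1 (fdbar phi (f k)) <= M'.
  have Lk := fdbar_L2 sp (Lf k); rewrite (le_trans (hn1_le_sum Lk))//; apply: ler_sum => j _.
  have [L0 Lj] := HL j.
  have -> : comp01 j (fdbar phi (f k)) = (fun z => dzbar j phi z * f k z).
    by apply/funext => z; rewrite /comp01 mxE.
  rewrite (le_trans (L2_hn_bd mO L0 (Lf k) (csmooth_L2M (csmooth_dzbar j sp) (Lf k)) Lj))//.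
  by rewrite ler_wpM2l.
have wa h : L2_01 Om h -> vanish (fun k => rn (ip_01 Om (fdbar phi (f k)) h)).
  move=> Lh; pose g j z := (dzbar j phi z)^* * h z 0 j.
  have Lg j : L2 Om (g j) := csmooth_L2M (csmoothJ (csmooth_dzbar j sp)) (Lh j).
  apply: vanish_le (vanish_sum (index_enum 'I_n) (fun j => nullseq_weak nf (Lg j))) => k.
  rewrite (le_trans (rn_sum _ _ _))//; apply: ler_sum => j _.
  suff -> : ip (fun z => fdbar phi (f k) z 0 j) (fun z => h z 0 j) = ip (f k) (g j) by [].
  apply: cintegral_eq => z _; rewrite mxE /g rmorphM/=.
  rewrite -[X in X * f k z](conjcK (dzbar j phi z)) mulrCA mulrA; reflexivity.
have vN := compact_weak (fun k => fdbar_L2 sp (Lf k)) aM wa.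
apply: vanish_sqrt; have M'0 : 0 <= M' by rewrite (le_trans (hn_ge0 _ _) (aM 0%N)).
apply: vanish_le (vanishZ M'0 vN) => k; rewrite (le_trans (hankel_bound sp (Af k)))//.
by rewrite ler_wpM2r// hn_ge0.
Qed.

End null_sequences.

(** * Uniform approximation of continuous symbols by smooth ones *)

Section csmooth_approx.
Context {R : realType} {n : nat}.
Local Notation C := R[i].
Local Notation Cn := 'rV[C]_n.

Lemma step_bounds (x : R) : 0 <= step x <= 1.
Proof.
have h := bump_den_gt0 x; apply/andP; split; rewrite /step; last by rewrite ler_pdivrMr// mul1r lerDl expinv_ge0.
by rewrite mulr_ge0 ?invr_ge0 ?expinv_ge0// ltW.
Qed.

Definition bump (t : R) (z : Cn) : R := \prod_j (1 + -1 * rstep t (sq j z)).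

Lemma csmooth_bump t : csmooth (fun z => (bump t z)%:C).
Proof.
apply: csmooth_prod => j; apply: (csmooth_sq j (h := fun x => 1 + -1 * rstep t x)).
by apply: READd; [exact: REcst|apply: REmul; [exact: REcst|exact: real_expr_rstep]].
Qed.

Lemma bump_ge0 t z : 0 <= bump t z.
Proof.
apply: prodr_ge0 => j _; rewrite /rstep mulN1r subr_ge0.
by have /andP[] := step_bounds (t ^- 2 * sq j z).
Qed.

Lemma bump1 t z : 0 < t -> 2 * rn z <= t -> bump t z = 1.
Proof.
move=> t0 zt; rewrite /bump big1// => j _; rewrite rstep_lt ?mulr0 ?addr0// /sq.
by have := rn_coord z j; have := rn_ge0 (z 0 j); nra.
Qed.

Lemma bump_supp t z : 0 < t -> t < rn z -> bump t z = 0.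
Proof.
move=> t0 /(rn_gt (ltW t0))[j tj]; rewrite /bump (bigD1 j)//= rstep_gt// ?mulr1 ?subrr ?mul0r// /sq.
by rewrite lerXn2r// ?nnegrE ?rn_ge0 ?ltW.
Qed.

Lemma within_rnP (K : set Cn) (phi : Cn -> C) (x : Cn) (e : R) : {within K, continuous phi} -> K x -> 0 < e ->
  exists2 t : R, 0 < t & forall z, K z -> rn (z - x) < t -> rn (phi z - phi x) < e.
Proof.
move=> /subspace_continuousP/(_ x)/[apply]/cvg_rnP/[apply]/nbhs_rnP[t t0 H].
by exists t => // z Kz zx; exact: H.
Qed.

(* Smooth partition of unity: [phi] is averaged over a finite cover by small
   balls; the total weight is at least 1 on [K] and is corrected away from [K]. *)
Lemma csmooth_approx (K : set Cn) (phi : Cn -> C) (e : R) : compact K -> {within K, continuous phi} -> 0 < e ->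
  exists2 psi, csmooth psi & forall z, K z -> rn (phi z - psi z) <= e.
Proof.
move=> cK cphi e0.
have /choice[t tP] (x : Cn) : exists t : R, 0 < t /\
    (K x -> forall z, K z -> rn (z - x) <= t -> rn (phi z - phi x) <= e).
  have [Kx|nK] := pselect (K x); last by exists 1.
  have [t t0 H] := within_rnP cphi Kx e0; exists (t / 2); split; first by rewrite divr_gt0.
  by move=> _ z Kz zx; apply/ltW/H => //; apply: le_lt_trans zx _; rewrite gtr_pMr// invf_lt1// ltr1n.
have := cK; rewrite compact_cover => /(_ Cn K (fun x => [set z | rn (z - x) < t x / 2])).
case=> [x _|z Kz|D' DK cD']; first exact: open_rn_ball.
  by exists z => //=; rewrite subrr rn0 divr_gt0//; case: (tP z).
pose D : seq Cn := finmap.enum_fset D'.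
have cD z : K z -> exists2 x, x \in D & rn (z - x) < t x / 2 by move=> /cD'[x xD zx]; exists x.
pose w (x z : Cn) := bump (t x) (z + - x).
pose S z := \sum_(x <- D) w x z.
have w0 x z : 0 <= w x z by exact: bump_ge0.
have S0 z : 0 <= S z by apply: sumr_ge0.
have S1 z : K z -> 1 <= S z.
  move=> /cD[x xD zx]; rewrite /S (big_rem x)//= {1}/w bump1.
  - by rewrite lerDl; apply: sumr_ge0.
  - by case: (tP x).
  - by move: zx; rewrite /= ltr_pdivlMr// mulrC => /ltW.
(* Equal to [S z] where [S z >= 1], in particular on [K], and positive everywhere, so that its
   inverse is smooth. *)
pose den z := S z + expinv 0 (-1 * S z + 1).
have den0 z : 0 < den z.
  rewrite /den; have [h|h] := ltP (S z) 1.
    by rewrite ltr_wpDl// expinv_gt0// mulN1r addrC subr_gt0.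
  by rewrite ltr_wpDr ?expinv_ge0// (lt_le_trans ltr01).
have denS z : K z -> den z = S z.
  by move=> /S1 h; rewrite /den expinv0 ?addr0// mulN1r addrC subr_le0.
have sw x : csmooth (fun z => (w x z)%:C) by exact: (csmooth_shift (- x) (csmooth_bump (t x))).
have ssum (a : Cn -> C) (r : seq Cn) : csmooth (fun z => \sum_(x <- r) a x * (w x z)%:C).
  elim: r => [|x r ih].
    rewrite (_ : (fun z => _) = fun=> 0); [exact: csmooth_cst|by apply/funext => z; rewrite big_nil].
  rewrite (_ : (fun z => _) = (fun z => a x * (w x z)%:C + \sum_(x <- r) a x * (w x z)%:C)).
    exact: (csmoothD (csmoothM (csmooth_cst (a x)) (sw x)) ih).
  by apply/funext => z; rewrite big_cons.
have sS : csmooth (fun z => (S z)%:C).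
  rewrite (_ : (fun z => _) = (fun z => \sum_(x <- D) 1 * (w x z)%:C)); first exact: ssum.
  by apply/funext => z; rewrite rmorph_sum; apply: eq_bigr => x _; rewrite mul1r.
have sden : csmooth (fun z => ((den z)%:C)^-1).
  apply: smooth_expr_csmooth; apply: SEinv.
    by move=> z; rewrite (inj_eq (@complexI R) _ 0) gt_eqF.
  rewrite (_ : (fun z => _) = (fun z => (S z)%:C + (expinv 0 (-1 * Re ((S z)%:C) + 1))%:C)).
    have Eh : real_expr (fun x : R => expinv 0 (-1 * x + 1)) := REaffine (-1) 1 (REexpinv 0).
    exact: (SEadd (SEsmooth sS) (SEsmooth (csmooth_real_expr Eh sS))).
  by apply/funext => z; rewrite -rmorphD.
exists (fun z => (\sum_(x <- D) phi x * (w x z)%:C) * ((den z)%:C)^-1); first exact: (csmoothM (ssum phi D) sden).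
move=> z Kz; have Sz := S1 z Kz; have Sz0 : 0 < S z by rewrite (lt_le_trans ltr01).
have Sn : (S z)%:C != 0 by rewrite (inj_eq (@complexI R) _ 0) gt_eqF.
rewrite denS//.
have -> : phi z - (\sum_(x <- D) phi x * (w x z)%:C) / (S z)%:C = (\sum_(x <- D) (phi z - phi x) * (w x z)%:C) / (S z)%:C.
  have -> : \sum_(x <- D) (phi z - phi x) * (w x z)%:C = phi z * (S z)%:C - \sum_(x <- D) phi x * (w x z)%:C.
    by rewrite rmorph_sum mulr_sumr -sumrB; apply: eq_bigr => x _; rewrite mulrBl.
  by rewrite mulrBl mulfK.
rewrite rnM rnV rn_real gtr0_norm// ler_pdivrMr// (le_trans (rn_sum _ _ _))// mulr_sumr.
rewrite big_seq [leRHS]big_seq; apply: ler_sum => x xD; rewrite rnM rn_real ger0_norm//.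
have [t0 tx] := tP x.
have [h|h] := leP (rn (z - x)) (t x); last by rewrite /w bump_supp// !mulr0.
by rewrite ler_wpM2r// tx//; exact: set_mem (DK x xD).
Qed.

End csmooth_approx.

(** * The Toeplitz algebra *)

Section bounded_operators.
Context {R : realType} {E : lmodType R[i]}.
Local Notation C := R[i].
Variables (V : set E) (ip : E -> E -> C).
Hypothesis H : prehilbert V ip.
Local Notation hn := (hnorm ip).
Implicit Types S T : E -> E.

Lemma bounded_opM T : bounded_op V ip T -> exists2 M : R, 0 <= M & forall f, V f -> hn (T f) <= M * hn f.
Proof.
move=> [_ _ [M HM]]; exists (Num.max 0 M); first by rewrite le_max lexx.
move=> f Vf; rewrite (le_trans (HM f Vf))// ler_wpM2r ?hn_ge0//.
by rewrite le_max lexx orbT.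
Qed.

(** [bounded_op] gives linearity only up to vectors of norm 0, so [T f - T g] and [T (f - g)] are
    compared through their norms. *)
Lemma bounded_op_lip T (M : R) f g : bounded_op V ip T -> (forall f, V f -> hn (T f) <= M * hn f) ->
  V f -> V g -> hn (T f - T g) <= M * hn (f - g).
Proof.
move=> [T1 T2 _] TM Vf Vg; have Vd := phB H Vf Vg.
have := T2 1 (f - g) g Vd Vg; rewrite !scale1r subrK opprD addrA addrAC => h.
have V1 := phB H (T1 _ Vf) (T1 _ Vg); have V2 := T1 _ Vd.
by rewrite (le_trans (hn_le_dist H V1 V2))// h addr0 TM.
Qed.

Lemma bounded_op_lin (a : C) S T : bounded_op V ip S -> bounded_op V ip T ->
  bounded_op V ip (fun f => a *: S f + T f).
Proof.
move=> bS bT; have [MS MS0 HS] := bounded_opM bS; have [MT MT0 HT] := bounded_opM bT.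
have [S1 S2 _] := bS; have [T1 T2 _] := bT.
have V1 f : V f -> V (a *: S f + T f) by move=> Vf; apply: (phL H); [exact: S1|exact: T1].
split => //.
- move=> b f g Vf Vg; apply/eqP; rewrite eq_le hn_ge0 andbT.
  have Vbfg := phL H b Vf Vg.
  have VS := phB H (S1 _ Vbfg) (phL H b (S1 _ Vf) (S1 _ Vg)).
  have VT := phB H (T1 _ Vbfg) (phL H b (T1 _ Vf) (T1 _ Vg)).
  set L := (X in hn X <= 0).
  have -> : L = a *: (S (b *: f + g) - (b *: S f + S g)) + (T (b *: f + g) - (b *: T f + T g)).
    rewrite /L !scalerBr !scalerDr !scalerA [b * a]mulrC.
    by rewrite [X in _ - X = _]addrACA opprD addrACA.
  rewrite (le_trans (hnD H (phZ H a VS) VT))// (hnZ H)//.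
  by rewrite (S2 b f g Vf Vg) (T2 b f g Vf Vg) mulr0 addr0.
- exists (rn a * MS + MT) => f Vf.
  rewrite (le_trans (hnD H (phZ H a (S1 _ Vf)) (T1 _ Vf)))// (hnZ H _ (S1 _ Vf)) mulrDl.
  by rewrite lerD ?HT// -mulrA ler_wpM2l ?rn_ge0// HS.
Qed.

Lemma bounded_op_comp S T : bounded_op V ip S -> bounded_op V ip T -> bounded_op V ip (S \o T).
Proof.
move=> bS bT; have [MS MS0 HS] := bounded_opM bS; have [MT MT0 HT] := bounded_opM bT.
have [S1 S2 _] := bS; have [T1 T2 _] := bT.
split; first by move=> f Vf; exact: S1 (T1 _ Vf).
- move=> b f g Vf Vg /=; apply/eqP; rewrite eq_le hn_ge0 andbT.
  have V1 := T1 _ (phL H b Vf Vg); have V2 := phL H b (T1 _ Vf) (T1 _ Vg).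
  have h := bounded_op_lip bS HS V1 V2; rewrite T2// mulr0 in h.
  have V3 := S1 _ V1; have V4 := S1 _ V2; have V5 := phL H b (S1 _ (T1 _ Vf)) (S1 _ (T1 _ Vg)).
  by rewrite (le_trans (hn_trans H V3 V4 V5))// S2 ?addr0//; exact: T1.
- exists (MS * MT) => f Vf /=; rewrite (le_trans (HS _ (T1 _ Vf)))// -mulrA ler_wpM2l//.
  exact: HT.
Qed.

End bounded_operators.

(** Dividing a tolerance by [K + 1] in place of [K] covers the case [K = 0]. *)
Lemma frac_le (R : realFieldType) (K e M : R) : 0 <= K -> 0 <= e -> 0 <= M -> K * (e / (K + 1) * M) <= e * M.
Proof.
move=> K0 e0 M0; have K1 : 0 < K + 1 by lra.
rewrite mulrA ler_wpM2r// mulrCA ler_piMr// ler_pdivrMr//; lra.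
Qed.

Section algebra.
Context {R : realType} {n : nat}.
Local Notation C := R[i].
Local Notation Cn := 'rV[C]_n.
Variables (Om : set Cn) (B : R).
Hypothesis oOm : open Om.
Hypothesis bOm : forall z, Om z -> rn z <= B.
Local Notation A2 := (bergman_space Om).
Local Notation ip := (L2ip Om).
Local Notation hn := (hnorm (L2ip Om)).
Local Notation L2Hm := (L2H oOm).
Local Notation A2Hm := (A2H oOm).
Local Notation mO := (mOm oOm).
Local Notation PB := (bergman_proj Om).
Hypothesis n_gt0 : (0 < n)%N.
Hypothesis Om0 : Om !=set0.
Hypothesis N_compact : compact_op (L2_01 Om) (ip_01 Om) (dbar_Neumann Om).

(** The symbol may depend on [e]. The error is proportional to the bound [M] of the sequence, and
    null sequences are preserved, because in a composition the second operator is applied to the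
    sequence produced by the first. *)
Definition asymp_mul (T : (Cn -> C) -> Cn -> C) : Prop :=
  [/\ bounded_op A2 ip T, forall f, nullseq Om f -> nullseq Om (fun k => T (f k)) &
    forall e : R, 0 < e -> exists2 phi, csmooth phi & forall f (M : R), nullseq Om f -> (forall k, hn (f k) <= M) ->
      exists2 y, vanish y & forall k, hn (T (f k) - (fun z => phi z * f k z)) <= e * M + y k].

Lemma nullseqE T f : bounded_op A2 ip T -> nullseq Om f ->
  (forall z, Om z -> vanish (fun k => rn (T (f k) z))) -> nullseq Om (fun k => T (f k)).
Proof.
move=> bT [Af [M fM] _] h; have [T1 _ _] := bT; have [L L0 HL] := bounded_opM bT.
split => //; first by move=> k; exact: T1.
exists (L * M) => k; rewrite (le_trans (HL _ (Af k)))//; exact: ler_wpM2l.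
Qed.

Lemma bounded_closure z : closure Om z -> rn z <= B.
Proof.
move=> cz; have := @closed_rn_ball R n 0 B; rewrite closure_id => e.
suff : [set w : Cn | rn (w - 0) <= B] z by rewrite /= subr0.
by rewrite e; apply: closureS cz => w /bOm /=; rewrite subr0.
Qed.

Lemma compact_closure_Om : compact (closure Om).
Proof. by apply: closed_bounded_compact bounded_closure; exact: closed_closure. Qed.

Lemma within_mc phi : {within closure Om, continuous phi} -> mc Om phi.
Proof.
move=> cphi; apply: ctn_mc_on => // z Oz; apply/ctnP => e e0.
have [t t0 H] := within_rnP cphi (subset_closure Oz) e0.
have /open_rnP/(_ z Oz)[d d0 Hd] := oOm.
exists (Num.min t d); first by rewrite lt_min t0.
by move=> w; rewrite lt_min => /andP[wt /Hd Ow]; apply: H => //; exact: subset_closure.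
Qed.

(** A smooth [psi] uniformly close to [phi] serves as symbol: exchanging the two costs [e * M], and
    the remaining term is the Hankel part of [psi], which vanishes along null sequences. *)
Lemma toeplitz_asymp phi : {within closure Om, continuous phi} -> asymp_mul (toeplitz Om phi).
Proof.
move=> cphi; have mphi := within_mc cphi.
have ap e : 0 < e -> exists2 psi, csmooth psi & forall z, Om z -> rn (phi z - psi z) <= e.
  move=> /(csmooth_approx compact_closure_Om cphi)[psi sp h]; exists psi => // z Oz.
  by apply: h; exact: subset_closure.
have [L L0 HL] : exists2 L : R, 0 <= L & forall z, Om z -> rn (phi z) <= L.
  have [psi sp h] := ap 1 ltr01; have [L L0 HL] := csmooth_bounded bOm sp.
  exists (1 + L) => [|z Oz]; first lra.
  by have := rnD (phi z - psi z) (psi z); rewrite subrK; have := h z Oz; have := HL z Oz; lra.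
have Lf f : A2 f -> L2 Om (phi \* f) by move=> [Lf _]; exact: (L2_bd mO Lf mphi HL).
have AT f : A2 f -> A2 (toeplitz Om phi f) by move=> /Lf /(projP oOm bOm)[].
have bT : bounded_op A2 ip (toeplitz Om phi).
  split => //.
  - move=> a f g Af Ag; have Aafg := phL A2Hm a Af Ag.
    have [P1 h1] := projP oOm bOm (Lf _ Aafg); have [P2 h2] := projP oOm bOm (Lf _ Af).
    have [P3 h3] := projP oOm bOm (Lf _ Ag).
    set d := _ - _; have P4 := phL A2Hm a P2 P3; have Ad : A2 d by exact: (phB A2Hm).
    have L1 := phB L2Hm (Lf _ Aafg) (A2_L2 P1); have L2' := phB L2Hm (Lf _ Af) (A2_L2 P2).
    have L3 := phB L2Hm (Lf _ Ag) (A2_L2 P3); have Ld := A2_L2 Ad.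
    have L4 := phL L2Hm a L2' L3.
    (* [d] lies in A^2 and is a combination of vectors orthogonal to A^2, so it is null; the
       selected projection need not be linear in a stricter sense. *)
    have dE : d = (a *: (phi \* f - PB (phi \* f)) + (phi \* g - PB (phi \* g))) - (phi \* (a *: f + g) - PB (phi \* (a *: f + g))).
      apply/funext => z; rewrite /d !fctE /toeplitz.
      by move: (PB _ z) (PB _ z) (PB _ z) => x y t; rewrite /GRing.scale/=; move: (phi z) (f z) (g z) => p q r; ring.
    have dd : ip d d = 0.
      rewrite {1}dE (ipBl L2Hm L4 L1 Ld) (h1 _ Ad) (ipDl L2Hm (phZ L2Hm a L2') L3 Ld).
      by rewrite (ipZl L2Hm a L2' Ld) (h2 _ Ad) (h3 _ Ad) mulr0 addr0 subr0.
    by rewrite /hnorm dd sqrtr0.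
  - exists L => f Af; rewrite (le_trans (proj_contract oOm bOm (Lf _ Af)))//.
    exact: (L2_hn_bd mO L0 (A2_L2 Af) (Lf _ Af) HL).
split; [exact: bT| |].
- move=> f nf; apply: (nullseqE bT nf) => z Oz; have [AK HK] := kernelP oOm bOm Oz.
  have [Af _ _] := nf.
  have Lg : L2 Om (fun w => (phi w)^* * bergman_kernel Om z w).
    apply: (L2_bd mO (A2_L2 AK) (mcJ mphi) (M := L)) => w Ow; by rewrite rnJ HL.
  apply: vanish_le (nullseq_weak oOm bOm nf Lg) => k.
  suff -> : toeplitz Om phi (f k) z = ip (f k) (fun w => (phi w)^* * bergman_kernel Om z w) by [].
  have [P1 h1] := projP oOm bOm (Lf _ (Af k)).
  rewrite (HK _ (AT _ (Af k))); transitivity (ip (phi \* f k) (bergman_kernel Om z)).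
    apply/eqP; rewrite eq_sym -subr_eq0; apply/eqP.
    exact (etrans (esym (ipBl L2Hm (Lf _ (Af k)) (A2_L2 P1) (A2_L2 AK))) (h1 _ AK)).
  apply: cintegral_eq => w _ /=; rewrite rmorphM/=.
  by rewrite -{1}[phi w]conjcK mulrCA mulrA; reflexivity.
- move=> e e0; have [psi sp h] := ap e e0; exists psi => // f M nf fM.
  exists (fun k => hn ((fun z => psi z * f k z) - PB (fun z => psi z * f k z))).
    exact: (hankel_smooth oOm bOm n_gt0 Om0 N_compact sp nf).
  move=> k; have [Af _ _] := nf; have Lk := A2_L2 (Af k).
  have Lp := csmooth_L2M oOm bOm sp Lk; have Lpf := Lf _ (Af k).
  set g := fun z => psi z * f k z; rewrite -/g in Lp.
  have Ld : L2 Om (phi \* f k - g) by exact: (phB L2Hm).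
  have [P1 h1] := projP oOm bOm Lpf; have [P2 h2] := projP oOm bOm Lp.
  have LPd := phB L2Hm (A2_L2 P1) (A2_L2 P2).
  have e1 : hn (PB (phi \* f k) - PB g) <= hn (phi \* f k - g).
    have Ad := phB A2Hm P1 P2.
    have L1 := phB L2Hm Lpf (A2_L2 P1); have L3 := phB L2Hm Lp (A2_L2 P2).
    have L4 := phB L2Hm L1 L3.
    rewrite -(@ler_pXn2r _ 2)// ?nnegrE ?hn_ge0//.
    have -> : phi \* f k - g = (phi \* f k - PB (phi \* f k) - (g - PB g)) + (PB (phi \* f k) - PB g).
      apply/funext => z; rewrite !fctE; move: (PB _ z) (PB _ z) => x y.
      by move: (phi z * f k z) (g z) => p q; ring.
    rewrite (hnD_sq L2Hm L4 LPd) (ipBl L2Hm L1 L3 LPd) (h1 _ Ad) (h2 _ Ad) subrr.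
    have := sqr_ge0 (hn (phi \* f k - PB (phi \* f k) - (g - PB g))).
    by move: (hn _ ^+ 2) (hn _ ^+ 2) => p q /=; lra.
  have e2 : hn (phi \* f k - g) <= e * M.
    have -> : phi \* f k - g = (fun z => (phi z - psi z) * f k z).
      by apply/funext => z; rewrite /g !fctE /= mulrBl.
    have Ld' : L2 Om (fun z => (phi z - psi z) * f k z).
      exact: (L2_bd mO Lk (mcB mphi (csmooth_mc Om sp)) h).
    by rewrite (le_trans (L2_hn_bd mO (ltW e0) Lk Ld' h))// ler_wpM2l// ltW.
  rewrite (le_trans (hn_trans L2Hm (A2_L2 P1) (A2_L2 P2) Lp))//.
  by rewrite (hn_distC L2Hm (A2_L2 P2) Lp) lerD2r (le_trans e1).
Qed.

Lemma asymp_lin (a : C) S T : asymp_mul S -> asymp_mul T -> asymp_mul (fun f => a *: S f + T f).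
Proof.
move=> [bS nS aS] [bT nT aT]; have bST := bounded_op_lin A2Hm a bS bT.
have [S1 _ _] := bS; have [T1 _ _] := bT; split; [exact: bST| |].
- move=> f nf; apply: (nullseqE bST nf) => z Oz.
  have [_ _ /(_ z Oz) vS] := nS f nf; have [_ _ /(_ z Oz) vT] := nT f nf.
  apply: vanish_le (vanishD (vanishZ (rn_ge0 a) vS) vT) => k.
  by rewrite (le_trans (rnD _ _))// rnZ.
- move=> e e0; have a1 : 0 < rn a + 1 by have := rn_ge0 a; lra.
  have e2 : 0 < e / 2 by rewrite divr_gt0.
  have [phi sphi hphi] := aS _ (divr_gt0 e2 a1); have [psi spsi hpsi] := aT _ e2.
  exists (fun z => a * phi z + psi z).
    exact: (csmoothD (csmoothM (csmooth_cst a) sphi) spsi).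
  move=> f M nf fM; have [y vy hy] := hphi f M nf fM; have [y' vy' hy'] := hpsi f M nf fM.
  exists (fun k => rn a * y k + y' k); first exact: (vanishD (vanishZ (rn_ge0 a) vy) vy').
  move=> k; have [Af _ _] := nf; have Lk := A2_L2 (Af k).
  have M0 : 0 <= M by rewrite (le_trans (hn_ge0 ip (f k))).
  have L1 := phB L2Hm (A2_L2 (S1 _ (Af k))) (csmooth_L2M oOm bOm sphi Lk).
  have L3 := phB L2Hm (A2_L2 (T1 _ (Af k))) (csmooth_L2M oOm bOm spsi Lk).
  have -> : a *: S (f k) + T (f k) - (fun z => (a * phi z + psi z) * f k z) =
      a *: (S (f k) - (fun z => phi z * f k z)) + (T (f k) - (fun z => psi z * f k z)).
    apply/funext => z; rewrite !fctE /GRing.scale/=.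
    by move: (S _ z) (T _ z) (phi z) (psi z) (f k z) => x1 x2 x3 x4 x5; ring.
  rewrite (le_trans (hnD L2Hm (phZ L2Hm a L1) L3))// (hnZ L2Hm)//.
  have := hy k; have := hy' k; move: (hn _) (hn _) => p q h1 h2.
  have h3 := frac_le (rn_ge0 a) (ltW e2) M0.
  have := rn_ge0 a; have := ler_wpM2l (rn_ge0 a) h2; rewrite mulrDr; lra.
Qed.

(** [S] acts on the null sequence of the [T (f k)], bounded by [K * M], and multiplication by the
    symbol of [S] costs a factor [L]; this fixes the two tolerances. *)
Lemma asymp_comp S T : asymp_mul S -> asymp_mul T -> asymp_mul (S \o T).
Proof.
move=> [bS nS aS] [bT nT aT]; have bST := bounded_op_comp A2Hm bS bT.
have [S1 _ _] := bS; have [T1 _ _] := bT; split; [exact: bST|by move=> f nf; exact: (nS _ (nT _ nf))|].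
move=> e e0; have e2 : 0 < e / 2 by rewrite divr_gt0.
have [K K0 HK] := bounded_opM bT; have K1 : 0 < K + 1 by lra.
have [psi spsi hpsi] := aS _ (divr_gt0 e2 K1).
have [L L0 HL] := csmooth_bounded bOm spsi; have L1 : 0 < L + 1 by lra.
have [phi sphi hphi] := aT _ (divr_gt0 e2 L1).
exists (fun z => psi z * phi z); first exact: csmoothM.
move=> f M nf fM; have [Af _ _] := nf.
have M0 : 0 <= M by rewrite (le_trans (hn_ge0 ip (f 0%N))).
have [y vy hy] := hphi f M nf fM.
have TM k : hn (T (f k)) <= K * M by rewrite (le_trans (HK _ (Af k)))// ler_wpM2l.
have [y' vy' hy'] := hpsi _ _ (nT f nf) TM.
exists (fun k => y' k + L * y k); first exact: (vanishD vy' (vanishZ L0 vy)).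
move=> k; have Lk := A2_L2 (Af k); have LT := A2_L2 (T1 _ (Af k)); have LS := A2_L2 (S1 _ (T1 _ (Af k))).
have Lpf := csmooth_L2M oOm bOm sphi Lk; have Ld := phB L2Hm LT Lpf.
have LpT := csmooth_L2M oOm bOm spsi LT; have Lppf := csmooth_L2M oOm bOm (csmoothM spsi sphi) Lk.
have h1 : hn ((fun z => psi z * T (f k) z) - (fun z => psi z * phi z * f k z)) <=
    L * hn (T (f k) - (fun z => phi z * f k z)).
  have -> : (fun z => psi z * T (f k) z) - (fun z => psi z * phi z * f k z) =
      (fun z => psi z * (T (f k) - (fun z => phi z * f k z)) z).
    by apply/funext => z; rewrite !fctE mulrBr mulrA.
  exact: (L2_hn_bd mO L0 Ld (csmooth_L2M oOm bOm spsi Ld) HL).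
rewrite (le_trans (hn_trans L2Hm LS LpT Lppf))//=.
have h2 := frac_le K0 (ltW e2) M0; rewrite mulrCA in h2; have h3 := frac_le L0 (ltW e2) M0.
have := hy' k; have := ler_wpM2l L0 (hy k); rewrite mulrDr.
move: (hn _) h1 => p h1; move: (hn _) (hn _) h1 => q s h1; lra.
Qed.

Lemma asymp_closed T : bounded_op A2 ip T ->
  (forall e : R, 0 < e -> exists2 S, asymp_mul S & forall f, A2 f -> hn (T f - S f) <= e * hn f) ->
  asymp_mul T.
Proof.
move=> bT h; have [T1 _ _] := bT; split; [exact: bT| |].
- move=> f nf; have [Af [M fM] _] := nf; apply: (nullseqE bT nf) => z Oz.
  have M0 : 0 <= M by rewrite (le_trans (hn_ge0 ip (f 0%N))).
  apply: vanish_approx => e e0; have [L L0 [d d0 HL]] := A2_eval oOm bOm Oz.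
  have [|_ {}HL] := HL z; first by rewrite subrr rn0.
  have LM : 0 < L * M + 1 by rewrite ltr_wpDl// mulr_ge0.
  have [S [bS nS _] hS] := h _ (divr_gt0 e0 LM); have [S1 _ _] := bS.
  have [_ _ /(_ z Oz) vS] := nS f nf; exists (fun k => rn (S (f k) z)) => // k.
  have Ad := phB A2Hm (T1 _ (Af k)) (S1 _ (Af k)).
  have h1 : rn (T (f k) z - S (f k) z) <= e.
    rewrite (le_trans (HL _ Ad))// (le_trans (ler_wpM2l L0 (hS _ (Af k))))//.
    have -> : L * (e / (L * M + 1) * hn (f k)) = e * (L * hn (f k)) / (L * M + 1) by ring.
    rewrite ler_pdivrMr// ler_wpM2l ?(ltW e0)//; have := ler_wpM2l L0 (fM k); lra.
  by have := rnD (T (f k) z - S (f k) z) (S (f k) z); rewrite subrK; lra.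
- move=> e e0; have e2 : 0 < e / 2 by rewrite divr_gt0.
  have [S [bS nS aS] hS] := h _ e2; have [phi sphi hphi] := aS _ e2; exists phi => // f M nf fM.
  have [y vy hy] := hphi f M nf fM; exists y => // k; have [Af _ _] := nf.
  have [S1 _ _] := bS; have Lk := A2_L2 (Af k).
  rewrite (le_trans (hn_trans L2Hm (A2_L2 (T1 _ (Af k))) (A2_L2 (S1 _ (Af k))) (csmooth_L2M oOm bOm sphi Lk)))//.
  have := hS _ (Af k); have := hy k; have := ler_wpM2l (ltW e2) (fM k).
  move: (hn _) (hn _) (hn _) => p q s; lra.
Qed.

(** Minimality: the operators with [asymp_mul] form a closed subalgebra that contains the
    generators. *)
Lemma toeplitz_algebra_asymp T : toeplitz_algebra Om T -> asymp_mul T.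
Proof.
move=> /(_ asymp_mul); apply; split.
  split; [by move=> S []|exact: asymp_lin|exact: asymp_comp|exact: asymp_closed].
by move=> _ [phi cphi <-]; exact: toeplitz_asymp.
Qed.

End algebra.

(** * Extraction of convergent subsequences *)

Section subsequences.
Context {R : realType}.
Local Notation C := R[i].

Lemma frequent_subseq (P : nat -> nat -> Prop) : (forall m N, exists2 k, (N <= k)%N & P m k) ->
  exists s : nat -> nat, (forall k, (s k < s k.+1)%N) /\ forall m, P m (s m).
Proof.
move=> h; have /choice[f fP] (p : nat * nat) : exists k, (p.2 <= k)%N /\ P p.1 k.
  by have [k k1 k2] := h p.1 p.2; exists k.
pose s := fix s m := if m is m'.+1 then f (m, (s m').+1) else f (0%N, 0%N).
exists s; split=> [k|[|m]]; first by have [] := fP (k.+1, (s k).+1).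
  by have [] := fP (0%N, 0%N).
by have [] := fP (m.+1, (s m).+1).
Qed.

Lemma vanish_inv : vanish (fun k => k.+1%:R^-1 : R).
Proof. by move=> e /inv_small[N H]; exists N. Qed.

Lemma compact_subseq n (K : set 'rV[C]_n) (x : nat -> 'rV[C]_n) : compact K -> (forall k, K (x k)) ->
  exists p, K p /\ exists s : nat -> nat, (forall k, (s k < s k.+1)%N) /\ vanish (fun k => rn (x (s k) - p)).
Proof.
move=> cK Kx; have FK : (x @ \oo) K by exists 0%N => // k _; exact: Kx.
have [p [Kp clp]] := cK (x @ \oo) _ FK; exists p; split => //.
have [s [sinc sP]] : exists s : nat -> nat, (forall k, (s k < s k.+1)%N) /\
    forall m, rn (x (s m) - p) < m.+1%:R^-1.
  apply: (@frequent_subseq (fun m k => rn (x k - p) < m.+1%:R^-1)) => m N.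
  have Fm : (x @ \oo) [set y | exists2 k, (N <= k)%N & y = x k] by exists N => // k /= Nk; exists k.
  have m0 : 0 < m.+1%:R^-1 :> R by rewrite invr_gt0.
  have nm : nbhs p [set w | rn (w - p) < m.+1%:R^-1] by apply/nbhs_rnP; exists m.+1%:R^-1.
  have [_ [[k Nk ->] h]] := clp _ _ Fm nm.
  by exists k.
by exists s; split => //; apply: vanish_le vanish_inv => k; exact: ltW.
Qed.

(** Tychonoff's theorem replaces the diagonal argument: neighbourhoods of a cluster point in the
    product that constrain finitely many coordinates yield the subsequence. *)
Lemma diagonal_subseq (a : nat -> nat -> C) (b : nat -> R) : (forall i k, rn (a i k) <= b i) ->
  exists (s : nat -> nat) (c : nat -> C), (forall k, (s k < s k.+1)%N) /\
    forall i, vanish (fun k => rn (a i (s k) - c i)).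
Proof.
move=> ab; pose PT := prod_topology (fun _ : nat => C).
pose A i : set C := [set x : C | `|Re x| <= b i /\ `|Im x| <= b i].
have cA : @compact PT [set f | forall i, A i (f i)].
  by apply: (@tychonoff _ (fun=> C)) => i; exact: compact_square.
pose x k : PT := fun i => a i k.
have FK : (x @ \oo) [set f | forall i, A i (f i)].
  exists 0%N => // k _ i; split; first by rewrite (le_trans (normr_Re _))// ab.
  by rewrite (le_trans (normr_Im _))// ab.
have [c [_ clc]] := cA (x @ \oo) _ FK.
have [s [sinc sP]] : exists s : nat -> nat, (forall k, (s k < s k.+1)%N) /\
    forall m i, (i < m)%N -> rn (a i (s m) - c i) < m.+1%:R^-1.
  apply: (@frequent_subseq (fun m k => forall i, (i < m)%N -> rn (a i k - c i) < m.+1%:R^-1)) => m N.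
  have Fm : (x @ \oo) [set y | exists2 k, (N <= k)%N & y = x k] by exists N => // k /= Nk; exists k.
  have m0 : 0 < m.+1%:R^-1 :> R by rewrite invr_gt0.
  have nc l : nbhs (c : PT) [set y : PT | forall i, (i < l)%N -> rn (y i - c i) < m.+1%:R^-1].
    elim: l => [|l ih]; first by apply: filterS filterT => y _ i.
    have nl : nbhs (c : PT) [set y : PT | rn (y l - c l) < m.+1%:R^-1].
      apply: (@proj_continuous _ (fun _ : nat => C) l c [set w | rn (w - c l) < m.+1%:R^-1]).
      by apply/nbhs_rnP; exists m.+1%:R^-1.
    apply: filterS (filterI ih nl) => y [h1 h2] i; rewrite ltnS leq_eqVlt => /predU1P[->//|]; exact: h1.
  have [_ [[k Nk ->] h]] := clc _ _ Fm (nc m).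
  by exists k.
exists s, c; split => // i e e0; have [N HN] := vanish_inv e0.
exists (maxn N i.+1) => k; rewrite geq_max => /andP[Nk ik].
exact: lt_trans (sP k i ik) (HN k Nk).
Qed.

Lemma vanish_lim_unique (a : nat -> C) (c c' : C) : vanish (fun k => rn (a k - c)) ->
  vanish (fun k => rn (a k - c')) -> c = c'.
Proof.
move=> v1 v2; apply/eqP; rewrite -subr_eq0; apply/eqP; apply: rn_eq0; apply/eqP.
rewrite eq_le rn_ge0 andbT; apply: (vanish_unique (vanishD v1 v2)) => k.
by rewrite [X in _ <= X + _]rn_distC; exact: rn_trans.
Qed.

End subsequences.

(** * Reduction of compactness to null sequences *)

Section compactness.
Context {R : realType} {n : nat}.
Local Notation C := R[i].
Local Notation Cn := 'rV[C]_n.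
Variables (Om : set Cn) (B : R).
Hypothesis oOm : open Om.
Hypothesis bOm : forall z, Om z -> rn z <= B.
Local Notation A2 := (bergman_space Om).
Local Notation ip := (L2ip Om).
Local Notation hn := (hnorm (L2ip Om)).
Local Notation L2Hm := (L2H oOm).
Local Notation A2Hm := (A2H oOm).
Local Notation mO := (mOm oOm).
Local Notation PB := (bergman_proj Om).
Local Notation K := (bergman_kernel Om).
Local Notation qp := (@rational_point R n).

Lemma rn_subJ (x y : C) : rn (x - y^*) = rn (x^* - y).
Proof. by rewrite -rnJ; congr rn; rewrite rmorphB; congr (_ - _); exact: conjcK. Qed.

(** Equicontinuity of bounded subsets of A^2 transfers the limit from rational points to all
    points. *)
Lemma nullseq_dense f (M : R) : (forall k, A2 (f k)) -> (forall k, hn (f k) <= M) ->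
  (forall i, Om (qp i) -> vanish (fun k => rn (f k (qp i)))) -> nullseq Om f.
Proof.
move=> Af fM h; split => //; first by exists M.
have M0 : 0 <= M by rewrite (le_trans (hn_ge0 ip (f 0%N))).
move=> z Oz; apply: vanish_approx => e e0; have M1 : 0 < M + 1 by lra.
have [d d0 Hd] := A2_equi oOm bOm Oz (divr_gt0 e0 M1).
have [i iz] := rational_point_dense z d0; have [Oi Hi] := Hd _ iz.
exists (fun k => rn (f k (qp i))) => [|k]; first exact: h.
have h1 : rn (f k (qp i) - f k z) <= e.
  rewrite (le_trans (Hi _ (Af k)))// (le_trans (ler_wpM2l _ (fM k))) ?divr_ge0 ?(ltW e0) ?(ltW M1)//.
  by rewrite mulrAC ler_pdivrMr// ler_wpM2l ?(ltW e0)//; lra.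
by have := rn_trans (f k z) (f k (qp i)) 0; rewrite !subr0 rn_distC; lra.
Qed.

(* l represents x |-> lim <x, u_(s k)>, defined on the x for which this limit exists. *)
Lemma A2_subseq u (M : R) : (forall k, A2 (u k)) -> (forall k, hn (u k) <= M) ->
  exists (s : nat -> nat) (l : Cn -> C), [/\ forall k, (s k < s k.+1)%N, A2 l & nullseq Om (fun k => u (s k) - l)].
Proof.
move=> Au uM; pose a i k : C := if `[< Om (qp i) >] then u k (qp i) else 0.
have M0 : 0 <= M by rewrite (le_trans (hn_ge0 ip (u 0%N))).
have ab i k : rn (a i k) <= M * hn (K (qp i)).
  rewrite /a; case: asboolP => [Oi|_]; last by rewrite rn0 mulr_ge0// hn_ge0.
  have [AK HK] := kernelP oOm bOm Oi; rewrite (HK _ (Au k)).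
  by rewrite (le_trans (cauchy_schwarz A2Hm (Au k) AK))// ler_wpM2r// hn_ge0.
have [s [c [sinc sc]]] := diagonal_subseq ab.
pose lim_to (x : Cn -> C) (d : C) := vanish (fun k => rn (ip x (u (s k)) - d)).
pose W : set (Cn -> C) := [set x | A2 x /\ exists d, lim_to x d].
have WA x : W x -> A2 x by case.
pose l (x : Cn -> C) : C := xget 0 [set d | lim_to x d].
have lP x : W x -> lim_to x (l x) by move=> [_ hx]; exact: (@xgetPex _ 0 [set d | lim_to x d] hx).
have lin (b : C) x y : W x -> W y -> lim_to (b *: x + y) (b * l x + l y).
  move=> Wx Wy; apply: vanish_le (vanishD (vanishZ (rn_ge0 b) (lP _ Wx)) (lP _ Wy)) => k.
  rewrite (phlin A2Hm b (WA _ Wx) (WA _ Wy) (Au _)) -rnM.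
  have -> : b * ip x (u (s k)) + ip y (u (s k)) - (b * l x + l y) =
    b * (ip x (u (s k)) - l x) + (ip y (u (s k)) - l y) by rewrite mulrBr opprD addrACA.
  exact: rnD.
have W0 : W 0.
  split; first exact: (A2_0 oOm).
  by exists 0; apply: vanish_le vanish0 => k; rewrite (ip0l A2Hm)// subr0 rn0.
have WL (b : C) x y : W x -> W y -> W (b *: x + y).
  by move=> Wx Wy; split; [exact: (phL A2Hm b (WA _ Wx) (WA _ Wy))|exists (b * l x + l y); exact: lin].
have ll (b : C) x y : W x -> W y -> l (b *: x + y) = b * l x + l y.
  by move=> Wx Wy; exact: (vanish_lim_unique (lP _ (WL b _ _ Wx Wy)) (lin b _ _ Wx Wy)).
have lM x : W x -> rn (l x) <= M * hn x.
  move=> Wx; rewrite -subr_le0; apply: (vanish_unique (lP _ Wx)) => k.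
  have := rn_trans (l x) (ip x (u (s k))) 0; rewrite !subr0 rn_distC.
  have := cauchy_schwarz A2Hm (WA _ Wx) (Au (s k)); have := ler_wpM2l (hn_ge0 ip x) (uM (s k)).
  move: (hn x) (hn (u _)) (rn _) (rn _) (rn _) => p q r t w; lra.
have [v [Av Hv _ _]] := @riesz _ _ _ _ A2Hm _ W id l M
  (A2_complete oOm bOm) W0 WL WA (fun _ _ _ _ _ => erefl) ll M0 lM.
exists s, v; split; [exact: sinc|exact: Av|apply: (@nullseq_dense _ (M + hn v))].
- by move=> k; exact: (phB A2Hm).
- by move=> k; rewrite (le_trans (hnB A2Hm (Au _) Av))// lerD2r.
move=> i Oi; have [AK HK] := kernelP oOm bOm Oi.
have ai k : a i k = (ip (K (qp i)) (u k))^*.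
  by rewrite /a asboolT// (HK _ (Au k)) (phC A2Hm AK (Au k)).
have lk : lim_to (K (qp i)) (c i)^*.
  apply: vanish_le (sc i) => k; rewrite ai le_eqVlt; apply/orP; left; apply/eqP; exact: rn_subJ.
have WK : W (K (qp i)) by split => //; exists (c i)^*.
have vc : v (qp i) = c i.
  rewrite (HK _ Av) (phC A2Hm AK Av) -(Hv _ WK) (vanish_lim_unique (lP _ WK) lk); exact: conjcK.
by apply: vanish_le (sc i) => k; rewrite /a asboolT// -vc.
Qed.

Lemma bounded_op_sub T f g : bounded_op A2 ip T -> A2 f -> A2 g -> hn (T f - T g) <= hn (T (f - g)).
Proof.
move=> [T1 T2 _] Vf Vg; have Vd := phB A2Hm Vf Vg.
have := T2 1 (f - g) g Vd Vg; rewrite !scale1r subrK opprD addrA addrAC => h.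
have V1 := phB A2Hm (T1 _ Vf) (T1 _ Vg); have V2 := T1 _ Vd.
by rewrite (le_trans (hn_le_dist A2Hm V1 V2))// h addr0.
Qed.

Lemma compact_op_nullseq T : bounded_op A2 ip T ->
  (forall f, nullseq Om f -> vanish (fun k => hn (T (f k)))) -> compact_op A2 ip T.
Proof.
move=> bT cc; have [T1 _ _] := bT; split => // u Au [M uM].
have [s [l [sinc Al nl]]] := A2_subseq Au uM.
exists s, (T l); split => //; first exact: T1.
apply/vanishP; first by move=> k; exact: hn_ge0.
by apply: vanish_le (cc _ nl) => k; exact: bounded_op_sub.
Qed.

(** Positivity holds because the constant 1 belongs to A^2 and a null kernel would reproduce the
    value 0. *)
Lemma kernel_norm z : Om z -> [/\ 0 < hn (K z), K z z = (hn (K z) ^+ 2)%:C & forall f, A2 f -> rn (f z) <= hn f * hn (K z)].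
Proof.
move=> Oz; have [AK HK] := kernelP oOm bOm Oz.
have A1 : A2 (fun=> 1) by split; [exact: (L2_1 oOm bOm)|move=> w _; exact: differentiable_cst].
split; [|by rewrite (HK _ AK) (ip_self A2Hm)|by move=> f Af; rewrite (HK _ Af); exact: (cauchy_schwarz A2Hm)].
rewrite lt_neqAle hn_ge0 andbT; apply/negP => /eqP h.
have := HK _ A1; rewrite (ip_nullr A2Hm A1 AK (esym h)) => /eqP; by rewrite oner_eq0.
Qed.

Lemma normalizedE z : Om z -> normalized_kernel Om z = ((hn (K z))^-1)%:C *: K z.
Proof.
move=> Oz; have [k0 kz _] := kernel_norm Oz; apply/funext => w; rewrite /normalized_kernel kz.
have -> : sqrtC ((hn (K z) ^+ 2)%:C) = (hn (K z))%:C.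
  by rewrite rmorphXn sqrCK// lecR hn_ge0.
by rewrite -fmorphV mulrC.
Qed.

Lemma normalizedP z : Om z -> [/\ A2 (normalized_kernel Om z), hn (normalized_kernel Om z) = 1 &
  forall f, A2 f -> ip f (normalized_kernel Om z) = ((hn (K z))^-1)%:C * f z].
Proof.
move=> Oz; have [k0 kz _] := kernel_norm Oz; have [AK HK] := kernelP oOm bOm Oz; rewrite (normalizedE Oz).
split; first exact: (phZ A2Hm _ AK).
  by rewrite (hnZ A2Hm _ AK) rn_real ger0_norm ?invr_ge0 ?hn_ge0// mulVf// gt_eqF.
move=> f Af; rewrite (ipZr A2Hm _ Af AK) -(HK _ Af); congr (_ * _); exact: conjc_real.
Qed.

End compactness.

(** * The Berezin transform *)

Section berezin.
Context {R : realType} {n : nat}.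
Local Notation C := R[i].
Local Notation Cn := 'rV[C]_n.
Variables (Om : set Cn) (B : R).
Hypothesis oOm : open Om.
Hypothesis bOm : forall z, Om z -> rn z <= B.
Local Notation A2 := (bergman_space Om).
Local Notation ip := (L2ip Om).
Local Notation hn := (hnorm (L2ip Om)).
Local Notation L2Hm := (L2H oOm).
Local Notation A2Hm := (A2H oOm).
Local Notation mO := (mOm oOm).
Local Notation PB := (bergman_proj Om).
Local Notation K := (bergman_kernel Om).
Local Notation nk := (normalized_kernel Om).
Local Notation qp := (@rational_point R n).

Lemma csmooth_conj_coord j : csmooth (fun z : Cn => (z 0 j)^*).
Proof. exact: csmoothJ (csmooth_coord j). Qed.

Lemma A2_coordM g (j : 'I_n) : A2 g -> A2 (fun z : Cn => z 0 j * g z).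
Proof.
move=> Ag; split; first exact: (csmooth_L2M oOm bOm (csmooth_coord j) (A2_L2 Ag)).
move=> z Oz; apply: (@differentiableM _ _ (fun z : Cn => z 0 j)); first exact: differentiable_coord.
exact (A2_diff Ag Oz).
Qed.

(* The adjoint of multiplication by z_j has k_l as an eigenvector. *)
Lemma normalized_coord l (j : 'I_n) : Om l ->
  hn (fun z : Cn => (z 0 j - l 0 j) * nk l z) <=
  hn ((fun z : Cn => (z 0 j)^* * nk l z) - PB (fun z : Cn => (z 0 j)^* * nk l z)).
Proof.
move=> Ol; have [Ak k1 Hk] := normalizedP oOm bOm Ol.
set h := fun z : Cn => (z 0 j)^* * nk l z.
have Lh : L2 Om h := csmooth_L2M oOm bOm (csmooth_conj_coord j) (A2_L2 Ak).
have [AP HP] := projP oOm bOm Lh; have Alk := phZ A2Hm (l 0 j)^* Ak.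
have Ad := phB A2Hm AP Alk; set d := PB h - (l 0 j)^* *: nk l in Ad.
(* Multiplication by z_j preserves A^2, so the reproducing property identifies [PB h] with the
   multiple of [nk l] by the conjugate of l_j, up to the null vector [d]. *)
have hg g : A2 g -> ip h g = (l 0 j)^* * ip (nk l) g.
  move=> Ag; have Azg := A2_coordM j Ag.
  transitivity (ip (nk l) (fun z : Cn => z 0 j * g z)).
    by apply: cintegral_eq => z _; rewrite /h rmorphM/= [_^* * nk l z]mulrC mulrA.
  rewrite (phC A2Hm Azg Ak) (phC A2Hm Ag Ak) (Hk _ Azg) (Hk _ Ag) mulrCA; exact: rmorphM.
have Ld := A2_L2 Ad; have Lhp := phB L2Hm Lh (A2_L2 AP).
have d0 : hn d = 0.
  have e : ip d d = 0.
    rewrite {1}/d (ipBl L2Hm (A2_L2 AP) (A2_L2 Alk) Ld) (ipZl L2Hm _ (A2_L2 Ak) Ld) -(hg _ Ad).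
    have := HP _ Ad; rewrite (ipBl L2Hm Lh (A2_L2 AP) Ld) => /eqP; rewrite subr_eq0 => /eqP ->.
    exact: subrr.
  by rewrite /hnorm e sqrtr0.
have Ll : L2 Om (fun z : Cn => (z 0 j - l 0 j) * nk l z).
  have := phB L2Hm (A2_L2 (A2_coordM j Ak)) (A2_L2 (phZ A2Hm (l 0 j) Ak)).
  by apply: (L2_eq mO) => z _; rewrite mulrBl.
have Lhl := phB L2Hm Lh (A2_L2 Alk).
apply: (@le_trans _ _ (hn (h - (l 0 j)^* *: nk l))).
  apply: (L2_hn_le mO Ll Lhl) => z _.
  have -> : (h - (l 0 j)^* *: nk l) z = (z 0 j - l 0 j)^* * nk l z by rewrite rmorphB mulrBl.
  by rewrite !rnM rnJ.
rewrite (le_trans (hn_trans L2Hm Lh (A2_L2 AP) (A2_L2 Alk)))// -/d d0 addr0.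
exact: lexx.
Qed.

Definition rnc (u : Cn -> C) : Cn -> C := fun z => (rn (u z))%:C.

Lemma rn_rnc u z : rn (rnc u z) = rn (u z).
Proof. by rewrite rn_real ger0_norm// rn_ge0. Qed.

Lemma rnc_L2 u : L2 Om u -> L2 Om (rnc u) /\ hn (rnc u) = hn u.
Proof.
move=> Lu; have Lr : L2 Om (rnc u).
  apply: (L2_le mO (g := fun z => rn (u z) ^+ 2)); [|by move=> z _; rewrite rn_rnc|exact: L2_ri].
  by apply: mc_real; exact: (mc_rn mO (L2_mc Lu)).
by split => //; apply/eqP; rewrite eq_le !(L2_hn_le mO)// => z _; rewrite rn_rnc.
Qed.

Lemma sum_rnc (I : Type) (r : seq I) (F : I -> Cn -> C) : (forall i, L2 Om (F i)) ->
  L2 Om (fun z => (\sum_(i <- r) rn (F i z))%:C) /\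
  hn (fun z => (\sum_(i <- r) rn (F i z))%:C) <= \sum_(i <- r) hn (F i).
Proof.
move=> LF; elim: r => [|i r [L1 h1]].
  rewrite big_nil (_ : (fun z => _) = 0); first by split; [exact: (ph0 L2Hm)|rewrite (hn0 L2Hm)].
  by apply/funext => z; rewrite big_nil.
have [L2' h2] := rnc_L2 (LF i).
have e : (fun z => (\sum_(j <- i :: r) rn (F j z))%:C) = rnc (F i) + (fun z => (\sum_(j <- r) rn (F j z))%:C).
  by apply/funext => z; rewrite big_cons rmorphD.
rewrite e big_cons; split; first exact: (phD L2Hm).
by rewrite (le_trans (hnD L2Hm L2' L1))// h2 lerD2l.
Qed.

Variables (lam : nat -> Cn) (p : Cn).
Hypothesis Ol : forall m, Om (lam m).
Hypothesis lp : vanish (fun m => rn (lam m - p)).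
Hypothesis nl : nullseq Om (fun m => nk (lam m)).
Hypothesis n_gt0 : (0 < n)%N.
Hypothesis N_compact : compact_op (L2_01 Om) (ip_01 Om) (dbar_Neumann Om).

Let Om0 : Om !=set0. Proof. by exists (lam 0%N). Qed.

Let Lcp j m (a : C) : L2 Om (fun z : Cn => (z 0 j - a) * nk (lam m) z).
Proof.
have [Ak _ _] := normalizedP oOm bOm (Ol m).
have := phB L2Hm (A2_L2 (A2_coordM j Ak)) (A2_L2 (phZ A2Hm a Ak)).
by apply: (L2_eq mO) => z _; rewrite mulrBl.
Qed.

(** The part centred at [lam m] is bounded by a Hankel term whose symbol is the conjugate of z_j,
    and recentring at [p] costs at most [rn (lam m - p)]. *)
Lemma coord_concentration j : vanish (fun m => hn (fun z : Cn => (z 0 j - p 0 j) * nk (lam m) z)).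
Proof.
have vh := hankel_smooth oOm bOm n_gt0 Om0 N_compact (csmooth_conj_coord j) nl.
apply: vanish_le (vanishD vh lp) => m; have [Ak k1 Hk] := normalizedP oOm bOm (Ol m).
have Lk := A2_L2 Ak; have L1 := Lcp j m (lam m 0 j); have L3 := phZ L2Hm (lam m 0 j - p 0 j) Lk.
have -> : (fun z : Cn => (z 0 j - p 0 j) * nk (lam m) z) =
    (fun z : Cn => (z 0 j - lam m 0 j) * nk (lam m) z) + (lam m 0 j - p 0 j) *: nk (lam m).
  by apply/funext => z; rewrite -[z 0 j - p 0 j](subrKA (lam m 0 j)) mulrDl.
rewrite (le_trans (hnD L2Hm L1 L3))// (hnZ L2Hm _ Lk) k1 mulr1.
apply: lerD; first exact: (normalized_coord j (Ol m)).
by have := rn_coord (lam m - p) j; rewrite !mxE.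
Qed.

(** Near [p] the bound [d] is continuity. At distance at least [t] from [p] the sum of the
    coordinate distances is at least [t], so [L = M / t] absorbs the global bound [M]. *)
Lemma csmooth_majorant phi (d : R) : csmooth phi -> 0 < d -> exists2 L : R, 0 <= L &
  forall z, Om z -> rn (phi z - phi p) <= d + L * \sum_j rn (z 0 j - p 0 j).
Proof.
move=> sp d0; have [L L0 HL] := csmooth_bounded bOm sp.
have /ctnP/(_ d d0)[t t0 Ht] := csmooth_ctn p sp.
pose M := L + rn (phi p); have M0 : 0 <= M by rewrite addr_ge0// rn_ge0.
exists (M / t) => [|z Oz]; first by rewrite divr_ge0// ltW.
have S0 : 0 <= \sum_j rn (z 0 j - p 0 j) by apply: sumr_ge0 => j _; exact: rn_ge0.
have Mt : 0 <= M / t by rewrite divr_ge0// ltW.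
have [h|h] := ltP (rn (z - p)) t.
  by rewrite (le_trans (ltW (Ht _ h)))// lerDl mulr_ge0.
rewrite (le_trans (rnB _ _))// (le_trans (lerD (HL z Oz) (lexx _)))// -/M ler_wpDl ?(ltW d0)//.
rewrite -mulrA ler_peMr// mulrC ler_pdivlMr// mul1r (le_trans h)//.
apply: rn_le => // j; rewrite !mxE (bigD1 j)//= lerDl; apply: sumr_ge0 => i _; exact: rn_ge0.
Qed.

Lemma concentration phi : csmooth phi -> vanish (fun m => hn (fun z => (phi z - phi p) * nk (lam m) z)).
Proof.
move=> sp; apply: vanish_approx => d d0; have [L L0 HL] := csmooth_majorant sp d0.
exists (fun m => L * \sum_j hn (fun z : Cn => (z 0 j - p 0 j) * nk (lam m) z)).
  apply: vanishZ => //; exact: (vanish_sum (index_enum _) coord_concentration).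
move=> m; have [Ak k1 Hk] := normalizedP oOm bOm (Ol m); have Lk := A2_L2 Ak.
have [Lr hr] := rnc_L2 Lk.
have [Ls hs] := sum_rnc (index_enum 'I_n) (fun j => Lcp j m (p 0 j)).
have L1 := phZ L2Hm d%:C Lr; have L3 := phZ L2Hm L%:C Ls.
have Lf : L2 Om (fun z => (phi z - phi p) * nk (lam m) z).
  have := phB L2Hm (csmooth_L2M oOm bOm sp Lk) (phZ L2Hm (phi p) Lk).
  by apply: (L2_eq mO) => z _; rewrite mulrBl.
rewrite (le_trans (L2_hn_le mO Lf (phD L2Hm L1 L3) _))//.
  move=> z Oz; have -> : (d%:C *: rnc (nk (lam m)) + L%:C *: (fun z : Cn => (\sum_j rn ((z 0 j - p 0 j) * nk (lam m) z))%:C)) z =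
      (d * rn (nk (lam m) z) + L * \sum_j rn ((z 0 j - p 0 j) * nk (lam m) z))%:C by rewrite rmorphD !rmorphM.
  rewrite rn_real ger0_norm; last first.
    rewrite addr_ge0// mulr_ge0 ?rn_ge0 ?(ltW d0)//; apply: sumr_ge0 => j _; exact: rn_ge0.
  rewrite rnM (le_trans (ler_wpM2r (rn_ge0 _) (HL z Oz)))// mulrDl lerD2l -mulrA ler_wpM2l//.
  by rewrite mulr_suml; apply: ler_sum => j _; rewrite rnM.
rewrite (le_trans (hnD L2Hm L1 L3))// (hnZ L2Hm _ Lr) (hnZ L2Hm _ Ls) hr k1 mulr1 !rn_real.
by rewrite (gtr0_norm d0) (ger0_norm L0) lerD2l ler_wpM2l.
Qed.

Lemma boundary_small T phi (e : R) : bounded_op A2 ip T -> csmooth phi ->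
  (exists2 y, vanish y & forall m, hn (T (nk (lam m)) - (fun z => phi z * nk (lam m) z)) <= e + y m) ->
  vanish (fun m => rn (berezin Om T (lam m))) -> rn (phi p) <= e.
Proof.
move=> [T1 _ _] sp [y vy hy] vb; rewrite -subr_le0.
apply: (vanish_unique (vanishD (vanishD vb vy) (concentration sp))) => m.
have [Ak k1 Hk] := normalizedP oOm bOm (Ol m); have Lk := A2_L2 Ak; set k := nk (lam m) in Ak k1 Lk hy *.
have LT := A2_L2 (T1 _ Ak); have Lp := csmooth_L2M oOm bOm sp Lk.
have Lf : L2 Om (fun z => (phi z - phi p) * k z).
  have := phB L2Hm Lp (phZ L2Hm (phi p) Lk).
  by apply: (L2_eq mO) => z _; rewrite mulrBl.
have LTp := phB L2Hm LT Lp.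
(* The terms are the Berezin transform, the error of the symbol and the error of concentration. The
   first and the last tend to 0, and the middle one is at most [e] in the limit. *)
have e1 : phi p = ip (T k) k - ip (T k - (fun z => phi z * k z)) k - ip (fun z => (phi z - phi p) * k z) k.
  have kk : ip k k = 1 by rewrite (ip_self A2Hm Ak) k1 expr1n.
  have -> : (fun z => (phi z - phi p) * k z) = (fun z => phi z * k z) - phi p *: k.
    by apply/funext => z; rewrite mulrBl.
  rewrite (ipBl L2Hm LT Lp Lk) (ipBl L2Hm Lp (phZ L2Hm _ Lk) Lk) (ipZl L2Hm _ Lk Lk) kk mulr1.
  by rewrite !subKr.
have h1 := cauchy_schwarz L2Hm LTp Lk; have h2 := cauchy_schwarz L2Hm Lf Lk; rewrite k1 mulr1 in h1 h2.
have h3 := rnB (ip (T k) k - ip (T k - (fun z => phi z * k z)) k) (ip (fun z => (phi z - phi p) * k z) k).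
have h4 := rnB (ip (T k) k) (ip (T k - (fun z => phi z * k z)) k).
rewrite -e1 in h3; have h5 := hy m; rewrite /berezin -/k.
move: h1 h2 h3 h4 h5; move: (rn (phi p)) (rn (ip (T k) k)) (rn (ip _ _)) (rn (ip _ _)) (rn (_ - _)) (hn _) (hn _).
move=> a1 a2 a3 a4 a5 a6 a7; lra.
Qed.

End berezin.

(** * The majorant of the kernels and the conclusion *)

Section nullseq_compact.
Context {R : realType} {n : nat}.
Local Notation C := R[i].
Local Notation Cn := 'rV[C]_n.
Variables (Om : set Cn) (B : R).
Hypothesis oOm : open Om.
Hypothesis bOm : forall z, Om z -> rn z <= B.
Local Notation A2 := (bergman_space Om).
Local Notation ip := (L2ip Om).
Local Notation hn := (hnorm (L2ip Om)).
Local Notation L2Hm := (L2H oOm).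
Local Notation A2Hm := (A2H oOm).
Local Notation mO := (mOm oOm).
Local Notation K := (bergman_kernel Om).
Local Notation nk := (normalized_kernel Om).
Local Notation qp := (@rational_point R n).
Local Notation vol := (@volume R n).
Hypothesis n_gt0 : (0 < n)%N.
Hypothesis N_compact : compact_op (L2_01 Om) (ip_01 Om) (dbar_Neumann Om).
Variable T : (Cn -> C) -> Cn -> C.
Hypothesis asT : asymp_mul Om T.
Hypothesis T_berezin : forall p, boundary Om p ->
  berezin Om T z @[z --> within Om (nbhs p)] --> (0 : C).

Definition Kq (i : nat) : Cn -> C := if `[< Om (qp i) >] then K (qp i) else 0.

Lemma Kq_L2 i : L2 Om (Kq i).
Proof.
rewrite /Kq; case: asboolP => [Oi|_]; last exact: (ph0 L2Hm).
by have [AK _] := kernelP oOm bOm Oi; exact: A2_L2.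
Qed.

(* If the bound failed along points l_N, the normalized kernels at the l_N would
   tend to 0 at all rational points, l_N would accumulate at a boundary point p
   and the Berezin transform would force |phi p| <= e. *)
Lemma kernel_majorant phi (e : R) : 0 < e -> csmooth phi ->
  (forall f (M : R), nullseq Om f -> (forall k, hn (f k) <= M) ->
    exists2 y, vanish y & forall k, hn (T (f k) - (fun z => phi z * f k z)) <= e * M + y k) ->
  exists N : nat, forall l, Om l -> 2 * e < rn (phi l) -> hn (K l) <= N%:R * (1 + \sum_(i <- iota 0 N) rn (Kq i l)).
Proof.
move=> e0 sp aT; apply: contrapT => nN.
have /choice[lam lamP] (N : nat) : exists l, [/\ Om l, 2 * e < rn (phi l) &
    N%:R * (1 + \sum_(i <- iota 0 N) rn (Kq i l)) < hn (K l)].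
  apply: contrapT => h; apply: nN; exists N => l Ol el; rewrite leNgt; apply/negP => lN.
  by apply: h; exists l.
have cO := compact_closure_Om bOm.
have [p [cp [s [sinc sp']]]] := @compact_subseq R n _ lam cO
  (fun k => let: And3 Ol _ _ := lamP k in @subset_closure _ _ _ Ol).
have Ol m : Om (lam (s m)) by have [] := lamP (s m).
have s_ge := incr_ge sinc.
have nl : nullseq Om (fun m => nk (lam (s m))).
  apply: (nullseq_dense oOm bOm (M := 1)).
  - by move=> m; have [] := normalizedP oOm bOm (Ol m).
  - by move=> m; have [_ -> _] := normalizedP oOm bOm (Ol m).
  move=> i Oi d d0; have [N HN] := inv_small d0.
  (* Once [i < s m], the i-th kernel occurs in the sum, and the failed bound makes the normalized
     kernel at [qp i] at most [(s m)%:R^-1]. *)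
  exists (maxn N.+1 i.+1) => m; rewrite geq_max => /andP[Nm im].
  have [k0 _ _] := kernel_norm oOm bOm (Ol m); have [AK HK] := kernelP oOm bOm (Ol m).
  have [AKi HKi] := kernelP oOm bOm Oi.
  rewrite (normalizedE oOm bOm (Ol m)) [X in rn X]/= rnM rn_real ger0_norm ?invr_ge0 ?hn_ge0//.
  have -> : rn (K (lam (s m)) (qp i)) = rn (Kq i (lam (s m))).
    by rewrite /Kq asboolT// (HKi _ AK) (HK _ AKi) (phC A2Hm AK AKi); exact: esym (rnJ _).
  have [_ _ hN] := lamP (s m).
  have S0 : rn (Kq i (lam (s m))) <= 1 + \sum_(i <- iota 0 (s m)) rn (Kq i (lam (s m))).
    rewrite (big_rem i)/=; last by rewrite mem_iota/= add0n (leq_trans im (s_ge m)).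
    have : 0 <= \sum_(j <- rem i (iota 0 (s m))) rn (Kq j (lam (s m))) by apply: sumr_ge0 => j _; exact: rn_ge0.
    lra.
  have s0 : 0 < (s m)%:R :> R by rewrite ltr0n (leq_trans _ (s_ge m))// (leq_trans _ Nm).
  have h1 : (s m)%:R * rn (Kq i (lam (s m))) <= hn (K (lam (s m))).
    by rewrite (le_trans _ (ltW hN))// ler_wpM2l// ltW.
  have h2 : (s m)%:R^-1 < d.
    have m1 : (0 < s m)%N by rewrite -(ltr0n R).
    by rewrite -(prednK m1); apply: HN; rewrite -ltnS (prednK m1) (leq_trans Nm (s_ge m)).
  by apply: le_lt_trans h2; rewrite mulrC ler_pdivrMr// mulrC ler_pdivlMr// mulrC.
(* Near an interior point the norms of the kernels are bounded, whereas the failed bound makes the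
   norm at [lam (s m)] exceed [s m]. *)
have nOp : ~ Om p.
  move=> Op; have [M M0 [d d0 H]] := A2_eval oOm bOm Op.
  have [N1 HN1] := sp' _ d0; pose m := maxn N1 (Num.trunc M).+1.
  have [_ HM] := H _ (HN1 m (leq_maxl _ _)).
  have [k0 kz _] := kernel_norm oOm bOm (Ol m); have [AK _] := kernelP oOm bOm (Ol m).
  have := HM _ AK; rewrite kz rn_real ger0_norm ?sqr_ge0// expr2 ler_pM2r// => hM.
  have [_ _ hN] := lamP (s m); have : M < (s m)%:R.
    rewrite (lt_le_trans (truncnS_gt _))// ler_nat (leq_trans (leq_maxr N1 _))//.
  have : (s m)%:R <= (s m)%:R * (1 + \sum_(i <- iota 0 (s m)) rn (Kq i (lam (s m)))).
    by rewrite ler_peMr// lerDl; apply: sumr_ge0 => i _; exact: rn_ge0.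
  lra.
have bp : boundary Om p by split => // /interior_subset.
have small : rn (phi p) <= e.
  have bT : bounded_op A2 ip T by case: asT.
  apply: (@boundary_small R n Om B oOm bOm (fun m => lam (s m)) p Ol sp' nl n_gt0 N_compact T phi e bT sp).
    have [|y vy hy] := aT _ 1 nl; first by move=> m; have [_ -> _] := normalizedP oOm bOm (Ol m).
    by exists y => // m; rewrite -[e]mulr1.
  move=> d d0; have /cvg_rnP/(_ _ d0)/nbhs_rnP[t t0 Ht] := T_berezin bp.
  have [N HN] := sp' _ t0; exists N => m Nm; have := Ht _ (HN m Nm) (Ol m); by rewrite subr0.
(* The threshold [2 * e] leaves room for continuity: near [p] the modulus of [phi] is below
   [rn (phi p) + e], hence below [2 * e]. *)
have [t t0 Ht] := (ctnP _ _).1 (csmooth_ctn p sp) e e0.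
have [N HN] := sp' _ t0; have := Ht _ (HN N (leqnn N)); have [_ h _] := lamP (s N).
by have := rnD (phi (lam (s N)) - phi p) (phi p); rewrite subrK; lra.
Qed.

Lemma nullseq_vanish f : nullseq Om f -> vanish (fun k => hn (T (f k))).
Proof.
move=> nf; have [Af [M fM] f0] := nf; have [[T1 _ _] _ aT] := asT.
have M0 : 0 <= M by rewrite (le_trans (hn_ge0 ip (f 0%N))).
apply: vanish_approx => d d0; have M1 : 0 < 3 * M + 1 by lra.
(* Of the 3, one is the error [e * M] of the symbol, and two come from the region where
   [rn (phi z) <= 2 * e]. *)
pose e := d / (3 * M + 1); have e0 : 0 < e by rewrite divr_gt0.
have eM : 3 * e * M <= d by rewrite /e mulrAC mulrA ler_pdivrMr// mulrC ler_wpM2l ?(ltW d0)//; lra.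
have [phi sp hp] := aT e e0; have [y vy hy] := hp f M nf fM.
have [N HN] := kernel_majorant e0 sp hp; have [L L0 HL] := csmooth_bounded bOm sp.
have [Ls _] := sum_rnc oOm (iota 0 N) Kq_L2.
pose H z : C := (L * (M * N%:R))%:C * (1 + (\sum_(i <- iota 0 N) rn (Kq i z))%:C).
have LH : L2 Om H.
  have := phZ L2Hm (L * (M * N%:R))%:C (phD L2Hm (L2_1 oOm bOm) Ls).
  by apply: (L2_eq mO).
have LHM : 0 <= L * (M * N%:R) by rewrite !mulr_ge0.
have Hge z : Om z -> 2 * e < rn (phi z) -> forall k, rn (phi z * f k z) <= rn (H z).
  move=> Oz ez k; rewrite /H !rnM -[X in rn (X + _)](rmorph1 (real_complex R)) -rmorphD !rn_real.
  have S0 : 0 <= \sum_(i <- iota 0 N) rn (Kq i z) by apply: sumr_ge0 => i _; exact: rn_ge0.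
  rewrite (ger0_norm LHM) ger0_norm ?addr_ge0// -!mulrA ler_pM ?rn_ge0 ?HL//.
  have [_ _ Kz] := kernel_norm oOm bOm Oz; rewrite (le_trans (Kz _ (Af k)))//.
  by rewrite ler_pM ?hn_ge0//; exact: HN.
have Lf k : L2 Om (fun z => phi z * f k z) := csmooth_L2M oOm bOm sp (A2_L2 (Af k)).
(* The minimum avoids splitting the domain: it is dominated everywhere, and where
   [2 * e < rn (phi z)] it equals the square of the modulus of [phi z * f k z]. *)
pose G k z := Num.min (rn (phi z * f k z) ^+ 2) (rn (H z) ^+ 2).
have hi : ri vol Om (fun z => rn (H z) ^+ 2) by exact: L2_ri.
have mG k : measurable_fun Om (G k).
  by apply: measurable_minr; apply: mc_rn2; apply: L2_mc.
have G0 k z : 0 <= G k z by rewrite /G le_min !sqr_ge0.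
have GH k z : Om z -> `|G k z| <= rn (H z) ^+ 2 by move=> _; rewrite ger0_norm// /G ge_min lexx orbT.
have Gi k : ri vol Om (G k) by exact: (ri_le mO (mG k) (GH k) hi).
have vG : vanish (fun k => \int[vol]_(z in Om) G k z).
  apply/vanishP; first by move=> k; apply: Rint_ge0.
  have -> : (0 : R) = \int[vol]_(z in Om) (fun=> 0) z by rewrite /Rintegral integral0.
  apply: (Rint_cvg mO mG hi GH) => z Oz.
  apply/vanishP => //; have v2 := vanishZ (rn_ge0 (phi z)) (f0 z Oz).
  move=> a a0; have a1 : 0 < Num.min 1 a by rewrite lt_min ltr01.
  have [N1 HN1] := v2 _ a1; exists N1 => k /HN1; rewrite lt_min => /andP[h1 h2].
  apply: le_lt_trans h2; rewrite /G ge_min; apply/orP; left; rewrite rnM.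
  by rewrite expr2 ler_piMl ?mulr_ge0 ?rn_ge0// ltW.
exists (fun k => y k + Num.sqrt (\int[vol]_(z in Om) G k z)).
  apply: (vanishD vy); apply: vanish_sqrt; apply: vanish_le vG => k.
  by rewrite sqr_sqrtr//; exact: Rint_ge0.
move=> k; have Lk := A2_L2 (Af k); have LT := A2_L2 (T1 _ (Af k)).
have I0 : 0 <= \int[vol]_(z in Om) G k z by exact: Rint_ge0.
have b1 : hn (fun z => phi z * f k z) ^+ 2 <= (2 * e * M) ^+ 2 + \int[vol]_(z in Om) G k z.
  have r1 : ri vol Om (fun z => (2 * e) ^+ 2 * rn (f k z) ^+ 2) by apply: (riZ mO); exact: L2_ri.
  rewrite (L2_hn2 mO (Lf k)) (le_trans (Rint_le mO (L2_ri (Lf k)) (riD mO r1 (Gi k)) _))//.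
    move=> z Oz; have [h|h] := ltP (2 * e) (rn (phi z)).
      have -> : G k z = rn (phi z * f k z) ^+ 2.
        by apply/min_idPl; rewrite lerXn2r// ?nnegrE ?rn_ge0//; exact: Hge.
      by rewrite lerDr mulr_ge0// sqr_ge0.
    rewrite ler_wpDr// rnM exprMn ler_wpM2r ?sqr_ge0// lerXn2r// ?nnegrE ?rn_ge0//.
    by rewrite mulr_ge0// ltW.
  have mOm := mO; have L2k := L2_ri Lk.
  rewrite (_ : \int[vol]_(x in Om) (_ + _) = \int[vol]_(x in Om) ((2 * e) ^+ 2 * rn (f k x) ^+ 2) + \int[vol]_(x in Om) G k x); last by apply: RintegralD => //; exact: Gi.
  rewrite lerD2r (_ : \int[vol]_(x in Om) _ = (2 * e) ^+ 2 * \int[vol]_(x in Om) rn (f k x) ^+ 2); last by apply: RintegralZl.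
  rewrite -(L2_hn2 mO Lk) [(_ * M) ^+ 2]exprMn ler_wpM2l ?sqr_ge0// lerXn2r// ?nnegrE ?hn_ge0//.
have b2 : hn (fun z => phi z * f k z) <= 2 * e * M + Num.sqrt (\int[vol]_(z in Om) G k z).
  have q0 : 0 <= 2 * e * M by apply: mulr_ge0 => //; apply: mulr_ge0 => //; exact: ltW.
  have r0 := sqrtr_ge0 (\int[vol]_(z in Om) G k z).
  rewrite -(@ler_pXn2r _ 2)// ?nnegrE ?hn_ge0 ?addr_ge0// (le_trans b1)//.
  by rewrite sqrrD sqr_sqrtr// lerD2r lerDl mulrn_wge0// mulr_ge0.
have := hn_le_dist L2Hm LT (Lf k); have := hy k; move: b2 eM.
move: (hn _) (hn _) (hn _) (Num.sqrt _) => x1 x2 x3 x4; lra.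
Qed.

Lemma compact_of_berezin : compact_op A2 ip T.
Proof. by apply: (compact_op_nullseq oOm bOm); [case: asT|exact: nullseq_vanish]. Qed.

End nullseq_compact.

Theorem theorem1 (R : realType) (n : nat) (n_gt0 : (0 < n)%N)
    (Om : set 'rV[R[i]]_n)
    (Om_smooth : smooth_bounded_domain Om)
    (Om_pseudoconvex : pseudoconvex Om)
    (N_compact : compact_op (L2_01 Om) (ip_01 Om) (dbar_Neumann Om))
    (T : ('rV[R[i]]_n -> R[i]) -> ('rV[R[i]]_n -> R[i]))
    (T_alg : toeplitz_algebra Om T)
    (T_berezin : forall p : 'rV[R[i]]_n, boundary Om p ->
      berezin Om T z @[z --> within Om (nbhs p)] --> (0 : R[i])) :
  compact_op (bergman_space Om) (L2ip Om) T.
Proof.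
have [Om0 oOm _ bOm _] := Om_smooth.
have [B HB] : exists B : R, forall z, Om z -> rn z <= B.
  (* [bounded_set] offers a complex [M] such that only strictly larger numbers are guaranteed to be
     bounds. *)
  move: bOm => [M [_ HM]]; exists (Re (M + 1)) => z Oz.
  have M1 : M < M + 1 by rewrite ltrDl ltr01.
  by have := HM _ M1 z Oz; rewrite /= lecE => /andP[].
have asT := toeplitz_algebra_asymp oOm HB n_gt0 Om0 N_compact T_alg.
exact: (compact_of_berezin oOm HB n_gt0 N_compact asT T_berezin).
Qed.
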